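(* Degenerate generalized Kähler structures of symplectic type are equivalent to holomorphic symplectic Morita equivalences with brane bisection. Precisely (all holomorphic Poisson structures being integrable): (a) Let $(I_+,I_-,Q,F)$ be a degenerate generalized Kähler structure of symplectic type on a smooth manifold $M$, with holomorphic Poisson structures $\sigma_\pm=-\tfrac14(I_\pm Q+iQ)$ on $X_\pm=(M,I_\pm)$. Let $(\Sigma(X_-),\Omega_-)$ be the Weinstein groupoid of $(X_-,\sigma_-)$ with source $s$, target $t$ and identity bisection $\epsilon$. Then $(Z,\Omega)=(\Sigma(X_-),\Omega_-+t^*F)$, with $\pi_+=t$, $\pi_-=s$ and $\mathcal L=\epsilon(M)$, is a holomorphic symplectic Morita equivalence with brane bisection from $(X_-,\sigma_-)$ to $(X_+,\sigma_+)$. (b) Conversely, let $(Z,\Omega,\mathcal L)$ be a holomorphic symplectic Morita equivalence with brane bisection from a holomorphic Poisson manifold $(X_-,\sigma_-)$ to a holomorphic Poisson manifold $(X_+,\sigma_+)$, where $X_\pm$ has complex structure $I_\pm$ and $\sigma_\pm=-\tfrac14(I_\pm Q_\pm+iQ_\pm)$. Identify the smooth manifolds underlying $X_+$ and $X_-$ with $M:=\mathcal L$ by means of the diffeomorphisms $\pi_\pm|_{\mathcal L}$. Then $Q_+=Q_-=:Q$ on $M$ and, setting $F:=\Omega|_{\mathcal L}$ (a real closed 2-form), $(I_+,I_-,Q,F)$ is a degenerate generalized Kähler structure of symplectic type on $M$. (c) The constructions in (a) and (b) are inverse to each other (up to isomorphism of holomorphic symplectic Morita equivalences with brane bisection).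
   Context: Conventions. A 2-form $F$ is regarded as a map $TM\to T^*M$, $X\mapsto \iota_XF$, and a bivector $Q$ as a map $T^*M\to TM$; $I^*:T^*M\to T^*M$ is the dual of $I$. A holomorphic Poisson structure on a complex manifold $X=(M,I)$ is written $\sigma=-\tfrac14(IQ+iQ)$ with $Q=-4\,\mathrm{Im}(\sigma)$ a real Poisson structure. Normalization: for a holomorphic symplectic form $\Omega=B+i\omega$ one has $B=\omega I$, and the inverse holomorphic Poisson structure has $Q=\omega^{-1}$. Degenerate generalized Kähler structure of symplectic type (with gauge fixed so that $\beta=0$): data $(I_+,I_-,Q,F)$ on $M$ where $I_\pm$ are (integrable) complex structures, $Q$ is a real bivector such that $\sigma_\pm=-\tfrac14(I_\pm Q+iQ)$ are holomorphic Poisson structures on $(M,I_\pm)$, and $F$ is a real closed 2-form with $L_{\sigma_+}=e^FL_{\sigma_-}$, where $L_{\sigma_\pm}=\{X+\sigma_\pm(\zeta)+\zeta: X\in T^{0,1}_\pm,\ \zeta\in T^*_{1,0,\pm}\}$ and $e^F(X+\xi)=X+\xi+\iota_XF$. Equivalently, $I_+-I_-=QF$ and $FI_++I_-^*F=0$. Symplectic groupoid: a Lie groupoid $\mathcal G\rightrightarrows M$ with symplectic form $\Omega$ satisfying $m^*\Omega=p_1^*\Omega+p_2^*\Omega$ on composable pairs; the target map is Poisson and the source map anti-Poisson onto the base. A holomorphic Poisson manifold is integrable if it is the base of such a (holomorphic) symplectic groupoid; the Weinstein groupoid $\Sigma(X)$ is the unique integration with connected and simply connected source fibres. All Poisson manifolds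 are assumed integrable. Holomorphic symplectic Morita equivalence from $(X_-,\sigma_-)$ to $(X_+,\sigma_+)$: a holomorphic symplectic manifold $(Z,\Omega)$ with holomorphic surjective submersions $\pi_\pm:Z\to X_\pm$ with connected and simply connected fibres such that: $\pi_+$ is Poisson and $\pi_-$ is anti-Poisson; $\ker d\pi_+$ and $\ker d\pi_-$ are $\Omega$-orthogonal complements of each other; $\pi_\pm$ are complete, i.e. the pullback of any complete Hamiltonian vector field is complete (for the underlying real maps from $(Z,\mathrm{Im}\,\Omega)$ to $(X_\pm,\pm Q_\pm)$). In (a), the complex structure on $Z$ is the one for which $\Omega$ is holomorphic symplectic: writing $\Omega=B+i\omega$ it is $\omega^{-1}B$. Brane bisection in $(Z,\Omega)$: a smooth submanifold $\mathcal L\subset Z$ which is Lagrangian for $\mathrm{Im}(\Omega)$ and is a section of both $\pi_+$ and $\pi_-$, i.e. $\pi_\pm|_{\mathcal L}:\mathcal L\to X_\pm$ are diffeomorphisms. An isomorphism of Morita equivalences with brane bisection between fixed $(X_\pm,\sigma_\pm)$ is a holomorphic symplectomorphism commuting with the maps $\pi_\pm$ and carrying one brane to the other. *)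

(* Defs.v *)
From HB Require Import structures.
From mathcomp Require Import all_boot all_order all_algebra.
From mathcomp Require Import all_classical all_reals all_analysis.
From mathcomp Require Import ring.

Set Implicit Arguments.
Unset Strict Implicit.
Unset Printing Implicit Defensive.

Import Order.TTheory GRing.Theory Num.Theory.
Import numFieldNormedType.Exports.
Local Open Scope classical_set_scope.
Local Open Scope ring_scope.

(** * Smooth functions on open subsets of R^n *)

(** C^k on an open set: all partial derivatives of order at most k exist
    and are continuous. *)
Fixpoint Ck (R : realType) (n k : nat) (U : set 'rV[R]_n)
    (f : 'rV[R]_n -> R) : Prop :=
  (forall x, U x -> {for x, continuous f}) /\
  if k is k'.+1 then
    forall i : 'I_n,
      (forall x, U x -> derivable f x (delta_mx 0 i)) /\
      Ck k' U ('D_(delta_mx 0 i) f)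
  else True.

Definition Cinfty (R : realType) (n : nat) (U : set 'rV[R]_n)
    (f : 'rV[R]_n -> R) : Prop := forall k, Ck k U f.

Section CkTheory.
Context (R : realType) (n : nat) (U : set 'rV[R]_n).
Context (oU : open U).
Implicit Types f g : 'rV[R]_n -> R.

Lemma Ck_cont k f : Ck k U f -> forall x, U x -> {for x, continuous f}.
Proof. by case: k => [|k] []. Qed.

Lemma Ck_ext k f g : (forall x, U x -> f x = g x) -> Ck k U f -> Ck k U g.
Proof.
have nfg (a b : 'rV[R]_n -> R) (ab : forall x, U x -> a x = b x) x :
    U x -> \forall y \near x, a y = b y.
  by move=> Ux; near=> y; apply: ab; near: y; exact: open_nbhs_nbhs.
elim: k f g => [|k IH] f g fg /= [cf Df]; split.
- move=> x Ux; rewrite /prop_for /continuous_at -(fg x Ux).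
  by apply: cvg_trans (cf x Ux); exact: (@near_eq_cvg _ _ (nbhs x) _ _ _ (nfg f g fg x Ux)).
- by [].
- move=> x Ux; rewrite /prop_for /continuous_at -(fg x Ux).
  by apply: cvg_trans (cf x Ux); exact: (@near_eq_cvg _ _ (nbhs x) _ _ _ (nfg f g fg x Ux)).
- move=> i; have [df Cf] := Df i; split.
    by move=> x Ux; apply: near_eq_derivable (df x Ux); exact: (nfg f g fg x Ux).
  apply: IH Cf => x Ux; apply: near_eq_derive; exact: (nfg f g fg x Ux).
Unshelve. all: by end_near. Qed.

Lemma CkW k f : Ck k.+1 U f -> Ck k U f.
Proof.
elim: k f => [|k IH] f [cf Df]; split => //.
by move=> i; have [df Cf] := Df i; split => //; exact: IH.
Qed.

Lemma Ck_cst k (c : R) : Ck k U (cst c).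
Proof.
elim: k c => [|k IH] c; split => //; try by move=> x _; exact: cst_continuous.
move=> i; split; first by move=> x _; exact: derivable_cst.
by apply: (@Ck_ext _ (cst 0)) => // x _; rewrite derive_cst.
Qed.

Lemma Ck_add k f g : Ck k U f -> Ck k U g -> Ck k U (f + g).
Proof.
elim: k f g => [|k IH] f g [cf Df] [cg Dg]; split => //;
  try by move=> x Ux; apply: continuousD; [exact: cf|exact: cg].
move=> i; have [df Cf] := Df i; have [dg Cg] := Dg i; split.
  by move=> x Ux; apply: derivableD; [exact: df|exact: dg].
by apply: Ck_ext (IH _ _ Cf Cg) => x Ux; rewrite deriveD//; [exact: df|exact: dg].
Qed.

Lemma Ck_mul k f g : Ck k U f -> Ck k U g -> Ck k U (f * g).
Proof.
elim: k f g => [|k IH] f g Cf Cg; have [cf Df] := Cf; have [cg Dg] := Cg;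
  split => //; try by move=> x Ux; apply: continuousM; [exact: cf|exact: cg].
move=> i; have [df Dif] := Df i; have [dg Dig] := Dg i; split.
  by move=> x Ux; apply: derivableM; [exact: df|exact: dg].
have := Ck_add (IH _ _ (CkW Cf) Dig) (IH _ _ (CkW Cg) Dif).
by apply: Ck_ext => x Ux; rewrite deriveM//; [exact: df|exact: dg].
Qed.

End CkTheory.

(** * Smooth manifolds *)

(** [cinv] is only meaningful on the image of [cdom] under [cmap]. *)
Record chart (R : realType) (T : topologicalType) (n : nat) := Chart {
  cdom : set T;
  cmap : T -> 'rV[R]_n;
  cinv : 'rV[R]_n -> T
}.

Definition is_chart (R : realType) (T : topologicalType) (n : nat)
    (c : chart R T n) : Prop :=
  [/\ open (cdom c), open (cmap c @` cdom c),
      (forall x, cdom c x -> cinv c (cmap c x) = x),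
      (forall x, cdom c x -> {for x, continuous (cmap c)}) &
      (forall y, (cmap c @` cdom c) y -> {for y, continuous (cinv c)})].

Definition compatible (R : realType) (T : topologicalType) (n : nat)
    (c d : chart R T n) : Prop :=
  forall i : 'I_n,
    Cinfty (cmap c @` (cdom c `&` cdom d)) (fun y => cmap d (cinv c y) 0 i).

Record manifold (R : realType) := Manifold {
  points :> topologicalType;
  mdim : nat;
  atlas : set (chart R points mdim);
  _ : hausdorff_space points;
  _ : @second_countable points;
  atlas_chart : forall c, atlas c -> is_chart c;
  _ : forall p, exists2 c, atlas c & cdom c p;
  _ : forall c d, atlas c -> atlas d -> compatible c d
}.

Definition smooth (R : realType) (M : manifold R) (f : M -> R) : Prop :=
  forall c, @atlas R M c -> Cinfty (cmap c @` cdom c) (f \o cinv c).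

Definition smooth_pred (R : realType) (M : manifold R) : {pred M -> R} :=
  fun f => `[< smooth f >].
Arguments smooth_pred {R} M.

Lemma smooth_predE (R : realType) (M : manifold R) (f : M -> R) :
  smooth f <-> f \in smooth_pred M.
Proof. by split=> [h|/asboolP]; [exact/asboolP|]. Qed.

Section SmoothAlgebra.
Context (R : realType) (M : manifold R).

Let open_dom (c : chart R M (mdim M)) : atlas c -> open (cmap c @` cdom c).
Proof. by move=> /atlas_chart[]. Qed.

Lemma smooth_cst (a : R) : smooth (cst a : M -> R).
Proof. by move=> c /open_dom oc k; exact: (Ck_cst oc). Qed.

Lemma smooth_add (f g : M -> R) : smooth f -> smooth g -> smooth (f + g).
Proof.
by move=> sf sg c cA k; apply: (Ck_add (open_dom cA)); [exact: sf|exact: sg].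
Qed.

Lemma smooth_mul (f g : M -> R) : smooth f -> smooth g -> smooth (f * g).
Proof.
by move=> sf sg c cA k; apply: (Ck_mul (open_dom cA)); [exact: sf|exact: sg].
Qed.

Lemma smooth_scale (a : R) (f : M -> R) : smooth f -> smooth (a *: f).
Proof. by move=> sf; exact: (smooth_mul (smooth_cst a) sf). Qed.

Lemma smooth_subring_closed : subring_closed (smooth_pred M).
Proof.
split=> [|f g /asboolP sf /asboolP sg|f g /asboolP sf /asboolP sg].
- by apply/asboolP; exact: smooth_cst.
- apply/asboolP; apply: smooth_add => //.
  by rewrite -scaleN1r; exact: smooth_scale.
- by apply/asboolP; exact: smooth_mul.
Qed.

HB.instance Definition _ :=
  GRing.isSubringClosed.Build (M -> R) (smooth_pred M) smooth_subring_closed.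

Lemma smooth_scaler_closed : GRing.scaler_closed (smooth_pred M).
Proof. by move=> a f /asboolP sf; apply/asboolP; exact: smooth_scale. Qed.

HB.instance Definition _ :=
  GRing.isScaleClosed.Build R (M -> R) (smooth_pred M) smooth_scaler_closed.

(** The algebra C^oo(M). *)
Record smoothfun := SmoothFun {
  sf_val :> M -> R;
  sf_valP : sf_val \in smooth_pred M
}.

HB.instance Definition _ := [isSub for sf_val].
HB.instance Definition _ := [Choice of smoothfun by <:].
HB.instance Definition _ := GRing.SubChoice_isSubComPzRing.Build
  _ _ smoothfun smooth_subring_closed.
HB.instance Definition _ := [SubZmodule_isSubLmodule of smoothfun by <:].

Lemma sf_smooth (f : smoothfun) : smooth f.
Proof. by apply/smooth_predE; exact: sf_valP. Qed.

Lemma sf_ext (f g : smoothfun) : f =1 g -> f = g.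
Proof. by move=> fg; apply/val_inj/funext. Qed.

Definition mk_sf (f : M -> R) (sf : smooth f) : smoothfun :=
  SmoothFun (proj1 (smooth_predE f) sf).

(** The element of C^oo(M) with underlying function [f]; it is only used for
    functions [f] that are smooth, and is 0 for the others. *)
Definition to_sf (f : M -> R) : smoothfun := insubd (0 : smoothfun) f.

End SmoothAlgebra.
Arguments smoothfun {R} M.

(** Smoothness in charts is the same as pulling smooth functions back to smooth
    functions, since bump functions extend local coordinates to the manifold. *)
Record smap (R : realType) (M N : manifold R) := SMap {
  sm_fun :> M -> N;
  sm_smooth : forall f : smoothfun N, smooth (f \o sm_fun)
}.

Definition sf_comp (R : realType) (M N : manifold R) (phi : smap M N)
    (f : smoothfun N) : smoothfun M := mk_sf (sm_smooth phi f).

Section SmapOps.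
Context (R : realType).

Lemma comp_smooth (M N P : manifold R) (psi : smap N P) (phi : smap M N)
  (f : smoothfun P) : smooth (f \o (psi \o phi)).
Proof. exact: (sm_smooth phi (sf_comp psi f)). Qed.

Definition smap_comp (M N P : manifold R) (psi : smap N P) (phi : smap M N) :
  smap M P := SMap (comp_smooth psi phi).

End SmapOps.

(** * Tangent and cotangent spaces *)

Section Dual.
Context (R : realType) (V : lmodType R).

Definition dual_pred : {pred V -> R} := fun l =>
  `[< forall (a : R) (u v : V), l (a *: u + v) = a * l u + l v >].

Lemma dual_submod_closed : GRing.submod_closed dual_pred.
Proof.
split=> [|a l m /asboolP hl /asboolP hm]; apply/asboolP => b u v.
  by rewrite /= mulr0 addr0.
have E x : (a *: l + m) x = a * l x + m x by [].
by rewrite !E hl hm; ring.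
Qed.

HB.instance Definition _ :=
  GRing.isSubmodClosed.Build R (V -> R) dual_pred dual_submod_closed.

Record dual := Dual { dual_val :> V -> R; dual_valP : dual_val \in dual_pred }.

HB.instance Definition _ := [isSub for dual_val].
HB.instance Definition _ := [Choice of dual by <:].
HB.instance Definition _ := [SubChoice_isSubLmodule of dual by <:].

End Dual.

Section Transpose.
Context (R : realType) (V W : lmodType R) (A : {linear V -> W}).

Lemma transp_subproof (l : dual W) : (l \o A) \in @dual_pred R V.
Proof.
by apply/asboolP => a u v /=; rewrite linearP; move/asboolP: (dual_valP l).
Qed.

Definition transp (l : dual W) : dual V := Dual (transp_subproof l).

Lemma transp_linear : linear transp.
Proof. by move=> a l m; apply/val_inj/funext. Qed.

HB.instance Definition _ :=
  GRing.isLinear.Build R (dual W) (dual V) _ transp transp_linear.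

End Transpose.

Section Tangent.
Context (R : realType) (M : manifold R) (p : M).

Definition derivation_pred : {pred smoothfun M -> R} := fun v =>
  `[< (forall (a : R) (f g : smoothfun M), v (a *: f + g) = a * v f + v g) /\
      (forall f g : smoothfun M, v (f * g) = f p * v g + g p * v f) >].

Lemma derivation_submod_closed : GRing.submod_closed derivation_pred.
Proof.
split=> [|a v w /asboolP[lv dv] /asboolP[lw dw]]; apply/asboolP; split.
- by move=> b f g /=; rewrite mulr0 addr0.
- by move=> f g /=; rewrite !mulr0 addr0.
- have E f : (a *: v + w) f = a * v f + w f by [].
  by move=> b f g; rewrite !E lv lw; ring.
- have E f : (a *: v + w) f = a * v f + w f by [].
  by move=> f g; rewrite !E dv dw; ring.
Qed.

HB.instance Definition _ := GRing.isSubmodClosed.Build R (smoothfun M -> R)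
  derivation_pred derivation_submod_closed.

(** T_pM, as the space of derivations of C^oo(M) at p; manifolds are Hausdorff,
    so that global functions are enough. *)
Record tangent := Tangent {
  tg_val :> smoothfun M -> R;
  tg_valP : tg_val \in derivation_pred
}.

HB.instance Definition _ := [isSub for tg_val].
HB.instance Definition _ := [Choice of tangent by <:].
HB.instance Definition _ := [SubChoice_isSubLmodule of tangent by <:].

Lemma tg_lin (v : tangent) a f g : v (a *: f + g) = a * v f + v g.
Proof. by have /asboolP[] := tg_valP v. Qed.

Lemma tg_leibniz (v : tangent) f g : v (f * g) = f p * v g + g p * v f.
Proof. by have /asboolP[] := tg_valP v. Qed.

Lemma differential_subproof (f : smoothfun M) :
  (fun v : tangent => v f) \in @dual_pred R tangent.
Proof. by apply/asboolP. Qed.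

(** d_pf in T_p^*M *)
Definition differential (f : smoothfun M) : dual tangent :=
  Dual (differential_subproof f).

End Tangent.

Notation cotangent p := (dual (tangent p)).

Section Dmap.
Context (R : realType) (M N : manifold R) (phi : smap M N) (p : M) (q : N).
Context (e : phi p = q).

Lemma dmap_subproof (v : tangent p) :
  (v \o sf_comp phi) \in derivation_pred q.
Proof.
apply/asboolP; split=> [a f g|f g] /=.
  by rewrite -tg_lin; congr (v _); apply: sf_ext.
have -> : sf_comp phi (f * g) = sf_comp phi f * sf_comp phi g by apply: sf_ext.
by rewrite tg_leibniz /= e.
Qed.

(** The tangent map T_pM -> T_qN of [phi], where q = phi(p). *)
Definition dmap (v : tangent p) : tangent q := Tangent (dmap_subproof v).

Lemma dmap_linear : linear dmap.
Proof. by move=> a v w; apply/val_inj/funext. Qed.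

HB.instance Definition _ :=
  GRing.isLinear.Build R (tangent p) (tangent q) _ dmap dmap_linear.

End Dmap.

Notation tmap phi p := (@dmap _ _ _ phi p _ (erefl (sm_fun phi p))).

(** * Tensor fields *)

(** Bundle maps TM -> TM, T^*M -> TM and TM -> T^*M over the identity, not
    necessarily smooth; a 2-form F is the bundle map X |-> iota_X F. *)
Definition endo (R : realType) (M : manifold R) :=
  forall p : M, {linear tangent p -> tangent p}.
Definition bivector (R : realType) (M : manifold R) :=
  forall p : M, {linear cotangent p -> tangent p}.
Definition form2 (R : realType) (M : manifold R) :=
  forall p : M, {linear tangent p -> cotangent p}.

Definition smooth_vf (R : realType) (M : manifold R)
    (X : forall p : M, tangent p) : Prop :=
  forall f : smoothfun M, smooth (fun p => X p f).

Record vfield (R : realType) (M : manifold R) := VField {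
  vf_val :> forall p : M, tangent p;
  vf_smooth : smooth_vf vf_val
}.

Section Bracket.
Context (R : realType) (M : manifold R).

(** The derivative X(f). *)
Definition lie (X : vfield M) (f : smoothfun M) : smoothfun M :=
  mk_sf (vf_smooth X f).

Lemma bracket_subproof (X Y : vfield M) (p : M) :
  (fun f => X p (lie Y f) - Y p (lie X f)) \in derivation_pred p.
Proof.
have lieL (Z : vfield M) a f g : lie Z (a *: f + g) = a *: lie Z f + lie Z g.
  by apply: sf_ext => q /=; exact: tg_lin.
have lieM (Z : vfield M) f g : lie Z (f * g) = 1 *: (f * lie Z g) + g * lie Z f.
  by apply: sf_ext => q; rewrite scale1r; exact: tg_leibniz.
apply/asboolP; split=> [a f g|f g].
  by rewrite !lieL !tg_lin; ring.
by rewrite !lieM !tg_lin !tg_leibniz /=; ring.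
Qed.

Lemma bracket_smooth (X Y : vfield M) :
  smooth_vf (fun p => Tangent (bracket_subproof X Y p)).
Proof. by move=> f; exact: (sf_smooth (lie X (lie Y f) - lie Y (lie X f))). Qed.

Definition bracket (X Y : vfield M) : vfield M := VField (bracket_smooth X Y).

Definition smooth_endo (I : endo M) : Prop :=
  forall X : vfield M, smooth_vf (fun p => I p (X p)).

Definition endo_vf (I : endo M) (sI : smooth_endo I) (X : vfield M) :
  vfield M := VField (sI X).

(** Hamiltonian vector field Q(df) *)
Definition ham (Q : bivector M) (f : smoothfun M) (p : M) : tangent p :=
  Q p (differential p f).

Definition real_bivector (Q : bivector M) : Prop :=
  (forall f : smoothfun M, smooth_vf (ham Q f)) /\
  (forall (p : M) (xi : cotangent p), xi (Q p xi) = 0).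

Definition eval2 (F : form2 M) (X Y : vfield M) : smoothfun M :=
  to_sf (fun p => F p (X p) (Y p)).

Definition real_2form (F : form2 M) : Prop :=
  (forall X Y : vfield M, smooth (fun p => F p (X p) (Y p))) /\
  (forall (p : M) (v : tangent p), F p v v = 0).

Definition closed_2form (F : form2 M) : Prop :=
  real_2form F /\
  forall X Y Z : vfield M,
    lie X (eval2 F Y Z) - lie Y (eval2 F X Z) + lie Z (eval2 F X Y)
    - eval2 F (bracket X Y) Z + eval2 F (bracket X Z) Y
    - eval2 F (bracket Y Z) X = 0.

End Bracket.

Definition pull2 (R : realType) (M N : manifold R) (phi : smap M N)
    (F : form2 N) : form2 M :=
  fun p => transp (tmap phi p) \o F (phi p) \o tmap phi p.

Definition add2 (R : realType) (M : manifold R) (F G : form2 M) : form2 M :=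
  fun p => F p \+ G p.

Definition opp_bivector (R : realType) (M : manifold R) (Q : bivector M) :
  bivector M := fun p => (-1) \*: Q p.

(** * Complexification *)

(** The complexification of V, with (x, y) standing for x + iy. *)
Notation cplx V := (V * V)%type.

Section Complexification.
Context (R : realType).

(** multiplication by i *)
Definition imul (V : lmodType R) (x : cplx V) : cplx V := (- x.2, x.1).

(** C-linear extension *)
Definition cext (V W : lmodType R) (A : V -> W) (x : cplx V) : cplx W :=
  (A x.1, A x.2).

(** C-bilinear extension of the duality pairing *)
Definition cpair (V : lmodType R) (l : cplx (dual V)) (x : cplx V) : cplx R :=
  (l.1 x.1 - l.2 x.2, l.1 x.2 + l.2 x.1).

End Complexification.

(** * Complex manifolds and holomorphic Poisson structures *)

Section Holomorphic.
Context (R : realType).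

(** An almost complex structure whose Nijenhuis tensor vanishes. *)
Definition complex_structure (M : manifold R) (I : endo M) : Prop :=
  (forall (p : M) (v : tangent p), I p (I p v) = - v) /\
  exists sI : smooth_endo I, forall (X Y : vfield M) (p : M),
    bracket (endo_vf sI X) (endo_vf sI Y) p
    - I p (bracket (endo_vf sI X) Y p) - I p (bracket X (endo_vf sI Y) p)
    - bracket X Y p = 0.

Definition holomorphic_map (M N : manifold R) (I : endo M) (J : endo N)
    (phi : smap M N) : Prop :=
  forall (p : M) (v : tangent p), tmap phi p (I p v) = J (phi p) (tmap phi p v).

Section OnM.
Context (M : manifold R) (I : endo M) (Q : bivector M).

(** f_1 + i f_2 is holomorphic on U: df(Iv) = i df(v). *)
Definition holomorphic_on (U : set M) (f : cplx (smoothfun M)) : Prop :=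
  forall (p : M) (v : tangent p), U p ->
    (I p v f.1, I p v f.2) = imul (v f.1, v f.2).

(** sigma = - (IQ + iQ) / 4, as a C-linear map from complex covectors to
    complex vectors at p *)
Definition sigma (p : M) (zeta : cplx (cotangent p)) : cplx (tangent p) :=
  - 4^-1 *: (cext (I p) (cext (Q p) zeta) + imul (cext (Q p) zeta)).

(** {f, g} = sigma(df, dg) *)
Definition sigma_bracket (f g : cplx (smoothfun M)) : cplx (smoothfun M) :=
  let b p := cpair (cext (differential p) g) (sigma (cext (differential p) f)) in
  (to_sf (fun p => (b p).1), to_sf (fun p => (b p).2)).

(** sigma is a bivector (of type (2,0), since sigma = - (IQ + iQ) / 4 takes
    values in T^{1,0}), it is holomorphic, i.e. the bracket of local
    holomorphic functions is holomorphic, and [sigma, sigma] = 0.  Germs of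
    holomorphic functions extend to smooth functions on M, so that it is
    enough to consider the latter. *)
Definition holomorphic_poisson : Prop :=
  [/\ complex_structure I,
      real_bivector Q,
      forall (p : M) (zeta : cplx (cotangent p)),
        cpair zeta (sigma zeta) = 0,
      forall (U : set M) (f g : cplx (smoothfun M)), open U ->
        holomorphic_on U f -> holomorphic_on U g ->
        holomorphic_on U (sigma_bracket f g) &
      forall f g h : cplx (smoothfun M),
        sigma_bracket f (sigma_bracket g h) +
        sigma_bracket g (sigma_bracket h f) +
        sigma_bracket h (sigma_bracket f g) = 0].

(** L_sigma = {X + sigma(zeta) + zeta : X in T^{0,1}, zeta in T^*_{1,0}} at p,
    with the element X + xi of the sum written (X, xi) *)
Definition L_sigma (p : M) : set (cplx (tangent p) * cplx (cotangent p)) :=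
  [set e | exists (X : cplx (tangent p)) (zeta : cplx (cotangent p)),
     [/\ cext (I p) X = - imul X, cext (transp (I p)) zeta = imul zeta &
         e = (X + sigma zeta, zeta)]].

End OnM.

(** e^F (X + xi) = X + xi + iota_X F *)
Definition expF (M : manifold R) (F : form2 M) (p : M)
    (e : cplx (tangent p) * cplx (cotangent p)) :
  cplx (tangent p) * cplx (cotangent p) := (e.1, e.2 + cext (F p) e.1).

(** The data (M, I, Q) of a holomorphic Poisson manifold; the axioms are
    [hpoisson]. *)
Record hpdata := HPData {
  hp_mfd :> manifold R;
  hp_I : endo hp_mfd;
  hp_Q : bivector hp_mfd
}.
Arguments hp_I : clear implicits.
Arguments hp_Q : clear implicits.

Definition hpoisson (X : hpdata) : Prop := holomorphic_poisson (hp_I X) (hp_Q X).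

Definition hp_opp (X : hpdata) : hpdata := HPData (hp_I X) (opp_bivector (hp_Q X)).

(** phi_* sigma_X = sigma_Y *)
Definition poisson_map (X Y : hpdata) (phi : smap X Y) : Prop :=
  forall (p : X) (zeta : cplx (cotangent (phi p))),
    cext (tmap phi p) (sigma (hp_I X) (hp_Q X) (cext (transp (tmap phi p)) zeta)) =
    sigma (hp_I Y) (hp_Q Y) zeta.

(** * Holomorphic symplectic forms *)

(** The complex 2-form B + i omega. *)
Record cform2 (M : manifold R) := CForm2 { re2 : form2 M; im2 : form2 M }.

Definition ceval2 (M : manifold R) (Om : cform2 M) (p : M) (u v : tangent p) :
  cplx R := (re2 Om p u v, im2 Om p u v).

(** Nondegenerate closed form of type (2,0); the dbar-part of the closedness
    says that it is holomorphic. *)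
Definition holomorphic_symplectic (M : manifold R) (I : endo M)
    (Om : cform2 M) : Prop :=
  [/\ complex_structure I,
      closed_2form (re2 Om) /\ closed_2form (im2 Om),
      forall (p : M) (u v : tangent p),
        ceval2 Om (I p u) v = imul (ceval2 Om u v) &
      forall (p : M) (u : tangent p),
        (forall v : tangent p, ceval2 Om u v = 0) -> u = 0].

(** Q is the inverse of omega. *)
Definition inverse_bivector (M : manifold R) (Q : bivector M) (om : form2 M) :
    Prop :=
  forall p : M, cancel (om p) (Q p) /\ cancel (Q p) (om p).

(** * Maps, submanifolds, fibres, completeness *)

Definition injective_differential (M N : manifold R) (phi : smap M N) : Prop :=
  forall p : M, injective (tmap phi p).

Definition surjective_submersion (M N : manifold R) (phi : smap M N) : Prop :=
  (forall q : N, exists p : M, phi p = q) /\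
  (forall (p : M) (w : tangent (phi p)), exists v : tangent p, tmap phi p v = w).

(** Smooth embeddings; smooth submanifolds are their images. *)
Definition embedding (M N : manifold R) (phi : smap M N) : Prop :=
  [/\ injective phi,
      forall U : set M, open U -> exists2 V : set N, open V & U = phi @^-1` V &
      injective_differential phi].

Record diffeo (M N : manifold R) := Diffeo {
  df_fwd :> smap M N;
  df_bwd : smap N M;
  df_fwdK : cancel df_fwd df_bwd;
  df_bwdK : cancel df_bwd df_fwd
}.

Definition is_diffeo (M N : manifold R) (phi : smap M N) : Prop :=
  exists D : diffeo M N, D =1 phi.

(** Transport of structures along a diffeomorphism. *)
Definition pull_endo (M N : manifold R) (D : diffeo M N) (I : endo N) : endo M :=
  fun p => dmap (df_fwdK D p) \o I (D p) \o tmap D p.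

Definition pull_bivector (M N : manifold R) (D : diffeo M N) (Q : bivector N) :
  bivector M :=
  fun p => dmap (df_fwdK D p) \o Q (D p) \o transp (dmap (df_fwdK D p)).

Definition simply_connected (T : topologicalType) (A : set T) : Prop :=
  forall gamma : R -> T,
    {within `[0, 1]%classic, continuous gamma} ->
    (forall s, s \in `[0, 1] -> A (gamma s)) -> gamma 0 = gamma 1 ->
    exists H : R * R -> T,
      [/\ {within `[0, 1]%classic `*` `[0, 1]%classic, continuous H},
          forall t s, t \in `[0, 1] -> s \in `[0, 1] -> A (H (t, s)),
          forall s, s \in `[0, 1] -> H (0, s) = gamma s,
          forall s, s \in `[0, 1] -> H (1, s) = gamma 0 &
          forall t, t \in `[0, 1] -> H (t, 0) = gamma 0 /\ H (t, 1) = gamma 0].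

Definition sc_fibres (M N : manifold R) (phi : smap M N) : Prop :=
  forall q : N, connected (phi @^-1` [set q]) /\
                simply_connected (phi @^-1` [set q]).

Definition complete_vf (M : manifold R) (X : forall p : M, tangent p) : Prop :=
  forall p : M, exists gamma : R -> M, gamma 0 = p /\
    forall (f : smoothfun M) (t : R),
      is_derive t 1 (f \o gamma) (X (gamma t) f).

Definition complete_map (M N : manifold R) (phi : smap M N)
    (QM : bivector M) (QN : bivector N) : Prop :=
  forall f : smoothfun N,
    complete_vf (ham QN f) -> complete_vf (ham QM (sf_comp phi f)).

(** * Degenerate generalized Kaehler structures of symplectic type *)

Record gkdata (M : manifold R) := GKData {
  gk_Ip : endo M; gk_Im : endo M; gk_Q : bivector M; gk_F : form2 M
}.

Definition Xplus (M : manifold R) (D : gkdata M) : hpdata :=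
  HPData (gk_Ip D) (gk_Q D).
Definition Xminus (M : manifold R) (D : gkdata M) : hpdata :=
  HPData (gk_Im D) (gk_Q D).

Definition degenerate_GK (M : manifold R) (D : gkdata M) : Prop :=
  [/\ hpoisson (Xplus D), hpoisson (Xminus D), closed_2form (gk_F D) &
      forall p : M, L_sigma (gk_Ip D) (gk_Q D) (p := p) =
                    expF (gk_F D) (p := p) @` L_sigma (gk_Im D) (gk_Q D) (p := p)].

Definition gk_eq (M : manifold R) (D D' : gkdata M) : Prop :=
  forall p : M, [/\ gk_Ip D p =1 gk_Ip D' p, gk_Im D p =1 gk_Im D' p,
                    gk_Q D p =1 gk_Q D' p & gk_F D p =1 gk_F D' p].

(** * Symplectic groupoids *)

(** Composable pairs are (g, h) with s(g) = t(h); they form the manifold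
    [gr_pairs] with projections p1 : (g, h) |-> g and p2 : (g, h) |-> h. *)
Record groupoid (M : manifold R) := Groupoid {
  gr_arrows : manifold R;
  gr_s : smap gr_arrows M;
  gr_t : smap gr_arrows M;
  gr_unit : smap M gr_arrows;
  gr_inv : smap gr_arrows gr_arrows;
  gr_pairs : manifold R;
  gr_p1 : smap gr_pairs gr_arrows;
  gr_p2 : smap gr_pairs gr_arrows;
  gr_mul : smap gr_pairs gr_arrows
}.

(** Fibre products in the category of smooth manifolds; for a submersion s
    this is the submanifold {(g, h) : s(g) = t(h)} of the product. *)
Definition fibre_product (G H M P : manifold R) (s : smap G M) (t : smap H M)
    (p1 : smap P G) (p2 : smap P H) : Prop :=
  s \o p1 =1 t \o p2 /\
  forall (N : manifold R) (a : smap N G) (b : smap N H), s \o a =1 t \o b ->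
    exists c : smap N P, [/\ p1 \o c =1 a, p2 \o c =1 b &
      forall c' : smap N P, p1 \o c' =1 a -> p2 \o c' =1 b -> c' =1 c].

Definition lie_groupoid (M : manifold R) (G : groupoid M) : Prop :=
  let s := gr_s G in let t := gr_t G in let e := gr_unit G in
  let i := gr_inv G in
  let p1 := gr_p1 G in let p2 := gr_p2 G in let m := gr_mul G in
  [/\ surjective_submersion s /\ surjective_submersion t,
      fibre_product s t p1 p2,
      [/\ forall q, s (m q) = s (p2 q), forall q, t (m q) = t (p1 q) &
          forall q q' r r',
            p1 q = p1 r' -> p2 q = p1 q' -> p2 q' = p2 r ->
            m q = p1 r -> m q' = p2 r' -> m r = m r'],
      [/\ forall x, s (e x) = x, forall x, t (e x) = x,
          forall q, p1 q = e (t (p2 q)) -> m q = p2 q &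
          forall q, p2 q = e (s (p1 q)) -> m q = p1 q] &
      [/\ forall g, s (i g) = t g, forall g, t (i g) = s g,
          forall q, p2 q = i (p1 q) -> m q = e (t (p1 q)) &
          forall q, p1 q = i (p2 q) -> m q = e (s (p2 q))]].

(** m^* F = p1^* F + p2^* F *)
Definition multiplicative (M : manifold R) (G : groupoid M)
    (F : form2 (gr_arrows G)) : Prop :=
  forall q : gr_pairs G,
    pull2 (gr_mul G) F q =1 add2 (pull2 (gr_p1 G) F) (pull2 (gr_p2 G) F) q.

(** (G, I, Om) is a holomorphic symplectic groupoid over X. *)
Definition symplectic_groupoid (X : hpdata) (G : groupoid X)
    (I : endo (gr_arrows G)) (Om : cform2 (gr_arrows G)) : Prop :=
  [/\ lie_groupoid G,
      holomorphic_symplectic I Om,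
      [/\ holomorphic_map I (hp_I X) (gr_s G),
          holomorphic_map I (hp_I X) (gr_t G),
          holomorphic_map (hp_I X) I (gr_unit G),
          holomorphic_map I I (gr_inv G) &
          exists I2 : endo (gr_pairs G),
            [/\ complex_structure I2, holomorphic_map I2 I (gr_p1 G),
                holomorphic_map I2 I (gr_p2 G) &
                holomorphic_map I2 I (gr_mul G)]],
      multiplicative (re2 Om) /\ multiplicative (im2 Om) &
      exists QG : bivector (gr_arrows G),
        [/\ inverse_bivector QG (im2 Om),
            @poisson_map (HPData I QG) X (gr_t G) &
            @poisson_map (HPData I QG) (hp_opp X) (gr_s G)]].

Definition hp_integrable (X : hpdata) : Prop :=
  exists (G : groupoid X) (I : endo (gr_arrows G)) (Om : cform2 (gr_arrows G)),
    symplectic_groupoid I Om.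

Definition weinstein_groupoid (X : hpdata) (G : groupoid X)
    (I : endo (gr_arrows G)) (Om : cform2 (gr_arrows G)) : Prop :=
  symplectic_groupoid I Om /\ sc_fibres (gr_s G).

(** * Morita equivalences with brane bisection *)

(** A span X_- <- Z -> X_+ with a complex structure and a complex 2-form on Z,
    and a map L -> Z. *)
Record bspan (Xm Xp : hpdata) := BSpan {
  bs_Z : manifold R;
  bs_I : endo bs_Z;
  bs_Om : cform2 bs_Z;
  bs_pim : smap bs_Z Xm;
  bs_pip : smap bs_Z Xp;
  bs_L : manifold R;
  bs_emb : smap bs_L bs_Z
}.
Arguments bs_I {Xm Xp}.

Definition orthogonal_to_kernel (M N : manifold R) (Om : cform2 M)
    (phi : smap M N) (p : M) : set (tangent p) :=
  [set u | forall v : tangent p, tmap phi p v = 0 -> ceval2 Om u v = 0].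

(** In the last condition, Q_Z is the inverse of Im(Omega). *)
Definition morita_equivalence (Xm Xp : hpdata) (Z : manifold R) (I : endo Z)
    (Om : cform2 Z) (pim : smap Z Xm) (pip : smap Z Xp) : Prop :=
  [/\ holomorphic_symplectic I Om,
      [/\ surjective_submersion pim, surjective_submersion pip,
          holomorphic_map I (hp_I Xm) pim & holomorphic_map I (hp_I Xp) pip],
      sc_fibres pim /\ sc_fibres pip,
      forall p : Z,
        [set u | tmap pim p u = 0] = orthogonal_to_kernel Om pip (p := p) /\
        [set u | tmap pip p u = 0] = orthogonal_to_kernel Om pim (p := p) &
      exists QZ : bivector Z,
        [/\ inverse_bivector QZ (im2 Om),
            @poisson_map (HPData I QZ) Xp pip,
            @poisson_map (HPData I QZ) (hp_opp Xm) pim,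
            complete_map pip QZ (hp_Q Xp) &
            complete_map pim QZ (opp_bivector (hp_Q Xm))]].

(** The tangent spaces of the submanifold equal their omega-orthogonals. *)
Definition lagrangian (L Z : manifold R) (om : form2 Z) (l : smap L Z) : Prop :=
  forall (p : L) (u : tangent (l p)),
    (forall v : tangent p, om (l p) u (tmap l p v) = 0) <->
    (exists v : tangent p, u = tmap l p v).

Definition brane_bisection (Xm Xp : hpdata) (S : bspan Xm Xp) : Prop :=
  [/\ embedding (bs_emb S),
      lagrangian (im2 (bs_Om S)) (bs_emb S),
      is_diffeo (smap_comp (bs_pim S) (bs_emb S)) &
      is_diffeo (smap_comp (bs_pip S) (bs_emb S))].

Definition morita_brane (Xm Xp : hpdata) (S : bspan Xm Xp) : Prop :=
  morita_equivalence (bs_I S) (bs_Om S) (bs_pim S) (bs_pip S) /\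
  brane_bisection S.

Definition bspan_iso (Xm Xp : hpdata) (S S' : bspan Xm Xp) : Prop :=
  exists Phi : diffeo (bs_Z S) (bs_Z S'),
    [/\ holomorphic_map (bs_I S) (bs_I S') Phi,
        forall (p : bs_Z S) (u v : tangent p),
          ceval2 (bs_Om S') (tmap Phi p u) (tmap Phi p v) = ceval2 (bs_Om S) u v,
        bs_pim S' \o Phi =1 bs_pim S,
        bs_pip S' \o Phi =1 bs_pip S &
        Phi @` range (bs_emb S) = range (bs_emb S')].

(** * The two constructions *)

(** Omega_- + t^* F *)
Definition gauge_form (M : manifold R) (G : groupoid M)
    (Om : cform2 (gr_arrows G)) (F : form2 M) : cform2 (gr_arrows G) :=
  CForm2 (add2 (re2 Om) (pull2 (gr_t G) F)) (im2 Om).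

(** I = omega^{-1} B *)
Definition complex_structure_of (Z : manifold R) (Om : cform2 Z) (I : endo Z) :
    Prop :=
  forall (p : Z) (v : tangent p), im2 Om p (I p v) = re2 Om p v.

(** [G] is a groupoid over X_-, with form [Om]; pi_+ = t, pi_- = s and the brane
    is the identity bisection. *)
Definition span_of_gk (M : manifold R) (D : gkdata M) (G : groupoid M)
    (Om : cform2 (gr_arrows G)) (I : endo (gr_arrows G)) :
    bspan (Xminus D) (Xplus D) :=
  @BSpan (Xminus D) (Xplus D) (gr_arrows G) I (gauge_form Om (gk_F D))
    (gr_s G) (gr_t G) M (gr_unit G).

(** X_- and X_+ are identified with L by means of the diffeomorphisms [Dm] and
    [Dp].  Q is transported from X_+, and F is the real part of the restriction
    of Omega to L; that transporting Q from X_- gives the same bivector and that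
    Omega is real on L has to be stated separately. *)
Definition gk_of_span (Xm Xp : hpdata) (S : bspan Xm Xp)
    (Dm : diffeo (bs_L S) Xm) (Dp : diffeo (bs_L S) Xp) : gkdata (bs_L S) :=
  {| gk_Ip := pull_endo Dp (hp_I Xp);
     gk_Im := pull_endo Dm (hp_I Xm);
     gk_Q := pull_bivector Dp (hp_Q Xp);
     gk_F := pull2 (bs_emb S) (re2 (bs_Om S)) |}.

(** A span from L to L seen as a span from X_- to X_+. *)
Definition retarget (Xm Xp Ym Yp : hpdata) (f : smap Ym Xm) (g : smap Yp Xp)
    (S : bspan Ym Yp) : bspan Xm Xp :=
  BSpan (bs_I S) (bs_Om S) (smap_comp f (bs_pim S)) (smap_comp g (bs_pip S))
    (bs_emb S).

End Holomorphic.
Arguments hp_I {R}.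
Arguments hp_Q {R}.
Arguments bs_I {R Xm Xp}.
Arguments gk_of_span {R Xm Xp}.

(* Main.v *)
(** Write Omega = B + i omega.  The relation between the Dirac structures of sigma_+ and sigma_- says that
    I_+ - I_- = QF and F I_+ + I_-^* F = 0; on the groupoid this makes omega^{-1}(B + t^*F) an almost complex
    structure, which is integrable because both forms are closed.  Conversely, for v tangent to the brane of a
    Morita equivalence let f be a function on X_+ with df = F v.  Then I v minus the Hamiltonian vector field of
    pi_+^* f is omega-orthogonal to the brane, hence tangent to it, and comparing its two projections gives
    I_+ v - I_- v = QF v.

    For uniqueness, identify X_+ and X_- with the brane and let k run through the functions with complete
    Hamiltonian vector fields.  The flows of the pi_+^* k preserve omega and the fibres of pi_-, cover the flows
    of the k, and act transitively on each (connected) fibre of pi_-.  Given two Morita equivalences with the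
    same brane data, words in these flows act on both, and the points obtained by applying the same word to the
    same point of the two branes are related.  Along a fibre of pi_- the relation is a union of graphs of local
    sections, so by simple connectedness it is the graph of a diffeomorphism Phi intertwining the flows.  The
    closed forms Phi^* omega' - omega and Phi^* B' - B are annihilated by the Hamiltonian vector fields of the
    pi_+^* k and vanish on the brane; hence they vanish. *)

From HB Require Import structures.
Require Import Defs.
From mathcomp Require Import all_boot all_order all_algebra.
From mathcomp Require Import all_classical all_reals all_analysis.
From mathcomp Require Import ring lra zify.

Set Implicit Arguments.
Unset Strict Implicit.
Unset Printing Implicit Defensive.

Import Order.TTheory GRing.Theory Num.Theory.
Import numFieldNormedType.Exports.
Local Open Scope classical_set_scope.
Local Open Scope ring_scope.

(** * Calculus *)

(** The obstacle is that a point of a fibre is reached by many words of flows. A word with variable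
    times is a smooth map [Th] out of a Euclidean space, and changing the times moves its endpoint
    by the Hamiltonian vector of a single function [par_ham], pulled back from the base. That
    function is built from the flows on the base alone, so it is the same for two Morita
    equivalences; this is why a local section written with words intertwines the flows, and why
    sections based at different points of a fibre match. On the groupoid, completeness comes from
    right translation: trajectories stay over trajectories on the base, and those starting at units
    near a given one live for a common time, which right translation carries to every arrow. Tangent
    vectors are derivations and smooth maps are recognised by pulling functions back, so charts
    enter only through coordinates cut off to global maps. Flows are limits of Euler polygons with
    dyadic steps; the derivative of a polygon in its starting point is again a polygon, and smooth
    dependence follows. Integrals with parameters and the inverse function theorem are obtained from
    flows as well. *)

Section MatrixNorm.
Context (R : realType).

Lemma near_forall n (T : topologicalType) (x : T) (P : 'I_n -> T -> Prop) :
  (forall i, \forall y \near x, P i y) -> \forall y \near x, forall i, P i y.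
Proof. exact: (@filter_forall _ 'I_n P (nbhs x)). Qed.

Lemma coord_le_norm n (x : 'rV[R]_n) i : `|x 0 i| <= `|x|.
Proof.
rewrite [leRHS]/Num.Def.normr/= mx_normrE.
exact: (le_bigmax _ (fun ij => `|x ij.1 ij.2|) (0, i)).
Qed.

Lemma norm_le_coord n (x : 'rV[R]_n) e :
  0 <= e -> (forall i, `|x 0 i| <= e) -> `|x| <= e.
Proof.
move=> e0 h; rewrite [leLHS]/Num.Def.normr/= mx_normrE.
by apply: bigmax_le => //= -[i j] _ /=; rewrite ord1.
Qed.

Lemma continuous_rV (T : topologicalType) n (g : T -> 'rV[R]_n) x :
  (forall i, {for x, continuous (fun y => g y 0 i)}) -> {for x, continuous g}.
Proof.
move=> cg; rewrite /prop_for /continuous_at; apply/cvgrPdist_le => e e0.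
have : \forall y \near x, forall i, `|g x 0 i - g y 0 i| <= e.
  apply: near_forall => i.
  by have /cvgrPdist_le/(_ _ e0) := cg i.
apply: filterS => y H; apply: norm_le_coord => [|i]; first exact: ltW.
by rewrite !mxE.
Qed.

Lemma continuous_coord (T : topologicalType) n (g : T -> 'rV[R]_n) x i :
  {for x, continuous g} -> {for x, continuous (fun y => g y 0 i)}.
Proof.
move=> cg; apply: (@continuous_comp _ _ _ g (fun z : 'rV[R]_n => z 0 i)) => //.
exact: coord_continuous.
Qed.

Lemma for_continuous_sum (T : topologicalType) (I : Type) (r : seq I)
    (F : I -> T -> R) x : (forall i, {for x, continuous (F i)}) ->
  {for x, continuous (fun y => \sum_(i <- r) F i y)}.
Proof.
move=> h; elim: r => [|i r IH].
  have -> : (fun y => \sum_(i <- [::]) F i y) = cst 0.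
    by apply/funext => y; rewrite big_nil.
  exact: cst_continuous.
have -> : (fun y => \sum_(j <- i :: r) F j y) = F i + (fun y => \sum_(j <- r) F j y).
  by apply/funext => y; rewrite big_cons.
exact: continuousD.
Qed.

Lemma for_continuous_ext (T U : topologicalType) (f g : T -> U) x :
  f =1 g -> {for x, continuous f} -> {for x, continuous g}.
Proof. by move=> /funext ->. Qed.

End MatrixNorm.

Section Lines.
Context (R : realType).

Lemma line_is_derive (V W : normedModType R) (f : V -> W) a v (t : R) df :
  is_derive (a + t *: v) v f df -> is_derive t 1 (fun s => f (a + s *: v)) df.
Proof.
have E : (fun h : R => h^-1 *: (((fun s => f (a + s *: v)) \o shift t) (h *: 1)
            - f (a + t *: v)))
       = (fun h => h^-1 *: ((f \o shift (a + t *: v)) (h *: v) - f (a + t *: v))).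
  apply/funext => h /=; congr (_ *: (f _ - _)).
  by rewrite [h *: 1]mulr1 scalerDl addrCA.
case=> fd fv; split; first by rewrite /derivable E.
by rewrite -fv /derive E.
Qed.

(** Both signs of [s] are treated at once, so the intermediate [c] is controlled only through its
    absolute value. *)
Lemma mvt_line (V : normedModType R) (f : V -> R) a v (s : R) :
  (forall t : R, `|t| <= `|s| -> derivable f (a + t *: v) v) ->
  exists2 c, `|c| <= `|s| & f (a + s *: v) - f a = s * 'D_v f (a + c *: v).
Proof.
move=> fd; pose g := fun t => f (a + t *: v).
have gd (t : R) : `|t| <= `|s| -> is_derive t 1 g ('D_v f (a + t *: v)).
  by move=> ts; apply: line_is_derive; apply: DeriveDef => //; exact: fd.
have gc (t : R) : `|t| <= `|s| -> {for t, continuous g}.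
  by move=> /gd[gt _]; apply/differentiable_continuous/derivable1_diffP.
case: (leP 0 s) => s0.
  have [||c] := @MVT_segment R g (fun t => 'D_v f (a + t *: v)) 0 s s0.
  - move=> t; rewrite in_itv /= => /andP[t0 ts]; apply: gd.
    by rewrite gtr0_norm// ger0_norm// ltW.
  - apply: continuous_in_subspaceT => t; rewrite inE/= in_itv/= => /andP[t0 ts].
    by apply: gc; rewrite !ger0_norm.
  - rewrite in_itv/= => /andP[c0 cs] E; exists c; first by rewrite !ger0_norm.
    by move: E; rewrite /g scale0r addr0 subr0 mulrC.
have [||c] := @MVT_segment R g (fun t => 'D_v f (a + t *: v)) s 0 (ltW s0).
- move=> t; rewrite in_itv /= => /andP[t0 ts]; apply: gd.
  by rewrite !ltr0_norm ?lerN2 ?ltW.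
- apply: continuous_in_subspaceT => t; rewrite inE/= in_itv/= => /andP[t0 ts].
  by apply: gc; rewrite !ler0_norm ?lerN2// ltW.
- rewrite in_itv/= => /andP[c0 cs] E; exists c; first by rewrite !ler0_norm ?lerN2// ltW.
  move: E; rewrite /g scale0r addr0 sub0r => E.
  by rewrite -[LHS]opprB E mulrN opprK mulrC.
Qed.

(** Restricting [g] to the line through [x] in direction [v] reduces this to the chain rule for a
    curve, so that [g] may be derivable in that one direction only. *)
Lemma derivable_comp (V W Z : normedModType R) (f : W -> Z) (g : V -> W) x v :
  derivable g x v -> differentiable f (g x) ->
  is_derive x v (f \o g) ('d f (g x) ('D_v g x)).
Proof.
move=> dg df; pose h (t : R) := g (x + t *: v).
have hd : is_derive (0 : R) 1 h ('D_v g x).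
  by apply: line_is_derive; rewrite scale0r addr0; exact: DeriveDef.
have h0 : h 0 = g x by rewrite /h scale0r addr0.
have dh : differentiable h 0 by apply/derivable1_diffP; case: hd.
have dfh : differentiable f (h 0) by rewrite h0.
have dfo : differentiable (f \o h) 0 by exact: differentiable_comp.
have E : (fun r : R => r^-1 *: (((f \o h) \o shift 0) (r *: 1) - (f \o h) 0))
    = (fun r => r^-1 *: (((f \o g) \o shift x) (r *: v) - (f \o g) x)).
  apply/funext => r /=; rewrite h0 /h addr0 [r *: 1]mulr1.
  by rewrite [x + _]addrC.
have [d1 d2] : is_derive (0 : R) 1 (f \o h) ('d f (g x) ('D_v g x)).
  apply: DeriveDef; first exact/derivable1_diffP.
  rewrite deriveE// diff_comp//= h0; congr ('d f _ _).
  by rewrite -deriveE//; case: hd.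
split; first by move: d1; rewrite /derivable E.
by rewrite -d2 /derive E.
Qed.

End Lines.

(** * Functions with continuous partial derivatives *)

Section C1.
Context (R : realType) (n : nat).
Notation E := 'rV[R]_n.
Notation e i := (delta_mx 0 i : E).
Implicit Types (f : E -> R) (x h : E).

(** Walk from [x] to [x + h] along the coordinate directions: [P j] keeps the first [j] coordinates
    of [h]. On each edge the mean value theorem replaces the increment by a partial derivative at a
    point of the ball, close to the one at [x]. *)
Lemma C1_bound f x :
  (forall i : 'I_n, \forall y \near x, derivable f y (e i)) ->
  (forall i : 'I_n, {for x, continuous ('D_(e i) f)}) ->
  forall eps, 0 < eps -> \forall h \near (0 : E),
  `|f (x + h) - f x - \sum_i h 0 i * 'D_(e i) f x| <= eps * `|h|.
Proof.
move=> fd fc eps eps0.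
(* Each of the [n] edges may cost [eps / n]; dividing by [n.+1] also covers [n = 0]. *)
pose eps' := eps / n.+1%:R.
have eps'0 : 0 < eps' by rewrite divr_gt0.
have : \forall y \near x, forall i : 'I_n, derivable f y (e i) /\
    `|'D_(e i) f x - 'D_(e i) f y| <= eps'.
  apply: near_forall => i; apply: filterI; first exact: fd.
  by have /cvgrPdist_le/(_ _ eps'0) := fc i.
move=> /nbhs_ballP[d /= d0 Hd].
apply/nbhs_ballP; exists d => //= h; rewrite -ball_normE /ball_ /= sub0r normrN => hd.
pose P (j : nat) : E := \row_k (if (k < j)%N then h 0 k else 0).
have Pb j c (k : 'I_n) : `|c| <= `|h 0 k| -> k = j :> nat ->
    ball x d (x + P j + c *: e k).
  move=> ck kj; rewrite -ball_normE /ball_ /= -addrA opprD addrA subrr sub0r normrN.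
  apply: le_lt_trans hd; apply: norm_le_coord => // i; rewrite !mxE eqxx /=.
  case: (ltngtP i j) => [ij|ij|ij] /=.
  - rewrite (_ : i == k = false) ?mulr0 ?addr0 ?coord_le_norm//.
    by apply/eqP => ik; move: ij; rewrite ik kj ltnn.
  - rewrite (_ : i == k = false) ?mulr0 ?addr0 ?normr0//.
    by apply/eqP => ik; move: ij; rewrite ik kj ltnn.
  - rewrite (_ : i == k) ?mulr1 ?add0r; last by apply/eqP/val_inj; rewrite /= ij kj.
    exact: le_trans ck (coord_le_norm _ _).
have P0 : P 0%N = 0 by apply/rowP => k; rewrite !mxE ltn0.
have Pn : P n = h by apply/rowP => k; rewrite !mxE ltn_ord.
have PS (k : 'I_n) : P k.+1 = P k + h 0 k *: e k.
  apply/rowP => i; rewrite !mxE eqxx /= ltnS leq_eqVlt.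
  case: (ltngtP i k) => [ik|ik|ik] /=.
  - by rewrite (_ : i == k = false) ?mulr0 ?addr0 ?add0r//; apply/eqP => E; rewrite E ltnn in ik.
  - by rewrite (_ : i == k = false) ?mulr0 ?addr0 ?add0r//; apply/eqP => E; rewrite E ltnn in ik.
  - by move/val_inj: ik => ->; rewrite eqxx mulr1 add0r.
have T : f (x + h) - f x = \sum_(k < n) (f (x + P k.+1) - f (x + P k)).
  rewrite -(big_mkord xpredT (fun k => f (x + P k.+1) - f (x + P k))).
  by rewrite telescope_sumr// Pn P0 addr0.
rewrite T -sumrB; apply: le_trans (ler_norm_sum _ _ _) _.
have le1 (k : 'I_n) : `|f (x + P k.+1) - f (x + P k) - h 0 k * 'D_(e k) f x|
    <= eps' * `|h|.
  have [t tk|c ck] := @mvt_line R E f (x + P k) (e k) (h 0 k).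
    by have [] := Hd _ (Pb k t k tk erefl) k.
  rewrite -addrA -PS => ->.
  rewrite -mulrBr normrM mulrC ler_pM//; last exact: coord_le_norm.
  rewrite distrC.
  by have [] := Hd _ (Pb k c k ck erefl) k.
apply: le_trans (ler_sum _ (fun k _ => le1 k)) _.
rewrite sumr_const card_ord -mulr_natr mulrAC ler_wpM2r//.
by rewrite /eps' mulrAC ler_pdivrMr ?ltr0n// ler_pM2l// ler_nat.
Qed.

Lemma C1_differentiable f x :
  (forall i : 'I_n, \forall y \near x, derivable f y (e i)) ->
  (forall i : 'I_n, {for x, continuous ('D_(e i) f)}) ->
  differentiable f x /\ forall v, 'd f x v = \sum_i v 0 i * 'D_(e i) f x.
Proof.
move=> fd fc; pose L (v : E) := \sum_i v 0 i * 'D_(e i) f x.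
have Ll : linear L.
  move=> a u v; rewrite /L scaler_sumr -big_split; apply: eq_bigr => i _ /=.
  by rewrite !mxE mulrDl -mulrA.
pose Llin := GRing.isLinear.Build _ _ _ _ L Ll.
pose LL : {linear E -> R} := HB.pack L Llin.
have cL : continuous LL.
  move=> y; apply: for_continuous_sum => i; apply: continuousM; last exact: cst_continuous.
  exact: coord_continuous.
have B := C1_bound fd fc.
have O : f \o shift x = cst (f x) + LL +o_ (0 : E) id.
  apply/eqaddoP => _/posnumP[eps].
  have := B _ [gt0 of eps%:num]; apply: filterS => h.
  move=> H; rewrite [X in `|X|](_ : _ = f (x + h) - f x - L h) //.
  by rewrite !fctE /= [h + x]addrC opprD addrA.
have DL := diff_unique cL O.
split; last by move=> v; rewrite DL.
by apply/diff_locallyP; rewrite DL.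
Qed.

(** The second difference over a square of side [r] is symmetric in the two directions, and two uses
    of the mean value theorem make it [r ^+ 2] times a mixed derivative near [x]. Comparing both
    orders for small [r] gives the equality. *)
Lemma Schwarz f x (i j : 'I_n) (U : set E) : open U -> U x -> Ck 2 U f ->
  'D_(e i) ('D_(e j) f) x = 'D_(e j) ('D_(e i) f) x.
Proof.
move=> oU Ux [_ Cf].
have key (a b : 'I_n) (eps : R) : 0 < eps -> exists2 d, 0 < d &
  forall r, 0 < r -> r < d ->
  `|f (x + r *: e a + r *: e b) - f (x + r *: e a) - f (x + r *: e b) + f x
    - r ^+ 2 * 'D_(e b) ('D_(e a) f) x| <= r ^+ 2 * eps.
  move=> eps0.
  have [da [_ Ca]] := Cf a; have [dab [cab _]] := Ca b.
  have : \forall y \near x, U y /\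
     `|'D_(e b) ('D_(e a) f) x - 'D_(e b) ('D_(e a) f) y| <= eps.
    apply: filterI; first exact: open_nbhs_nbhs.
    by have /cvgrPdist_le/(_ _ eps0) := cab _ Ux.
  move=> /nbhs_ballP[d /= d0 Hd]; exists (d / 2); first by rewrite divr_gt0.
  move=> r r0 rd.
  have ne (k : 'I_n) : `|e k : E| <= 1.
    apply: norm_le_coord => // l; rewrite mxE eqxx /=.
    by case: (_ == _); rewrite ?normr1 ?normr0.
  have inb (s t : R) : `|s| <= `|r| -> `|t| <= `|r| -> ball x d (x + s *: e a + t *: e b).
    move=> sr tr; rewrite -ball_normE /ball_ /= -addrA opprD addrA subrr sub0r normrN.
    apply: le_lt_trans (ler_normD _ _) _; rewrite !normrZ.
    rewrite [d]splitr; apply: ler_ltD; apply: le_lt_trans rd || apply: le_trans (ltW rd).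
      by rewrite -[leRHS]mulr1 ler_pM// (le_trans sr)// gtr0_norm.
    by rewrite -[leRHS]mulr1 ler_pM// (le_trans tr)// gtr0_norm.
  pose g (y : 'rV[R]_n) := f (y + r *: e b) - f y.
  have gd (t : R) : `|t| <= `|r| -> derivable g (x + t *: e a) (e a) /\
     'D_(e a) g (x + t *: e a) =
      'D_(e a) f (x + t *: e a + r *: e b) - 'D_(e a) f (x + t *: e a).
    move=> tr.
    have d1 : derivable f (x + t *: e a) (e a).
      by apply: da; have := inb t 0 tr; rewrite scale0r addr0 normr0 => /(_ (normr_ge0 _)) /Hd[].
    have d2 : is_derive (x + t *: e a) (e a) (fun y : 'rV[R]_n => f (y + r *: e b))
        ('D_(e a) f (x + t *: e a + r *: e b)).
      have d3 : derivable f (x + t *: e a + r *: e b) (e a).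
        by apply: da; have /Hd[] := inb t r tr (lexx _).
      have E : (fun h : R => h^-1 *: (((fun y : 'rV[R]_n => f (y + r *: e b)) \o shift (x + t *: e a)) (h *: e a) - f (x + t *: e a + r *: e b)))
       = (fun h : R => h^-1 *: ((f \o shift (x + t *: e a + r *: e b)) (h *: e a) - f (x + t *: e a + r *: e b))).
        by apply/funext => h /=; rewrite !addrA.
      by split; [rewrite /derivable E | rewrite /derive E].
    have d3 := DeriveDef d1 erefl.
    have d4 := is_deriveB d2 d3.
    by split; [exact: ex_derive|exact: derive_val].
  have [t tr|c cr] := @mvt_line R E g x (e a) r; first exact: (gd t tr).1.
  rewrite (gd c cr).2 => E1.
  have [t tr|c' c'r E2] := @mvt_line R E ('D_(e a) f) (x + c *: e a) (e b) r.
    by apply: dab; have /Hd[] := inb c t cr tr.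
  have -> : f (x + r *: e a + r *: e b) - f (x + r *: e a) - f (x + r *: e b) + f x
     = g (x + r *: e a) - g x.
    by rewrite /g; ring.
  rewrite E1 E2 mulrA -expr2 -mulrBr normrM ger0_norm ?sqr_ge0// ler_pM2l ?exprn_gt0//.
  by rewrite distrC; have /Hd[] := inb c c' cr c'r.
apply/eqP; rewrite -subr_eq0 -normr_eq0 eq_le normr_ge0 andbT.
apply/ler_addgt0Pr => eps eps0; rewrite add0r.
have e20 : 0 < eps / 2 by rewrite divr_gt0.
have [d1 d10 H1] := key i j _ e20; have [d2 d20 H2] := key j i _ e20.
pose r := Num.min d1 d2 / 2.
have m0 : 0 < Num.min d1 d2 by rewrite lt_min d10.
have r0 : 0 < r by rewrite divr_gt0.
have rm : r < Num.min d1 d2 by rewrite /r ltr_pdivrMr// ltr_pMr// ltr1n.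
have [rd1 rd2] : r < d1 /\ r < d2 by move: rm; rewrite lt_min => /andP[].
have {}H1 := H1 r r0 rd1; have {}H2 := H2 r r0 rd2.
have r20 : 0 < r ^+ 2 by rewrite exprn_gt0.
rewrite -(ler_pM2l r20) -{1}(ger0_norm (ltW r20)) -normrM mulrBr.
set A := f (x + r *: e i + r *: e j) - f (x + r *: e i) - f (x + r *: e j) + f x in H1.
have EA : f (x + r *: e j + r *: e i) - f (x + r *: e j) - f (x + r *: e i) + f x = A.
  by rewrite /A (addrAC x); ring.
rewrite EA in H2.
have tri (u w c : R) : `|A - w| <= c -> `|A - u| <= c -> `|u - w| <= c + c.
  move=> h1 h2; have -> : u - w = (A - w) - (A - u) by ring.
  by apply: le_trans (ler_normB _ _) _; exact: lerD.
by apply: le_trans (tri _ _ _ H1 H2) _; rewrite -mulrDr -splitr.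
Qed.

End C1.

Section CkMore.
Context (R : realType).

Lemma Ck_sub n k (U V : set 'rV[R]_n) f : U `<=` V -> Ck k V f -> Ck k U f.
Proof.
move=> UV; elim: k f => [|k IH] f /= [cf Df]; split => //; try by move=> x /UV; exact: cf.
move=> i; have [df Cf] := Df i; split; first by move=> x /UV; exact: df.
exact: IH.
Qed.

Lemma Ck_local n k (U : set 'rV[R]_n) f :
  (forall x, U x -> exists2 W, W x & Ck k W f) -> Ck k U f.
Proof.
elim: k f => [|k IH] f H /=; split => //.
- by move=> x /H[W Wx [cf _]]; exact: cf.
- by move=> x /H[W Wx [cf _]]; exact: cf.
- move=> i; split.
    by move=> x /H[W Wx [_ /(_ i)[df _]]]; exact: df.
  by apply: IH => x /H[W Wx [_ /(_ i)[_ Cf]]]; exists W.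
Qed.

Section OneSpace.
Context (n : nat) (U : set 'rV[R]_n) (oU : open U).

Lemma Ck_sum (I : Type) (r : seq I) k (F : I -> 'rV[R]_n -> R) :
  (forall i, Ck k U (F i)) -> Ck k U (fun x => \sum_(i <- r) F i x).
Proof.
move=> h; elim: r => [|i r IH].
  by apply: (Ck_ext oU _ (Ck_cst oU k 0)) => x _; rewrite big_nil.
by apply: (Ck_ext oU _ (Ck_add oU (h i) IH)) => x _; rewrite big_cons.
Qed.

Lemma Ck_prod (I : Type) (r : seq I) k (F : I -> 'rV[R]_n -> R) :
  (forall i, Ck k U (F i)) -> Ck k U (fun x => \prod_(i <- r) F i x).
Proof.
move=> h; elim: r => [|i r IH].
  by apply: (Ck_ext oU _ (Ck_cst oU k 1)) => x _; rewrite big_nil.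
by apply: (Ck_ext oU _ (Ck_mul oU (h i) IH)) => x _; rewrite big_cons.
Qed.

Lemma Ck_opp k f : Ck k U f -> Ck k U (fun x => - f x).
Proof.
move=> h; apply: (Ck_ext oU _ (Ck_mul oU (Ck_cst oU k (-1)) h)) => x _.
by rewrite !fctE mulN1r.
Qed.

Lemma coord_is_derive j (x v : 'rV[R]_n) :
  is_derive x v (fun y : 'rV[R]_n => y 0 j) (v 0 j).
Proof.
apply: DeriveDef; first exact/diff_derivable/differentiable_coord.
have := @derive_mx R _ _ _ id x v (@derivable_id _ _ x v).
by rewrite derive_id => {2}->; rewrite mxE.
Qed.

Lemma Ck_coord k j : Ck k U (fun x => x 0 j).
Proof.
case: k => [|k]; split => //; try by move=> x _; exact: coord_continuous.
move=> i; split; first by move=> x _; have [] := coord_is_derive j x (delta_mx 0 i).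
apply: (Ck_ext oU _ (Ck_cst oU k ((delta_mx 0 i : 'rV[R]_n) 0 j))) => x _.
by have [_ ->] := coord_is_derive j x (delta_mx 0 i).
Qed.

Lemma Ck_differentiable k f x : U x -> Ck k.+1 U f -> differentiable f x /\
  forall v, 'd f x v = \sum_i v 0 i * 'D_(delta_mx 0 i) f x.
Proof.
move=> Ux [_ Df]; apply: C1_differentiable => i; have [df Cf] := Df i.
  near=> y; apply: df; near: y; exact: open_nbhs_nbhs.
exact: (Ck_cont Cf).
Unshelve. all: by end_near. Qed.

Lemma Ck_derive k f x v : U x -> Ck k.+1 U f ->
  is_derive x v f (\sum_i v 0 i * 'D_(delta_mx 0 i) f x).
Proof.
move=> Ux Cf; have [df E] := Ck_differentiable Ux Cf.
by apply: DeriveDef; [exact: diff_derivable | rewrite deriveE// E].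
Qed.

(** The chain rule expresses a partial derivative of the composite by partial derivatives of [f]
    composed with the same [g], so the induction on [k] changes [f] and keeps [g]. *)
Lemma Ck_comp m k (V : set 'rV[R]_m) (oV : open V) (f : 'rV[R]_m -> R)
    (g : 'I_m -> 'rV[R]_n -> R) :
  Ck k V f -> (forall j, Ck k U (g j)) -> (forall x, U x -> V (\row_j g j x)) ->
  Ck k U (fun x => f (\row_j g j x)).
Proof.
have gE (i : 'I_m) : (fun y => (\row_j g j y : 'rV_m) 0 i) = g i.
  by apply/funext => y; rewrite mxE.
move=> + + UV; elim: k f g gE UV => [|k IH] f g gE UV Cf Cg.
  split => // x Ux; apply: (@continuous_comp _ _ _ (fun x => \row_j g j x) f).
    by apply: continuous_rV => i; rewrite gE; exact: (Ck_cont (Cg i) Ux).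
  exact: (Ck_cont Cf (UV _ Ux)).
split.
  move=> x Ux; apply: (@continuous_comp _ _ _ (fun x => \row_j g j x) f).
    by apply: continuous_rV => i; rewrite gE; exact: (Ck_cont (Cg i) Ux).
  exact: (Ck_cont Cf (UV _ Ux)).
have D x i : U x -> is_derive x (delta_mx 0 i) (fun x => f (\row_j g j x))
   (\sum_j 'D_(delta_mx 0 i) (g j) x * 'D_(delta_mx 0 j) f (\row_j g j x)).
  move=> Ux; pose G x := (\row_j g j x : 'rV_m).
  have dG : derivable G x (delta_mx 0 i).
    apply/derivable_mxP => a b; rewrite ord1 /G gE.
    by have [_ /(_ i)[dg _]] := Cg b; exact: dg.
  have [oVx dV] : differentiable f (G x) /\ forall v, 'd f (G x) v = \sum_i v 0 i * 'D_(delta_mx 0 i) f (G x).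
    have [_ Df] := Cf; apply: C1_differentiable => j; have [df Cfj] := Df j.
      near=> y; apply: df; near: y; apply: open_nbhs_nbhs; split => //; exact: UV.
    exact: (Ck_cont Cfj (UV _ Ux)).
  have := derivable_comp dG oVx; rewrite dV.
  rewrite (_ : \sum_i0 _ = \sum_j 'D_(delta_mx 0 i) (g j) x * 'D_(delta_mx 0 j) f (\row_j g j x)) //.
  by apply: eq_bigr => j _; rewrite derive_mx// mxE gE.
move=> i; split; first by move=> x Ux; have [] := D x i Ux.
apply: (Ck_ext oU (f := fun x => \sum_j 'D_(delta_mx 0 i) (g j) x * 'D_(delta_mx 0 j) f (\row_j g j x))).
  by move=> x Ux; have [_ ->] := D x i Ux.
apply: Ck_sum => j; apply: Ck_mul => //; first by have [_ /(_ i)[]] := Cg j.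
by apply: (IH ('D_(delta_mx 0 j) f) g gE UV) => [|l]; [have [_ /(_ j)[]] := Cf|exact: CkW].
Unshelve. all: by end_near. Qed.

Lemma Ck_inv k f : (forall x, U x -> f x != 0) -> Ck k U f -> Ck k U (fun x => (f x)^-1).
Proof.
move=> f0; elim: k => [|k IH] Cf.
  by split => // x Ux; apply: continuousV; [exact: f0|exact: (Ck_cont Cf)].
split; first by move=> x Ux; apply: continuousV; [exact: f0|exact: (Ck_cont Cf)].
have [_ Df] := Cf; move=> i; have [df Cfi] := Df i; split.
  by move=> x Ux; apply: derivableV; [exact: f0|exact: df].
apply: (Ck_ext oU _ (Ck_opp (Ck_mul oU (Ck_mul oU (IH (CkW Cf)) (IH (CkW Cf))) Cfi))).
move=> x Ux; rewrite deriveV ?f0//; last exact: df.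
by rewrite !fctE -mulNr -invfM -expr2.
Qed.

(** [phi] lists a function together with its successive derivatives. Quantifying over the index [j]
    lets the induction on [k] pass from [phi j] to [phi j.+1]. *)
Lemma Ck_comp1 (phi : nat -> R -> R) :
  (forall j (t : R), is_derive t 1 (phi j) (phi j.+1 t)) ->
  forall k j f, Ck k U f -> Ck k U (phi j \o f).
Proof.
move=> dphi; elim=> [|k IH] j f Cf.
  split => // x Ux; apply: continuous_comp; first exact: (Ck_cont Cf).
  by apply/differentiable_continuous/derivable1_diffP; have [] := dphi j (f x).
split.
  move=> x Ux; apply: continuous_comp; first exact: (Ck_cont Cf).
  by apply/differentiable_continuous/derivable1_diffP; have [] := dphi j (f x).
have [_ Df] := Cf; move=> i; have [df Cfi] := Df i.
have D x : U x -> is_derive x (delta_mx 0 i) (phi j \o f)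
    ('D_(delta_mx 0 i) f x * phi j.+1 (f x)).
  move=> Ux; have [d1 d2] := dphi j (f x).
  have d3 : differentiable (phi j) (f x) by exact/derivable1_diffP.
  have := derivable_comp (df x Ux) d3.
  rewrite (_ : 'd _ _ _ = 'D_(delta_mx 0 i) f x * phi j.+1 (f x)) //.
  by rewrite -[X in 'd _ _ X]mulr1 linearZ/= -deriveE// d2.
split; first by move=> x Ux; have [] := D x Ux.
apply: (Ck_ext oU _ (Ck_mul oU Cfi (IH j.+1 f (CkW Cf)))).
by move=> x Ux; have [_ ->] := D x Ux.
Qed.

End OneSpace.
End CkMore.

(** * Flat functions, plateaus and bumps *)

Section Bump.
Context (R : realType).

(** The polynomial factor makes the family stable under derivation; for [P = 1] this is the
    classical flat function. *)
Definition rho (P : {poly R}) (x : R) : R :=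
  if 0 < x then P.[x^-1] * expR (- x^-1) else 0.

Lemma poly_le_expR (P : {poly R}) : exists C, 0 <= C /\
  forall y, 0 <= y -> `|P.[y]| <= C * expR y.
Proof.
exists (\sum_(i < size P) `|P`_i| * i`!%:R); split.
  by apply: sumr_ge0 => i _; rewrite mulr_ge0.
move=> y y0; rewrite horner_coef mulr_suml; apply: le_trans (ler_norm_sum _ _ _) _.
apply: ler_sum => i _; rewrite normrM -mulrA ler_wpM2l// ger0_norm ?exprn_ge0//.
case: (nat_of_ord i) => [|j].
  by rewrite expr0 fact0 mul1r -[leLHS]expR0 ler_expR.
rewrite -ler_pdivrMl ?ltr0n ?fact_gt0// mulrC; apply: le_trans (expR_ge1Dxn j y0).
by rewrite lerDr.
Qed.

(** With [y = 1/h] this is the bound of [P * 'X^2] by the exponential. Quadratic decay is what makes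
    the derivative at 0 exist and vanish. *)
Lemma rho_bound P : exists C, 0 <= C /\ forall h, `|rho P h| <= C * h ^+ 2.
Proof.
have [C [C0 HC]] := poly_le_expR (P * 'X^2).
exists C; split => // h; rewrite /rho; case: ifPn => [h0|_]; last first.
  by rewrite normr0 mulr_ge0 ?sqr_ge0.
have y0 : 0 <= h^-1 by rewrite invr_ge0 ltW.
have := HC _ y0; rewrite hornerM hornerXn normrM [`|_ ^+ 2|]ger0_norm ?sqr_ge0//.
rewrite exprVn ler_pdivrMr ?exprn_gt0// normrM [`|expR _|]gtr0_norm ?expR_gt0//.
by rewrite expRN ler_pdivrMr ?expR_gt0// mulrAC.
Qed.

Lemma is_derive_quadratic (f : R -> R) C :
  (forall h, `|f h| <= C * h ^+ 2) -> is_derive (0 : R) (1 : R) f 0.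
Proof.
move=> H.
have C0 : 0 <= C by have := H 1; rewrite expr1n mulr1; exact: le_trans.
have f0 : f 0 = 0 by apply/eqP; rewrite -normr_eq0 eq_le normr_ge0 andbT (le_trans (H 0))// expr0n mulr0.
suff L : (fun h => h^-1 *: ((f \o shift 0) (h *: (1 : R)) - f 0)) @ (0 : R)^' --> (0 : R).
  by split; [apply/cvg_ex; exists 0 | exact: cvg_lim L].
have C1 : 0 < C + 1 by rewrite ltr_wpDl.
apply/cvgrPdist_le => e e0; near=> h.
have hn0 : h != 0 by near: h; exact: nbhs_dnbhs_neq.
rewrite sub0r normrN /= f0 subr0 addr0 [h *: 1]mulr1 normrM normfV.
rewrite ler_pdivrMl ?normr_gt0//; apply: le_trans (H h) _.
rewrite -real_normK ?num_real// expr2 mulrCA ler_wpM2l//.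
apply: (@le_trans _ _ ((C + 1) * `|h|)); first by rewrite ler_wpM2r// lerDl.
rewrite -ler_pdivlMl//; near: h; by apply: dnbhs0_le; apply: mulr_gt0; rewrite ?invr_gt0.
Unshelve. all: by end_near. Qed.

(** For positive [x] the product rule gives [x ^- 2] times [P - P'] at [1/x] times the exponential,
    which accounts for the new polynomial; at 0 the quadratic bound gives derivative 0. *)
Lemma rho_derive P (x : R) : is_derive x 1 (rho P) (rho ('X^2 * (P - P^`())) x).
Proof.
have [x0|x0|->] := ltgtP x 0.
- rewrite {2}/rho ltNge ltW//=; apply: (@near_eq_is_derive _ _ _ (cst 0)) => //.
  near=> y; rewrite /rho ltNge (_ : y <= 0)//; apply/ltW; near: y; exact: lt_nbhsl.
- pose g := horner P \o (fun y : R => y^-1); pose k := (@expR R) \o (fun y : R => - y^-1).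
  apply: (@near_eq_is_derive _ _ _ (g * k)).
    near=> y; rewrite /rho (_ : 0 < y)//; near: y; exact: lt_nbhsr.
  have xn0 : x != 0 by rewrite gt_eqF.
  have dV : is_derive x 1 (fun y : R => y^-1) (- x ^- 2).
    by have := @is_deriveV R id x 1 1 xn0 (is_derive_id _ _); rewrite [_ *: 1]mulr1.
  have dg : is_derive x 1 g (- x ^- 2 * P^`().[x^-1]).
    by have := @is_derive1_comp R (horner P) _ x _ _ (is_derive_poly P x^-1) dV; rewrite mulrC.
  have dk : is_derive x 1 k (x ^- 2 * expR (- x^-1)).
    have := @is_derive1_comp R (@expR R) _ x _ _ (is_derive_expR _) (is_deriveN dV).
    by rewrite opprK mulrC.
  apply: is_derive_eq (is_deriveM dg dk) _.
  rewrite /rho x0 /g /k /= hornerM hornerXn hornerD hornerN exprVn.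
  by rewrite /GRing.scale /=; ring.
- rewrite {2}/rho ltxx; have [C [_ H]] := rho_bound P; exact: is_derive_quadratic H.
Unshelve. all: by end_near. Qed.

Lemma Ck_rho n k (U : set 'rV[R]_n) f : open U -> Ck k U f -> Ck k U (fun x => rho 1 (f x)).
Proof.
move=> oU; pose P j := iter j (fun P : {poly R} => 'X^2 * (P - P^`())) 1.
exact: (@Ck_comp1 _ _ _ oU (fun j => rho (P j)) (fun j t => rho_derive (P j) t) k 0).
Qed.

Lemma rho1_gt0 x : (0 < rho 1 x) = (0 < x).
Proof. by rewrite /rho; case: ifP => _; rewrite ?ltxx// hornerE mul1r expR_gt0. Qed.

Lemma rho1_ge0 x : 0 <= rho 1 x.
Proof. by rewrite /rho; case: ifP => // _; rewrite hornerE mul1r expR_ge0. Qed.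

(** The constants make it 1 on [-1, 1] and 0 outside ]-2, 2[; the square in place of an absolute
    value keeps it smooth. *)
Definition plateau (s : R) := rho 1 (4 - s ^+ 2) / (rho 1 (4 - s ^+ 2) + rho 1 (s ^+ 2 - 1)).

Lemma plateau_den (s : R) : rho 1 (4 - s ^+ 2) + rho 1 (s ^+ 2 - 1) != 0.
Proof.
rewrite gt_eqF//; case: (ltP (s ^+ 2) 4) => h.
  by rewrite ltr_wpDr ?rho1_ge0// rho1_gt0 subr_gt0.
by rewrite ltr_wpDl ?rho1_ge0// rho1_gt0 subr_gt0 (lt_le_trans _ h)// ltr1n.
Qed.

Lemma plateau1 s : `|s| <= 1 -> plateau s = 1.
Proof.
move=> s1; have := plateau_den s; rewrite /plateau.
have -> : rho 1 (s ^+ 2 - 1) = 0.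
  rewrite /rho ifF//; apply/negbTE; rewrite -leNgt subr_le0 -real_normK ?num_real//.
  by rewrite expr_le1.
by rewrite addr0 => h; rewrite divff.
Qed.

Lemma plateau0 s : 2 <= `|s| -> plateau s = 0.
Proof.
move=> s2; rewrite /plateau (_ : rho 1 (4 - s ^+ 2) = 0) ?mul0r//.
rewrite /rho ifF//; apply/negbTE; rewrite -leNgt subr_le0 -real_normK ?num_real//.
by rewrite (_ : 4 = 2 ^+ 2) ?lerXn2r// ?nnegrE//; ring.
Qed.

Lemma plateau_itv s : 0 <= plateau s <= 1.
Proof.
rewrite /plateau divr_ge0 ?addr_ge0 ?rho1_ge0//= ler_pdivrMr ?mul1r ?lerDl ?rho1_ge0//.
by rewrite lt_neqAle eq_sym plateau_den addr_ge0 ?rho1_ge0.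
Qed.

Lemma Ck_plateau n k (U : set 'rV[R]_n) f : open U -> Ck k U f -> Ck k U (fun x => plateau (f x)).
Proof.
move=> oU Cf.
have C2 : Ck k U (fun x => f x ^+ 2) by apply: (Ck_ext oU _ (Ck_mul oU Cf Cf)) => x _; rewrite !fctE expr2.
have C4 : Ck k U (fun x => rho 1 (4 - f x ^+ 2)).
  by apply: Ck_rho => //; exact: (Ck_add oU (Ck_cst oU k 4) (Ck_opp oU C2)).
have C1 : Ck k U (fun x => rho 1 (f x ^+ 2 - 1)).
  by apply: Ck_rho => //; exact: (Ck_add oU C2 (Ck_cst oU k (-1))).
apply: (Ck_mul oU C4); apply: (Ck_inv oU) => [x _|]; first exact: plateau_den.
exact: (Ck_add oU C4 C1).
Qed.

(** A product of plateaus in the coordinates suits the maximum norm: far from [a], some coordinate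
    realises the norm and makes its factor vanish. *)
Lemma bump n (a : 'rV[R]_n) r : 0 < r -> exists b : 'rV[R]_n -> R,
  [/\ Cinfty setT b, forall x, `|x - a| <= r -> b x = 1,
      forall x, 2 * r <= `|x - a| -> b x = 0 & forall x, 0 <= b x <= 1].
Proof.
move=> r0; exists (fun x => \prod_i plateau (r^-1 * (x 0 i - a 0 i))); split.
- move=> k; have oT := @openT 'rV[R]_n; apply: Ck_prod => // i; apply: Ck_plateau => //.
  apply: (Ck_mul oT (Ck_cst oT k r^-1)).
  exact: (Ck_add oT (Ck_coord oT k i) (Ck_cst oT k (- a 0 i))).
- move=> x xa; rewrite big1// => i _; rewrite plateau1// normrM gtr0_norm ?invr_gt0//.
  rewrite ler_pdivrMl// mulr1; apply: le_trans xa.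
  by have := coord_le_norm (x - a) i; rewrite !mxE.
- move=> x xa; have [[i xi]|H] := pselect (exists i, 2 * r <= `|x 0 i - a 0 i|).
    rewrite (bigD1 i)//= plateau0 ?mul0r// normrM gtr0_norm ?invr_gt0//.
    by rewrite ler_pdivlMl// mulrC.
  exfalso; have n0 : x - a != 0 by rewrite -normr_gt0 (lt_le_trans _ xa)// mulr_gt0.
  have [|[i j] /= E] := @mx_norm_neq0 _ _ _ (x - a).
    by rewrite -[mx_norm _]/(`|x - a|) normr_eq0.
  apply: H; exists j; move: xa; rewrite [leRHS]/Num.Def.normr/= E.
  by rewrite ord1 !mxE.
- move=> x; rewrite prodr_ge0 => [|i _]; last by have /andP[] := plateau_itv (r^-1 * (x 0 i - a 0 i)).
  by apply: prodr_ile1 => i _; exact: plateau_itv.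
Qed.

End Bump.

(** * Ordinary differential equations *)

Definition Cinfv (R : realType) n m (U : set 'rV[R]_n) (g : 'rV[R]_n -> 'rV[R]_m) :=
  forall j, Cinfty U (fun x => g x 0 j).

Section Bounds.
Context (R : realType) (n : nat).
Notation E := 'rV[R]_n.

Lemma ball_bounded (f : E -> R) r : continuous f ->
  exists K, 0 <= K /\ forall x, `|x| <= r -> `|f x| <= K.
Proof.
move=> cf; have [r0|r0] := ltP r 0.
  by exists 0; split => // x xr; have := le_lt_trans xr r0; rewrite normr_lt0.
pose A : set E := [set x | `|x| <= r].
have cA : compact A.
  apply: bounded_closed_compact.
    by exists r; split; [exact: num_real|move=> M rM x /= xr; rewrite (le_trans xr)// ltW].
  have -> : A = (fun x : E => `|x|) @^-1` [set s | s <= r] by [].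
  by apply: closed_comp => [x _|]; [exact: norm_continuous|exact: closed_le].
have A0 : A !=set0 by exists 0; rewrite /A /= normr0.
have cn : {within A, continuous (fun x => `|f x|)}.
  by apply: continuous_subspaceT => x; apply: continuous_comp; [exact: cf|exact: norm_continuous].
have [c _ Hc] := EVT_max_rV A0 cA cn.
by exists `|f c|; split => // x xr; apply: Hc; rewrite inE.
Qed.

Lemma Cinfty_continuous (f : E -> R) : Cinfty setT f -> continuous f.
Proof. by move=> Cf x; have := Ck_cont (Cf 0%N) (I : setT x). Qed.

Lemma Cinfty_derive (U : set E) (f : E -> R) i : Cinfty U f -> Cinfty U ('D_(delta_mx 0 i) f).
Proof. by move=> Cf k; have [_ /(_ i)[]] := Cf k.+1. Qed.

(** The sum of the nonnegative bounds serves as a common one, whatever [n] is. *)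
Lemma fin_bound (P : 'I_n -> R -> Prop) :
  (forall i a b, a <= b -> P i a -> P i b) ->
  (forall i, exists K, 0 <= K /\ P i K) -> exists K, 0 <= K /\ forall i, P i K.
Proof.
move=> mono H; have [K HK] := choice H.
exists (\sum_i K i); split; first by apply: sumr_ge0 => i _; have [] := HK i.
move=> i; apply: mono (HK i).2; rewrite (bigD1 i)//= lerDl.
by apply: sumr_ge0 => j _; have [] := HK j.
Qed.

End Bounds.

Section Bounds2.
Context (R : realType) (n m : nat).
Implicit Types X : 'rV[R]_n -> 'rV[R]_m.

Lemma Cinfv_continuous X : Cinfv setT X -> continuous X.
Proof. by move=> sX x; apply: continuous_rV => j; exact: (Cinfty_continuous (sX j)). Qed.

Lemma Cinfv_bounded X r : Cinfv setT X ->
  exists K, 0 <= K /\ forall x, `|x| <= r -> `|X x| <= K.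
Proof.
move=> sX; have [i a b ab H x /H h|i|K [K0 HK]] :=
  @fin_bound R m (fun j K => forall x, `|x| <= r -> `|X x 0 j| <= K).
- exact: le_trans h ab.
- exact/ball_bounded/Cinfty_continuous.
- by exists K; split => // x xr; apply: norm_le_coord => // i; exact: HK.
Qed.

Lemma Cinfv_lip X r : Cinfv setT X ->
  exists L, 0 <= L /\ forall x y, `|x| <= r -> `|y| <= r ->
  `|X x - X y| <= L * `|x - y|.
Proof.
move=> sX; have [i a b ab H x y xr yr|j|K [K0 HK]] := @fin_bound R m
  (fun j K => forall x y, `|x| <= r -> `|y| <= r -> `|X x 0 j - X y 0 j| <= K * `|x - y|).
- by apply: le_trans (H x y xr yr) _; rewrite ler_wpM2r.
(* The mean value point is [y + c *: (x - y)] with [c] of absolute value at most 1, possibly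
   negative, so the derivatives are bounded on the ball of radius [3 * r]. *)
- have [i a b ab H x xr|i|K [K0 HK]] := @fin_bound R n
    (fun i K => forall x, `|x| <= 3 * r -> `|'D_(delta_mx 0 i) (fun x => X x 0 j) x| <= K).
  + exact: le_trans (H x xr) ab.
  + exact/ball_bounded/Cinfty_continuous/Cinfty_derive.
  exists (n%:R * K); split; first by rewrite mulr_ge0.
  move=> x y xr yr; pose f x := X x 0 j.
  have D z v : is_derive z v f (\sum_i v 0 i * 'D_(delta_mx 0 i) f z).
    exact: (@Ck_derive R n setT openT 0%N f z v I (sX j 1%N)).
  have [t _|c] := @mvt_line R _ f y (x - y) 1; first by have [] := D (y + t *: (x - y)) (x - y).
  rewrite normr1 scale1r mul1r subrKC => c1 E.
  rewrite -[X x 0 j - _]/(f x - f y) E; have [_ ->] := D (y + c *: (x - y)) (x - y).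
  apply: le_trans (ler_norm_sum _ _ _) _.
  apply: (@le_trans _ _ (\sum_(i < n) K * `|x - y|)); last first.
    by rewrite sumr_const card_ord -mulrA mulr_natl.
  apply: ler_sum => i _.
  rewrite normrM mulrC ler_pM//; last exact: coord_le_norm.
  apply: HK; apply: le_trans (ler_normD _ _) _.
  rewrite normrZ (_ : 3 * r = r + 1 * (r + r)); last by ring.
  rewrite lerD// ler_pM//; apply: le_trans (ler_normB _ _) _; exact: lerD.
- exists K; split => // x y xr yr; apply: norm_le_coord; first by rewrite mulr_ge0.
  by move=> i; rewrite !mxE; exact: HK.
Qed.

End Bounds2.

(** * The Euler scheme and its error estimates *)

Section Euler.
Context (R : realType) (n : nat).
Notation E := 'rV[R]_n.
Implicit Types (X : E -> E) (x y : E).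

Definition eul X (h : R) x : E := x + h *: X x.

(** An a priori bound on all Euler polygons up to time [T]. It takes the place of completeness,
    holds for bounded fields, and passes to the linearised equation, for which a global Lipschitz
    bound need not hold. *)
Definition euler_bounded X := forall T r : R, 0 <= T -> 0 <= r -> exists r', 0 <= r' /\
  forall h j x, 0 <= h -> h * j%:R <= T -> `|x| <= r -> `|iter j (eul X h) x| <= r'.

(** Discrete Gronwall inequality; putting the factor [(1 + a) ^+ j] on the source term too makes the
    induction immediate. *)
Lemma gronwall_nat (a b : R) (e : nat -> R) : 0 <= a -> 0 <= b -> e 0%N = 0 ->
  forall J, (forall j, (j < J)%N -> e j.+1 <= (1 + a) * e j + b) ->
  e J <= b * J%:R * expR (a * J%:R).
Proof.
move=> a0 b0 e0 J H.
suff G j : (j <= J)%N -> e j <= b * j%:R * (1 + a) ^+ j.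
  apply: le_trans (G J (leqnn _)) _; rewrite ler_wpM2l ?mulr_ge0//.
  by rewrite mulrC expRM_natl lerXn2r ?nnegrE ?addr_ge0// expR_ge1Dx.
elim: j => [|j IH] jJ; first by rewrite e0 mulr0 mul0r.
apply: le_trans (H _ jJ) _; have a1 : 1 <= (1 + a) ^+ j.+1 by rewrite exprn_ege1// lerDl.
apply: (@le_trans _ _ ((1 + a) * (b * j%:R * (1 + a) ^+ j) + b * (1 + a) ^+ j.+1)).
  by rewrite lerD// ?ler_wpM2l ?addr_ge0 ?IH 1?ltnW// ler_peMr.
by rewrite exprS -natr1 le_eqVlt; apply/orP; left; apply/eqP; ring.
Qed.

Section Scheme.
Variables (X : E -> E) (T r r' K L : R).
Hypotheses (T0 : 0 <= T) (K0 : 0 <= K) (L0 : 0 <= L).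
Hypothesis Hr' : forall h j x, 0 <= h -> h * j%:R <= T -> `|x| <= r ->
  `|iter j (eul X h) x| <= r'.
Hypothesis HK : forall x, `|x| <= r' -> `|X x| <= K.
Hypothesis HL : forall x y, `|x| <= r' -> `|y| <= r' -> `|X x - X y| <= L * `|x - y|.

Let step_le (h : R) i j : 0 <= h -> (i <= j)%N -> h * j%:R <= T -> h * i%:R <= T.
Proof. by move=> h0 ij; apply: le_trans; rewrite ler_wpM2l// ler_nat. Qed.

Lemma eul_drift h i j x : 0 <= h -> h * (i + j)%:R <= T -> `|x| <= r ->
  `|iter (i + j) (eul X h) x - iter i (eul X h) x| <= h * j%:R * K.
Proof.
move=> h0; elim: j => [|j IH] hT xr; first by rewrite addn0 subrr normr0 mulr0 mul0r.
have hT' : h * (i + j)%:R <= T by apply: step_le hT; rewrite // leq_add2l.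
rewrite addnS iterS {1}/eul addrAC; apply: le_trans (ler_normD _ _) _.
rewrite -natr1 mulrDr mulr1 mulrDl lerD ?IH// normrZ ger0_norm// ler_wpM2l//.
exact/HK/Hr'.
Qed.

(** Over [j] steps the polygon leaves its initial tangent by a quadratic amount, uniformly in the
    step [h]; this survives the limit and yields the derivative of the flow. *)
Lemma eul_taylor h i j x : 0 <= h -> h * (i + j)%:R <= T -> `|x| <= r ->
  `|iter (i + j) (eul X h) x - iter i (eul X h) x - (h * j%:R) *: X (iter i (eul X h) x)|
  <= L * K * (h * j%:R) ^+ 2.
Proof.
move=> h0; elim: j => [|j IH] hT xr.
  by rewrite addn0 subrr !mulr0 scale0r subrr normr0 expr0n mulr0.
have hT' : h * (i + j)%:R <= T by apply: step_le hT; rewrite // leq_add2l.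
have hTi : h * i%:R <= T by apply: step_le hT'; rewrite // leq_addr.
rewrite addnS iterS; set y := iter (i + j) _ x; set z := iter i _ x.
rewrite -natr1 mulrDr mulr1 scalerDl /eul.
have -> : y + h *: X y - z - ((h * j%:R) *: X z + h *: X z) =
  (y - z - (h * j%:R) *: X z) + h *: (X y - X z).
  by apply/rowP => l; rewrite !mxE; ring.
apply: le_trans (ler_normD _ _) _; rewrite normrZ (ger0_norm h0).
apply: (@le_trans _ _ (L * K * (h * j%:R) ^+ 2 + h * (L * (h * j%:R * K)))).
  rewrite lerD ?IH// ler_wpM2l//; apply: le_trans (HL _ _) _; try exact: Hr'.
  by rewrite ler_wpM2l//; exact: eul_drift.
rewrite -subr_ge0 (_ : _ - _ = L * K * h ^+ 2 * (j%:R + 1)); last by ring.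
by rewrite !mulr_ge0// ?sqr_ge0// addr_ge0.
Qed.

Lemma eul_lip h j x y : 0 <= h -> h * j%:R <= T -> `|x| <= r -> `|y| <= r ->
  `|iter j (eul X h) x - iter j (eul X h) y| <= expR (L * T) * `|x - y|.
Proof.
move=> h0 hT xr yr.
have G i : (i <= j)%N -> `|iter i (eul X h) x - iter i (eul X h) y| <= (1 + L * h) ^+ i * `|x - y|.
  elim: i => [|i IH] ij; first by rewrite expr0 mul1r.
  have hi : h * i%:R <= T by apply: step_le hT; rewrite // ltnW.
  rewrite !iterS {1 3}/eul opprD addrACA -scalerBr.
  apply: le_trans (ler_normD _ _) _; rewrite normrZ (ger0_norm h0).
  set a := iter i _ x in IH *; set b := iter i _ y in IH *.
  have hl : `|X a - X b| <= L * `|a - b| by apply: HL; exact: Hr'.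
  apply: (@le_trans _ _ ((1 + L * h) * `|a - b|)).
    by rewrite mulrDl mul1r lerD2l mulrAC mulrC ler_wpM2r.
  by rewrite exprS -mulrA ler_wpM2l ?IH// 1?ltnW// addr_ge0// mulr_ge0.
apply: le_trans (G j (leqnn _)) _; rewrite ler_wpM2r//.
apply: (@le_trans _ _ (expR (L * h) ^+ j)).
  by rewrite lerXn2r ?nnegrE ?expR_ge0 ?addr_ge0 ?mulr_ge0// expR_ge1Dx.
by rewrite -expRM_natl ler_expR mulrC -mulrA ler_wpM2l.
Qed.

(** Two steps of length [h / 2] differ from one step of length [h] by a multiple of [h ^+ 2];
    Gronwall adds up the at most [T / h] local errors to a multiple of [h]. *)
Lemma eul_half h j x : 0 <= h -> h * j%:R <= T -> `|x| <= r ->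
  `|iter j.*2 (eul X (h / 2)) x - iter j (eul X h) x| <= L * K * T * expR (L * T) * h.
Proof.
move=> h0 hT xr; have h20 : 0 <= h / 2 by rewrite divr_ge0.
have h2T i : (i <= j.*2)%N -> h / 2 * i%:R <= T.
  move=> ij; apply: le_trans hT; rewrite mulrAC ler_pdivrMr// -mulrA ler_wpM2l//.
  by rewrite -natrM ler_nat muln2.
pose e i := `|iter i.*2 (eul X (h / 2)) x - iter i (eul X h) x|.
have S i : (i < j)%N -> e i.+1 <= (1 + L * h) * e i + L * K * h ^+ 2.
  move=> ij; rewrite /e doubleS !iterS.
  set a := iter i.*2 _ x; set b := iter i _ x.
  have ai : `|a| <= r' by apply: Hr' => //; apply: h2T; rewrite leq_double ltnW.
  have bi : `|b| <= r' by apply: Hr' => //; apply: step_le hT; rewrite // ltnW.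
  set c := eul X (h / 2) a.
  have ci : `|c| <= r'.
    rewrite /c /a -iterS; apply: Hr' => //; apply: h2T.
    by rewrite ltn_double.
  have -> : eul X (h / 2) c - eul X h b = (a - b) + h *: (X a - X b) + (h / 2) *: (X c - X a).
    rewrite {1}/eul /c {1}/eul /eul !scalerBr opprD.
    have -> : h *: X a = (h / 2) *: X a + (h / 2) *: X a by rewrite -scalerDl -splitr.
    by apply/rowP => l; rewrite !mxE; ring.
  apply: le_trans (ler_normD _ _) _; apply: lerD.
    apply: le_trans (ler_normD _ _) _; rewrite normrZ ger0_norm//.
    rewrite mulrDl mul1r lerD2l mulrAC mulrC ler_wpM2r//; exact: HL.
  rewrite normrZ ger0_norm//.
  apply: (@le_trans _ _ (h / 2 * (L * (h / 2 * K)))).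
    rewrite ler_wpM2l//; apply: le_trans (HL ci ai) _; rewrite ler_wpM2l//.
    by rewrite /c /eul addrC addKr normrZ ger0_norm// ler_wpM2l// HK.
  rewrite -subr_ge0 (_ : _ - _ = L * K * h ^+ 2 * (3 / 4)); last by field.
  by rewrite !mulr_ge0// sqr_ge0.
have := @gronwall_nat (L * h) (L * K * h ^+ 2) e _ _ _ j S.
rewrite !mulr_ge0 ?sqr_ge0// => /(_ isT isT); rewrite /e subrr normr0 => /(_ erefl) H.
apply: le_trans H _.
have -> : L * K * h ^+ 2 * j%:R * expR (L * h * j%:R) = L * K * h * ((h * j%:R) * expR (L * (h * j%:R))).
  by rewrite -[L * h * j%:R]mulrA; ring.
have -> : L * K * T * expR (L * T) * h = L * K * h * (T * expR (L * T)) by ring.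
rewrite ler_wpM2l ?mulr_ge0// ler_pM ?mulr_ge0 ?expR_ge0// ler_expR ler_wpM2l//.
Qed.

End Scheme.

End Euler.

Section GeometricLimit.
Context (R : realType).

(** [g k] is the tail of the geometric series, so the intervals of radius [g k] around [u k] are
    nested, and the supremum of their lower ends lies in all of them. *)
Lemma geometric_limit (u : nat -> R) C :
  (forall k, `|u k.+1 - u k| <= C * 2^-1 ^+ k) ->
  exists l, forall k, `|l - u k| <= 2 * C * 2^-1 ^+ k.
Proof.
move=> H; pose g k : R := 2 * C * 2^-1 ^+ k.
have C0 : 0 <= C by have := H 0%N; rewrite expr0 mulr1; exact: le_trans.
have gS k : g k - g k.+1 = C * 2^-1 ^+ k by rewrite /g exprS; field.
have g0 k : 0 <= g k by rewrite !mulr_ge0// exprn_ge0.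
have Hk k : u k - g k <= u k.+1 - g k.+1 /\ u k.+1 + g k.+1 <= u k + g k.
  have := H k; rewrite -gS ler_norml => /andP[h1 h2]; split; lra.
have v_nd : {homo (fun k => u k - g k) : m p / (m <= p)%N >-> m <= p}.
  by apply/nondecreasing_seqP => k; have [] := Hk k.
have w_ni : {homo (fun k => u k + g k) : m p / (m <= p)%N >-> p <= m}.
  by apply/nonincreasing_seqP => k; have [] := Hk k.
have vw k p : u k - g k <= u p + g p.
  have [kp|pk] := leqP k p.
    by apply: le_trans (v_nd _ _ kp) _; rewrite /= lerBlDr -addrA lerDl addr_ge0.
  by apply: le_trans (w_ni _ _ (ltnW pk)); rewrite /= lerBlDr -addrA lerDl addr_ge0.
pose S := [set u k - g k | k in [set: nat]].
have S0 : S !=set0 by exists (u 0%N - g 0%N), 0%N.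
have Sub p : ubound S (u p + g p) by move=> _ [k _ <-].
exists (sup S) => k; rewrite ler_norml; apply/andP; split.
  rewrite lerBrDr addrC; apply: ub_le_sup; last by exists k.
  by exists (u 0%N + g 0%N).
by rewrite lerBlDl; apply: ge_sup.
Qed.

End GeometricLimit.

(** * Limits of dyadic Euler polygons *)

Section FlowLimit.
Context (R : realType) (n : nat).
Notation E := 'rV[R]_n.
Implicit Types (X : E -> E) (x y : E).

Definition dya (k : nat) : R := 2^-1 ^+ k.
Definition nst (k : nat) (t : R) : nat := Num.truncn (2 ^+ k * t).
Definition approx X k t x : E := iter (nst k t) (eul X (dya k)) x.

Lemma dya_gt0 k : 0 < dya k. Proof. by rewrite exprn_gt0. Qed.

Lemma dyaS k : dya k.+1 = dya k / 2. Proof. by rewrite /dya exprSr. Qed.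

Lemma nst_itv k t : 0 <= t -> dya k * (nst k t)%:R <= t < dya k * (nst k t)%:R + dya k.
Proof.
move=> t0; have p0 : 0 < (2 : R) ^+ k by rewrite exprn_gt0.
have /truncn_itv/andP[h1 h2] : 0 <= 2 ^+ k * t by rewrite mulr_ge0// ltW.
rewrite /nst /dya exprVn ler_pdivrMl// h1 /= -[X in _ + X]mulr1 -mulrDr natr1.
by rewrite mulrC ltr_pdivlMr// mulrC.
Qed.

Lemma nstS k t : 0 <= t -> nst k.+1 t = (nst k t).*2 \/ nst k.+1 t = (nst k t).*2.+1.
Proof.
move=> t0; have /andP[a1 a2] := nst_itv k t0; have /andP[b1 b2] := nst_itv k.+1 t0.
have d0 := dya_gt0 k; rewrite dyaS in b1 b2.
set a := nst k t in a1 a2 *; set b := nst k.+1 t in b1 b2 *.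
have h1 : (a.*2 < b.+1)%N.
  rewrite -(ltr_nat R) -(ltr_pM2l d0) -natr1 -muln2 natrM; nra.
have h2 : (b < a.*2.+2)%N.
  rewrite -(ltr_nat R) -(ltr_pM2l d0) -2!natr1 -muln2 natrM; nra.
lia.
Qed.

(** Passing from level [k] to [k.+1] costs the halving error and at most one extra step, both of
    order [dya k]; the levels therefore converge geometrically, uniformly on bounded sets. *)
Lemma flow_exists X : Cinfv setT X -> euler_bounded X ->
  exists phi : R -> E -> E, forall T r, 0 <= T -> 0 <= r -> exists C, 0 <= C /\
  forall k t x, 0 <= t -> t <= T -> `|x| <= r -> `|phi t x - approx X k t x| <= C * dya k.
Proof.
move=> sX bX.
have H T r : 0 <= T -> 0 <= r -> exists C, 0 <= C /\ forall k t x, 0 <= t -> t <= T ->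
   `|x| <= r -> `|approx X k.+1 t x - approx X k t x| <= C * dya k.
  move=> T0 r0; have [r' [r'0 Hr']] := bX T r T0 r0.
  have [K [K0 HK]] := Cinfv_bounded r' sX; have [L [L0 HL]] := Cinfv_lip r' sX.
  exists (L * K * T * expR (L * T) + K); split.
    by rewrite addr_ge0// !mulr_ge0// expR_ge0.
  move=> k t x t0 tT xr; have /andP[a1 a2] := nst_itv k t0.
  have d0 := ltW (dya_gt0 k).
  have aT := le_trans a1 tT.
  have h := eul_half K0 L0 Hr' HK HL d0 aT xr.
  rewrite mulrDl /approx dyaS; have [->|E1] := nstS k t0.
    by apply: le_trans h _; rewrite lerDl mulr_ge0.
  have /andP[b1 b2] := nst_itv k.+1 t0; rewrite dyaS E1 in b1 b2.
  rewrite E1 iterS {1}/eul addrAC; apply: le_trans (ler_normD _ _) _.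
  rewrite lerD// normrZ ger0_norm ?divr_ge0// mulrC ler_pM//; first exact: divr_ge0.
    apply: HK; apply: Hr' => //; first exact: divr_ge0.
    apply: le_trans (le_trans b1 tT); rewrite ler_wpM2l ?divr_ge0// ler_nat; exact: leqnSn.
  by rewrite ler_pdivrMr// ler_peMr// ler1n.
(* The limit has to serve all bounds [T] and [r] at once, so it is characterised for every
   admissible constant [C] simultaneously. *)
have G t x i : exists l, 0 <= t -> forall C, (forall k, `|approx X k.+1 t x - approx X k t x| <= C * dya k) ->
    forall k, `|l - approx X k t x 0 i| <= 2 * C * dya k.
  have [t0|t0] := leP 0 t; last by exists 0.
  have [C [C0 HC]] := H t `|x| t0 (normr_ge0 x).
  have [|l Hl] := @geometric_limit R (fun k => approx X k t x 0 i) C.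
    move=> k; apply: le_trans (HC k t x t0 (lexx _) (lexx _)).
    by have := coord_le_norm (approx X k.+1 t x - approx X k t x) i; rewrite !mxE.
  exists l => _ C' HC' k.
  have [|l' Hl'] := @geometric_limit R (fun k => approx X k t x 0 i) C'.
    move=> p; apply: le_trans (HC' p).
    by have := coord_le_norm (approx X p.+1 t x - approx X p t x) i; rewrite !mxE.
  suff -> : l = l' by exact: Hl'.
  apply/eqP; rewrite -subr_eq0 -normr_eq0 eq_le normr_ge0 andbT.
  apply/ler_addgt0Pr => e e0; rewrite add0r.
  have C'0 : 0 <= C' by have := HC' 0%N; rewrite /dya expr0 mulr1; exact: le_trans.
  have [p Hp] : exists p, (2 * C + 2 * C') * dya p <= e.
    have S0 : 0 < 2 * C + 2 * C' + 1 by lra.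
    have : (fun p => (2 * C + 2 * C' + 1) * dya p) @ \oo --> (2 * C + 2 * C' + 1) * 0.
      by apply: cvgMr; apply: cvg_expr; rewrite ger0_norm// invf_lt1// ltr1n.
    rewrite mulr0 => /cvgrPdist_le/(_ e e0)[p _ /(_ p (leqnn p))] /=.
    rewrite sub0r normrN ger0_norm ?mulr_ge0// ?(ltW S0) ?(ltW (dya_gt0 p))// => h.
    by exists p; apply: le_trans h; rewrite ler_wpM2r ?(ltW (dya_gt0 p))// lerDl.
  have -> : l - l' = (l - approx X p t x 0 i) - (l' - approx X p t x 0 i) by ring.
  apply: le_trans (ler_normB _ _) _; apply: le_trans Hp; rewrite mulrDl; exact: lerD.
have {G} [phi Hphi] : exists phi : R -> E -> E, forall t x i, 0 <= t -> forall C,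
   (forall k, `|approx X k.+1 t x - approx X k t x| <= C * dya k) ->
    forall k, `|phi t x 0 i - approx X k t x 0 i| <= 2 * C * dya k.
  have [psi Hpsi] := choice (fun a : R * E * 'I_n => G a.1.1 a.1.2 a.2).
  by exists (fun t x => \row_i psi (t, x, i)) => t x i; rewrite mxE; exact: (Hpsi (t, x, i)).
exists phi => T r T0 r0; have [C [C0 HC]] := H T r T0 r0.
exists (2 * C); split; first by rewrite mulr_ge0.
move=> k t x t0 tT xr; apply: norm_le_coord; first by rewrite !mulr_ge0// ltW// dya_gt0.
by move=> i; rewrite !mxE; apply: Hphi => // p; exact: HC.
Qed.

End FlowLimit.

Section FlowProps.
Context (R : realType) (n : nat).
Notation E := 'rV[R]_n.
Implicit Types (X : E -> E) (x y : E).

Lemma dya_small (C e : R) : 0 < e -> exists p, C * dya R p <= e.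
Proof.
move=> e0; have : (fun p => C * dya R p) @ \oo --> C * 0.
  by apply: cvgMr; apply: cvg_expr; rewrite ger0_norm// invf_lt1// ltr1n.
rewrite mulr0 => /cvgrPdist_le/(_ e e0)[p _ /(_ p (leqnn p))] /=.
by rewrite sub0r normrN => h; exists p; apply: le_trans h; exact: ler_norm.
Qed.

Lemma le_dya (a b C : R) : (forall k, a <= b + C * dya R k) -> a <= b.
Proof.
move=> H; apply/ler_addgt0Pr => e e0; have [p Hp] := dya_small C e0.
by apply: le_trans (H p) _; rewrite lerD2l.
Qed.

Definition euler_limit X (phi : R -> E -> E) := forall T r, 0 <= T -> 0 <= r ->
  exists C, 0 <= C /\ forall k t x, 0 <= t -> t <= T -> `|x| <= r ->
  `|phi t x - approx X k t x| <= C * dya R k.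

Section Fixed.
Variables (X : E -> E) (phi : R -> E -> E).
Hypotheses (sX : Cinfv setT X) (bX : euler_bounded X) (lX : euler_limit X phi).

(** The Taylor estimate of the polygons passes to the limit. Both orders of [t] and [t'] are
    covered, so that two-sided derivatives come out. *)
Lemma flow_quad T x : 0 <= T -> exists C, 0 <= C /\ forall t t',
  0 <= t -> t <= T -> 0 <= t' -> t' <= T ->
  `|phi t' x - phi t x - (t' - t) *: X (phi t x)| <= C * (t' - t) ^+ 2.
Proof.
move=> T0; have [r' [r'0 Hr']] := bX T0 (normr_ge0 x).
have [K [K0 HK]] := Cinfv_bounded r' sX; have [L [L0 HL]] := Cinfv_lip (r' + 1) sX.
have HL' y z : `|y| <= r' -> `|z| <= r' -> `|X y - X z| <= L * `|y - z|.
  by move=> yr zr; apply: HL; [apply: (le_trans yr)|apply: (le_trans zr)]; rewrite lerDl.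
have [C [C0 HC]] := lX T0 (normr_ge0 x).
have apT k t : 0 <= t -> t <= T -> dya R k * (nst k t)%:R <= T.
  by move=> t0; apply: le_trans; have /andP[] := nst_itv k t0.
have apb k t : 0 <= t -> t <= T -> `|approx X k t x| <= r'.
  by move=> t0 tT; apply: Hr' => //; [exact/ltW/dya_gt0|exact: apT].
have phb t : 0 <= t -> t <= T -> `|phi t x| <= r'.
  move=> t0 tT; apply: (@le_dya _ _ C) => k.
  have -> : phi t x = approx X k t x + (phi t x - approx X k t x) by rewrite subrKC.
  apply: le_trans (ler_normD _ _) _; rewrite lerD//; first exact: apb.
  exact: (HC k t x t0 tT (lexx _)).
have fwd t t' : 0 <= t -> t <= t' -> t' <= T ->
  `|phi t' x - phi t x - (t' - t) *: X (phi t x)| <= L * K * (t' - t) ^+ 2.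
  move=> t0 tt' t'T; have t'0 := le_trans t0 tt'; have tT := le_trans tt' t'T.
  (* The constant collects the distance to the polygons, the change of [X] between [phi t x] and the
     polygon, and the rounding of both times to multiples of the step. *)
  apply: (@le_dya _ _ (2 * C + T * L * C + 2 * K + L * K * (2 * T + 1))) => k.
  set d := dya R k; have d0 : 0 < d := dya_gt0 R k.
  have d1 : d <= 1 by rewrite /d /dya exprn_ile1// invf_le1// ler1n.
  have /andP[a1 a2] := nst_itv k t0; have /andP[b1 b2] := nst_itv k t'0.
  have nn : (nst k t <= nst k t')%N.
    rewrite -ltnS -(ltr_nat R) -(ltr_pM2l d0) -[X in _ < _ * X]natr1 mulrDr mulr1.
    by rewrite -/d in a1 b2; lra.
  pose j := (nst k t' - nst k t)%N.
  have Ej : nst k t' = (nst k t + j)%N by rewrite subnKC.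
  have jT : d * (nst k t + j)%:R <= T by rewrite -Ej; exact: apT.
  have := eul_taylor K0 L0 Hr' HK HL' (ltW d0) jT (lexx `|x|).
  rewrite -Ej -/(approx X k t' x) -/(approx X k t x) => Tay.
  set y := approx X k t x in Tay *; set y' := approx X k t' x in Tay *.
  have Hy : `|phi t x - y| <= C * d by exact: (HC k t x t0 tT (lexx _)).
  have Hy' : `|phi t' x - y'| <= C * d by exact: (HC k t' x t'0 t'T (lexx _)).
  have dj : d * j%:R = d * (nst k t')%:R - d * (nst k t)%:R by rewrite -mulrBr -natrB.
  set s := d * j%:R in Tay dj; have s0 : 0 <= s by rewrite mulr_ge0// ltW.
  have sd : `|s - (t' - t)| <= d.
    rewrite dj ler_norml; rewrite -/d in a1 a2 b1 b2; apply/andP; split; lra.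
  have yb : `|y| <= r' by exact: apb.
  have -> : phi t' x - phi t x - (t' - t) *: X (phi t x) =
    (phi t' x - y') - (phi t x - y) + (y' - y - s *: X y)
    + (s - (t' - t)) *: X y - (t' - t) *: (X (phi t x) - X y).
    by apply/rowP => l; rewrite !mxE; ring.
  have n1 : `|(s - (t' - t)) *: X y| <= d * K by rewrite normrZ ler_pM// HK.
  have n2 : `|(t' - t) *: (X (phi t x) - X y)| <= T * L * C * d.
    rewrite normrZ ger0_norm ?subr_ge0// -!mulrA ler_pM ?subr_ge0//; first by lra.
    by apply: le_trans (HL' _ _ (phb _ t0 tT) yb) _; rewrite ler_wpM2l.
  have n3 : L * K * s ^+ 2 <= L * K * (t' - t) ^+ 2 + L * K * (2 * T + 1) * d.
    rewrite (_ : _ + _ = L * K * ((t' - t) ^+ 2 + (2 * T + 1) * d)); last by ring.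
    rewrite ler_wpM2l ?mulr_ge0//.
    move: sd; rewrite ler_norml => /andP[sd1 sd2]; nra.
  apply: le_trans (ler_normB _ _) _.
  apply: le_trans (lerD (le_trans (ler_normD _ _) (lerD (le_trans (ler_normD _ _)
    (lerD (le_trans (ler_normB _ _) (lerD Hy' Hy)) Tay)) n1)) n2) _.
  have : 0 <= K * d by rewrite mulr_ge0// ltW.
  lra.
exists (L * K + L * K + L * L * K * T); split.
  by rewrite !addr_ge0 ?mulr_ge0.
move=> t t' t0 tT t'0 t'T; have [tt'|t't] := leP t t'.
  apply: le_trans (fwd t t' t0 tt' t'T) _; rewrite ler_wpM2r ?sqr_ge0//.
  by rewrite -addrA lerDl addr_ge0 ?mulr_ge0.
(* Backwards in time, apply the forward estimate from [t'] and move the field from [phi t' x] to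
   [phi t x], which adds a term of the same order. *)
have := fwd t' t t'0 (ltW t't) tT => H.
have Pb : `|phi t x - phi t' x| <= (t - t') * K + L * K * (t - t') ^+ 2.
  have -> : phi t x - phi t' x = (t - t') *: X (phi t' x) + (phi t x - phi t' x - (t - t') *: X (phi t' x)).
    by rewrite subrKC.
  apply: le_trans (ler_normD _ _) _; rewrite lerD// normrZ ger0_norm ?subr_ge0 ?(ltW t't)//.
  by rewrite ler_wpM2l ?subr_ge0 ?(ltW t't)// HK// phb.
have -> : phi t' x - phi t x - (t' - t) *: X (phi t x) =
  - (phi t x - phi t' x - (t - t') *: X (phi t' x)) + (t - t') *: (X (phi t x) - X (phi t' x)).
  by apply/rowP => l; rewrite !mxE; ring.
apply: le_trans (ler_normD _ _) _; rewrite normrN normrZ ger0_norm ?subr_ge0 ?(ltW t't)//.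
have H2 := HL' _ _ (phb _ t0 tT) (phb _ t'0 t'T).
have H3 : (t - t') * `|X (phi t x) - X (phi t' x)| <=
   (t - t') * (L * ((t - t') * K + L * K * (t - t') ^+ 2)).
  by rewrite ler_wpM2l ?subr_ge0 ?(ltW t't)// (le_trans H2)// ler_wpM2l.
apply: le_trans (lerD H H3) _.
have H4 : (t - t') * (L * L * K * (t - t') ^+ 2) <= T * (L * L * K * (t - t') ^+ 2).
  have tT' : t - t' <= T by rewrite lerBlDr (le_trans tT)// lerDl.
  have q0 : 0 <= L * L * K * (t - t') ^+ 2 by rewrite mulr_ge0 ?sqr_ge0// !mulr_ge0.
  exact: ler_wpM2r.
rewrite -subr_ge0 (_ : _ - _ = T * (L * L * K * (t - t') ^+ 2) - (t - t') * (L * L * K * (t - t') ^+ 2)).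
  by rewrite subr_ge0.
by ring.
Qed.

Lemma flow0 x : phi 0 x = x.
Proof.
have [C [C0 HC]] := lX (lexx 0) (normr_ge0 x).
apply/eqP; rewrite -subr_eq0 -normr_eq0 eq_le normr_ge0 andbT.
apply: (@le_dya _ _ C) => k; rewrite add0r.
have := HC k 0 x (lexx _) (lexx _) (lexx _).
by rewrite /approx /nst mulr0 truncn0.
Qed.

Lemma flow_lip T r : 0 <= T -> 0 <= r -> exists C, 0 <= C /\ forall t x y,
  0 <= t -> t <= T -> `|x| <= r -> `|y| <= r -> `|phi t x - phi t y| <= C * `|x - y|.
Proof.
move=> T0 r0; have [r' [r'0 Hr']] := bX T0 r0.
have [K [K0 HK]] := Cinfv_bounded r' sX; have [L [L0 HL]] := Cinfv_lip r' sX.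
have [C [C0 HC]] := lX T0 r0.
exists (expR (L * T)); split; first exact: expR_ge0.
move=> t x y t0 tT xr yr; apply: (@le_dya _ _ (2 * C)) => k.
have -> : phi t x - phi t y = (approx X k t x - approx X k t y) +
   ((phi t x - approx X k t x) - (phi t y - approx X k t y)).
  by apply/rowP => l; rewrite !mxE; ring.
apply: le_trans (ler_normD _ _) _; apply: lerD.
  apply: (eul_lip L0 Hr' HL) => //; first exact/ltW/dya_gt0.
  by apply: le_trans tT; have /andP[] := nst_itv k t0.
apply: le_trans (ler_normB _ _) _.
apply: le_trans (lerD (HC k t x t0 tT xr) (HC k t y t0 tT yr)) _.
by lra.
Qed.

End Fixed.
End FlowProps.

Section Deriv.
Context (R : realType).

Lemma is_derive_eps (W : normedModType R) (f : R -> W) (a : R) d :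
  (forall e, 0 < e -> exists2 r, 0 < r &
    forall t, `|t| < r -> `|f (a + t) - f a - t *: d| <= e * `|t|) ->
  is_derive a 1 f d.
Proof.
move=> H.
suff L : (fun h => h^-1 *: ((f \o shift a) (h *: (1 : R)) - f a)) @ (0 : R)^' --> d.
  by split; [apply/cvg_ex; exists d | exact: cvg_lim L].
apply/cvgrPdist_le => e e0; have [r r0 Hr] := H e e0.
near=> h.
have hn0 : h != 0 by near: h; exact: nbhs_dnbhs_neq.
have hr : `|h| < r by near: h; exact: dnbhs0_lt.
rewrite /= [h *: 1]mulr1 [h + a]addrC -[d]scale1r -{1}(mulVf hn0) -scalerA -scalerBr.
rewrite normrZ normfV ler_pdivrMl ?normr_gt0// mulrC distrC; exact: Hr.
Unshelve. all: by end_near. Qed.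

Lemma is_derive_quad (W : normedModType R) (f : R -> W) (a : R) d C r : 0 < r ->
  (forall t, `|t| < r -> `|f (a + t) - f a - t *: d| <= C * t ^+ 2) ->
  is_derive a 1 f d.
Proof.
move=> r0 H; apply: is_derive_eps => e e0.
exists (Num.min r (e / (`|C| + 1))).
  by rewrite lt_min r0 divr_gt0// ltr_wpDl.
move=> t; rewrite lt_min => /andP[tr te]; apply: le_trans (H t tr) _.
rewrite -real_normK ?num_real// expr2 mulrA ler_wpM2r//.
apply: (@le_trans _ _ ((`|C| + 1) * `|t|)).
  by rewrite ler_wpM2r// (le_trans (ler_norm C))// lerDl.
by rewrite mulrC -ler_pdivlMr ?ltr_wpDl// ltW.
Qed.

Lemma line_is_derive_inv (V W : normedModType R) (f : V -> W) a v df :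
  is_derive (0 : R) 1 (fun s : R => f (a + s *: v)) df -> is_derive a v f df.
Proof.
have E : (fun h : R => h^-1 *: (((fun s : R => f (a + s *: v)) \o shift 0) (h *: 1)
            - f (a + 0 *: v)))
       = (fun h : R => h^-1 *: ((f \o shift a) (h *: v) - f a)).
  apply/funext => h /=; congr (_ *: (f _ - f _)); last by rewrite scale0r addr0.
  by rewrite [h *: 1]mulr1 addr0 addrC.
case; rewrite /derivable /derive E => d1 d2; split; first exact: d1.
by rewrite -d2 /derive.
Qed.

(** The mean value theorem for [fk k] is passed to the limit with the error [C * dya R k];
    continuity of [g] at 0 then gives the derivative there. *)
Lemma limit_derive (f g : R -> R) (fk gk : nat -> R -> R) C :
  (forall k (t : R), is_derive t 1 (fk k) (gk k t)) ->
  (forall k t, `|t| <= 1 -> `|f t - fk k t| <= C * dya R k) ->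
  (forall k t, `|t| <= 1 -> `|g t - gk k t| <= C * dya R k) ->
  {for 0, continuous g} -> is_derive (0 : R) 1 f (g 0).
Proof.
move=> fD Hf Hg cg; apply: is_derive_eps => e e0.
have /cvgrPdist_le/(_ e e0)/nbhs_ballP[r /= r0 Hr] := cg.
exists (Num.min r 1); first by rewrite lt_min r0/=.
move=> t; rewrite lt_min add0r => /andP[tr t1].
apply: (@le_dya _ _ _ (3 * C)) => k.
have [s _|c ct] := @mvt_line R _ (fk k) 0 1 t; first by have [] := fD k (0 + s *: 1).
have [_ ->] := fD k (0 + c *: 1); rewrite !add0r [t *: 1]mulr1 [c *: 1]mulr1 => E.
have c1 : `|c| <= 1 by apply: le_trans ct (ltW t1).
have -> : f t - f 0 - t *: g 0 = (f t - fk k t) - (f 0 - fk k 0)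
   + t * (gk k c - g c) + t * (g c - g 0).
  have -> : fk k t = fk k 0 + t * gk k c by rewrite -E; ring.
  by rewrite /GRing.scale /=; ring.
have C0 : 0 <= C * dya R k by apply: le_trans (Hf k 0 _); rewrite ?normr0.
have h1 : `|t * (gk k c - g c)| <= C * dya R k.
  by rewrite normrM -[leRHS]mul1r ler_pM// ?(ltW t1)// distrC Hg.
have h2 : `|t * (g c - g 0)| <= e * `|t|.
  rewrite normrM mulrC ler_wpM2r// distrC.
  by apply: Hr; rewrite -ball_normE /ball_/= sub0r normrN (le_lt_trans ct).
apply: le_trans (ler_normD _ _) _; rewrite addrC lerD//.
apply: le_trans (ler_normD _ _) _.
apply: le_trans (lerD (ler_normB _ _) h1) _.
have := Hf k t (ltW t1); have := Hf k 0; rewrite normr0 => /(_ ler01); lra.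
Qed.

End Deriv.

Section CinfvTools.
Context (R : realType).

Lemma row_eta n (x : 'rV[R]_n) : \row_j x 0 j = x.
Proof. by apply/rowP => j; rewrite mxE. Qed.

Lemma Ck_compv n m k (U : set 'rV[R]_n) (V : set 'rV[R]_m) (f : 'rV[R]_m -> R)
    (g : 'rV[R]_n -> 'rV[R]_m) : open U -> open V ->
  Ck k V f -> (forall j, Ck k U (fun x => g x 0 j)) -> (forall x, U x -> V (g x)) ->
  Ck k U (f \o g).
Proof.
move=> oU oV Cf Cg UV.
apply: (Ck_ext oU _ (@Ck_comp R n U oU m k V oV f (fun j x => g x 0 j) Cf Cg _)) => x Ux;
  by rewrite row_eta//; exact: UV.
Qed.

Lemma Cinfty_compv n m (U : set 'rV[R]_n) (V : set 'rV[R]_m) (f : 'rV[R]_m -> R)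
    (g : 'rV[R]_n -> 'rV[R]_m) : open U -> open V ->
  Cinfty V f -> Cinfv U g -> (forall x, U x -> V (g x)) -> Cinfty U (f \o g).
Proof. by move=> oU oV Cf Cg UV k; apply: (Ck_compv oU oV (Cf k)) => // j; exact: Cg. Qed.

Lemma Cinfv_comp n m p (U : set 'rV[R]_n) (V : set 'rV[R]_m) (f : 'rV[R]_m -> 'rV[R]_p)
    (g : 'rV[R]_n -> 'rV[R]_m) : open U -> open V ->
  Cinfv V f -> Cinfv U g -> (forall x, U x -> V (g x)) -> Cinfv U (f \o g).
Proof. by move=> oU oV Cf Cg UV j; exact: (Cinfty_compv oU oV (Cf j)). Qed.

Lemma Cinfv_id n (U : set 'rV[R]_n) : open U -> Cinfv U (fun x => x).
Proof. by move=> oU j k; exact: Ck_coord. Qed.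

Lemma Cinfv_cst n m (U : set 'rV[R]_n) (a : 'rV[R]_m) : open U -> Cinfv U (fun=> a).
Proof. by move=> oU j k; exact: (Ck_cst oU). Qed.

Lemma Cinfv_add n m (U : set 'rV[R]_n) (f g : 'rV[R]_n -> 'rV[R]_m) : open U ->
  Cinfv U f -> Cinfv U g -> Cinfv U (fun x => f x + g x).
Proof.
move=> oU Cf Cg j k; apply: (Ck_ext oU _ (Ck_add oU (Cf j k) (Cg j k))) => x _.
by rewrite !fctE mxE.
Qed.

Lemma Cinfv_scale n m (U : set 'rV[R]_n) (a : 'rV[R]_n -> R) (f : 'rV[R]_n -> 'rV[R]_m) :
  open U -> Cinfty U a -> Cinfv U f -> Cinfv U (fun x => a x *: f x).
Proof.
move=> oU Ca Cf j k; apply: (Ck_ext oU _ (Ck_mul oU (Ca k) (Cf j k))) => x _.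
by rewrite !fctE mxE.
Qed.

Lemma Cinfv_opp n m (U : set 'rV[R]_n) (f : 'rV[R]_n -> 'rV[R]_m) : open U ->
  Cinfv U f -> Cinfv U (fun x => - f x).
Proof.
move=> oU Cf j k; apply: (Ck_ext oU _ (Ck_opp oU (Cf j k))) => x _; by rewrite mxE.
Qed.

Lemma Cinfv_lsub n m (U : set 'rV[R]_(n + m)) : open U -> Cinfv U (@lsubmx R 1 n m).
Proof.
move=> oU j k; apply: (Ck_ext oU _ (Ck_coord oU k (lshift m j))) => x _; by rewrite mxE.
Qed.

Lemma Cinfv_rsub n m (U : set 'rV[R]_(n + m)) : open U -> Cinfv U (@rsubmx R 1 n m).
Proof.
move=> oU j k; apply: (Ck_ext oU _ (Ck_coord oU k (rshift n j))) => x _; by rewrite mxE.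
Qed.

Lemma Cinfv_row_mx n m p (U : set 'rV[R]_n) (f : 'rV[R]_n -> 'rV[R]_m)
    (g : 'rV[R]_n -> 'rV[R]_p) : open U ->
  Cinfv U f -> Cinfv U g -> Cinfv U (fun x => row_mx (f x) (g x)).
Proof.
move=> oU Cf Cg j k; case: (split_ordP j) => i ->.
  by apply: (Ck_ext oU _ (Cf i k)) => x _; rewrite row_mxEl.
by apply: (Ck_ext oU _ (Cg i k)) => x _; rewrite row_mxEr.
Qed.

Lemma Cinfv_sub n m (U V : set 'rV[R]_n) (f : 'rV[R]_n -> 'rV[R]_m) : U `<=` V ->
  Cinfv V f -> Cinfv U f.
Proof. by move=> UV Cf j k; exact: Ck_sub (Cf j k). Qed.

Lemma norm_lsub n m (z : 'rV[R]_(n + m)) : `|lsubmx z| <= `|z|.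
Proof. by apply: norm_le_coord => // i; rewrite mxE coord_le_norm. Qed.

Lemma norm_rsub n m (z : 'rV[R]_(n + m)) : `|rsubmx z| <= `|z|.
Proof. by apply: norm_le_coord => // i; rewrite mxE coord_le_norm. Qed.

Lemma norm_row_mx n m (x : 'rV[R]_n) (y : 'rV[R]_m) : `|row_mx x y| <= `|x| + `|y|.
Proof.
apply: norm_le_coord => [|j]; first by rewrite addr_ge0.
case: (split_ordP j) => i ->; first by rewrite row_mxEl (le_trans (coord_le_norm _ _))// lerDl.
by rewrite row_mxEr (le_trans (coord_le_norm _ _))// lerDr.
Qed.

End CinfvTools.

(** * The linearised equation and smooth dependence on initial values *)

Section TangentLift.
Context (R : realType) (n : nat).
Notation E := 'rV[R]_n.
Variables (X : E -> E) (sX : Cinfv setT X).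
Notation e i := (delta_mx 0 i : E).

Definition diffv (x v : E) : E := \row_j \sum_i v 0 i * 'D_(e i) (fun x => X x 0 j) x.

(** The tangent lift of the field: its flow is the derivative of the flow of [X]. *)
Definition tlift (z : 'rV[R]_(n + n)) : 'rV[R]_(n + n) :=
  row_mx (X (lsubmx z)) (diffv (lsubmx z) (rsubmx z)).

Lemma tlift_smooth : Cinfv setT tlift.
Proof.
have oT := @openT 'rV[R]_(n + n).
apply: Cinfv_row_mx => //.
  by apply: (Cinfv_comp oT openT sX) => //; exact: Cinfv_lsub.
move=> j k; apply: (Ck_ext oT (f := fun z => \sum_i (rsubmx z) 0 i *
   'D_(e i) (fun x => X x 0 j) (lsubmx z))) => [z _|]; first by rewrite mxE.
apply: (Ck_sum oT) => i; apply: (Ck_mul oT); first exact: Cinfv_rsub.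
by apply: (Cinfty_compv oT openT (Cinfty_derive i (sX j))) => //; exact: Cinfv_lsub.
Qed.

Lemma lsub_iter h j z : lsubmx (iter j (eul tlift h) z) = iter j (eul X h) (lsubmx z).
Proof.
elim: j => // j IH; rewrite !iterS -IH; set y := iter j _ z.
by rewrite /eul /tlift -[y in LHS]hsubmxK scale_row_mx add_row_mx row_mxKl !row_mxKl.
Qed.

Lemma rsub_iterS h j z : rsubmx (iter j.+1 (eul tlift h) z) =
  rsubmx (iter j (eul tlift h) z) +
  h *: diffv (iter j (eul X h) (lsubmx z)) (rsubmx (iter j (eul tlift h) z)).
Proof.
rewrite iterS -lsub_iter; set y := iter j _ z.
by rewrite /eul /tlift -[X in rsubmx (X + _)]hsubmxK scale_row_mx add_row_mx !row_mxKr.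
Qed.

(** The second component obeys a linear recursion whose coefficients are bounded along the polygon
    of the first, so it grows at most by the factor [expR (A * T)]. *)
Lemma euler_bounded_tlift : euler_bounded X -> euler_bounded tlift.
Proof.
move=> bX T r T0 r0; have [r' [r'0 Hr']] := bX T r T0 r0.
have [A [A0 HA]] : exists A, 0 <= A /\ forall x v, `|x| <= r' -> `|diffv x v| <= A * `|v|.
  have [j a b ab H x v /H h|j|A [A0 HA]] := @fin_bound R n
     (fun j A => forall x v, `|x| <= r' -> `|diffv x v 0 j| <= A * `|v|).
  - by apply: le_trans (h v) _; rewrite ler_wpM2r.
  - have [i a b ab H x xr|i|K [K0 HK]] := @fin_bound R n
      (fun i K => forall x, `|x| <= r' -> `|'D_(e i) (fun x => X x 0 j) x| <= K).
    + exact: le_trans (H x xr) ab.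
    + exact/ball_bounded/Cinfty_continuous/Cinfty_derive.
    exists (n%:R * K); split; first by rewrite mulr_ge0.
    move=> x v xr; rewrite mxE; apply: le_trans (ler_norm_sum _ _ _) _.
    apply: (@le_trans _ _ (\sum_(i < n) K * `|v|)); last first.
      by rewrite sumr_const card_ord -mulrA mulr_natl.
    apply: ler_sum => i _; rewrite normrM mulrC ler_pM//; [exact: HK|exact: coord_le_norm].
  - exists A; split => // x v xr; apply: norm_le_coord; first by rewrite mulr_ge0.
    by move=> i; exact: HA.
exists (r' + expR (A * T) * r); split; first by rewrite addr_ge0// mulr_ge0// expR_ge0.
move=> h j z h0 hT zr; rewrite -[iter _ _ _]hsubmxK.
apply: le_trans (norm_row_mx _ _) _; apply: lerD.
  by rewrite lsub_iter; apply: Hr' => //; exact: le_trans (norm_lsub _) zr.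
have G i : (i <= j)%N -> `|rsubmx (iter i (eul tlift h) z)| <= (1 + A * h) ^+ i * r.
  elim: i => [|i IH] ij; first by rewrite expr0 mul1r (le_trans (norm_rsub _)).
  rewrite rsub_iterS; apply: le_trans (ler_normD _ _) _; rewrite normrZ (ger0_norm h0).
  set v := rsubmx _ in IH *.
  have hi : h * i%:R <= T by apply: le_trans hT; rewrite ler_wpM2l// ler_nat ltnW.
  apply: (@le_trans _ _ ((1 + A * h) * `|v|)).
    rewrite mulrDl mul1r lerD2l [A * h]mulrC -mulrA ler_wpM2l//.
    by apply: HA; apply: Hr' => //; exact: le_trans (norm_lsub _) zr.
  by rewrite exprS -mulrA ler_wpM2l ?IH// 1?ltnW// addr_ge0// mulr_ge0.
apply: le_trans (G j (leqnn _)) _; rewrite ler_wpM2r//.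
apply: (@le_trans _ _ (expR (A * h) ^+ j)).
  by rewrite lerXn2r ?nnegrE ?expR_ge0 ?addr_ge0 ?mulr_ge0// expR_ge1Dx.
by rewrite -expRM_natl ler_expR mulrC -mulrA ler_wpM2l.
Qed.

(** The scheme commutes with linearisation: the derivative of an Euler polygon in its starting point
    is exactly an Euler polygon of the tangent lift, before any limit. *)
Lemma iter_derive h j x v : is_derive x v (iter j (eul X h))
  (rsubmx (iter j (eul tlift h) (row_mx x v))).
Proof.
elim: j => [|j IH].
  by rewrite /= row_mxKr; exact: is_derive_id.
rewrite rsub_iterS row_mxKl; set g := iter j (eul X h) in IH *.
set w := rsubmx _ in IH *; have [gd gD] := IH.
have D l : is_derive x v (fun y => X (g y) 0 l) (diffv (g x) w 0 l).
  have [df E] := @Ck_differentiable R n setT openT 0%N (fun y => X y 0 l) (g x) I (sX l 1%N).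
  have := derivable_comp gd df; rewrite gD E.
  by rewrite /diffv mxE.
have Dg l : is_derive x v (fun y => g y 0 l) (w 0 l).
  have gl : derivable (fun y => g y 0 l) x v by move/derivable_mxP: gd => /(_ 0 l).
  apply: DeriveDef => //; move: gD; rewrite derive_mx// => <-; by rewrite mxE.
have DD l : is_derive x v (fun y => iter j.+1 (eul X h) y 0 l) ((w + h *: diffv (g x) w) 0 l).
  have E : (fun y => iter j.+1 (eul X h) y 0 l) = (fun y => g y 0 l) + h *: (fun y => X (g y) 0 l).
    by apply/funext => y; rewrite iterS !fctE /eul !mxE.
  rewrite E; apply: is_derive_eq (is_deriveD (Dg l) (is_deriveZ h (D l))) _.
  by rewrite !mxE.
have d : derivable (iter j.+1 (eul X h)) x v.
  by apply/derivable_mxP => a b; rewrite ord1; have [] := DD b.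
apply: DeriveDef => //; rewrite derive_mx//; apply/rowP => l; rewrite mxE.
by have [_ ->] := DD l.
Qed.

End TangentLift.

Section FlowSmooth.
Context (R : realType).

Lemma flow_continuous n (X : 'rV[R]_n -> 'rV[R]_n) phi t : Cinfv setT X -> euler_bounded X ->
  euler_limit X phi -> 0 <= t -> forall j, continuous (fun x => phi t x 0 j).
Proof.
move=> sX bX lX t0 j x; apply: continuous_coord.
have FF : Filter (nbhs (x : 'rV[R]_n)) by exact: nbhs_filter.
apply/(@cvgrPdist_le _ _ _ (nbhs x) FF) => eps eps0.
have [C [C0 HC]] := flow_lip sX bX lX t0 (addr_ge0 (normr_ge0 x) ler01).
have C1 : 0 < C + 1 by rewrite ltr_wpDl.
near=> y.
have xy : `|x - y| <= eps / (C + 1).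
  by near: y; apply: cvgr_dist_le => //; rewrite divr_gt0.
have xy1 : `|x - y| <= 1 by near: y; apply: cvgr_dist_le.
apply: le_trans (HC t x y t0 (lexx _) _ _) _.
- by rewrite lerDl.
- rewrite -[y](subrKC x); apply: le_trans (ler_normD _ _) _.
  by rewrite lerD2l distrC.
- apply: (@le_trans _ _ ((C + 1) * `|x - y|)); first by rewrite ler_wpM2r// lerDl.
  by rewrite mulrC -ler_pdivlMr.
Unshelve. all: by end_near. Qed.

(** A partial derivative of the flow is a component of the flow of the tangent lift, by uniform
    convergence of the polygons and of their derivatives. The induction on [k] therefore runs over
    all dimensions and fields. *)
Lemma flow_Ck k n (X : 'rV[R]_n -> 'rV[R]_n) phi t j : Cinfv setT X -> euler_bounded X ->
  euler_limit X phi -> 0 <= t -> Ck k setT (fun x => phi t x 0 j).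
Proof.
elim: k n X phi j => [|k IH] n X phi j sX bX lX t0.
all: have cphi : continuous (fun x => phi t x 0 j) by exact: (flow_continuous sX bX lX t0).
  by split => // x _; exact: cphi.
split; first by move=> x _; exact: cphi.
have [Phi lPhi] := flow_exists (tlift_smooth sX) (euler_bounded_tlift sX bX).
move=> i.
have D x : is_derive x (delta_mx 0 i) (fun x => phi t x 0 j)
    (Phi t (row_mx x (delta_mx 0 i)) 0 (rshift n j)).
  apply: line_is_derive_inv.
  set v := delta_mx 0 i; pose r := `|x| + `|v| + `|v|.
  have r0 : 0 <= r by rewrite !addr_ge0.
  have [C [C0 HC]] := lX t r t0 r0; have [D [D0 HD]] := lPhi t r t0 r0.
  have br (s : R) : `|s| <= 1 -> `|x + s *: v| <= `|x| + `|v|.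
    move=> s1; apply: le_trans (ler_normD _ _) _; rewrite lerD2l normrZ.
    by rewrite -[leRHS]mul1r ler_wpM2r.
  have := @limit_derive R (fun s => phi t (x + s *: v) 0 j)
    (fun s => Phi t (row_mx (x + s *: v) v) 0 (rshift n j))
    (fun k s => approx X k t (x + s *: v) 0 j)
    (fun k s => approx (tlift X) k t (row_mx (x + s *: v) v) 0 (rshift n j)) (C + D).
  rewrite scale0r addr0; apply.
  - move=> p s; rewrite /approx.
    have := line_is_derive (iter_derive sX (dya R p) (nst p t) (x + s *: v) v).
    set G := fun s => _; set w := rsubmx _ => -[gd gD].
    have gl : derivable (fun y => G y 0 j) s 1 by move/derivable_mxP: gd => /(_ 0 j).
    apply: DeriveDef => //; move: gD; rewrite derive_mx// => /rowP/(_ j).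
    by rewrite !mxE.
  - move=> p s s1.
    have := coord_le_norm (phi t (x + s *: v) - approx X p t (x + s *: v)) j.
    rewrite !mxE => h; apply: le_trans h _; apply: le_trans (HC p t _ t0 (lexx _) _) _.
      by apply: le_trans (br s s1) _; rewrite lerDl.
    by rewrite ler_wpM2r ?(ltW (dya_gt0 R p))// lerDl.
  - move=> p s s1; set z := row_mx _ _.
    have := coord_le_norm (Phi t z - approx (tlift X) p t z) (rshift n j).
    rewrite !mxE => h; apply: le_trans h _; apply: le_trans (HD p t _ t0 (lexx _) _) _.
      by apply: le_trans (norm_row_mx _ _) _; rewrite lerD2r br.
    by rewrite ler_wpM2r ?(ltW (dya_gt0 R p))// lerDr.
  - have c1 := Ck_cont (IH _ _ _ (rshift n j) (tlift_smooth sX) (euler_bounded_tlift sX bX) lPhi t0).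
    apply: (@continuous_comp _ _ _ (fun s : R => row_mx (x + s *: v) v) (fun z => Phi t z 0 (rshift n j))).
      apply: continuous_rV => l; case: (split_ordP l) => a ->.
        apply: (@for_continuous_ext _ _ (fun y : R => x 0 a + y * v 0 a)).
          by move=> y; rewrite row_mxEl !mxE.
        apply: continuousD; first exact: cst_continuous.
        by apply: cvgM; [exact: cvg_id|exact: cvg_cst].
      apply: (@for_continuous_ext _ _ (fun y : R => v 0 a)).
        by move=> y; rewrite row_mxEr.
      exact: cst_continuous.
    exact: c1.
split; first by move=> x _; have [] := D x.
apply: (Ck_ext (@openT _) (f := fun x => Phi t (row_mx x (delta_mx 0 i)) 0 (rshift n j))).
  by move=> x _; have [_ ->] := D x.
apply: (Ck_compv openT openT (IH _ _ _ (rshift n j) (tlift_smooth sX) (euler_bounded_tlift sX bX) lPhi t0)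
   (g := fun x => row_mx x (delta_mx 0 i))) => // l.
exact: (Cinfv_row_mx openT (Cinfv_id openT) (Cinfv_cst _ openT)).
Unshelve. all: by end_near. Qed.

End FlowSmooth.

(** * Global flows and uniqueness of solutions *)

Section Ode.
Context (R : realType) (n : nat).
Notation E := 'rV[R]_n.
Implicit Types (X : E -> E).

Record flow_of X (F : R -> E -> E) : Prop := FlowOf {
  flow_init : forall x, F 0 x = x;
  flow_derive : forall (t : R) x, is_derive t 1 (fun s => F s x) (X (F t x));
  flow_smooth : forall t, Cinfv setT (F t)
}.

(** Negative times use the forward flow of [- X]. The quadratic estimates of both halves hold up to
    time 0, where they are glued. *)
Lemma ode_flow X : Cinfv setT X -> euler_bounded X -> euler_bounded (fun x => - X x) ->
  exists F, flow_of X F.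
Proof.
move=> sX bX bY; have sY : Cinfv setT (fun x => - X x) by apply: Cinfv_opp => //; exact: openT.
have [phi lphi] := flow_exists sX bX; have [psi lpsi] := flow_exists sY bY.
pose F (t : R) x := if 0 <= t then phi t x else psi (- t) x.
exists F; split.
- by move=> x; rewrite /F lexx (flow0 lphi).
- move=> t x.
  have T0 : 0 <= `|t| + 1 by rewrite addr_ge0.
  have [C [C0 HC]] := flow_quad sX bX lphi x T0.
  have [D [D0 HD]] := flow_quad sY bY lpsi x T0.
  have Hp s : 0 <= t -> `|s| < 1 -> 0 <= t + s ->
    `|F (t + s) x - F t x - s *: X (F t x)| <= (C + D) * s ^+ 2.
    move=> t0 s1 ts; rewrite /F t0 ts.
    have Es : t + s - t = s by ring.
    have := HC t (t + s) t0; rewrite Es => H.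
    apply: le_trans (H _ ts _) _.
    - by rewrite ger0_norm// lerDl.
    - by rewrite ger0_norm// lerD2l (le_trans (ler_norm s))// ltW.
    - by rewrite ler_wpM2r ?sqr_ge0// lerDl.
  have Hn s : t <= 0 -> `|s| < 1 -> t + s <= 0 ->
    `|F (t + s) x - F t x - s *: X (F t x)| <= (C + D) * s ^+ 2.
    move=> t0 s1 ts.
    have FN a : a <= 0 -> F a x = psi (- a) x.
      rewrite le_eqVlt => /orP[/eqP ->|a0]; last by rewrite /F leNgt a0.
      by rewrite /F lexx oppr0 (flow0 lphi) (flow0 lpsi).
    rewrite !FN//.
    have := HD (- t) (- (t + s)); rewrite !oppr_ge0 t0 ts => /(_ isT _ isT).
    have -> : - (t + s) - - t = - s by ring.
    rewrite sqrrN scalerN scaleNr opprK => H.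
    apply: le_trans (H _ _) _.
    - by rewrite ler0_norm// lerDl.
    - rewrite opprD ler0_norm// lerD2l; apply: le_trans (ler_norm _) _; by rewrite normrN ltW.
    - by rewrite ler_wpM2r ?sqr_ge0// lerDr.
  have [t0|t0|t0] := ltgtP t 0.
  + apply: (@is_derive_quad _ _ _ t _ (C + D) (Num.min 1 (- t))).
      by rewrite lt_min ltr01 oppr_gt0.
    move=> s; rewrite lt_min => /andP[s1 st]; apply: Hn => //; first exact: ltW.
    by rewrite -lerBrDl sub0r ltW// (le_lt_trans (ler_norm s)).
  + apply: (@is_derive_quad _ _ _ t _ (C + D) (Num.min 1 t)).
      by rewrite lt_min ltr01.
    move=> s; rewrite lt_min => /andP[s1 st]; apply: Hp => //; first exact: ltW.
    by rewrite -lerBlDl sub0r lerNl ltW// (le_lt_trans _ st)// -normrN ler_norm.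
  + apply: (@is_derive_quad _ _ _ t _ (C + D) 1) => // s s1.
    have [s0|s0] := leP 0 s; first by apply: Hp; rewrite ?t0 ?add0r.
    by apply: Hn; rewrite ?t0 ?add0r// ltW.
- move=> t j k; rewrite /F; have [t0|t0] := boolP (0 <= t); first exact: flow_Ck.
  have nt : 0 <= - t by rewrite oppr_ge0 ltW// ltNge.
  exact: (flow_Ck _ _ sY bY lpsi nt).
Qed.

Lemma bounded_euler_bounded X K : (forall x, `|X x| <= K) -> euler_bounded X.
Proof.
move=> HK T r T0 r0; have K0 : 0 <= K by apply: le_trans (HK 0).
exists (r + T * K); split; first by rewrite addr_ge0// mulr_ge0.
move=> h j x h0 hT xr.
suff G i : (i <= j)%N -> `|iter i (eul X h) x| <= r + h * i%:R * K.
  by apply: le_trans (G j (leqnn _)) _; rewrite lerD2l ler_wpM2r.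
elim: i => [|i IH] ij; first by rewrite mulr0 mul0r addr0.
rewrite iterS {1}/eul; apply: le_trans (ler_normD _ _) _.
rewrite -natr1 mulrDr mulr1 mulrDl addrA; apply: lerD; first by apply: IH; exact: ltnW.
by rewrite normrZ ger0_norm// ler_wpM2l.
Qed.

Lemma nonincreasing_itv (z dz : R -> R) (b : R) : 0 <= b ->
  (forall t : R, 0 <= t -> t <= b -> is_derive t 1 z (dz t)) ->
  (forall t : R, 0 <= t -> t <= b -> dz t <= 0) -> z b <= z 0.
Proof.
move=> b0 zd zn.
have [||c] := @MVT_segment R z dz 0 b b0.
- by move=> t; rewrite in_itv/= => /andP[t0 tb]; apply: zd; exact: ltW.
- apply: continuous_in_subspaceT => t; rewrite inE/= in_itv/= => /andP[t0 tb].
  by apply/differentiable_continuous/derivable1_diffP; have [] := zd t t0 tb.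
- rewrite in_itv/= => /andP[c0 cb] E; rewrite -subr_le0 E subr0.
  by rewrite mulr_le0_ge0// zn.
Qed.

(** The sum [w] of the squared coordinate differences satisfies [w' <= c w], so it becomes
    nonincreasing after multiplication by a decaying exponential; it starts at 0. *)
Lemma ode_unique_fwd X (u v : R -> E) (b : R) : Cinfv setT X -> 0 <= b ->
  (forall t : R, 0 <= t -> t <= b -> is_derive t 1 u (X (u t))) ->
  (forall t : R, 0 <= t -> t <= b -> is_derive t 1 v (X (v t))) ->
  u 0 = v 0 -> u b = v b.
Proof.
move=> sX b0 ud vd uv0.
have bnd (w : R -> E) : (forall t : R, 0 <= t -> t <= b -> is_derive t 1 w (X (w t))) ->
    exists r, 0 <= r /\ forall t, 0 <= t -> t <= b -> `|w t| <= r.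
  move=> wd; have [|c _ Hc] := @EVT_max R (fun t => `|w t|) 0 b b0.
    apply: continuous_in_subspaceT => t; rewrite inE/= in_itv/= => /andP[t0 tb].
    apply: continuous_comp; last exact: norm_continuous.
    by apply/differentiable_continuous/derivable1_diffP; have [] := wd t t0 tb.
  by exists `|w c|; split => // t t0 tb; apply: Hc; rewrite in_itv/= t0.
have [ru [ru0 Hu]] := bnd u ud; have [rv [rv0 Hv]] := bnd v vd.
have [L [L0 HL]] := Cinfv_lip (ru + rv) sX.
pose d t i := u t 0 i - v t 0 i.
pose w t := \sum_(i < n) d t i ^+ 2.
pose dX t i := X (u t) 0 i - X (v t) 0 i.
(* The norm is a maximum while [w] is a sum over [n] coordinates: each of them contributes at most
   [2 L w] to the derivative. *)
pose c := 2 * (L * n%:R).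
have dd i t : 0 <= t -> t <= b -> is_derive t 1 (fun s => d s i) (dX t i).
  move=> t0 tb; have [u1 u2] := ud t t0 tb; have [v1 v2] := vd t t0 tb.
  have ui : is_derive t 1 (fun s => u s 0 i) (X (u t) 0 i).
    by apply: DeriveDef; [by move/derivable_mxP: u1 => /(_ 0 i)|rewrite -u2 derive_mx// mxE].
  have vi : is_derive t 1 (fun s => v s 0 i) (X (v t) 0 i).
    by apply: DeriveDef; [by move/derivable_mxP: v1 => /(_ 0 i)|rewrite -v2 derive_mx// mxE].
  exact: is_deriveB.
pose z t := expR (- (c * t)) * w t.
have w0 t : 0 <= w t by apply: sumr_ge0 => i _; exact: sqr_ge0.
have wd t : 0 <= t -> t <= b -> is_derive t 1 w (\sum_(i < n) 2 * (d t i * dX t i)).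
  move=> t0 tb.
  have := @is_derive_sum R R R n (fun i s => d s i ^+ 2) t 1 (fun i => 2 * (d t i * dX t i)).
  rewrite (_ : (\sum_(i < n) (fun s => d s i ^+ 2)) = w); last first.
    by apply/funext => s; rewrite fct_sumE.
  apply => i; have := @is_deriveX R R (fun s => d s i) 2 t 1 (dX t i) (dd i t t0 tb).
  by rewrite [_ *: dX t i]mulrC => H; apply: is_derive_eq H _; rewrite expr1; ring.
have ed (t : R) : is_derive t 1 (fun s => expR (- (c * s))) (- c * expR (- (c * t))).
  have h : is_derive t 1 (fun s : R => - (c * s)) (- c).
    have := is_deriveN (is_deriveZ c (is_derive_id t (1 : R))).
    by rewrite [c *: 1]mulr1.
  by have := @is_derive1_comp R (@expR R) (fun s : R => - (c * s)) t _ _ (is_derive_expR _) h; rewrite mulrC.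
have zd t : 0 <= t -> t <= b -> is_derive t 1 z
   (expR (- (c * t)) * (\sum_(i < n) 2 * (d t i * dX t i) - c * w t)).
  move=> t0 tb; apply: is_derive_eq (is_deriveM (ed t) (wd t t0 tb)) _.
  by rewrite /GRing.scale /=; ring.
have := nonincreasing_itv b0 zd; rewrite /z.
have -> : w 0 = 0 by apply: big1 => i _; rewrite /d uv0 subrr expr0n.
rewrite mulr0 pmulr_rle0 ?expR_gt0// => H.
have wb : w b <= 0.
  apply: H => t t0 tb; rewrite pmulr_rle0 ?expR_gt0// subr_le0.
  have nd : `|u t - v t| ^+ 2 <= w t.
    have [[i Hi]|N] := pselect (exists i, `|u t - v t| <= `|d t i|).
      rewrite /w (bigD1 i)//= -[leLHS]addr0 lerD ?sumr_ge0// => [|j _]; last exact: sqr_ge0.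
      by rewrite -[leRHS]real_normK ?num_real// lerXn2r ?nnegrE.
    suff -> : `|u t - v t| = 0 by rewrite expr0n /=.
    apply/eqP; rewrite -[_ == _]negbK; apply/negP => n0.
    have [[a i] /= E] := @mx_norm_neq0 _ _ _ (u t - v t) n0.
    apply: N; exists i; rewrite [leLHS]/Num.Def.normr/= E ord1 /d !mxE; exact: lexx.
  apply: (@le_trans _ _ (\sum_(i < n) 2 * (L * `|u t - v t| ^+ 2))).
    apply: ler_sum => i _; rewrite ler_wpM2l//.
    apply: le_trans (ler_norm _) _; rewrite normrM expr2 mulrCA.
    have di : `|d t i| <= `|u t - v t|.
      by have := coord_le_norm (u t - v t) i; rewrite !mxE.
    have dXi : `|dX t i| <= L * `|u t - v t|.
      have h := coord_le_norm (X (u t) - X (v t)) i; rewrite !mxE in h.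
      apply: le_trans h _; apply: HL.
        by apply: le_trans (Hu t t0 tb) _; rewrite lerDl.
      by apply: le_trans (Hv t t0 tb) _; rewrite lerDr.
    by rewrite ler_pM.
  rewrite sumr_const card_ord -[X in X <= _]mulr_natr /c; set q := _ ^+ 2 in nd *.
  have -> : 2 * (L * q) * n%:R = 2 * (L * n%:R) * q by ring.
  by rewrite ler_wpM2l// !mulr_ge0.
have w00 : w b = 0 by apply/eqP; rewrite eq_le wb w0.
apply/rowP => i; apply/eqP; rewrite -subr_eq0 -sqrf_eq0.
by have /psumr_eq0P/(_ i isT) : w b = 0 := w00; move=> ->// j _; exact: sqr_ge0.
Qed.

Lemma ode_unique X (u v : R -> E) (a b : R) : Cinfv setT X -> a < 0 -> 0 < b ->
  (forall t : R, a < t -> t < b -> is_derive t 1 u (X (u t))) ->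
  (forall t : R, a < t -> t < b -> is_derive t 1 v (X (v t))) ->
  u 0 = v 0 -> forall t, a < t -> t < b -> u t = v t.
Proof.
move=> sX a0 b0 ud vd uv t at_ tb; have [t0|t0] := leP 0 t.
  apply: (ode_unique_fwd sX t0 _ _ uv) => s s0 st.
    by apply: ud; [exact: lt_le_trans a0 s0|exact: le_lt_trans tb].
  by apply: vd; [exact: lt_le_trans a0 s0|exact: le_lt_trans tb].
have sY : Cinfv setT (fun x => - X x) by apply: Cinfv_opp => //; exact: openT.
have rev (w : R -> E) : (forall t : R, a < t -> t < b -> is_derive t 1 w (X (w t))) ->
   forall s : R, 0 <= s -> s <= - t -> is_derive s 1 (fun s => w (- s)) (- X (w (- s))).
  move=> wd s s0 st.
  have as_ : a < - s by rewrite (lt_le_trans at_)// lerNr.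
  have sb : - s < b by rewrite (le_lt_trans _ b0)// oppr_le0.
  have [w1 w2] := wd _ as_ sb.
  have dn : is_derive s 1 (fun s : R => - s) (-1) by exact: is_deriveNid.
  have df : differentiable w (- s) by apply/derivable1_diffP.
  have [n1 n2] := dn; have := @derivable_comp R R R E w (fun s : R => - s) s 1 n1 df; rewrite n2.
  have E1 : 'd w (- s) (-1) = - X (w (- s)).
    by rewrite -w2 deriveE//; exact: (raddfN ('d w (- s)) 1).
  by rewrite E1.
have nt : 0 <= - t by rewrite oppr_ge0 ltW.
have := @ode_unique_fwd _ (fun s => u (- s)) (fun s => v (- s)) (- t) sY nt (rev u ud) (rev v vd).
by rewrite oppr0 opprK; exact.
Qed.

End Ode.

(** * Smooth inverses of matrices and extension by cut-off *)

Section SmoothMatrix.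
Context (R : realType) (n : nat) (U : set 'rV[R]_n) (oU : open U).

Lemma Cinfty_det m (A : 'rV[R]_n -> 'M[R]_m) :
  (forall i j, Cinfty U (fun x => A x i j)) -> Cinfty U (fun x => \det (A x)).
Proof.
move=> CA k; rewrite /determinant; apply: (Ck_sum oU) => s.
apply: (Ck_mul oU (Ck_cst oU k _)); apply: (Ck_prod oU) => i; exact: CA.
Qed.

(** By Cramer's rule the entries are cofactors divided by the determinant. *)
Lemma Cinfty_invmx m (A : 'rV[R]_n -> 'M[R]_m) :
  (forall i j, Cinfty U (fun x => A x i j)) -> (forall x, U x -> A x \in unitmx) ->
  forall i j, Cinfty U (fun x => invmx (A x) i j).
Proof.
move=> CA uA i j k.
apply: (Ck_ext oU (f := fun x => (\det (A x))^-1 * \adj (A x) i j)) => [x Ux|].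
  by rewrite /invmx (uA x Ux) [RHS]mxE.
apply: (Ck_mul oU).
  apply: (Ck_inv oU) => [x Ux|]; last exact: Cinfty_det.
  by have := uA x Ux; rewrite unitmxE unitfE.
apply: (Ck_ext oU (f := fun x => cofactor (A x) j i)) => [x _|]; first by rewrite mxE.
rewrite /cofactor; apply: (Ck_mul oU (Ck_cst oU k _)).
case: m A CA uA i j => [|m] A CA uA i j; first by case: (i) => [].
apply: (Cinfty_det _ k) => a b k'.
apply: (Ck_ext oU _ (CA (lift j a) (lift i b) k')) => x _; by rewrite !mxE.
Qed.

End SmoothMatrix.

Section CutOff.
Context (R : realType).

(** The product vanishes on the open set beyond radius [2 * r], while [U] reaches radius [3 * r];
    these two open sets cover the space, and smoothness is checked on each. *)
Lemma bump_extend n (a : 'rV[R]_n) r (b f : 'rV[R]_n -> R) (U : set 'rV[R]_n) :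
  open U -> (forall x, `|x - a| < 2 * r + 1 * r -> U x) -> 0 < r ->
  Cinfty setT b -> (forall x, 2 * r <= `|x - a| -> b x = 0) -> Cinfty U f ->
  Cinfty setT (fun x => b x * f x).
Proof.
move=> oU HU r0 Cb b0 Cf k; apply: Ck_local => x _.
have cn : continuous (fun x : 'rV[R]_n => `|x - a|).
  move=> y; apply: (@continuous_comp _ _ _ (fun x : 'rV[R]_n => x - a) (fun x : 'rV[R]_n => `|x|)); last exact: norm_continuous.
  by apply: continuousB; [exact: cvg_id|exact: cst_continuous].
have [xa|xa] := ltP `|x - a| (2 * r + 1 * r).
  exists U; first exact: HU.
  by apply: (Ck_mul oU) => //; exact: Ck_sub (Cb k).
exists [set x : 'rV[R]_n | 2 * r < `|x - a|]; first by rewrite /= (lt_le_trans _ xa)// ltrDl mul1r.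
have oW : open [set x : 'rV[R]_n | 2 * r < `|x - a|].
  by apply: (open_comp (f := fun x : 'rV[R]_n => `|x - a|) (D := [set s | 2 * r < s])) => [y _|]; [exact: cn|exact: open_gt].
apply: (Ck_ext oW _ (Ck_cst oW k 0)) => y /= ya.
by rewrite b0 ?mul0r// ltW.
Qed.

Lemma open_ball_sub n (U : set 'rV[R]_n) a : open U -> U a ->
  exists2 r, 0 < r & forall x, `|x - a| < r -> U x.
Proof.
move=> oU Ua; have /nbhs_ballP[r /= r0 Hr] : nbhs a U by exact: open_nbhs_nbhs.
by exists r => // x xa; apply: Hr; rewrite -ball_normE /ball_/= distrC.
Qed.

Lemma local_global n (a : 'rV[R]_n) (f : 'rV[R]_n -> R) (U : set 'rV[R]_n) :
  open U -> U a -> Cinfty U f -> exists (g : 'rV[R]_n -> R) (r s : R),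
  [/\ 0 < r, Cinfty setT g, forall x, `|x - a| <= r -> g x = f x & forall x, s <= `|x - a| -> g x = 0].
Proof.
move=> oU Ua Cf; have [r r0 Hr] := open_ball_sub oU Ua.
have r4 : 0 < r / 4 by rewrite divr_gt0.
have [b [Cb b1 b0 _]] := bump a r4.
exists (fun x => b x * f x), (r / 4), (2 * (r / 4)); split => //.
- apply: (bump_extend oU _ r4 Cb b0 Cf) => x xa; apply: Hr; lra.
- by move=> x xa; rewrite b1// mul1r.
- by move=> x xa; rewrite b0// mul0r.
Qed.

End CutOff.

Section DeriveRV.
Context (R : realType).

Lemma is_derive_rV n (u : R -> 'rV[R]_n) (t : R) (du : 'rV[R]_n) :
  (forall j, is_derive t 1 (fun s => u s 0 j) (du 0 j)) <-> is_derive t 1 u du.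
Proof.
split=> [H|[d1 d2] j].
  have d : derivable u t 1 by apply/derivable_mxP => i j; rewrite ord1; have [] := H j.
  apply: DeriveDef => //; rewrite derive_mx//; apply/rowP => j; rewrite mxE.
  by have [_ ->] := H j.
apply: DeriveDef; first by move/derivable_mxP: d1 => /(_ 0 j).
by rewrite -d2 derive_mx// mxE.
Qed.

End DeriveRV.

(** * Flows with parameters, joint smoothness, Hadamard's lemma *)

Section ParamFlow.
Context (R : realType) (p n : nat).

(** Parameters are added as coordinates with zero velocity, so that smooth dependence on initial
    values covers them. *)
Lemma param_flow (Z : 'rV[R]_(p + n) -> 'rV[R]_n) : Cinfv setT Z ->
  (forall r, exists K, forall w x, `|w| <= r -> `|Z (row_mx w x)| <= K) ->
  exists F : 'rV[R]_p -> R -> 'rV[R]_n -> 'rV[R]_n,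
  [/\ forall w x, F w 0 x = x,
      forall w (t : R) x, is_derive t 1 (fun s => F w s x) (Z (row_mx w (F w t x))) &
      forall t, Cinfv setT (fun z => F (lsubmx z) t (rsubmx z))].
Proof.
move=> sZ gZ; pose Y (z : 'rV[R]_(p + n)) : 'rV[R]_(p + n) := row_mx 0 (Z z).
have sY : Cinfv setT Y by apply: Cinfv_row_mx => //; [exact: openT|exact/Cinfv_cst/openT].
(* The sign [e] treats the field and its opposite together, as [ode_flow] asks for both. *)
have bY (e : R) : `|e| = 1 -> euler_bounded (fun z => e *: Y z).
  move=> e1 T r T0 r0; have [K HK] := gZ r.
  have K0 : 0 <= K by apply: le_trans (HK 0 0 _); rewrite ?normr0.
  exists (r + (r + T * K)); split; first by rewrite !addr_ge0// mulr_ge0.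
  move=> h j x h0 hT xr.
  suff G i : (i <= j)%N -> lsubmx (iter i (eul (fun z => e *: Y z) h) x) = lsubmx x /\
      `|rsubmx (iter i (eul (fun z => e *: Y z) h) x)| <= r + h * i%:R * K.
    rewrite -[iter _ _ _]hsubmxK; have [-> Hr] := G j (leqnn _).
    apply: le_trans (norm_row_mx _ _) _; apply: lerD; first exact: le_trans (norm_lsub _) xr.
    by apply: le_trans Hr _; rewrite lerD2l ler_wpM2r.
  elim: i => [|i IH] ij.
    by split => //; rewrite mulr0 mul0r addr0 /=; exact: le_trans (norm_rsub _) xr.
  have [IH1 IH2] := IH (ltnW ij); rewrite iterS; set y := iter i _ x in IH1 IH2 *.
  have E : eul (fun z => e *: Y z) h y = row_mx (lsubmx y) (rsubmx y + (h * e) *: Z y).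
    by rewrite /eul /Y -[y in LHS]hsubmxK scalerA scale_row_mx scaler0 add_row_mx addr0 hsubmxK.
  rewrite E row_mxKl row_mxKr; split => //.
  apply: le_trans (ler_normD _ _) _; rewrite -natr1 mulrDr mulr1 mulrDl addrA; apply: lerD => //.
  rewrite normrZ normrM e1 mulr1 ger0_norm// ler_wpM2l//.
  by rewrite -[y]hsubmxK IH1; apply: HK; exact: le_trans (norm_lsub _) xr.
have b1 : euler_bounded Y.
  by have := bY 1 (normr1 _); congr euler_bounded; apply/funext => z; rewrite scale1r.
have bN : euler_bounded (fun z => - Y z).
  by have := bY (-1) (normrN1 _); congr euler_bounded; apply/funext => z; rewrite scaleN1r.
have [G [G0 GD Gs]] := ode_flow sY b1 bN.
have Gcoord z t j : is_derive t (1 : R) (fun s => G s z 0 j) (Y (G t z) 0 j).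
  have [d1 d2] := GD t z; apply: DeriveDef; first by move/derivable_mxP: d1 => /(_ 0 j).
  by rewrite -d2 derive_mx// mxE.
have Gl t z : lsubmx (G t z) = lsubmx z.
  apply/rowP => j; rewrite !mxE.
  have c s : is_derive s (1 : R) (fun s => G s z 0 (lshift n j)) 0.
    by apply: is_derive_eq (Gcoord z s (lshift n j)) _; rewrite /Y row_mxEl mxE.
  by have := @is_derive_0_is_cst R _ t 0 c; rewrite G0.
exists (fun w t x => rsubmx (G t (row_mx w x))); split.
- by move=> w x; rewrite G0 row_mxKr.
- move=> w t x; set z := row_mx w x.
  have -> : Z (row_mx w (rsubmx (G t z))) = rsubmx (Y (G t z)).
    by rewrite /Y row_mxKr -[G t z in RHS]hsubmxK Gl row_mxKl.
  apply/is_derive_rV => j; rewrite [rsubmx (Y _) 0 j]mxE.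
  rewrite (_ : (fun s => _) = (fun s => G s z 0 (rshift p j))); first exact: Gcoord.
  by apply/funext => s; rewrite mxE.
- move=> t j k; apply: (Ck_ext openT (f := fun z => G t z 0 (rshift p j))).
    by move=> z _; rewrite hsubmxK mxE.
  exact: Gs.
Qed.

End ParamFlow.

Section FlowApplications.
Context (R : realType).

Lemma is_derive_mulc (W : normedModType R) (u : R -> W) (c t : R) du :
  is_derive (t * c) 1 u du -> is_derive t 1 (fun s => u (s * c)) (c *: du).
Proof.
move=> [d1 d2]; have df : differentiable u (t * c) by exact/derivable1_diffP.
have dm : is_derive t 1 (fun s : R => s * c) c.
  have := is_deriveZ c (is_derive_id t (1 : R)); rewrite [c *: 1]mulr1.
  by congr is_derive; apply/funext => s; rewrite /GRing.scale /= mulrC.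
have [m1 m2] := dm; have := @derivable_comp R R R W u (fun s => s * c) t 1 m1 df.
rewrite m2; have -> : 'd u (t * c) c = c *: du.
  by rewrite -[X in 'd _ _ X = _]mulr1 linearZ/= -deriveE// d2.
exact.
Qed.

Lemma row_mx10 n (w : 'rV[R]_1) (x : 'rV[R]_n) : row_mx w x 0 0 = w 0 0.
Proof. by rewrite -(row_mxEl w x 0 0); congr (row_mx _ _ _ _); exact/val_inj. Qed.

Lemma row_mx11 (w x : 'rV[R]_1) : row_mx w x 0 1 = x 0 0.
Proof. by rewrite -(row_mxEr w x 0 0); congr (row_mx _ _ _ _); exact/val_inj. Qed.

(** Time becomes a parameter: by uniqueness, the flow of [X] at time [t] is the flow of [t *: X] at
    time 1. *)
Lemma flow_joint n (X : 'rV[R]_n -> 'rV[R]_n) K : Cinfv setT X ->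
  (forall x, `|X x| <= K) -> exists F, flow_of X F /\
  Cinfv setT (fun z : 'rV[R]_(1 + n) => F (z 0 0) (rsubmx z)).
Proof.
move=> sX HK.
have HN x : `|- X x| <= K by rewrite normrN.
have [F HF] := ode_flow sX (bounded_euler_bounded HK) (bounded_euler_bounded HN).
exists F; split => //; have [F0 FD Fs] := HF.
pose Z (z : 'rV[R]_(1 + n)) := z 0 0 *: X (rsubmx z).
have oT := @openT 'rV[R]_(1 + n).
have sZ : Cinfv setT Z.
  apply: (Cinfv_scale oT) => [k|]; first exact: Ck_coord.
  by apply: (Cinfv_comp oT openT sX) => //; exact: Cinfv_rsub.
have [|G [G0 GD Gs]] := param_flow sZ.
  move=> r; exists (r * K) => w x wr; rewrite /Z normrZ row_mxKr ler_pM//.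
  by rewrite row_mx10; exact: le_trans (coord_le_norm _ _) wr.
move=> j k; apply: (Ck_ext oT _ (Gs 1 j k)) => z _; congr (_ _ _ _).
pose t := z 0 0; set w := lsubmx z; set x := rsubmx z.
have tw y : row_mx w y 0 0 = t.
  by rewrite row_mx10 mxE /t; congr (z 0 _); exact/val_inj.
have sY : Cinfv setT (fun x => t *: X x).
  by apply: Cinfv_scale => //; [exact: openT|move=> k'; exact/Ck_cst/openT].
have := @ode_unique R n (fun x => t *: X x) (fun s => G w s x) (fun s => F (s * t) x) (-2) 2 sY.
rewrite oppr_lt0 ltr0n => /(_ isT isT) H.
suff : G w 1 x = F (1 * t) x by rewrite mul1r.
apply: H.
- move=> s _ _; have := GD w s x; rewrite /Z row_mxKr tw; exact.
- by move=> s _ _; apply: is_derive_mulc; exact: FD.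
- by rewrite G0 mul0r F0.
- lra.
- lra.
Qed.

(** The usual [g i x], the integral over [0, 1] of a partial derivative at [t *: x], is obtained as
    the value at time 1 of a differential equation with parameter [x]; its smoothness is then smooth
    dependence on parameters. *)
Lemma hadamard n (f : 'rV[R]_n -> R) (s : R) : Cinfty setT f ->
  (forall x, s <= `|x| -> f x = 0) -> exists g : 'I_n -> 'rV[R]_n -> R,
  (forall i, Cinfty setT (g i)) /\ forall x, f x = f 0 + \sum_i x 0 i * g i x.
Proof.
move=> Cf f0; have oT k := @openT 'rV[R]_k.
have dbound i : exists K, forall x, `|'D_(delta_mx 0 i) f x| <= K.
  have [K [K0 HK]] := ball_bounded (s + 1) (Cinfty_continuous (Cinfty_derive i Cf)).
  exists K => x; have [xs|xs] := leP `|x| (s + 1); first exact: HK.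
  suff -> : 'D_(delta_mx 0 i) f x = 0 by rewrite normr0.
  rewrite -(derive_cst (0 : R) x (delta_mx 0 i)); apply: near_eq_derive.
  have : \forall y \near x, s < `|y|.
    have cn : {for x, continuous (fun y : 'rV[R]_n => `|y|)} by exact: norm_continuous.
    by apply: (cvgr_gt _ cn); rewrite (lt_trans _ xs)// ltrDl.
  by apply: filterS => y ys; rewrite f0// ltW.
have [K HK] := choice dbound.
(* The state consists of the time [t] and the integral so far; their velocities are 1 and the
   partial derivative of [f] at [t *: x]. *)
pose Z i (z : 'rV[R]_(n + (1 + 1))) : 'rV[R]_(1 + 1) :=
  row_mx (const_mx 1) (const_mx ('D_(delta_mx 0 i) f (rsubmx z 0 0 *: lsubmx z))).
have sZ i : Cinfv setT (Z i).
  apply: (Cinfv_row_mx (oT _)); first exact: (Cinfv_cst _ (oT _)).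
  move=> j k; apply: (Ck_ext (oT _) (f := fun z : 'rV[R]_(n + (1 + 1)) =>
      'D_(delta_mx 0 i) f (rsubmx z 0 0 *: lsubmx z))) => [z _|]; first by rewrite [RHS]mxE.
  apply: (Cinfty_compv (oT _) (oT _) (Cinfty_derive i Cf) (g := fun z : 'rV[R]_(n + (1 + 1)) => rsubmx z 0 0 *: lsubmx z)) => // l k'.
  apply: (Cinfv_scale (oT _)); last exact: (Cinfv_lsub (oT _)).
  exact: (Cinfv_rsub (oT _)).
have gZ i r : exists C, forall w x, `|w| <= r -> `|Z i (row_mx w x)| <= C.
  exists (1 + `|K i|) => w x _; apply: le_trans (norm_row_mx _ _) _.
  apply: lerD; apply: norm_le_coord => // j; rewrite mxE ?normr1//.
  exact: le_trans (HK i _) (ler_norm _).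
have [G HG] := choice (fun i => param_flow (sZ i) (gZ i)).
pose g i (x : 'rV[R]_n) := G i x 1 0 0 1.
exists g; split.
  move=> i k; have [_ _ Gs] := HG i.
  apply: (Ck_ext (oT _) _ (Ck_compv (oT _) (oT _) (Gs 1 1 k) (g := fun x => row_mx x 0) _ _)) => //.
    by move=> x _ /=; rewrite row_mxKl row_mxKr.
  by move=> j; apply: (Cinfv_row_mx (oT _)); [exact: (Cinfv_id (oT _))|exact: (Cinfv_cst _ (oT _))].
move=> x.
have Gt i (t : R) : G i x t 0 0 0 = t.
  have [G0 GD _] := HG i.
  have c (r : R) : is_derive r 1 (fun r => G i x r 0 0 0 - r) 0.
    have /is_derive_rV/(_ 0) h := GD x r 0.
    apply: is_derive_eq (is_deriveB h (is_derive_id r (1 : R))) _.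
    by rewrite row_mx10 mxE subrr.
  have := @is_derive_0_is_cst R _ t 0 c; rewrite G0 mxE subrr => /eqP.
  by rewrite subr_eq0 => /eqP.
pose u (t : R) := f (0 + t *: x) - \sum_i x 0 i * G i x t 0 0 1.
have du (t : R) : is_derive t 1 u 0.
  have h1 : is_derive t 1 (fun t : R => f (0 + t *: x)) (\sum_i x 0 i * 'D_(delta_mx 0 i) f (t *: x)).
    apply: line_is_derive; rewrite add0r.
    exact: (@Ck_derive R n setT openT 0%N f (t *: x) x I (Cf 1%N)).
  have h2 i : is_derive t 1 (fun t : R => x 0 i * G i x t 0 0 1) (x 0 i * 'D_(delta_mx 0 i) f (t *: x)).
    have [G0 GD _] := HG i; have /is_derive_rV/(_ 1) h := GD x t 0.
    have := is_deriveZ (x 0 i) h; rewrite /Z.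
    by rewrite row_mx11 mxE row_mxKl row_mxKr Gt.
  have h3 := @is_derive_sum R R R n (fun i t => x 0 i * G i x t 0 0 1) t 1 _ h2.
  have := is_deriveB h1 h3; rewrite subrr.
  congr is_derive; apply/funext => r; rewrite !fctE /u; congr (_ - _).
  by rewrite fct_sumE.
have := @is_derive_0_is_cst R _ 1 0 du; rewrite /u scale1r scale0r !add0r.
have -> : \sum_i x 0 i * G i x 0 0 0 1 = 0.
  by apply: big1 => i _; have [G0 _ _] := HG i; rewrite G0 mxE mulr0.
by rewrite subr0 => /eqP; rewrite subr_eq => /eqP ->.
Qed.

End FlowApplications.

(** * The inverse function theorem *)

Section InverseFunction.
Context (R : realType).

(** Rows index the variables because vectors are rows: the differential is [v |-> v *m jac f x]. *)
Definition jac n m (f : 'rV[R]_n -> 'rV[R]_m) (x : 'rV[R]_n) : 'M[R]_(n, m) :=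
  \matrix_(i, j) 'D_(delta_mx 0 i) (fun y => f y 0 j) x.

Lemma jac_derive n m (U : set 'rV[R]_n) (f : 'rV[R]_n -> 'rV[R]_m) x v : open U -> U x ->
  Cinfv U f -> is_derive x v f (v *m jac f x).
Proof.
move=> oU Ux Cf.
have D j : is_derive x v (fun y => f y 0 j) ((v *m jac f x) 0 j).
  apply: is_derive_eq (@Ck_derive R n U oU 0%N (fun y => f y 0 j) x v Ux (Cf j 1%N)) _.
  by rewrite mxE; apply: eq_bigr => i _; rewrite mxE.
have d : derivable f x v by apply/derivable_mxP => i j; rewrite ord1; have [] := D j.
apply: DeriveDef => //; rewrite derive_mx//; apply/rowP => j; rewrite mxE.
by have [_ ->] := D j.
Qed.

Lemma Cinfv_differentiable n m (U : set 'rV[R]_n) (f : 'rV[R]_n -> 'rV[R]_m) x : open U -> U x ->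
  Cinfv U f -> differentiable f x.
Proof.
move=> oU Ux Cf.
have df j : differentiable (fun y => f y 0 j) x.
  by have [] := @Ck_differentiable R n U oU 0%N (fun y => f y 0 j) x Ux (Cf j 1%N).
have E : f = (fun y => \sum_j (f y 0 j) *: (delta_mx 0 j : 'rV[R]_m)).
  by apply/funext => y; rewrite -row_sum_delta.
rewrite E; have := @differentiable_sum R 'rV[R]_n 'rV[R]_m m (fun j y => f y 0 j *: (delta_mx 0 j : 'rV[R]_m)) x.
rewrite (_ : \sum_(i < m) _ = (fun y => \sum_j (f y 0 j) *: (delta_mx 0 j : 'rV[R]_m))).
  by apply => j; exact: differentiableZl.
by apply/funext => y; rewrite fct_sumE.
Qed.

Lemma curve_derive n m (U : set 'rV[R]_n) (f : 'rV[R]_n -> 'rV[R]_m) (u : R -> 'rV[R]_n) (t : R) du :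
  open U -> U (u t) -> Cinfv U f -> is_derive t 1 u du ->
  is_derive t 1 (fun s => f (u s)) (du *m jac f (u t)).
Proof.
move=> oU Uu Cf [d1 d2].
have df := Cinfv_differentiable oU Uu Cf.
have := @derivable_comp R R 'rV[R]_n 'rV[R]_m f u t 1 d1 df; rewrite d2 -deriveE//.
by have [_ ->] := jac_derive du oU Uu Cf.
Qed.

Lemma curve_bound n (u du : R -> 'rV[R]_n) K : 0 <= K ->
  (forall t : R, is_derive t 1 u (du t)) -> (forall t, `|du t| <= K) ->
  forall t, `|u t - u 0| <= K * `|t|.
Proof.
move=> K0 ud uK t; apply: norm_le_coord => [|j]; first by rewrite mulr_ge0.
have dj (s : R) : is_derive s 1 (fun s => u s 0 j) (du s 0 j) by move/is_derive_rV: (ud s).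
have [s _|c ct] := @mvt_line R _ (fun s => u s 0 j) 0 1 t; first by have [] := dj (0 + s *: 1).
have [_ ->] := dj (0 + c *: 1); rewrite !add0r [t *: 1]mulr1 !mxE => ->.
by rewrite normrM mulrC ler_wpM2r// (le_trans (coord_le_norm _ _)).
Qed.

(** The inverse is found by continuation. With [w = y - h 0], the solution of
    [u' = w *m invmx (J u)] starting at 0 satisfies [h (u t) = h 0 + t *: w], so [u 1] is a preimage
    of [y]; it depends smoothly on the parameter [w]. *)
Lemma right_inverse_id m (h : 'rV[R]_m -> 'rV[R]_m) (U : set 'rV[R]_m) :
  open U -> U 0 -> Cinfv U h -> jac h 0 = 1%:M ->
  exists r (g : 'rV[R]_m -> 'rV[R]_m), [/\ 0 < r, g (h 0) = 0, Cinfv setT g &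
    forall y, `|y - h 0| < r -> U (g y) /\ h (g y) = y].
Proof.
move=> oU U0 Ch J0.
pose J := jac h; pose V := [set x | U x /\ \det (J x) != 0].
have CJ i j : Cinfty U (fun x => J x i j).
  move=> k; apply: (Ck_ext oU _ (Cinfty_derive i (Ch j) k)) => x _; by rewrite /J mxE.
have oV : open V.
  rewrite openE => x [Ux dx]; rewrite /interior.
  have cd : {for x, continuous (fun x => \det (J x))} by exact: (Ck_cont (Cinfty_det oU CJ 0%N) Ux).
  apply: filterI; first exact: open_nbhs_nbhs.
  exact: (cvgr_neq0 _ cd dx).
have V0 : V 0 by split => //; rewrite /J J0 det1 oner_neq0.
have [r r0 Hr] := open_ball_sub oV V0.
have r4 : 0 < r / 4 by rewrite divr_gt0.
have [b [Cb b1 b0 _]] := bump (0 : 'rV[R]_m) r4.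
have VU : V `<=` U by move=> x [].
have CV i j : Cinfty V (fun x => invmx (J x) i j).
  apply: (Cinfty_invmx oV) => [a c k|x [_ dx]]; first exact: Ck_sub (CJ a c k).
  by rewrite unitmxE unitfE.
have CB i j : Cinfty setT (fun x => b x * invmx (J x) i j).
  by apply: (bump_extend oV _ r4 Cb b0 (CV i j)) => x xr; apply: Hr; lra.
have [K [K0 HK]] : exists K, 0 <= K /\ forall x i j, `|b x * invmx (J x) i j| <= K.
  have [|i|K [K0 HK]] := @fin_bound R m (fun i K => forall x j, `|b x * invmx (J x) i j| <= K).
  - by move=> i a c ac H x j; exact: le_trans (H x j) ac.
  - have [|j|K [K0 HK]] := @fin_bound R m (fun j K => forall x, `|b x * invmx (J x) i j| <= K).
    + by move=> j a c ac H x; exact: le_trans (H x) ac.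
    + have [K [K0 HK]] := ball_bounded (2 * (r / 4)) (Cinfty_continuous (CB i j)).
      exists K; split => // x; have [xr|xr] := leP `|x| (2 * (r / 4)); first exact: HK.
      by rewrite b0 ?mul0r ?normr0// subr0 ltW.
    + by exists K; split => // x j; exact: HK.
  - by exists K; split => // x i j; exact: HK.
pose Z (z : 'rV[R]_(m + m)) : 'rV[R]_m := \row_j \sum_i (lsubmx z) 0 i * (b (rsubmx z) * invmx (J (rsubmx z)) i j).
have oT k := @openT 'rV[R]_k.
have sZ : Cinfv setT Z.
  move=> j k; apply: (Ck_ext (oT _) (f := fun z : 'rV[R]_(m + m) => \sum_i (lsubmx z) 0 i * (b (rsubmx z) * invmx (J (rsubmx z)) i j))).
    by move=> z _; rewrite mxE.
  apply: (Ck_sum (oT _)) => i; apply: (Ck_mul (oT _)); first exact: (Cinfv_lsub (oT _)).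
  apply: (Cinfty_compv (oT _) (oT _) (CB i j) (g := fun z : 'rV[R]_(m + m) => rsubmx z)) => //.
  exact: (Cinfv_rsub (oT _)).
have gZ w x : `|Z (row_mx w x)| <= (m%:R * K) * `|w|.
  apply: norm_le_coord => [|j]; first by rewrite !mulr_ge0.
  rewrite mxE row_mxKl row_mxKr; apply: le_trans (ler_norm_sum _ _ _) _.
  apply: (@le_trans _ _ (\sum_(i < m) K * `|w|)); last first.
    by rewrite sumr_const card_ord -mulrA mulr_natl.
  by apply: ler_sum => i _; rewrite normrM mulrC ler_pM//; exact: coord_le_norm.
have [|F [F0 FD Fs]] := param_flow sZ.
  by move=> s; exists (m%:R * K * s) => w x ws; apply: le_trans (gZ w x) _; rewrite ler_wpM2l// mulr_ge0.
pose C := m%:R * K.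
have C0 : 0 <= C by rewrite mulr_ge0.
have C1 : 0 < C + 1 by rewrite ltr_wpDl.
(* The speed is at most [C] times the norm of [w], so this radius keeps [u] up to time 1 in the ball
   of radius [r / 4], where the cut-off [b] is 1. *)
exists (r / 4 / (C + 1)), (fun y => F (y - h 0) 1 0); split.
- by rewrite divr_gt0.
- rewrite subrr; apply/eqP; rewrite -normr_eq0 eq_le normr_ge0 andbT.
  have := @curve_bound m (fun s => F 0 s 0) (fun s => Z (row_mx 0 (F 0 s 0))) 0 (lexx _) (fun t => FD 0 t 0).
  move=> /(_ _ 1); rewrite F0 subr0 mul0r; apply => s.
  by have := gZ 0 (F 0 s 0); rewrite normr0 mulr0.
- move=> j k.
  apply: (Ck_ext (oT _) _ (Ck_compv (oT _) (oT _) (Fs 1 j k) (g := fun y => row_mx (y - h 0) 0) _ _)) => //.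
    by move=> x _ /=; rewrite row_mxKl row_mxKr.
  move=> l; apply: (Cinfv_row_mx (oT _)); last exact: (Cinfv_cst _ (oT _)).
  exact: (Cinfv_add (oT _) (Cinfv_id (oT _)) (Cinfv_cst _ (oT _))).
move=> y yr; set w := y - h 0.
have wr : C * `|w| <= r / 4.
  apply: (@le_trans _ _ ((C + 1) * `|w|)); first by rewrite ler_wpM2r// lerDl.
  by rewrite mulrC -ler_pdivlMr// ltW.
pose u s := F w s 0.
have ub t : `|t| <= 1 -> `|u t| <= r / 4.
  move=> t1; have := @curve_bound m u (fun s => Z (row_mx w (u s))) (C * `|w|) _ (fun t => FD w t 0) (fun s => gZ w _) t.
  rewrite {2}/u F0 subr0 => /(_ (mulr_ge0 C0 (normr_ge0 _))) H; apply: le_trans H _.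
  by apply: le_trans wr; rewrite ler_piMr// mulr_ge0.
have uV t : `|t| <= 1 -> V (u t).
  by move=> /ub h1; apply: Hr; rewrite subr0 (le_lt_trans h1)// ltr_pdivrMr// ltr_pMr// ltr1n.
split; first by have [] := uV 1 (ltac:(by rewrite normr1)).
have Zu t : `|t| <= 1 -> Z (row_mx w (u t)) *m J (u t) = w.
  move=> t1; have [Uu du] := uV t t1.
  have -> : Z (row_mx w (u t)) = w *m invmx (J (u t)).
    apply/rowP => j; rewrite !mxE row_mxKl row_mxKr; apply: eq_bigr => i _.
    by rewrite b1 ?mul1r// subr0; exact: ub.
  by rewrite -mulmxA mulVmx ?mulmx1// unitmxE unitfE.
apply/rowP => j.
pose z (s : R) := h (u s) 0 j - s * w 0 j.
have zd (t : R) : `|t| <= 1 -> is_derive t 1 z 0.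
  move=> t1; have := curve_derive oU (VU _ (uV t t1)) Ch (FD w t 0).
  rewrite -/(J (u t)) Zu// => /is_derive_rV/(_ j) h1.
  have h2 : is_derive t 1 (fun s : R => s * w 0 j) (w 0 j).
    have := is_deriveZ (w 0 j) (is_derive_id t (1 : R)); rewrite [_ *: 1]mulr1.
    by congr is_derive; apply/funext => s; rewrite /GRing.scale /= mulrC.
  by have := is_deriveB h1 h2; rewrite subrr.
have [s s1|c c1] := @mvt_line R _ z 0 1 1.
  by rewrite normr1 in s1; have [] := zd (0 + s *: 1) (ltac:(by rewrite add0r [s *: 1]mulr1)).
rewrite normr1 in c1.
have [_ ->] := zd (0 + c *: 1) (ltac:(by rewrite add0r [c *: 1]mulr1)).
rewrite mulr0 scale1r add0r /z /u F0 mul1r mul0r subr0 => /eqP.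
rewrite subr_eq0 => /eqP; rewrite /w !mxE => E.
by move: E; lra.
Qed.

(** Composing [f] with the affine map [w |-> a + w *m A] gives a map whose Jacobian at 0 is the
    identity. *)
Lemma right_inverse n m (f : 'rV[R]_n -> 'rV[R]_m) (U : set 'rV[R]_n) a (A : 'M[R]_(m, n)) :
  open U -> U a -> Cinfv U f -> A *m jac f a = 1%:M ->
  exists r (g : 'rV[R]_m -> 'rV[R]_n), [/\ 0 < r, g (f a) = a, Cinfv setT g &
    forall y, `|y - f a| < r -> U (g y) /\ f (g y) = y].
Proof.
move=> oU Ua Cf AJ; pose k (w : 'rV[R]_m) := a + w *m A.
have oT j := @openT 'rV[R]_j.
have Ck_ : Cinfv setT k.
  apply: (Cinfv_add (oT _)); first exact: (Cinfv_cst _ (oT _)).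
  move=> j p; apply: (Ck_ext (oT _) (f := fun w : 'rV[R]_m => \sum_i w 0 i * A i j)) => [w _|].
    by rewrite mxE.
  by apply: (Ck_sum (oT _)) => i; apply: (Ck_mul (oT _)); [exact: (Ck_coord (oT _))|exact: (Ck_cst (oT _))].
pose W := k @^-1` U.
have oW : open W by apply: open_comp => // x _; exact: Cinfv_continuous.
have k0 : k 0 = a by rewrite /k mul0mx addr0.
have W0 : W 0 by rewrite /W /= k0.
have Ch : Cinfv W (f \o k) by apply: (Cinfv_comp oW oU Cf) => //; exact: Cinfv_sub Ck_.
have jk : jac (f \o k) 0 = 1%:M.
  apply/row_matrixP => i; rewrite !rowE mulmx1.
  have [_ <-] := jac_derive (delta_mx 0 i) oW W0 Ch.
  have dk := jac_derive (delta_mx 0 i) (oT _) (I : setT 0) Ck_.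
  have Ek : is_derive 0 (delta_mx 0 i) k (delta_mx 0 i *m A).
    apply: (@line_is_derive_inv R).
    rewrite (_ : (fun s => _) = (fun s : R => a + s *: (delta_mx 0 i *m A))); last first.
      by apply/funext => s; rewrite add0r /k -scalemxAl.
    by apply: line_is_derive; exact: is_derive_id.
  have [d1 d2] := Ek.
  have df : differentiable f (k 0) by rewrite k0; exact: (Cinfv_differentiable oU Ua Cf).
  have [_ ->] := @derivable_comp R 'rV[R]_m 'rV[R]_n 'rV[R]_m f k 0 (delta_mx 0 i) d1 df.
  rewrite d2 -deriveE//; have [_] := jac_derive (delta_mx 0 i *m A) oU Ua Cf.
  by rewrite k0 => ->; rewrite -mulmxA AJ mulmx1.
have [r [g [r0 g0 Cg Hg]]] := right_inverse_id oW W0 Ch jk.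
exists r, (k \o g); split => //.
- by rewrite /= -[in X in g X]k0 -[f (k 0)]/((f \o k) 0) g0.
- exact: (Cinfv_comp (oT _) (oT _) Ck_ Cg).
- by move=> y yr; have := Hg y; rewrite /= k0 => /(_ yr).
Qed.

End InverseFunction.

(** * Manifolds *)

Lemma near_open (T : topologicalType) (x : T) (P : T -> Prop) : (\forall y \near x, P y) ->
  exists V, [/\ open V, V x & forall y, V y -> P y].
Proof.
by exists (interior P); split=> //; [exact: open_interior|exact: interior_subset].
Qed.

Section Euclid.
Context (R : realType) (n : nat).

Definition euclid_chart : chart R 'rV[R]_n n := Chart setT id id.

Lemma euclid_is_chart (c : chart R 'rV[R]_n n) : [set euclid_chart] c -> is_chart c.
Proof.
move=> ->; split => //=; [exact: openT|rewrite image_id; exact: openT| |];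
  by move=> x _; exact: cvg_id.
Qed.

Lemma euclid_second_countable : @second_countable 'rV[R]_n.
Proof.
pose B (a : 'rV[rat]_n * nat) : set 'rV[R]_n := @ball R 'rV[R]_n (map_mx (ratr : rat -> R) a.1) (a.2.+1%:R^-1 : R).
exists (range B); first by apply: (card_le_trans (card_image_le _ _)); exact: countableP.
split=> [_ [a _ <-]|x U /nbhs_ballP[e /= e0 He]].
  by apply: ball_open; rewrite invr_gt0.
have [k Hk] : exists k : nat, k.+1%:R^-1 < e / 2.
  have e2 : 0 < (e / 2)^-1 by rewrite invr_gt0 divr_gt0.
  exists (Num.truncn (e / 2)^-1); rewrite invf_plt ?posrE ?divr_gt0//.
  by have /truncn_itv/andP[] := ltW e2.
have k0 : 0 < k.+1%:R^-1 :> R by rewrite invr_gt0.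
have [q Hq] : exists q : 'I_n -> rat, forall i, ratr (q i) \in `]x 0 i - k.+1%:R^-1, x 0 i[.
  have Hi (i : 'I_n) : exists q : rat, ratr q \in `]x 0 i - k.+1%:R^-1, x 0 i[.
    have [|r Hr] := @rat_in_itvoo R (x 0 i - k.+1%:R^-1) (x 0 i); last by exists r.
    by rewrite ltrBlDr ltrDl.
  by have [q Hq] := choice Hi; exists q.
have bd y : ball (map_mx (ratr : rat -> R) (\row_i q i) : 'rV[R]_n) (k.+1%:R^-1) y <-> `|(map_mx (ratr : rat -> R) (\row_i q i) : 'rV[R]_n) - y| < k.+1%:R^-1.
  by rewrite -ball_normE.
have xq : `|(map_mx (ratr : rat -> R) (\row_i q i) : 'rV[R]_n) - x| < k.+1%:R^-1.
  have [n0|[[a i] /= E]] : (map_mx (ratr : rat -> R) (\row_i q i) : 'rV[R]_n) - x = 0 \/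
     exists i, mx_norm ((map_mx (ratr : rat -> R) (\row_i q i) : 'rV[R]_n) - x) = `|((map_mx (ratr : rat -> R) (\row_i q i) : 'rV[R]_n) - x) i.1 i.2|.
    have [->|n0] := eqVneq ((map_mx (ratr : rat -> R) (\row_i q i) : 'rV[R]_n) - x) 0; first by left.
    by right; apply: mx_norm_neq0; rewrite -[mx_norm _]/(`|(map_mx (ratr : rat -> R) (\row_i q i) : 'rV[R]_n) - x|) normr_eq0.
    by rewrite n0 normr0.
  rewrite [ltLHS]/Num.Def.normr/= E ord1 !mxE.
  have := Hq i; rewrite in_itv /= => /andP[q1 q2].
  have Hab (u v w : R) : 0 < w -> v - w < u -> u < v -> `|u - v| < w.
    by move=> w0 h1 h2; rewrite ltr_norml; apply/andP; split; lra.
  exact: Hab.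
exists (B (\row_i q i, k)); first by split; [exists (\row_i q i, k)|exact/bd].
move=> y /bd yq; apply: He; rewrite -ball_normE /ball_/=.
have -> : x - y = (map_mx (ratr : rat -> R) (\row_i q i) - y) - (map_mx (ratr : rat -> R) (\row_i q i) - x) by apply/rowP => j; rewrite !mxE; ring.
apply: le_lt_trans (ler_normB _ _) _; rewrite [e]splitr.
by apply: ltrD; [exact: lt_trans Hk|exact: lt_trans Hk].
Qed.

(** Kept transparent, so that points and dimension of [euclid R n] convert to ['rV[R]_n] and [n]. *)
Definition euclid : manifold R.
Proof.
refine (@Manifold R 'rV[R]_n n [set euclid_chart] _ _ euclid_is_chart _ _).
- exact: norm_hausdorff.
- exact: euclid_second_countable.
- by move=> p; exists euclid_chart.
- move=> c d -> -> i k /=; rewrite setIT image_id; apply: Ck_coord; exact: openT.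
Defined.

Lemma euclid_smooth (f : euclid -> R) : smooth f <-> Cinfty setT f.
Proof.
split=> [/(_ euclid_chart erefl)|Cf c ->]; first by rewrite /= image_id.
by rewrite /= image_id.
Qed.

End Euclid.

Section LocalSmooth.
Context (R : realType) (M : manifold R).

Lemma atlas_at (p : M) : exists2 c, @atlas R M c & cdom c p.
Proof. by case: M p => T n A h s ac cov comp p /=; exact: cov. Qed.

Lemma atlas_compat c d : @atlas R M c -> @atlas R M d -> compatible c d.
Proof. by case: M c d => T n A h s ac cov comp /= c d; exact: comp. Qed.

Lemma manifold_hausdorff : hausdorff_space M.
Proof. by case: M. Qed.

Section Chart.
Variables (c : chart R M (mdim M)) (cA : @atlas R M c).

Lemma chart_open : open (cdom c). Proof. by have [] := atlas_chart cA. Qed.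
Lemma chart_img_open : open (cmap c @` cdom c). Proof. by have [] := atlas_chart cA. Qed.
Lemma chartK x : cdom c x -> cinv c (cmap c x) = x.
Proof. by have [_ _ + _ _] := atlas_chart cA; exact. Qed.
Lemma cmap_cont x : cdom c x -> {for x, continuous (cmap c)}.
Proof. by have [_ _ _ + _] := atlas_chart cA; exact. Qed.
Lemma cinv_cont y : (cmap c @` cdom c) y -> {for y, continuous (cinv c)}.
Proof. by have [_ _ _ _ +] := atlas_chart cA; exact. Qed.
Lemma cinvK y : (cmap c @` cdom c) y -> cmap c (cinv c y) = y.
Proof. by move=> [x dx <-]; rewrite chartK. Qed.
Lemma cinv_dom y : (cmap c @` cdom c) y -> cdom c (cinv c y).
Proof. by move=> [x dx <-]; rewrite chartK. Qed.
End Chart.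

(** One chart around each point suffices, because the coordinate changes to the other charts of the
    atlas are smooth. *)
Lemma chart_smooth (h : M -> R) :
  (forall p : M, exists c, [/\ @atlas R M c, cdom c p &
    exists V, [/\ open V, V (cmap c p) & Cinfty V (h \o cinv c)]]) -> smooth h.
Proof.
move=> H d dA k; apply: Ck_local => _ [q dq <-].
have [c [cA cq [V [oV Vq CV]]]] := H q.
have oI : open (cmap d @` (cdom d `&` cdom c)).
  rewrite openE => _ [r [dr cr] <-]; rewrite /interior.
  have /(cinv_cont dA) cc : (cmap d @` cdom d) (cmap d r) by exists r.
  have n1 : \forall y \near cmap d r, cdom c (cinv d y).
    by apply: cc; rewrite chartK//; apply: open_nbhs_nbhs; split => //; exact: chart_open.
  have n2 : \forall y \near cmap d r, (cmap d @` cdom d) y.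
    by apply: open_nbhs_nbhs; split; [exact: chart_img_open|exists r].
  near=> y; exists (cinv d y).
    split; last by near: y.
    by apply: cinv_dom => //; near: y.
  by apply: cinvK => //; near: y.
pose g y := cmap c (cinv d y).
have Cg : Cinfv (cmap d @` (cdom d `&` cdom c)) g by move=> j k'; exact: atlas_compat.
pose W := (cmap d @` (cdom d `&` cdom c)) `&` g @^-1` V.
have oW : open W.
  rewrite openE => y [Iy Oy]; rewrite /interior; apply: filterI; first exact: open_nbhs_nbhs.
  have cg : {for y, continuous g}.
    by apply: continuous_rV => i; exact: (Ck_cont (Cg i 0%N)).
  by apply: cg; exact: open_nbhs_nbhs.
exists W; first by split; [exists q|rewrite /g /= chartK].
apply: (Ck_ext oW (f := (h \o cinv c) \o g)).
  move=> y [[r [dr cr] <-] _] /=; rewrite /g /= (chartK dA dr).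
  by rewrite (chartK cA).
apply: (Ck_compv oW oV (CV k)) => [j|y []//].
by apply: Ck_sub (Cg j k) => y [].
Unshelve. all: by end_near. Qed.

Lemma smooth_local (h : M -> R) :
  (forall p : M, exists2 g : smoothfun M, True & \forall q \near p, h q = g q) -> smooth h.
Proof.
move=> H; apply: chart_smooth => p; have [c cA cp] := atlas_at p.
have [g _ hg] := H p; exists c; split => //.
have ip : (cmap c @` cdom c) (cmap c p) by exists p.
have : \forall y \near cmap c p, h (cinv c y) = g (cinv c y) /\ (cmap c @` cdom c) y.
  apply: filterI; last by apply: open_nbhs_nbhs; split => //; exact: chart_img_open.
  have n1 : nbhs (cinv c (cmap c p)) [set q | h q = g q] by rewrite chartK.
  exact: (cinv_cont cA ip n1).
move=> /near_open[V [oV Vp HV]]; exists V; split => // k.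
apply: (Ck_ext oV (f := g \o cinv c)) => [y /HV[h1 _]|]; first by rewrite /= h1.
by apply: Ck_sub (sf_smooth g cA k) => y /HV[].
Qed.

Lemma smooth_near (f : M -> R) (p : M) : smooth f -> {for p, continuous f}.
Proof.
move=> sf; have [c cA cp] := atlas_at p.
have ip : (cmap c @` cdom c) (cmap c p) by exists p.
have cf : {for cmap c p, continuous (f \o cinv c)} by exact: (Ck_cont (sf c cA 0%N)).
have E : \forall q \near p, (f \o cinv c) (cmap c q) = f q.
  near=> q; rewrite /= chartK//; near: q.
  by apply: open_nbhs_nbhs; split => //; exact: chart_open.
rewrite /prop_for /continuous_at; have -> : f p = (f \o cinv c) (cmap c p) by rewrite /= chartK.
apply: cvg_trans; first by apply: near_eq_cvg; exact: E.
exact: (@continuous_comp M _ _ (cmap c) (f \o cinv c) p (cmap_cont cA cp) cf).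
Unshelve. all: by end_near. Qed.

(** The preimage [K] of the closed ball of radius [2 * r] is compact, hence closed because manifolds
    are Hausdorff. Around a point outside [K] the extension is therefore identically 0. *)
Lemma chart_extend (c : chart R M (mdim M)) (a : 'rV[R]_(mdim M)) r h : @atlas R M c -> 0 < r ->
  (forall x, `|x - a| < 2 * r + 1 * r -> (cmap c @` cdom c) x) ->
  Cinfty (cmap c @` cdom c) h -> (forall x, 2 * r <= `|x - a| -> h x = 0) ->
  smooth (fun q => if `[< cdom c q >] then h (cmap c q) else 0).
Proof.
move=> cA r0 Hr Ch h0.
pose K := cinv c @` [set x | `|x - a| <= 2 * r].
have cK : compact K.
  apply: continuous_compact.
    apply: continuous_in_subspaceT => x; rewrite inE /= => xa; apply: cinv_cont => //; apply: Hr.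
    by rewrite (le_lt_trans xa)// ltrDl mul1r.
  apply: bounded_closed_compact.
    exists (`|a| + 2 * r); split; first exact: num_real.
    move=> B hB x /= xa; rewrite -[x](subrK a) addrC; apply: le_trans (ler_normD _ _) _.
    by apply: le_trans (ltW hB); rewrite lerD2l.
  have -> : [set x | `|x - a| <= 2 * r] = (fun x : 'rV[R]_(mdim M) => `|x - a|) @^-1` [set s | s <= 2 * r] by [].
  apply: closed_comp => [x _|]; last exact: closed_le.
  apply: (@continuous_comp _ _ _ (fun x : 'rV[R]_(mdim M) => x - a) (fun x : 'rV[R]_(mdim M) => `|x|)); last exact: norm_continuous.
  by apply: continuousB; [exact: cvg_id|exact: cst_continuous].
have clK : closed K := compact_closed manifold_hausdorff cK.
apply: chart_smooth => p; have [Kp|nKp] := pselect (K p).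
  have [x /= xa xp] := Kp.
  have ix : (cmap c @` cdom c) x by apply: Hr; rewrite (le_lt_trans xa)// ltrDl mul1r.
  have dp : cdom c p by rewrite -xp; exact: cinv_dom.
  exists c; split => //; exists (cmap c @` cdom c); split; [exact: chart_img_open|by exists p|].
  move=> k; apply: (Ck_ext (chart_img_open cA) _ (Ch k)) => y iy /=.
  have -> : `[< cdom c (cinv c y) >] by apply/asboolP; exact: cinv_dom.
  by rewrite cinvK.
have [d dA dp] := atlas_at p; exists d; split => //.
have ip : (cmap d @` cdom d) (cmap d p) by exists p.
have : \forall y \near cmap d p, (~` K) (cinv d y).
  apply: (cinv_cont dA ip); rewrite chartK//; apply: open_nbhs_nbhs; split => //.
  by rewrite openC.
move=> /near_open[V [oV Vp HV]]; exists V; split => // k.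
apply: (Ck_ext oV _ (Ck_cst oV k 0)) => y /HV nK /=.
case: asboolP => // dy; rewrite h0//; rewrite leNgt; apply/negP => hlt; apply: nK.
by exists (cmap c (cinv d y)); [exact: ltW|rewrite chartK].
Qed.

End LocalSmooth.

(** * Coordinates and bump functions on a manifold *)

Section Coordinates.
Context (R : realType).

Lemma smooth_to_euclid (M : manifold R) n (y : M -> euclid R n) :
  (forall i, smooth (fun q => (y q : 'rV[R]_n) 0 i)) ->
  forall f : smoothfun (euclid R n), smooth (f \o y).
Proof.
move=> sy f c cA; have oI := chart_img_open cA.
have /euclid_smooth Cf := sf_smooth f.
have := @Cinfty_compv R _ _ _ setT f (y \o cinv c : _ -> 'rV[R]_n) oI openT Cf; apply => //.
by move=> j; exact: (sy j c cA).
Qed.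

Definition to_euclid (M : manifold R) n (y : 'I_n -> smoothfun M) : smap M (euclid R n) :=
  SMap (smooth_to_euclid (y := fun q => \row_i y i q) (fun i k cA =>
    ltac:(rewrite (_ : (fun q => _) = y i) ?(sf_smooth (y i) cA)//;
      [exact: (sf_smooth (y i) cA)|by apply/funext => q; rewrite mxE]))).

Lemma euclid_smap n m (f : 'rV[R]_n -> 'rV[R]_m) : Cinfv setT f ->
  forall g : smoothfun (euclid R m), @smooth R (euclid R n) (g \o f).
Proof.
move=> Cf g; apply: (@smooth_to_euclid (euclid R n) m f) => i; exact/euclid_smooth.
Qed.

Definition emap n m (f : 'rV[R]_n -> 'rV[R]_m) (Cf : Cinfv setT f) : smap (euclid R n) (euclid R m) :=
  SMap (euclid_smap Cf).

Lemma coord_smooth n (i : 'I_n) : @smooth R (euclid R n) (fun x => (x : 'rV[R]_n) 0 i).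
Proof. by apply/euclid_smooth => k; apply: Ck_coord; exact: openT. Qed.

Definition ecoord n (i : 'I_n) : smoothfun (euclid R n) := mk_sf (coord_smooth i).

Lemma smap_euclid_Cinfv n m (f : smap (euclid R n) (euclid R m)) : Cinfv setT (f : 'rV[R]_n -> 'rV[R]_m).
Proof. move=> i; apply/euclid_smooth; exact: (sf_smooth (sf_comp f (ecoord i))). Qed.

Context (M : manifold R).

(** Both maps are global: the chart is multiplied by a bump function and its inverse is precomposed
    with [kap]. As they invert each other near [p], later arguments need no domains of charts. *)
Lemma local_coords (p : M) : exists (y : smap M (euclid R (mdim M))) (gam : smap (euclid R (mdim M)) M),
  [/\ gam (y p) = p, \forall q \near p, gam (y q) = q & \forall x \near (y p : 'rV_(mdim M)), y (gam x) = x].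
Proof.
have [c cA cp] := atlas_at p; set a := cmap c p.
have ia : (cmap c @` cdom c) a by exists p.
have oI := chart_img_open cA.
have [r r0 Hr] := open_ball_sub oI ia.
have s0 : 0 < r / 4 by rewrite divr_gt0.
have [b [Cb b1 b0 b01]] := bump a s0.
have sub3 x : `|x - a| < 2 * (r / 4) + 1 * (r / 4) -> (cmap c @` cdom c) x.
  by move=> xa; apply: Hr; lra.
have sy i : smooth (fun q => if `[< cdom c q >] then b (cmap c q) * (cmap c q) 0 i else 0).
  apply: (chart_extend (a := a) (h := fun x => b x * x 0 i) cA s0 sub3).
    move=> k; apply: (Ck_mul oI); first exact: Ck_sub (Cb k).
    exact: Ck_coord.
  by move=> x xa; rewrite b0 ?mul0r.
pose y := to_euclid (fun i => mk_sf (sy i)).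
(* [kap] sends the whole space into the image of the chart and is the identity near [a]. *)
pose kap (x : 'rV[R]_(mdim M)) := a + b x *: (x - a).
have Ckap : Cinfv setT kap.
  apply: (Cinfv_add openT (Cinfv_cst a openT)); apply: (Cinfv_scale openT Cb).
  exact: (Cinfv_add openT (Cinfv_id openT) (Cinfv_cst _ openT)).
have kapI x : (cmap c @` cdom c) (kap x).
  apply: sub3; rewrite /kap [a + _]addrC addrK normrZ.
  have [xa|xa] := ltP `|x - a| (2 * (r / 4)); last by rewrite b0// normr0 mul0r; lra.
  have /andP[b00 b11] := b01 x; rewrite ger0_norm//.
  by apply: (@le_lt_trans _ _ `|x - a|); [rewrite ler_piMl|lra].
have sg (f : smoothfun M) : @smooth R (euclid R (mdim M)) (f \o (cinv c \o kap)).
  apply/euclid_smooth.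
  exact: (@Cinfty_compv R _ _ setT (cmap c @` cdom c) (f \o cinv c) kap openT oI (sf_smooth f cA) Ckap).
pose gam : smap (euclid R (mdim M)) M := SMap sg.
have yE q : cdom c q -> `|cmap c q - a| <= r / 4 -> y q = cmap c q.
  move=> dq qa; apply/rowP => i; rewrite !mxE /= asboolT// b1// mul1r //.
have gE x : `|x - a| <= r / 4 -> gam x = cinv c x.
  by move=> xa; rewrite /gam /= /kap b1// scale1r subrKC.
have ya : y p = a by rewrite yE// subrr normr0 ltW.
exists y, gam; split.
- by rewrite ya gE ?subrr ?normr0 ?(ltW s0)// /a chartK.
- have n1 : \forall q \near p, cdom c q by apply: open_nbhs_nbhs; split => //; exact: chart_open.
  have n2 : \forall q \near p, `|cmap c q - a| <= r / 4.
    by near=> q; rewrite distrC; near: q; apply: cvgr_dist_le => //; exact: cmap_cont.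
  near=> q; have dq : cdom c q by near: q.
  have qa : `|cmap c q - a| <= r / 4 by near: q.
  by rewrite yE// gE// chartK.
- rewrite ya; have : \forall x \near a, `|a - x| <= r / 4.
    by apply: (@cvgr_dist_le _ _ _ (nbhs a) _ id a) => //; exact: cvg_id.
  apply: filterS => x; rewrite distrC => xa.
  have ix : (cmap c @` cdom c) x by apply: sub3; lra.
  by rewrite gE// yE ?cinvK//; exact: cinv_dom.
Unshelve. all: by end_near. Qed.

Lemma bump_manifold (p : M) (W : set M) : nbhs p W -> exists chi : smoothfun M,
  (\forall q \near p, chi q = 1) /\ forall q, ~ W q -> chi q = 0.
Proof.
move=> nW; have [c cA cp] := atlas_at p; set a := cmap c p.
have ia : (cmap c @` cdom c) a by exists p.
have oI := chart_img_open cA.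
have : \forall x \near a, (cmap c @` cdom c) x /\ W (cinv c x).
  apply: filterI; first exact: open_nbhs_nbhs.
  by apply: (cinv_cont cA ia); rewrite chartK.
move=> /nbhs_ballP[r /= r0 Hr].
have {}Hr x : `|x - a| < r -> (cmap c @` cdom c) x /\ W (cinv c x).
  by move=> xa; apply: Hr; rewrite -ball_normE /ball_/= distrC.
have s0 : 0 < r / 4 by rewrite divr_gt0.
have [b [Cb b1 b0 _]] := bump a s0.
have sub3 x : `|x - a| < 2 * (r / 4) + 1 * (r / 4) -> (cmap c @` cdom c) x.
  by move=> xa; apply: (Hr x _).1; lra.
have sb := chart_extend (a := a) (h := b) cA s0 sub3 (fun k => Ck_sub (subsetT _) (Cb k)) b0.
exists (mk_sf sb); split.
  have n1 : \forall q \near p, cdom c q by apply: open_nbhs_nbhs; split => //; exact: chart_open.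
  have n2 : \forall q \near p, `|cmap c q - a| <= r / 4.
    by near=> q; rewrite distrC; near: q; apply: cvgr_dist_le => //; exact: cmap_cont.
  near=> q; have dq : cdom c q by near: q.
  have qa : `|cmap c q - a| <= r / 4 by near: q.
  by rewrite /= asboolT// b1.
move=> q nWq /=; case: asboolP => // dq; apply: b0; rewrite leNgt; apply/negP => h.
by apply: nWq; have [] := Hr (cmap c q) (ltac:(lra)); rewrite chartK.
Unshelve. all: by end_near. Qed.

End Coordinates.

(** A bump function at [phi p] vanishing outside [V] pulls back to a continuous function, which
    stays positive near [p]. *)
Lemma smap_continuous (R : realType) (M N : manifold R) (phi : smap M N) : continuous phi.
Proof.
move=> p V nV; have [chi [c1 c0]] := bump_manifold nV.
have sc := @smooth_near R M _ p (sf_smooth (sf_comp phi chi)).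
have cp : chi (phi p) = 1 by exact: nbhs_singleton c1.
have : \forall q \near p, 0 < chi (phi q).
  by apply: (cvgr_gt _ sc); rewrite /= cp.
by apply: filterS => q h; apply: contrapT => /c0 E; rewrite E ltxx in h.
Qed.

(** * Tangent vectors as derivations, local frames *)

Section TangentLocal.
Context (R : realType).
Implicit Types M N : manifold R.

Lemma tangent_ext M (p : M) (v w : tangent p) : (forall f, v f = w f) -> v = w.
Proof. by move=> h; apply/val_inj/funext. Qed.

Lemma dual_ext (V : lmodType R) (l m : dual V) : (forall v, l v = m v) -> l = m.
Proof. by move=> h; apply/val_inj/funext. Qed.

Lemma dualP (V : lmodType R) (l : dual V) a u v : l (a *: u + v) = a * l u + l v.
Proof. by have /asboolP := dual_valP l. Qed.

Lemma dual0 (V : lmodType R) (l : dual V) : l 0 = 0.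
Proof. by have := dualP l (-1) 0 0; rewrite scaler0 addr0 mulN1r addNr. Qed.

Lemma dualD (V : lmodType R) (l : dual V) u v : l (u + v) = l u + l v.
Proof. by have := dualP l 1 u v; rewrite scale1r mul1r. Qed.

Lemma dualZ (V : lmodType R) (l : dual V) a u : l (a *: u) = a * l u.
Proof. by have := dualP l a u 0; rewrite dual0 !addr0. Qed.

Lemma dualN (V : lmodType R) (l : dual V) u : l (- u) = - l u.
Proof. by rewrite -scaleN1r dualZ mulN1r. Qed.

Lemma dualB (V : lmodType R) (l : dual V) u v : l (u - v) = l u - l v.
Proof. by rewrite dualD dualN. Qed.

Lemma dual_sum (V : lmodType R) (l : dual V) I (r : seq I) (F : I -> V) :
  l (\sum_(i <- r) F i) = \sum_(i <- r) l (F i).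
Proof. by elim: r => [|i r IH]; rewrite ?big_nil ?dual0// !big_cons dualD IH. Qed.

Lemma dadd (V : lmodType R) (l m : dual V) v : (l + m) v = l v + m v. Proof. by []. Qed.
Lemma dopp (V : lmodType R) (l : dual V) v : (- l) v = - l v. Proof. by []. Qed.
Lemma dzero (V : lmodType R) v : (0 : dual V) v = 0. Proof. by []. Qed.
Lemma dsum (V : lmodType R) I (r : seq I) (F : I -> dual V) v :
  (\sum_(i <- r) F i) v = \sum_(i <- r) F i v.
Proof. by elim: r => [|i r IH]; rewrite ?big_nil// !big_cons dadd IH. Qed.

Lemma tadd M (p : M) (v w : tangent p) f : (v + w) f = v f + w f. Proof. by []. Qed.
Lemma topp M (p : M) (v : tangent p) f : (- v) f = - v f. Proof. by []. Qed.
Lemma tscale M (p : M) a (v : tangent p) f : (a *: v) f = a * v f. Proof. by []. Qed.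
Lemma tzero M (p : M) f : (0 : tangent p) f = 0. Proof. by []. Qed.
Lemma tsum M (p : M) I (r : seq I) (F : I -> tangent p) f :
  (\sum_(i <- r) F i) f = \sum_(i <- r) F i f.
Proof. by elim: r => [|i r IH]; rewrite ?big_nil// !big_cons tadd IH. Qed.

Definition sf_cst M (a : R) : smoothfun M := mk_sf (smooth_cst a).

Section Values.
Context (M : manifold R) (f g : smoothfun M) (q : M).
Lemma sfadd : (f + g) q = f q + g q. Proof. by []. Qed.
Lemma sfopp : (- f) q = - f q. Proof. by []. Qed.
Lemma sfmul : (f * g) q = f q * g q. Proof. by []. Qed.
Lemma sfscale a : (a *: f) q = a * f q. Proof. by []. Qed.
Lemma sf0 : (0 : smoothfun M) q = 0. Proof. by []. Qed.
Lemma sf1 : (1 : smoothfun M) q = 1. Proof. by []. Qed.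
End Values.

Lemma sf_sum M I (l : seq I) (F : I -> smoothfun M) y : (\sum_(i <- l) F i) y = \sum_(i <- l) F i y.
Proof. by elim: l => [|i l IH]; rewrite ?big_nil ?sf0// !big_cons sfadd IH. Qed.

Section AtPoint.
Context (M : manifold R) (p : M).
Implicit Types v : tangent p.

Lemma tgD v f g : v (f + g) = v f + v g.
Proof. by have := tg_lin v 1 f g; rewrite scale1r mul1r. Qed.

Lemma tg0 v : v 0 = 0.
Proof. by have := tg_lin v (-1) 0 0; rewrite scaler0 addr0 mulN1r addNr. Qed.

Lemma tgZ v a f : v (a *: f) = a * v f.
Proof. by have := tg_lin v a f 0; rewrite tg0 !addr0. Qed.

Lemma tgN v f : v (- f) = - v f.
Proof. by rewrite -scaleN1r tgZ mulN1r. Qed.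

Lemma tgB v f g : v (f - g) = v f - v g.
Proof. by rewrite tgD tgN. Qed.

Lemma tg_sum v I (r : seq I) (F : I -> smoothfun M) :
  v (\sum_(i <- r) F i) = \sum_(i <- r) v (F i).
Proof. by elim: r => [|i r IH]; rewrite ?big_nil ?tg0// !big_cons tgD IH. Qed.

Lemma tg1 v : v 1 = 0.
Proof.
have := tg_leibniz v 1 1; rewrite mulr1 [(1 : smoothfun M) p]/(1 : R) !mul1r.
by move=> /eqP; rewrite -subr_eq0 opprD addrA subrr sub0r oppr_eq0 => /eqP.
Qed.

(** A bump function [chi] annihilates [f - g]; apply the Leibniz rule to the product at [p], where
    [chi] is 1 and [f - g] is 0. *)
Lemma tg_near v (f g : smoothfun M) : (\forall q \near p, f q = g q) -> v f = v g.
Proof.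
move=> fg; apply/eqP; rewrite -subr_eq0 -tgB; apply/eqP.
have [chi [c1 c0]] := bump_manifold fg.
have E : chi * (f - g) = 0.
  apply: sf_ext => q; rewrite sfmul sfadd sfopp sf0.
  have [->|ne] := eqVneq (f q) (g q); first by rewrite subrr mulr0.
  by rewrite c0 ?mul0r// => E; rewrite E eqxx in ne.
have := tg_leibniz v chi (f - g); rewrite E tg0.
have -> : (f - g) p = 0 by apply/eqP; rewrite subr_eq0; apply/eqP; exact: nbhs_singleton fg.
by rewrite mul0r addr0 (nbhs_singleton c1) mul1r.
Qed.

Lemma tg_sf_cst v a : v (sf_cst M a) = 0.
Proof.
have -> : sf_cst M a = a *: (1 : smoothfun M) by apply: sf_ext => q; rewrite sfscale sf1 mulr1.
by rewrite tgZ tg1 mulr0.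
Qed.

Lemma tg_cst v (f : smoothfun M) a : (\forall q \near p, f q = a) -> v f = 0.
Proof.
by move=> h; rewrite (@tg_near v f (sf_cst M a)) ?tg_sf_cst.
Qed.

End AtPoint.

Lemma Cinfty_ext n (U : set 'rV[R]_n) f g : open U -> (forall x, U x -> f x = g x) ->
  Cinfty U f -> Cinfty U g.
Proof. by move=> oU fg Cf k; exact: (Ck_ext oU fg). Qed.

(* by Hadamard's lemma *)
Lemma tangent_euclid n (a : euclid R n) (v : tangent a) (f : smoothfun (euclid R n)) :
  v f = \sum_i v (ecoord R i) * 'D_(delta_mx 0 i) (f : 'rV[R]_n -> R) a.
Proof.
have /euclid_smooth Cf := sf_smooth f.
have [g [r [s [r0 Cg gf gs]]]] := local_global (openT : open (setT : set 'rV[R]_n)) (I : setT (a : 'rV[R]_n)) Cf.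
pose h (x : 'rV[R]_n) := g (a + x).
have Csh : Cinfv setT (fun x : 'rV[R]_n => a + x).
  exact: (Cinfv_add openT (Cinfv_cst (a : 'rV[R]_n) openT) (Cinfv_id openT)).
have Ch : Cinfty setT h by exact: (Cinfty_compv openT openT Cg Csh).
have [|G [CG HG]] := @hadamard R n h s Ch.
  by move=> x xs; apply: gs; rewrite addrAC subrr add0r.
have Cbk : Cinfv setT (fun x : 'rV[R]_n => x - a).
  exact: (Cinfv_add openT (Cinfv_id openT) (Cinfv_cst _ openT)).
have sG i : @smooth R (euclid R n) (fun x => G i ((x : 'rV[R]_n) - a)).
  by apply/euclid_smooth; exact: (Cinfty_compv openT openT (CG i) Cbk).
have sg : @smooth R (euclid R n) g by exact/euclid_smooth.
have nfg : \forall x \near (a : 'rV[R]_n), g x = f x.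
  apply/nbhs_ballP; exists r => //= x; rewrite -ball_normE /ball_/= distrC => xa.
  by apply: gf; exact: ltW.
have -> : v f = v (mk_sf sg) by apply: tg_near; apply: filterS nfg => x /= ->.
have gE : mk_sf sg = sf_cst _ (g a) + \sum_i (ecoord R i - sf_cst _ ((a : 'rV[R]_n) 0 i)) * mk_sf (sG i).
  apply: sf_ext => x; rewrite sfadd sf_sum.
  transitivity (h ((x : 'rV[R]_n) - a)); first by rewrite /h subrKC.
  rewrite HG /h addr0; congr (_ + _); apply: eq_bigr => i _.
  by rewrite sfmul sfadd sfopp !mxE.
rewrite gE tgD tg_sf_cst add0r tg_sum; apply: eq_bigr => i _.
rewrite tg_leibniz.
have -> : (ecoord R i - sf_cst _ ((a : 'rV[R]_n) 0 i)) a = 0 by rewrite sfadd sfopp subrr.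
rewrite mul0r add0r tgB tg_sf_cst subr0 mulrC; congr (_ * _).
transitivity (G i ((a : 'rV[R]_n) - a)); first by [].
rewrite subrr.
have -> : 'D_(delta_mx 0 i) (f : 'rV[R]_n -> R) a = 'D_(delta_mx 0 i) g a.
  by apply: near_eq_derive; apply: filterS nfg => x ->.
have -> : g = (fun x : 'rV[R]_n => h (x - a)) by apply/funext => x; rewrite /h subrKC.
have D : is_derive (a : 'rV[R]_n) (delta_mx 0 i : 'rV[R]_n) (fun x : 'rV[R]_n => h (x - a)) (G i 0).
  apply: line_is_derive_inv.
  have cG : {for 0, continuous (fun s : R => G i (s *: delta_mx 0 i))}.
    apply: (@continuous_comp _ _ _ (fun s : R => s *: (delta_mx 0 i : 'rV[R]_n)) (G i)).
      exact: scalel_continuous.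
    exact: (Cinfty_continuous (CG i)).
  have E : (fun s : R => h (a + s *: (delta_mx 0 i : 'rV[R]_n) - a)) =
      (fun s : R => h 0 + s * G i (s *: delta_mx 0 i)).
    apply/funext => u; rewrite addrAC subrr add0r HG; congr (_ + _).
    rewrite (bigD1 i)//= big1 ?addr0; first by rewrite !mxE !eqxx mulr1.
    by move=> j ji; rewrite !mxE (negPf ji) andbF mulr0 mul0r.
  rewrite E; apply: is_derive_eps => e e0.
  have /cvgrPdist_le/(_ e e0)/nbhs_ballP[d /= d0 Hd] := cG.
  exists d => // t td; rewrite add0r.
  have -> : h 0 + t * G i (t *: delta_mx 0 i) - (h 0 + 0 * G i (0 *: delta_mx 0 i)) - t *: G i 0 =
      t * (G i (t *: delta_mx 0 i) - G i 0).
    by rewrite -[t *: G i 0]/(t * G i 0); ring.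
  rewrite normrM mulrC ler_wpM2r// distrC.
  have := Hd t; rewrite -ball_normE /ball_/= sub0r normrN scale0r; exact.
by rewrite (@derive_val _ _ _ _ _ _ _ D).
Qed.

Section EuclidVector.
Context (n : nat) (a : euclid R n) (u : 'rV[R]_n).

Lemma evec_subproof : (fun f : smoothfun (euclid R n) => 'D_u (f : 'rV[R]_n -> R) a) \in derivation_pred a.
Proof.
have D (f : smoothfun (euclid R n)) : derivable (f : 'rV[R]_n -> R) a u.
  have /euclid_smooth Cf := sf_smooth f.
  by have [] := @Ck_derive R n setT openT 0%N f a u I (Cf 1%N).
apply/asboolP; split=> [c f g|f g].
  rewrite -[sf_val (c *: f + g)]/(c \*: (sf_val f) + sf_val g).
  by rewrite deriveD ?deriveZ//; exact: derivableZ.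
by rewrite -[sf_val (f * g)]/(sf_val f * sf_val g) deriveM.
Qed.

Definition evec : tangent a := Tangent evec_subproof.

Lemma evec_coord i : evec (ecoord R i) = u 0 i.
Proof. by have [_ E] := coord_is_derive i (a : 'rV[R]_n) u. Qed.

End EuclidVector.

Lemma evecK n (a : euclid R n) (v : tangent a) : v = evec a (\row_i v (ecoord R i)).
Proof.
apply: tangent_ext => f; rewrite tangent_euclid [in RHS]tangent_euclid.
by apply: eq_bigr => i _; rewrite evec_coord mxE.
Qed.

Lemma dmapE M N (phi : smap M N) p q (e : phi p = q) (v : tangent p) f :
  dmap e v f = v (sf_comp phi f).
Proof. by []. Qed.

Section InCoordinates.
Context (M : manifold R) (p : M) (y : smap M (euclid R (mdim M))) (gam : smap (euclid R (mdim M)) M).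
Hypothesis gy : \forall q \near p, gam (y q) = q.

Definition ycoord (i : 'I_(mdim M)) : smoothfun M := sf_comp y (ecoord R i).

Lemma tangent_coord (v : tangent p) (f : smoothfun M) :
  v f = \sum_i v (ycoord i) * 'D_(delta_mx 0 i) (fun x : 'rV[R]_(mdim M) => f (gam x)) (y p).
Proof.
have -> : v f = v (sf_comp y (sf_comp gam f)).
  by apply: tg_near; apply: filterS gy => q /= ->.
rewrite -(dmapE (erefl (y p)) v (sf_comp gam f)) tangent_euclid.
by apply: eq_bigr => i _.
Qed.

Lemma tangent_coord_ext (v w : tangent p) : (forall i, v (ycoord i) = w (ycoord i)) -> v = w.
Proof.
move=> h; apply: tangent_ext => f; rewrite tangent_coord [RHS]tangent_coord.
by apply: eq_bigr => i _; rewrite h.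
Qed.

End InCoordinates.

Section Frames.
Context (M : manifold R) (p : M).

(** The coordinate fields of [gam], multiplied by a bump function; near [p] they are dual to the
    differentials of the coordinates. *)
Lemma local_frame : exists (y : smap M (euclid R (mdim M))) (gam : smap (euclid R (mdim M)) M)
    (V : 'I_(mdim M) -> vfield M),
  [/\ gam (y p) = p, \forall q \near p, gam (y q) = q,
      \forall x \near (y p : 'rV_(mdim M)), y (gam x) = x,
      \forall q \near p, forall i j, V i q (ycoord y j) = (i == j)%:R &
      \forall q \near p, forall v : tangent q, v = \sum_i v (ycoord y i) *: V i q].
Proof.
have [y [gam [gyp gy yg]]] := local_coords p.
have ygy : \forall q \near p, y (gam (y q)) = y q by apply: filterS gy => q ->.
have [W [oW Wp HW]] : exists W, [/\ open W, W p & forall q, W q -> gam (y q) = q /\ \forall x \near (y q : 'rV_(mdim M)), y (gam x) = x].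
  have [W1 [oW1 W1p HW1]] := near_open gy; have [W2 [oW2 W2p HW2]] := near_open yg.
  exists (W1 `&` y @^-1` W2); split.
  - apply: openI => //; apply: open_comp => // x _; exact: smap_continuous.
  - by split.
  - move=> q [W1q W2q]; split; first exact: HW1.
    by apply: filterS HW2 _; apply: open_nbhs_nbhs.
have [chi [c1 c0]] : exists chi : smoothfun M, (\forall q \near p, chi q = 1) /\ forall q, ~ W q -> chi q = 0.
  by apply: bump_manifold; apply: open_nbhs_nbhs.
(* A vector at [y q] is pushed to [gam (y q)], which is [q] only on [W]; elsewhere the bump function
   is 0, so the default 0 agrees with the formula [VvE]. *)
pose Vv i q : tangent q := match pselect (gam (y q) = q) with
  | left e => chi q *: dmap e (evec (y q) (delta_mx 0 i)) | right _ => 0 end.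
have VvE i q f : Vv i q f = chi q * 'D_(delta_mx 0 i) (fun x : 'rV[R]_(mdim M) => f (gam x)) (y q).
  rewrite /Vv; case: pselect => [e|ne]; first by [].
  by rewrite c0 ?mul0r// => /HW[].
have sV i : smooth_vf (Vv i).
  move=> f; have sD : @smooth R (euclid R (mdim M)) ('D_(delta_mx 0 i) (fun x : 'rV[R]_(mdim M) => f (gam x))).
    by apply/euclid_smooth/Cinfty_derive/euclid_smooth; exact: (sf_smooth (sf_comp gam f)).
  have := sf_smooth (chi * sf_comp y (mk_sf sD)).
  by congr smooth; apply/funext => q; rewrite VvE.
have nV : \forall q \near p, forall i j, Vv i q (ycoord y j) = (i == j)%:R.
  have nW : \forall q \near p, W q by exact: open_nbhs_nbhs.
  near=> q => i j.
  have c1q : chi q = 1 by near: q.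
  have Wq : W q by near: q.
  rewrite VvE c1q mul1r; have [_ yq] := HW q Wq.
  have -> : 'D_(delta_mx 0 i) (fun x : 'rV[R]_(mdim M) => ycoord y j (gam x)) (y q) =
            'D_(delta_mx 0 i) (fun x : 'rV[R]_(mdim M) => x 0 j) (y q).
    by apply: near_eq_derive; apply: filterS yq => x /= ->.
  have [_ ->] := coord_is_derive j (y q : 'rV[R]_(mdim M)) (delta_mx 0 i).
  by rewrite mxE eqxx /= eq_sym.
exists y, gam, (fun i => VField (sV i)); split => //.
have nW : \forall q \near p, W q by exact: open_nbhs_nbhs.
near=> q => v.
have Wq : W q by near: q.
have nVq : forall i j, Vv i q (ycoord y j) = (i == j)%:R by near: q.
have gq : \forall r \near q, gam (y r) = r.
  have : \forall r \near q, W r by apply: open_nbhs_nbhs.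
  by apply: filterS => r /HW[].
apply: (tangent_coord_ext gq) => j; rewrite tsum (bigD1 j)//= big1 ?addr0.
  by transitivity (v (ycoord y j) * Vv j q (ycoord y j)); [rewrite nVq eqxx mulr1|].
by move=> i ij; transitivity (v (ycoord y i) * Vv i q (ycoord y j)); [|rewrite nVq (negPf ij) mulr0].
Unshelve. all: by end_near. Qed.

End Frames.

Section VfieldOps.
Context (M : manifold R).

Lemma vf_comb_smooth n (c : 'I_n -> smoothfun M) (V : 'I_n -> vfield M) :
  smooth_vf (fun q => \sum_i c i q *: V i q).
Proof.
move=> f; have := sf_smooth (\sum_i c i * lie (V i) f); congr smooth; apply/funext => q.
by rewrite tsum sf_sum.
Qed.

Definition vf_comb n (c : 'I_n -> smoothfun M) (V : 'I_n -> vfield M) : vfield M :=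
  VField (vf_comb_smooth c V).

Lemma vf_extend (p : M) (v : tangent p) : exists X : vfield M, X p = v.
Proof.
have [y [gam [V [_ _ _ _ Hv]]]] := local_frame p.
exists (vf_comb (fun i => sf_cst M (v (ycoord y i))) V).
by rewrite [RHS](nbhs_singleton Hv v).
Qed.

Lemma covector_differential (p : M) (xi : cotangent p) : exists f : smoothfun M, xi = differential p f.
Proof.
have [y [gam [V [_ _ _ _ Hv]]]] := local_frame p.
exists (\sum_i xi (V i p) *: ycoord y i); apply: dual_ext => v.
rewrite [in LHS](nbhs_singleton Hv v) dual_sum.
transitivity (\sum_i v (xi (V i p) *: ycoord y i)); last by rewrite -tg_sum.
by apply: eq_bigr => i _; rewrite dualZ tgZ mulrC.
Qed.

End VfieldOps.
End TangentLocal.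

(** * Differential forms *)

Section Forms.
Context (R : realType).
Implicit Types M N : manifold R.

Lemma to_sfE M (f : M -> R) q : smooth f -> to_sf f q = f q.
Proof.
move=> /smooth_predE sf; rewrite /to_sf.
by have -> : sf_val (insubd (0 : smoothfun M) f) = f by exact: (insubdK (0 : smoothfun M) sf).
Qed.

Section Algebra.
Context (M : manifold R) (F : form2 M) (p : M).
Implicit Types u v w : tangent p.

Lemma f2DL u v w : F p (u + v) w = F p u w + F p v w.
Proof. by rewrite linearD. Qed.
Lemma f2ZL a u w : F p (a *: u) w = a * F p u w.
Proof. by rewrite linearZ. Qed.
Lemma f2NL u w : F p (- u) w = - F p u w.
Proof. by rewrite linearN. Qed.
Lemma f2_0L w : F p 0 w = 0.
Proof. by rewrite linear0. Qed.
Lemma f2_sumL I (r : seq I) (G : I -> tangent p) w : F p (\sum_(i <- r) G i) w = \sum_(i <- r) F p (G i) w.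
Proof. by rewrite linear_sum dsum. Qed.

Lemma f2_alt u v : real_2form F -> F p u v = - F p v u.
Proof.
move=> [_ a]; have := a p (u + v); rewrite f2DL !dualD !a add0r addr0 => /eqP.
by rewrite addr_eq0 => /eqP.
Qed.
End Algebra.

Lemma eval2E M (F : form2 M) (X Y : vfield M) q : real_2form F -> eval2 F X Y q = F q (X q) (Y q).
Proof. by move=> [s _]; exact: to_sfE. Qed.

Lemma smap_near M N (phi : smap M N) (p : M) (P : N -> Prop) :
  (\forall q \near phi p, P q) -> \forall q \near p, P (phi q).
Proof. exact: smap_continuous. Qed.

Lemma lieE M (X : vfield M) f q : lie X f q = X q f. Proof. by []. Qed.

Definition ext_d M (F : form2 M) (X Y Z : vfield M) : smoothfun M :=
  lie X (eval2 F Y Z) - lie Y (eval2 F X Z) + lie Z (eval2 F X Y)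
    - eval2 F (bracket X Y) Z + eval2 F (bracket X Z) Y - eval2 F (bracket Y Z) X.

(** The form is written with functions [h] and antisymmetric coefficients [c] rather than with a
    frame, because functions pull back along every map and vector fields do not. *)
Definition local_form M (F : form2 M) (p : M) n (h : 'I_n -> smoothfun M)
    (c : 'I_n * 'I_n -> smoothfun M) : Prop :=
  (forall k, c k = - c (k.2, k.1)) /\
  \forall q \near p, forall u v : tangent q, F q u v = \sum_k c k q * (u (h k.1) * v (h k.2)).

Lemma local_formP M (F : form2 M) (p : M) : real_2form F ->
  exists h c, @local_form M F p (mdim M) h c.
Proof.
move=> rF; have [y [gam [V [_ _ _ _ Hv]]]] := local_frame p.
exists (ycoord y), (fun k => eval2 F (V k.1) (V k.2)); split.
  by move=> [i j]; apply: sf_ext => q; rewrite sfopp !eval2E// f2_alt.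
apply: filterS Hv => q Hq u v; rewrite {1}(Hq u) {1}(Hq v) f2_sumL.
rewrite (eq_bigr (fun i => \sum_j eval2 F (V i) (V j) q * (u (ycoord y i) * v (ycoord y j)))).
  by rewrite pair_bigA.
move=> i _; rewrite dual_sum; apply: eq_bigr => j _.
by rewrite f2ZL dualZ eval2E//; ring.
Qed.

Lemma local_form_pull M N (phi : smap M N) (F : form2 N) (p : M) n h c :
  @local_form N F (phi p) n h c ->
  local_form (pull2 phi F) p (fun i => sf_comp phi (h i)) (fun k => sf_comp phi (c k)).
Proof.
move=> [ca HF]; split=> [k|]; first by apply: sf_ext => q; rewrite [LHS]/(c k (phi q)) ca.
apply: (filterS _ (smap_near HF)) => q Hq u v.
by transitivity (F (phi q) (tmap phi q u) (tmap phi q v)); [|rewrite Hq].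
Qed.

Lemma local_form_smooth M (F : form2 M) (X Y : vfield M) :
  (forall p, exists n h c, @local_form M F p n h c) -> smooth (fun p => F p (X p) (Y p)).
Proof.
move=> H; apply: smooth_local => p; have [n [h [c [_ HF]]]] := H p.
exists (\sum_k c k * (lie X (h k.1) * lie Y (h k.2))) => //.
by apply: filterS HF => q ->; rewrite sf_sum; apply: eq_bigr.
Qed.

Lemma antisym_sum n (c S : 'I_n * 'I_n -> R) : (forall k, c k = - c (k.2, k.1)) ->
  (forall k, S k = S (k.2, k.1)) -> \sum_k c k * S k = 0.
Proof.
move=> ca sS; have : \sum_k c k * S k = - \sum_k c k * S k; last by lra.
rewrite [LHS](reindex_inj (h := fun k => (k.2, k.1))); last by move=> [a b] [c' d] [-> ->].
by rewrite -sumrN; apply: eq_bigr => k _; rewrite -sS (ca (k.2, k.1)) /= mulNr; case: k.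
Qed.

Section LocalExt.
Context (M : manifold R) (F : form2 M) (p : M) (n : nat) (h : 'I_n -> smoothfun M) (c : 'I_n * 'I_n -> smoothfun M).
Hypotheses (rF : real_2form F) (lF : local_form F p h c).

Lemma lie_eval2 (u : tangent p) (Y Z : vfield M) : u (eval2 F Y Z) =
  \sum_k (u (c k) * (Y p (h k.1) * Z p (h k.2)) +
    c k p * (Y p (h k.1) * u (lie Z (h k.2)) + Z p (h k.2) * u (lie Y (h k.1)))).
Proof.
have -> : u (eval2 F Y Z) = u (\sum_k c k * (lie Y (h k.1) * lie Z (h k.2))).
  apply: tg_near; have [_ HF] := lF; apply: filterS HF => q Hq.
  by rewrite eval2E// Hq sf_sum; apply: eq_bigr.
rewrite tg_sum; apply: eq_bigr => k _; rewrite tg_leibniz tg_leibniz.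
by rewrite sfmul /=; ring.
Qed.

Lemma eval2_local (Y Z : vfield M) : eval2 F Y Z p = \sum_k c k p * (Y p (h k.1) * Z p (h k.2)).
Proof. by rewrite eval2E//; have [_ /nbhs_singleton ->] := lF. Qed.

Lemma bracketE (X Y : vfield M) (q : M) (f : smoothfun M) : bracket X Y q f = X q (lie Y f) - Y q (lie X f).
Proof. by []. Qed.

(** The terms with second derivatives and brackets form the symmetric expression [S], which the
    antisymmetric coefficients kill. What remains depends only on the values of the fields at
    [p]. *)
Lemma ext_d_local (X Y Z : vfield M) : ext_d F X Y Z p =
  \sum_k (X p (c k) * (Y p (h k.1) * Z p (h k.2)) - Y p (c k) * (X p (h k.1) * Z p (h k.2))
    + Z p (c k) * (X p (h k.1) * Y p (h k.2))).
Proof.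
rewrite /ext_d !sfadd !sfopp !lieE !lie_eval2 !eval2_local.
pose S (k : 'I_n * 'I_n) := Y p (h k.1) * X p (lie Z (h k.2)) + X p (lie Z (h k.1)) * Y p (h k.2)
  - X p (h k.1) * bracket Y Z p (h k.2) - bracket Y Z p (h k.1) * X p (h k.2).
have S0 : \sum_k c k p * S k = 0.
  apply: (@antisym_sum n (fun k => c k p)) => [k|[i j]]; last by rewrite /S /=; ring.
  by rewrite {1}(proj1 lF k) sfopp.
rewrite -[RHS]addr0 -[X in _ = _ + X]S0.
rewrite -!sumrN -!big_split /=; apply: eq_bigr => k _; rewrite /S !bracketE; ring.
Qed.

End LocalExt.

(** Fields on [M] have no push-forward, but the local expression only sees their values at [p];
    these are pushed to [phi p] and extended there to fields on [N]. *)
Lemma closed_pull2 M N (phi : smap M N) (F : form2 N) : closed_2form F -> closed_2form (pull2 phi F).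
Proof.
move=> [rF cF]; have lF p := local_formP (phi p) rF.
have rP : real_2form (pull2 phi F).
  split=> [X Y|p v]; last by have [_ a] := rF; exact: a.
  apply: local_form_smooth => p; have [h [c lh]] := lF p.
  by do 3 eexists; exact: local_form_pull lh.
split=> // X Y Z; apply: sf_ext => p; rewrite [RHS]sf0.
have [h [c lh]] := lF p.
rewrite -/(ext_d (pull2 phi F) X Y Z) (ext_d_local rP (local_form_pull lh)).
have [X' X'E] := vf_extend (tmap phi p (X p)).
have [Y' Y'E] := vf_extend (tmap phi p (Y p)).
have [Z' Z'E] := vf_extend (tmap phi p (Z p)).
have := congr1 (fun f : smoothfun N => f (phi p)) (cF X' Y' Z').
rewrite -/(ext_d F X' Y' Z') (ext_d_local rF lh) sf0 => E0; rewrite -[RHS]E0.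
by apply: eq_bigr => k _; rewrite X'E Y'E Z'E.
Qed.

Lemma real_add2 M (F G : form2 M) : real_2form F -> real_2form G -> real_2form (add2 F G).
Proof.
move=> rF rG; split=> [X Y|p v]; last first.
  by transitivity (F p v v + G p v v); [|rewrite rF.2 rG.2 addr0].
by have := sf_smooth (eval2 F X Y + eval2 G X Y); congr smooth; apply/funext => p;
  rewrite sfadd !eval2E.
Qed.

Lemma closed_add2 M (F G : form2 M) : closed_2form F -> closed_2form G -> closed_2form (add2 F G).
Proof.
move=> [rF cF] [rG cG]; have rS := real_add2 rF rG; split=> // X Y Z.
have E A B : eval2 (add2 F G) A B = eval2 F A B + eval2 G A B.
  by apply: sf_ext => p; rewrite sfadd !eval2E.
have L A f g : lie A (f + g) = lie A f + lie A g by apply: sf_ext => p; exact: tgD.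
rewrite !E !L; have := congr2 (fun f g : smoothfun M => f + g) (cF X Y Z) (cG X Y Z).
by rewrite addr0 => <-; ring.
Qed.

Lemma inj_unitmx n (C : 'M[R]_n) : (forall r : 'rV_n, r *m C = 0 -> r = 0) -> C \in unitmx.
Proof. by move=> H; rewrite -row_free_unit; apply: inj_row_free. Qed.

Lemma euclid_near_extend n (U : set 'rV[R]_n) f (a : 'rV[R]_n) : open U -> U a -> Cinfty U f ->
  exists g : smoothfun (euclid R n), \forall x \near a, g x = f x.
Proof.
move=> oU Ua Cf; have [g [r [s [r0 Cg gf _]]]] := local_global oU Ua Cf.
have sg : @smooth R (euclid R n) g by exact/euclid_smooth.
exists (mk_sf sg); apply/nbhs_ballP; exists r => //= x; rewrite -ball_normE /ball_/= distrC => xa.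
by apply: gf; exact: ltW.
Qed.

(** In a local frame the matrix [C] of [om] is smooth and invertible near [p], so the components of
    [Q p (xi p)] are given by its inverse. The entries of the inverse, smooth near [y p], are
    extended to global functions [K]. *)
Lemma inverse_smooth M (om : form2 M) (Q : bivector M) (xi : forall p : M, cotangent p) :
  real_2form om -> inverse_bivector Q om ->
  (forall X : vfield M, smooth (fun p => xi p (X p))) -> smooth_vf (fun p => Q p (xi p)).
Proof.
move=> rom HQ sxi f; apply: smooth_local => p.
have [y [gam [V [gyp gy yg HV Hv]]]] := local_frame p; set n := mdim M in y gam V yg gyp gy HV Hv *.
pose C q : 'M[R]_n := \matrix_(i, j) eval2 om (V i) (V j) q.
have CE q i j : C q i j = om q (V i q) (V j q) by rewrite mxE eval2E.
have Cu : \forall q \near p, C q \in unitmx.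
  near=> q; apply: inj_unitmx => r rC.
  have Hq : forall v : tangent q, v = \sum_i v (ycoord y i) *: V i q by near: q.
  have Vq : forall i j, V i q (ycoord y j) = (i == j)%:R by near: q.
  have w0 : \sum_i r 0 i *: V i q = 0.
    rewrite -[LHS](proj1 (HQ q)) -[RHS](linear0 (Q q)); congr (Q q _).
    apply: dual_ext => v; rewrite (Hq v) dual_sum dzero big1// => j _; rewrite dualZ f2_sumL.
    have := congr1 (fun A : 'rV[R]_n => A 0 j) rC; rewrite mxE [RHS]mxE => E.
    by rewrite (_ : \sum_i _ = 0) ?mulr0// -[RHS]E; apply: eq_bigr => i _; rewrite f2ZL CE.
  apply/rowP => j; rewrite mxE -[RHS](tzero q (ycoord y j)) -w0 tsum (bigD1 j)//= big1 ?addr0.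
    by transitivity (r 0 j * V j q (ycoord y j)); [rewrite Vq eqxx mulr1|].
  by move=> i ij; transitivity (r 0 i * V i q (ycoord y j)); [|rewrite Vq (negPf ij) mulr0].
pose A (x : 'rV[R]_n) := C (gam x).
have CA i j : Cinfty setT (fun x => A x i j).
  have := sf_smooth (sf_comp gam (eval2 om (V i) (V j))) => /euclid_smooth.
  by apply: Cinfty_ext => [|x _]; [exact: openT|rewrite /A mxE].
pose U := [set x | \det (A x) != 0].
have oU : open U.
  have -> : U = (fun x => \det (A x)) @^-1` [set s | s != 0] by [].
  apply: open_comp => [x _|]; last exact: open_neq.
  exact: (Ck_cont (Cinfty_det openT CA 0%N)).
have Ua : U (y p).
  by rewrite /U /= /A gyp -unitfE -unitmxE; exact: nbhs_singleton Cu.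
have [K HK] : exists K : 'I_n -> 'I_n -> smoothfun (euclid R n), forall i j,
    \forall x \near (y p : 'rV[R]_n), K i j x = invmx (A x) i j.
  have Hij (k : 'I_n * 'I_n) : exists g : smoothfun (euclid R n), \forall x \near (y p : 'rV[R]_n), g x = invmx (A x) k.1 k.2.
    apply: (euclid_near_extend oU Ua); apply: Cinfty_invmx => //.
      by move=> i j k'; apply: Ck_sub (CA i j k').
    by move=> x; rewrite /U /= unitmxE unitfE.
  by have [K HK] := choice Hij; exists (fun i j => K (i, j)) => i j; exact: (HK (i, j)).
exists (\sum_i (\sum_j mk_sf (sxi (V j)) * sf_comp y (K j i)) * lie (V i) f) => //.
have HK' : \forall q \near p, forall i j, K i j (y q) = invmx (A (y q)) i j.
  apply: (@smap_near _ _ y p (fun z => forall i j, K i j z = invmx (A z) i j)).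
  by apply: near_forall => i; apply: near_forall => j; exact: HK.
near=> q.
have Hq : forall v : tangent q, v = \sum_i v (ycoord y i) *: V i q by near: q.
have Kq : forall i j, K i j (y q) = invmx (A (y q)) i j by near: q.
have gq : gam (y q) = q by near: q.
have Cq : C q \in unitmx by near: q.
set w := Q q (xi q).
have wE : \row_i w (ycoord y i) = (\row_j xi q (V j q)) *m invmx (C q).
  rewrite -[LHS](mulmxK Cq); congr (_ *m _); apply/rowP => j; rewrite !mxE.
  rewrite -[xi q](proj2 (HQ q)) -/w [in RHS](Hq w) f2_sumL; apply: eq_bigr => i _.
  by rewrite f2ZL CE mxE.
rewrite [in LHS](Hq w) tsum sf_sum; apply: eq_bigr => i _.
transitivity (w (ycoord y i) * V i q f) => //; rewrite sfmul; congr (_ * _).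
have := congr1 (fun B : 'rV[R]_n => B 0 i) wE; rewrite mxE => ->; rewrite mxE sf_sum.
by apply: eq_bigr => j _; transitivity (xi q (V j q) * K j i (y q)); [rewrite mxE Kq /A gq|].
Unshelve. all: by end_near. Qed.

Lemma ham_smooth M (om : form2 M) (Q : bivector M) f : real_2form om -> inverse_bivector Q om ->
  smooth_vf (ham Q f).
Proof. by move=> rom HQ; apply: inverse_smooth rom HQ _ => X; exact: vf_smooth. Qed.

End Forms.

(** * Curves and flows *)

Section RealInduction.
Context (R : realType).

(** A locally constant predicate on the connected line. This is the induction principle of all
    continuation arguments in time. *)
Lemma real_ind (P : R -> Prop) : P 0 ->
  (forall t, exists2 e, 0 < e & forall s s', `|s - t| < e -> `|s' - t| < e -> P s -> P s') ->
  forall t, P t.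
Proof.
move=> P0 H.
have oc (b : bool) : open [set t | if b then P t else ~ P t].
  rewrite openE => t /= Pt; rewrite /interior; have [e e0 He] := H t.
  apply/nbhs_ballP; exists e => //= s; rewrite -ball_normE /ball_/= distrC => ste.
  have tt : `|t - t| < e by rewrite subrr normr0.
  by case: b Pt => /= Pt; [exact: He Pt|move=> Ps; apply: Pt; exact: He Ps].
have E : [set t | P t] = setT.
  apply: (proj2 (connected_intervalP (setT : set R))) => //.
  - by exists 0.
  - by exists [set t | P t]; [exact: (oc true)|rewrite setTI].
  - exists [set t | P t]; last by rewrite setTI.
    have -> : [set t | P t] = ~` [set t | ~ P t] by apply/seteqP; split=> t /= Pt; [|exact: contrapT].
    by rewrite closedC; exact: (oc false).
by move=> t; have : [set: R] t by []; rewrite -E.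
Qed.

Lemma near_interval (P : R -> Prop) t : (\forall s \near t, P s) -> exists2 e, 0 < e & forall s, `|s - t| < e -> P s.
Proof.
by move=> /nbhs_ballP[e /= e0 H]; exists e => // s ste; apply: H; rewrite -ball_normE /ball_/= distrC.
Qed.

Lemma interval_near (P : R -> Prop) t e : 0 < e -> (forall s, `|s - t| < e -> P s) -> \forall s \near t, P s.
Proof.
by move=> e0 H; apply/nbhs_ballP; exists e => //= s; rewrite -ball_normE /ball_/= distrC; exact: H.
Qed.

Lemma near_is_derive (f g : R -> R) (t d : R) : (\forall s \near t, f s = g s) -> is_derive t 1 f d -> is_derive t 1 g d.
Proof.
move=> fg [df vf]; split; first exact: near_eq_derivable df.
by rewrite -vf; apply: near_eq_derive; apply: filterS fg.
Qed.

End RealInduction.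

Section Curves.
Context (R : realType).
Implicit Types M N : manifold R.

(** The base point [q] is an argument, tied to the curve by an equation, so that velocities at
    provably equal points need no transport. *)
Definition has_vel M (gam : R -> M) (t : R) (q : M) (u : tangent q) : Prop :=
  gam t = q /\ forall f : smoothfun M, is_derive t 1 (fun s => f (gam s)) (u f).

Lemma has_vel_uniq M (gam : R -> M) t q (u v : tangent q) : has_vel gam t u -> has_vel gam t v -> u = v.
Proof.
by move=> [_ hu] [_ hv]; apply: tangent_ext => f; have [_ <-] := hu f; have [_ <-] := hv f.
Qed.

Lemma has_vel_map M N (phi : smap M N) (gam : R -> M) t q (u : tangent q) :
  has_vel gam t u -> has_vel (phi \o gam) t (tmap phi q u).
Proof. by move=> [gq hu]; split=> [|f]; [rewrite /= gq|exact: (hu (sf_comp phi f))]. Qed.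

Lemma has_vel_near M (gam gam' : R -> M) t q (u : tangent q) : (\forall s \near t, gam s = gam' s) ->
  has_vel gam t u -> has_vel gam' t u.
Proof.
move=> h [gq hu]; split; first by rewrite -(nbhs_singleton h).
by move=> f; apply: near_is_derive (hu f); apply: filterS h => s ->.
Qed.

Lemma has_vel_cst M (q : M) t : has_vel (fun=> q) t (0 : tangent q).
Proof. by split=> // f; exact: is_derive_cst. Qed.

Lemma has_vel_cont M (gam : R -> M) t q (u : tangent q) : has_vel gam t u -> {for t, continuous gam}.
Proof.
move=> [gq hu] V nV; rewrite gq in nV; have [chi [c1 c0]] := bump_manifold nV.
have cp : chi (gam t) = 1 by rewrite gq; exact: nbhs_singleton c1.
have [dchi _] := hu chi.
have /differentiable_continuous sc : differentiable (fun s => chi (gam s)) t by apply/derivable1_diffP.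
have : \forall s \near t, 0 < chi (gam s) by apply: (cvgr_gt _ sc); rewrite cp.
by apply: filterS => s h; apply: contrapT => /c0 E; rewrite E ltxx in h.
Qed.

Lemma has_vel_scale M (gam : R -> M) (a t : R) q (u : tangent q) : has_vel gam (t * a) u ->
  has_vel (fun s => gam (s * a)) t (a *: u).
Proof. by move=> [gq hu]; split=> // f; exact: (is_derive_mulc (hu f)). Qed.

Lemma has_vel_shift M (gam : R -> M) (a t : R) q (u : tangent q) : has_vel gam (a + t) u ->
  has_vel (fun s => gam (a + s)) t u.
Proof.
move=> [gq hu]; split=> // f; have := @line_is_derive R R R (fun s => f (gam s)) a 1 t (u f).
rewrite [t *: 1]mulr1 => /(_ (hu f)); congr is_derive; apply/funext => s; by rewrite [s *: 1]mulr1.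
Qed.

Lemma has_vel_euclid n (x : R -> 'rV[R]_n) (t : R) dx : is_derive t 1 x dx ->
  has_vel (x : R -> euclid R n) t (evec (x t : euclid R n) dx).
Proof.
move=> [dx1 dxE]; split=> // f; have /euclid_smooth Cf := sf_smooth f.
have [df dfE] := Ck_differentiable openT (I : setT (x t)) (Cf 1%N).
have := @derivable_comp R R _ _ (f : 'rV[R]_n -> R) x t 1 dx1 df; rewrite dxE dfE.
by have [_ <-] := Ck_derive openT dx (I : setT (x t)) (Cf 1%N).
Qed.

Lemma is_derive_line n (a u : 'rV[R]_n) (t : R) : is_derive t 1 (fun s : R => a + s *: u) u.
Proof.
apply: is_derive_eps => e e0; exists 1 => // s _.
have -> : a + (t + s) *: u - (a + t *: u) - s *: u = 0 by apply/rowP => l; rewrite !mxE; ring.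
by rewrite normr0 mulr_ge0// ltW.
Qed.

Lemma is_derive_const_mx (t : R) : is_derive t 1 (fun s : R => const_mx s : 'rV[R]_1) (const_mx 1).
Proof.
have -> : (fun s : R => const_mx s : 'rV[R]_1) = (fun s : R => 0 + s *: const_mx 1).
  by apply/funext => s; apply/rowP => l; rewrite !mxE; ring.
exact: is_derive_line.
Qed.

Definition pt (t : R) : euclid R 1 := const_mx t.

Lemma ptE (x : euclid R 1) : pt ((x : 'rV[R]_1) 0 0) = x.
Proof. by apply/rowP => l; rewrite mxE (ord1 l). Qed.

Definition cvel M (c : smap (euclid R 1) M) t : tangent (c (pt t)) :=
  tmap c (pt t) (evec (pt t) (const_mx 1)).

Lemma cvelP M (c : smap (euclid R 1) M) t : has_vel (c \o pt) t (cvel c t).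
Proof. exact: (has_vel_map c (has_vel_euclid (is_derive_const_mx t))). Qed.

Lemma has_vel_line M n (c : smap (euclid R n) M) (a u : 'rV[R]_n) t :
  has_vel (fun s : R => c (a + s *: u)) t (tmap c (a + t *: u : euclid R n) (evec (a + t *: u : euclid R n) u)).
Proof. exact: (has_vel_map c (has_vel_euclid (is_derive_line a u t))). Qed.

Lemma coords_vel M (p : M) (y : smap M (euclid R (mdim M))) (gam : smap (euclid R (mdim M)) M)
  (x : R -> 'rV[R]_(mdim M)) t (u : tangent p) : gam (y p) = p -> (\forall q \near p, gam (y q) = q) ->
  x t = y p -> is_derive t 1 x (\row_i u (ycoord y i)) -> has_vel (fun s => gam (x s)) t u.
Proof.
move=> gyp gy xt dx; split=> [|f]; first by rewrite xt.
have [_ h] := has_vel_map gam (has_vel_euclid dx).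
have := h f; congr is_derive; rewrite (tangent_coord gy u) dmapE tangent_euclid.
by apply: eq_bigr => i _; rewrite evec_coord mxE xt.
Qed.

Lemma curve_exists M (p : M) (u : tangent p) : exists c : smap (euclid R 1) M, has_vel (c \o pt) 0 u.
Proof.
have [y [gam [gyp gy _]]] := local_coords p.
pose w : 'rV[R]_(mdim M) := \row_i u (ycoord y i).
have C : Cinfv setT (fun x : 'rV[R]_1 => (y p : 'rV[R]_(mdim M)) + x 0 0 *: w).
  apply: (Cinfv_add openT (Cinfv_cst _ openT)); apply: (Cinfv_scale openT _ (Cinfv_cst _ openT)).
  by move=> k; apply: Ck_coord; exact: openT.
exists (smap_comp gam (emap C)).
apply: (@has_vel_near _ (fun s => gam ((y p : 'rV[R]_(mdim M)) + s *: w))).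
  by apply: (interval_near ltr01) => s _; rewrite /= mxE.
by apply: (coords_vel gyp gy); [rewrite scale0r addr0|exact: is_derive_line].
Qed.

(** Squeezing the line into []-r, r[] without changing it near 0 turns a curve with a property near
    0 into one that has it everywhere. *)
Lemma reparam (r : R) : 0 < r -> exists th : smap (euclid R 1) (euclid R 1),
  (forall x, `|(th x : 'rV[R]_1) 0 0| < r) /\ forall t, `|t| < r / 4 -> th (pt t) = pt t.
Proof.
(* With this [k] the plateau is 1 up to [r / 4] and 0 from [r / 2] on. *)
move=> r0; pose k := 4 / r; have k0 : 0 < k by rewrite divr_gt0.
have C : Cinfv setT (fun x : 'rV[R]_1 => plateau (k * x 0 0) *: x).
  apply: (Cinfv_scale openT _ (Cinfv_id openT)) => j; apply: (Ck_plateau openT).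
  by apply: (Ck_mul openT (Ck_cst openT _ k)); apply: Ck_coord; exact: openT.
exists (emap C); split=> [x|t tr] /=; last first.
  rewrite mxE plateau1 ?scale1r// normrM (gtr0_norm k0) -(ler_pM2l (x := r / 4)) ?divr_gt0//.
  by rewrite mulrA mulr1 /k (_ : r / 4 * (4 / r) = 1) ?mul1r ?ltW//; field; rewrite gt_eqF.
rewrite mxE; set s := (x : 'rV[R]_1) 0 0; have [h|h] := leP 2 `|k * s|.
  by rewrite plateau0// mul0r normr0.
rewrite normrM; have /andP[p0 p1] := plateau_itv (k * s); rewrite (ger0_norm p0).
apply: (@le_lt_trans _ _ `|s|); first by rewrite ler_piMl.
rewrite -(ltr_pM2l k0) -{1}(gtr0_norm k0) -normrM; apply: (lt_trans h).
by rewrite /k mulfVK ?gt_eqF// ltr_nat.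
Qed.

End Curves.

(** * Submersions: local sections and lifts of curves *)

Section Submersions.
Context (R : realType).
Implicit Types M N : manifold R.

Section ChartJacobian.
Context (M N : manifold R) (phi : smap M N) (p : M).
Variables (y : smap M (euclid R (mdim M))) (gam : smap (euclid R (mdim M)) M).
Variables (y' : smap N (euclid R (mdim N))) (gam' : smap (euclid R (mdim N)) N).
Hypotheses (gy : \forall q \near p, gam (y q) = q) (gyp : gam (y p) = p).
Hypotheses (gyp' : gam' (y' (phi p)) = phi p)
  (yg' : \forall x \near (y' (phi p) : 'rV_(mdim N)), y' (gam' x) = x).

Definition chart_rep : 'rV[R]_(mdim M) -> 'rV[R]_(mdim N) := smap_comp y' (smap_comp phi gam).

Lemma chart_repC : Cinfv setT chart_rep.
Proof. exact: smap_euclid_Cinfv. Qed.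

Lemma tangent_jac (v : tangent p) :
  (\row_i v (ycoord y i)) *m jac chart_rep (y p) = \row_k tmap phi p v (ycoord y' k).
Proof.
apply/rowP => k; rewrite !mxE dmapE (tangent_coord gy v); apply: eq_bigr => i _.
by rewrite !mxE.
Qed.

Lemma jac_surj : (forall w : tangent (phi p), exists v, tmap phi p v = w) ->
  exists A, A *m jac chart_rep (y p) = 1%:M.
Proof.
move=> surj; have /choice[v Hv] (j : 'I_(mdim N)) : exists v, tmap phi p v =
  dmap gyp' (evec (y' (phi p)) (delta_mx 0 j)) by exact: surj.
exists (\matrix_(j, i) v j (ycoord y i)); apply/row_matrixP => j.
rewrite row_mul (_ : row j _ = \row_i v j (ycoord y i)); last by apply/rowP => i; rewrite !mxE.
rewrite tangent_jac Hv; apply/rowP => k; rewrite !mxE dmapE.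
rewrite (@tg_near R _ _ _ _ (ecoord R k)) ?evec_coord ?mxE ?eqxx//; first by rewrite eq_sym.
by apply: filterS yg' => x /= ->.
Qed.

End ChartJacobian.

(** Surjectivity of the differential provides a right inverse [A] of the Jacobian, and
    [right_inverse] a section in coordinates that passes through [p]. *)
Lemma local_section M N (phi : smap M N) (p : M) :
  (forall w : tangent (phi p), exists v, tmap phi p v = w) ->
  exists psi : smap N M, psi (phi p) = p /\ \forall z \near phi p, phi (psi z) = z.
Proof.
move=> surj; have [y [gam [gyp gy yg]]] := local_coords p.
have [y' [gam' [gyp' gy' yg']]] := local_coords (phi p).
have [A AE] := jac_surj gy gyp' yg' surj.
have [r [g [r0 ga Cg Hg]]] := right_inverse openT I (chart_repC phi gam y') AE.
have fa : chart_rep phi gam y' (y p) = y' (phi p) by rewrite /chart_rep /= gyp.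
rewrite fa in ga Hg.
exists (smap_comp gam (smap_comp (emap Cg) y')); split; first by rewrite /= ga.
have n1 : \forall z \near phi p, phi (gam (g (y' z))) = z.
  have n2 : \forall z \near phi p, `|(y' z : 'rV[R]_(mdim N)) - y' (phi p)| < r.
    apply: (@smap_near _ _ (euclid R (mdim N)) y' (phi p) (fun x : 'rV[R]_(mdim N) => `|x - y' (phi p)| < r)).
    by apply/nbhs_ballP; exists r => //= x; rewrite -ball_normE /ball_/= distrC.
  have n3 : \forall z \near phi p, gam' (y' (phi (gam (g (y' z))))) = phi (gam (g (y' z))).
    have := @smap_near R _ _ (smap_comp phi (smap_comp gam (smap_comp (emap Cg) y'))) (phi p) (fun w => gam' (y' w) = w).
    by rewrite /= ga gyp; exact.
  near=> z.
  have h2 : `|(y' z : 'rV[R]_(mdim N)) - y' (phi p)| < r by near: z.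
  have h3 : gam' (y' (phi (gam (g (y' z))))) = phi (gam (g (y' z))) by near: z.
  have h4 : gam' (y' z) = z by near: z.
  by rewrite -h3; have [_ ] := Hg _ h2; rewrite /chart_rep /= => ->.
by [].
Unshelve. all: by end_near. Qed.

(** In coordinates the lift is [a + t *: uu + w *m A], with [w] determined by the requirement that
    [f] map it to the coordinates of [b]. The map [H] sending [(t, w)] to [t] and the value of [f]
    there has an injective differential at 0, so its local inverse [h] solves for [w]. *)
Lemma lift_curve M N (s : smap M N) (g : M) (u : tangent g) (b : smap (euclid R 1) N) :
  (forall w : tangent (s g), exists v, tmap s g v = w) ->
  has_vel (b \o @pt R) 0 (tmap s g u) ->
  exists c : smap (euclid R 1) M, has_vel (c \o @pt R) 0 u /\
    exists2 r, 0 < r & forall t : R, `|t| < r -> s (c (pt t)) = b (pt t).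
Proof.
move=> surj hb; have [y [gam [gyp gy yg]]] := local_coords g.
have [y' [gam' [gyp' gy' yg']]] := local_coords (s g).
have [A AE] := jac_surj gy gyp' yg' surj.
set n := mdim M in y gam gyp gy yg A AE *; set m := mdim N in y' gam' gyp' gy' yg' A AE *.
pose f := chart_rep s gam y'; have Cf : Cinfv setT f := chart_repC s gam y'.
pose a : 'rV[R]_n := y g; pose uu : 'rV[R]_n := \row_i u (ycoord y i).
have fa : f a = y' (s g) by rewrite /f /chart_rep /= gyp.
pose k (z : 'rV[R]_(1 + m)) : 'rV[R]_n := a + (z 0 0 *: uu + rsubmx z *m A).
have Ck0 : Cinfv setT k.
  apply: (Cinfv_add openT (Cinfv_cst _ openT)); apply: (Cinfv_add openT).
    by apply: (Cinfv_scale openT _ (Cinfv_cst _ openT)) => j; apply: Ck_coord; exact: openT.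
  move=> i; have Cr := @Cinfv_rsub R 1 m setT openT.
  apply: (@Cinfty_ext R _ setT (fun z : 'rV[R]_(1 + m) => \sum_l rsubmx z 0 l * A l i)) => [|z _|j].
  - exact: openT.
  - by rewrite mxE.
  - apply: (Ck_sum openT) => l; apply: (Ck_mul openT); [exact: Cr|exact: (Ck_cst openT)].
pose H (z : 'rV[R]_(1 + m)) : 'rV[R]_(1 + m) := row_mx (lsubmx z) (f (k z)).
have CH : Cinfv setT H.
  apply: (Cinfv_row_mx openT); first exact: (Cinfv_lsub openT).
  exact: (Cinfv_comp openT openT Cf Ck0).
have k0 : k 0 = a by rewrite /k mxE scale0r add0r linear0 mul0mx addr0.
have JH v : v *m jac H 0 = row_mx (lsubmx v) ((v 0 0 *: uu + rsubmx v *m A) *m jac f a).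
  have d0 : is_derive (0 : R) 1 (fun t : R => H (0 + t *: v)) (v *m jac H 0).
    have := curve_derive openT I CH (is_derive_line (0 : 'rV[R]_(1 + m)) v (0 : R)).
    by rewrite scale0r addr0.
  have dk : is_derive (0 : R) 1 (fun t : R => k (0 + t *: v)) (v 0 0 *: uu + rsubmx v *m A).
    have -> : (fun t : R => k (0 + t *: v)) = (fun t : R => a + t *: (v 0 0 *: uu + rsubmx v *m A)).
      apply/funext => t; rewrite /k add0r mxE linearZ /= -scalemxAl scalerDr scalerA //.
    exact: is_derive_line.
  have d1 : is_derive (0 : R) 1 (fun t : R => H (0 + t *: v)) (row_mx (lsubmx v) ((v 0 0 *: uu + rsubmx v *m A) *m jac f a)).
    apply/is_derive_rV => j; rewrite mxE; case: splitP => i ji.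
      have -> : (fun t : R => H (0 + t *: v) 0 j) = (fun t : R => (0 + t *: lsubmx v) 0 i).
        apply/funext => t; rewrite /H mxE; case: splitP => i' ji'; last by move: (ltn_ord i); rewrite -ji ji' ltnNge leq_addr.
        by rewrite add0r linearZ /= add0r; congr (_ 0 _); apply: val_inj; rewrite /= -ji -ji'.
      exact: (proj2 (is_derive_rV _ _ _) (is_derive_line (0 : 'rV[R]_1) (lsubmx v) (0 : R))).
    have -> : (fun t : R => H (0 + t *: v) 0 j) = (fun t : R => f (k (0 + t *: v)) 0 i).
      apply/funext => t; rewrite /H mxE; case: splitP => i' ji'; first by move: (ltn_ord i'); rewrite -ji' ji ltnNge leq_addr.
      by congr (_ 0 _); apply: val_inj; apply: (@addnI 1); rewrite -ji -ji'.
    have kt0 : k (0 + (0 : R) *: v) = a by rewrite scale0r addr0 k0.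
    have := curve_derive openT I Cf dk; rewrite kt0 => D.
    exact: (proj2 (is_derive_rV _ _ _) D i).
  by have [_ <-] := d0; have [_ <-] := d1.
have JHinj (v : 'rV[R]_(1 + m)) : v *m jac H 0 = 0 -> v = 0.
  rewrite JH => E; have l0 : lsubmx v = 0 by have := congr1 lsubmx E; rewrite row_mxKl linear0.
  have v00 : v 0 0 = 0.
    have := congr1 (fun B : 'rV[R]_1 => B 0 0) l0; rewrite !mxE => <-; congr (v _ _); exact: val_inj.
  have r0 : rsubmx v = 0.
    have := congr1 rsubmx E; rewrite row_mxKr linear0 v00 scale0r add0r -mulmxA AE mulmx1 //.
  by rewrite -[v]hsubmxK l0 r0 row_mx0.
have [r [h [r0 h0 Ch Hh]]] := right_inverse openT I CH (mulVmx (inj_unitmx JHinj)).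
have H0 : H 0 = row_mx 0 (y' (s g)) by rewrite /H k0 fa linear0.
rewrite H0 in h0 Hh.
pose z (x : 'rV[R]_1) : 'rV[R]_(1 + m) := row_mx x (y' (b x)).
have Cz : Cinfv setT z.
  by apply: (Cinfv_row_mx openT (Cinfv_id openT)); exact: (smap_euclid_Cinfv (smap_comp y' b)).
have b0 : b (pt 0) = s g by have [] := hb.
have z0 : z (const_mx 0) = row_mx 0 (y' (s g)).
  by rewrite /z -/(pt 0) b0; congr row_mx; apply/rowP => l; rewrite !mxE.
have Chz := Cinfv_comp openT openT Ch Cz (fun _ _ => I).
have Ckz := Cinfv_comp openT openT Ck0 Chz (fun _ _ => I).
exists (smap_comp gam (emap Ckz)).
have dz : is_derive (0 : R) 1 (fun t => z (const_mx t)) (row_mx (const_mx 1) (uu *m jac f a)).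
  apply/is_derive_rV => j; rewrite mxE; case: splitP => i ji.
    have -> : (fun t => z (const_mx t) 0 j) = (fun t : R => (const_mx t : 'rV[R]_1) 0 i).
      apply/funext => t; rewrite /z mxE; case: splitP => i' ji'; last by move: (ltn_ord i); rewrite -ji ji' ltnNge leq_addr.
      by congr (_ 0 _); apply: val_inj; rewrite /= -ji -ji'.
    exact: (proj2 (is_derive_rV _ _ _) (is_derive_const_mx (0 : R))).
  have -> : (fun t => z (const_mx t) 0 j) = (fun t : R => ycoord y' i (b (pt t))).
    apply/funext => t; rewrite /z mxE; case: splitP => i' ji'; first by move: (ltn_ord i'); rewrite -ji' ji ltnNge leq_addr.
    by congr (_ 0 _); apply: val_inj; apply: (@addnI 1); rewrite -ji -ji'.
  have [_ hb'] := hb; have := hb' (ycoord y' i).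
  suff -> : (uu *m jac f a) 0 i = tmap s g u (ycoord y' i) by [].
  by have /(congr1 (fun B : 'rV[R]_m => B 0 i)) := tangent_jac s y' gy u; rewrite [RHS]mxE.
have nz : \forall t \near (0 : R), `|z (const_mx t) - row_mx 0 (y' (s g))| < r.
  have cz : {for 0, continuous (fun t => z (const_mx t))}.
    by have [dz1 _] := dz; apply: differentiable_continuous; exact/derivable1_diffP.
  have Fil : Filter (nbhs (0 : R)) by exact: nbhs_filter.
  apply: (filterS _ ((proj1 (@cvgrPdist_lt _ _ _ (nbhs (0 : R)) Fil _ _)) cz r r0)) => t.
  by rewrite z0 distrC.
have [d d0 Hd] := near_interval nz.
(* [H] takes [h (z t)] back to [z t] and its differential at 0 is injective, so this curve has
   velocity [(1, 0)]: the correction [w] starts with velocity 0 and the lift with velocity [u]. *)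
have dhz : is_derive (0 : R) 1 (fun t => h (z (const_mx t))) (row_mx (const_mx 1) 0).
  have D := curve_derive openT I Ch dz; rewrite z0 in D.
  set del := (_ *m _) in D.
  suff -> : row_mx (const_mx 1) 0 = del by exact: D.
  have D2 := curve_derive openT I CH D; rewrite z0 h0 in D2.
  have D3 : is_derive (0 : R) 1 (fun t => H (h (z (const_mx t)))) (row_mx (const_mx 1) (uu *m jac f a)).
    apply/is_derive_rV => j; have := proj2 (is_derive_rV _ _ _) dz j.
    apply: near_is_derive; apply: (interval_near d0) => t td.
    by have [_ ->] := Hh _ (Hd t td).
  apply/eqP; rewrite -subr_eq0; apply/eqP; apply: JHinj; rewrite mulmxBl.
  have [_ E2] := D2; have [_ E3] := D3; rewrite E3 in E2; rewrite -E2 JH row_mxKl row_mxKr mul0mx addr0.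
  by rewrite (row_mx10 (const_mx 1 : 'rV[R]_1) (0 : 'rV[R]_m)) mxE scale1r subrr.
split.
  apply: (@has_vel_near _ _ (fun t => gam (k (h (z (const_mx t)))))); first by apply: (interval_near ltr01).
  apply: (coords_vel gyp gy); first by rewrite z0 h0 k0.
  have D := curve_derive openT I Ck0 dhz; rewrite z0 h0 in D.
  suff Du : row_mx (const_mx 1) 0 *m jac k 0 = uu by rewrite Du in D; exact: D.
  have D0 : is_derive (0 : R) 1 (fun t : R => k (0 + t *: row_mx (const_mx 1) 0)) (row_mx (const_mx 1 : 'rV[R]_1) (0 : 'rV[R]_m) *m jac k 0).
    have := curve_derive openT I Ck0 (is_derive_line (0 : 'rV[R]_(1 + m)) (row_mx (const_mx 1) 0) (0 : R)).
    by rewrite scale0r addr0.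
  have D1 : is_derive (0 : R) 1 (fun t : R => k (0 + t *: row_mx (const_mx 1) 0)) uu.
    have -> : (fun t : R => k (0 + t *: row_mx (const_mx 1) 0)) = (fun t : R => a + t *: uu).
      apply/funext => t; rewrite /k add0r mxE linearZ /= row_mxKr scaler0 mul0mx addr0.
      by rewrite (row_mx10 (const_mx 1 : 'rV[R]_1) (0 : 'rV[R]_m)) mxE mulr1.
    exact: is_derive_line.
  by have [_ <-] := D0; have [_ <-] := D1.
have n1 : \forall t \near (0 : R), gam' (y' (b (pt t))) = b (pt t).
  have := has_vel_cont hb; move=> /(_ [set w | gam' (y' w) = w]); rewrite /= b0; exact.
pose cc : smap (euclid R 1) N := smap_comp s (smap_comp gam (emap Ckz)).
have n2 : \forall t \near (0 : R), gam' (y' (cc (pt t))) = cc (pt t).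
  have cc0 : (cc \o @pt R) 0 = s g.
    by transitivity (s (gam (k (h (z (const_mx 0)))))) => //; rewrite z0 h0 k0 gyp.
  by have := has_vel_cont (cvelP cc 0); move=> /(_ [set w | gam' (y' w) = w]); rewrite cc0; exact.
have [e e0 He] := near_interval (filterI n1 n2).
exists (Num.min d e); first by rewrite lt_min d0.
move=> t; rewrite lt_min => /andP[td te].
have td0 : `|t - 0| < d by rewrite subr0.
have te0 : `|t - 0| < e by rewrite subr0.
have [E1 E2] := He t te0; rewrite -[LHS]/(cc (pt t)) -E2 -[RHS]E1; congr (gam' _).
have [_] := Hh _ (Hd t td0); rewrite /H /z => /(congr1 rsubmx); rewrite !row_mxKr => <-.
by [].
Qed.

End Submersions.

(** * Integral curves of vector fields on a manifold *)

Section IntegralCurves.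
Context (R : realType) (M : manifold R).
Implicit Types (X : vfield M) (gam : R -> M).

Definition icurve (X : forall p : M, tangent p) gam (a b : R) : Prop :=
  forall t, a < t -> t < b -> has_vel gam t (X (gam t)).

Lemma icurveW X gam a b a' b' : a <= a' -> b' <= b -> icurve X gam a b -> icurve X gam a' b'.
Proof. by move=> aa bb H t t1 t2; apply: H; [exact: le_lt_trans t1|exact: lt_le_trans t2 bb]. Qed.

Lemma icurve_shift X gam a b s : icurve X gam a b -> icurve X (fun r => gam (s + r)) (a - s) (b - s).
Proof.
move=> H t t1 t2; apply: (has_vel_shift (a := s)).
by apply: H; [rewrite -ltrBlDl|rewrite -ltrBrDl].
Qed.

Lemma icurve_cont X gam a b t : icurve X gam a b -> a < t -> t < b -> {for t, continuous gam}.
Proof. by move=> H t1 t2; exact: has_vel_cont (H t t1 t2). Qed.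

Lemma near_neq (S T : topologicalType) (f g : S -> T) x : hausdorff_space T ->
  {for x, continuous f} -> {for x, continuous g} -> f x <> g x -> \forall y \near x, f y <> g y.
Proof.
rewrite open_hausdorff => hT cf cg /eqP fg.
have [[A B] [/= fA gB] [oA oB /eqP AB]] := hT _ _ fg; rewrite !inE in fA gB.
have nA : \forall y \near x, A (f y) by apply: cf; exact: open_nbhs_nbhs.
have nB : \forall y \near x, B (g y) by apply: cg; exact: open_nbhs_nbhs.
near=> y => E; have hA : A (f y) by near: y.
have hB : B (g y) by near: y.
have : (A `&` B) (f y) by split=> //; rewrite E.
by rewrite AB.
Unshelve. all: by end_near. Qed.

Section Local.
Variables (p : M).

Lemma good_coords : exists (y : smap M (euclid R (mdim M))) (gam : smap (euclid R (mdim M)) M) (r : R) (V : set M),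
  [/\ 0 < r, gam (y p) = p,
    open V /\ V p,
    forall x : 'rV[R]_(mdim M), `|x - y p| < r -> V (gam x) /\ y (gam x) = x &
    forall q, V q -> gam (y q) = q].
Proof.
have [y [gam [gyp gy yg]]] := local_coords p.
have [V [oV Vp HV]] := near_open gy.
have nV : \forall x \near (y p : 'rV[R]_(mdim M)), V (gam x).
  apply: (@smap_near _ _ _ gam (y p) V); rewrite gyp; exact: open_nbhs_nbhs.
have nn : \forall x \near (y p : 'rV[R]_(mdim M)), V (gam x) /\ y (gam x) = x by exact: filterI.
have /nbhs_ballP[r /= r0 Hr] := nn.
exists y, gam, r, V; split => // x xr; apply: Hr.
by rewrite -ball_normE /ball_/= distrC.
Qed.

Variables (y : smap M (euclid R (mdim M))) (gam : smap (euclid R (mdim M)) M) (r : R) (V : set M).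
Hypotheses (r0 : 0 < r) (gyp : gam (y p) = p) (oV : open V)
  (yg : forall x : 'rV[R]_(mdim M), `|x - y p| < r -> V (gam x) /\ y (gam x) = x)
  (gy : forall q, V q -> gam (y q) = q).
Variable (X : vfield M).

(** In coordinates the field is cut off to a bounded one on the whole Euclidean space, which has a
    global flow. *)
Lemma cutoff_field : exists (Xt : 'rV[R]_(mdim M) -> 'rV[R]_(mdim M)) (K : R),
  [/\ Cinfv setT Xt, 0 <= K /\ forall x, `|Xt x| <= K,
    forall x : 'rV[R]_(mdim M), `|x - y p| <= r / 4 -> Xt x = \row_i X (gam x) (ycoord y i),
    forall x : 'rV[R]_(mdim M), r / 2 <= `|x - y p| -> Xt x = 0 &
    forall x, X (gam x) = 0 -> Xt x = 0].
Proof.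
have r4 : 0 < r / 4 by rewrite divr_gt0.
have [b [Cb b1 b0 _]] := bump (y p : 'rV[R]_(mdim M)) r4.
pose Xt (x : 'rV[R]_(mdim M)) : 'rV[R]_(mdim M) := b x *: \row_i X (gam x) (ycoord y i).
have CX : Cinfv setT Xt.
  apply: (Cinfv_scale openT Cb) => i.
  have /euclid_smooth := sf_smooth (sf_comp gam (lie X (ycoord y i))).
  by apply: Cinfty_ext => [|x _]; [exact: openT|rewrite mxE].
have X0 x : r / 2 <= `|x - y p| -> Xt x = 0.
  by move=> h; rewrite /Xt b0 ?scale0r//; lra.
have [K [K0 HK]] := Cinfv_bounded (`|(y p : 'rV[R]_(mdim M))| + r / 2) CX.
exists Xt, K; split=> // [|x xr|x Xx].
- split=> // x; have [h|h] := leP (r / 2) `|x - y p|; first by rewrite X0// normr0.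
  apply: HK; have -> : x = y p + (x - y p) by rewrite subrKC.
  by apply: le_trans (ler_normD _ _) _; rewrite lerD2l ltW.
- by rewrite /Xt b1// scale1r.
- by apply/rowP => i; rewrite !mxE Xx tzero mulr0.
Qed.

Lemma coords_icurve (x : R -> 'rV[R]_(mdim M)) t : `|x t - y p| < r ->
  is_derive t 1 x (\row_i X (gam (x t)) (ycoord y i)) -> has_vel (fun s => gam (x s)) t (X (gam (x t))).
Proof.
move=> xr dx; have [Vx yx] := yg xr.
apply: (@coords_vel R M (gam (x t)) y gam) => //; first by rewrite yx.
by have : nbhs (gam (x t)) V by [exact: open_nbhs_nbhs]; apply: filterS.
Qed.

End Local.

Definition small_ball (p : M) (y : smap M (euclid R (mdim M))) (V : set M) (r : R) : set M :=
  [set q | V q /\ `|(y q : 'rV[R]_(mdim M)) - y p| < r].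

Lemma small_ball_open p y V r : open V -> 0 < r -> open (small_ball p y V r).
Proof.
move=> oV r0; have -> : small_ball p y V r = V `&` (y @^-1` [set x : 'rV[R]_(mdim M) | `|x - y p| < r]) by [].
apply: openI => //; apply: open_comp => [q _|]; first exact: smap_continuous.
have -> : [set x : 'rV[R]_(mdim M) | `|x - y p| < r] = ball (y p : 'rV[R]_(mdim M)) r.
  by apply/seteqP; split=> x; rewrite -ball_normE /ball_/= distrC.
exact: ball_open.
Qed.

Lemma local_flow X (p : M) : exists (y : smap M (euclid R (mdim M))) (g : smap (euclid R (1 + mdim M)) M) (e : R) (W : set M),
  [/\ 0 < e, open W, W p &
    forall q, W q -> g (row_mx (const_mx 0) (y q)) = q /\
      icurve X (fun t => g (row_mx (const_mx t) (y q))) (- e) e].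
Proof.
have [y [gam [r [V [r0 gyp [oV Vp] yg gy]]]]] := good_coords p.
have [Xt [K [CX [K0 HK] X1 _ _]]] := @cutoff_field p y gam r r0 X.
have [F [[F0 dF _] CF]] := flow_joint CX HK.
(* Starting within [r / 8] and moving with speed at most [K], a trajectory stays up to this time
   within [r / 4], where [Xt] still represents [X]. *)
pose e := r / 8 / (K + 1).
have K1 : 0 < K + 1 by lra.
have e0 : 0 < e by rewrite divr_gt0// divr_gt0.
have FE (t : R) (x : 'rV[R]_(mdim M)) : (smap_comp gam (emap CF)) (row_mx (const_mx t) x) = gam (F t x).
  by rewrite /= row_mxKr row_mx10 mxE.
exists y, (smap_comp gam (emap CF)), e, (small_ball p y V (r / 8)); split => //.
- by apply: small_ball_open => //; rewrite divr_gt0.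
- by split=> //; rewrite subrr normr0 divr_gt0.
- move=> q [Vq yq]; split; first by rewrite FE F0 gy.
  move=> t t1 t2; rewrite FE.
  have Fr : `|F t (y q) - y p| < r / 4.
    have b1 := curve_bound K0 (fun s => dF s (y q)) (fun s => HK _) t.
    have te : `|t| < e by rewrite ltr_norml t1.
    have b2 : K * `|t| <= r / 8.
      apply: (@le_trans _ _ ((K + 1) * e)); last by rewrite /e mulrC divfK ?gt_eqF.
      by apply: ler_pM => //; [lra|exact: ltW].
    rewrite F0 in b1; have -> : F t (y q) - y p = (F t (y q) - y q) + ((y q : 'rV[R]_(mdim M)) - y p).
      by apply/rowP => i; rewrite !mxE; ring.
    by apply: le_lt_trans (ler_normD _ _) _; lra.
  apply: (@has_vel_near _ _ (fun s => gam (F s (y q)))); first by apply: (interval_near ltr01) => s _; rewrite FE.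
  apply: (coords_icurve oV yg gy (x := fun s => F s (y q))); first by lra.
  by have := dF t (y q); rewrite X1// ltW.
Qed.

Lemma local_uniq X (p : M) : exists W : set M, [/\ open W, W p &
  forall (u v : R -> M) a b, a < 0 -> 0 < b -> icurve X u a b -> icurve X v a b ->
    (forall t, a < t -> t < b -> W (u t) /\ W (v t)) -> u 0 = v 0 -> forall t, a < t -> t < b -> u t = v t].
Proof.
have [y [gam [r [V [r0 gyp [oV Vp] yg gy]]]]] := good_coords p.
have [Xt [K [CX [K0 HK] X1 _ _]]] := @cutoff_field p y gam r r0 X.
exists (small_ball p y V (r / 4)); split.
- by apply: small_ball_open => //; rewrite divr_gt0.
- by split=> //; rewrite subrr normr0 divr_gt0.
- move=> u v a b a0 b0 Hu Hv Huv uv t ta tb.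
  have D (w : R -> M) : icurve X w a b -> (forall t, a < t -> t < b -> small_ball p y V (r / 4) (w t)) ->
      forall s, a < s -> s < b -> is_derive s 1 (fun s => y (w s) : 'rV[R]_(mdim M)) (Xt (y (w s))).
    move=> Hw Ww s sa sb; have [Vw yw] := Ww s sa sb; have [_ hw] := Hw s sa sb.
    rewrite X1 ?ltW// gy//; apply/is_derive_rV => j; rewrite mxE; exact: (hw (ycoord y j)).
  have Du := D u Hu (fun t ta tb => (Huv t ta tb).1).
  have Dv := D v Hv (fun t ta tb => (Huv t ta tb).2).
  have [[Vu _] [Vv _]] := Huv t ta tb.
  rewrite -(gy _ Vu) -(gy _ Vv); congr (gam _).
  exact: (ode_unique CX a0 b0 Du Dv (congr1 (fun q => y q : 'rV[R]_(mdim M)) uv) ta tb).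
Qed.

(** Agreement is an open condition by local uniqueness, and disagreement is open because the
    manifold is Hausdorff. *)
Lemma icurve_uniq X (u v : R -> M) a b : a < 0 -> 0 < b -> icurve X u a b -> icurve X v a b ->
  u 0 = v 0 -> forall t, a < t -> t < b -> u t = v t.
Proof.
move=> a0 b0 Hu Hv uv t0 ta tb.
pose a' := Num.min 0 t0; pose b' := Num.max 0 t0.
(* [c] clamps time to the segment between 0 and [t0], so that the induction can run over the whole
   line although the curves live on []a, b[]. *)
pose c t := Num.max a' (Num.min b' t).
have aa : a < a' by rewrite /a' lt_min a0.
have bb : b' < b by rewrite /b' gt_max b0.
have ab' : a' <= b' by rewrite /a' /b' ge_min le_max lexx.
have c1 t : a < c t by rewrite /c lt_max aa.
have c2 t : c t < b by rewrite /c gt_max (le_lt_trans ab' bb)/= gt_min bb.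
have clip s t : `|c s - c t| <= `|s - t|.
  have n1 (p q : R) : `|p - q| <= `|s - t| <-> - `|s - t| <= p - q /\ p - q <= `|s - t|.
    by rewrite ler_norml; split=> [/andP|[-> ->]].
  have k1 := ler_norm (s - t); have k2 := ler_norm (t - s); rewrite distrC in k2.
  have /n1[m1 m2] : `|Num.min b' s - Num.min b' t| <= `|s - t|.
    by apply/n1; rewrite /Order.min; case: ifPn; case: ifPn; rewrite -?leNgt => *; split; lra.
  apply/n1; rewrite /c /Order.max; case: ifPn; case: ifPn; rewrite -?leNgt => *; split; lra.
have cid t : a' <= t -> t <= b' -> c t = t.
  by move=> h1 h2; rewrite /c (min_idPr h2) (max_idPr h1).
have : u (c t0) = v (c t0); last first.
  by rewrite cid// /a' /b' ?ge_min ?le_max lexx orbT.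
pose P t := u (c t) = v (c t).
apply: (@real_ind R P) => [|t].
  by rewrite /P cid// /a' /b' ?ge_min ?le_max lexx.
have cu := icurve_cont Hu (c1 t) (c2 t); have cv := icurve_cont Hv (c1 t) (c2 t).
have [E|nE] := pselect (u (c t) = v (c t)); last first.
  have [e e0 He] := near_interval (near_neq (@manifold_hausdorff _ M) cu cv nE).
  exists e => // s s' st _ Ps; exfalso; apply: (He (c s) _ Ps).
  exact: le_lt_trans (clip _ _) st.
have [W [oW Wp HW]] := local_uniq X (u (c t)).
have nu : \forall s \near c t, W (u s) by apply: cu; exact: open_nbhs_nbhs.
have nv : \forall s \near c t, W (v s) by apply: cv; rewrite -E; exact: open_nbhs_nbhs.
have [e1 e10 He1] := near_interval (filterI nu nv).
pose e := Num.min e1 (Num.min (c t - a) (b - c t)).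
have e0 : 0 < e by rewrite !lt_min e10 !subr_gt0 c1 c2.
have [ee1 eea eeb] : [/\ e <= e1, e <= c t - a & e <= b - c t].
  by split; rewrite /e !ge_min lexx ?orbT.
exists e => // s s' _ st' _; rewrite /P.
have d := le_lt_trans (clip s' t) st'.
have := HW (fun r => u (c t + r)) (fun r => v (c t + r)) (- e) e.
have Iu : icurve X (fun r => u (c t + r)) (- e) e.
  by apply: icurveW (icurve_shift (s := c t) Hu); lra.
have Iv : icurve X (fun r => v (c t + r)) (- e) e.
  by apply: icurveW (icurve_shift (s := c t) Hv); lra.
move=> /(_ _ e0 Iu Iv) H.
have e0' : - e < 0 by lra.
rewrite -[c s'](subrKC (c t)); apply: (H e0').
- move=> q q1 q2; apply: He1; rewrite addrAC subrr add0r ltr_norml.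
  by apply/andP; split; lra.
- by rewrite addr0.
- by move: d; rewrite ltr_norml => /andP[].
- by move: d; rewrite ltr_norml => /andP[].
Qed.

(** The hypothesis gives, near every time [T], a uniform extra lifespan [2 * e] to any solution that
    has come within [e] of [T]. Hence all times are reached, and uniqueness makes the solutions
    agree. *)
Lemma icurve_extend X (q : M) :
  (forall T, exists2 e, 0 < e & forall s gam a b, `|s - T| < e -> a < 0 -> 0 < b -> a < s -> s < b ->
    gam 0 = q -> icurve X gam a b -> exists2 d, d 0 = gam s & icurve X d (- (2 * e)) (2 * e)) ->
  exists gam, gam 0 = q /\ forall t, has_vel gam t (X (gam t)).
Proof.
move=> H.
pose P T := exists gam a b, [/\ a < 0, 0 < b, a < T, T < b & gam 0 = q /\ icurve X gam a b].
have HP : forall T, P T.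
  apply: (@real_ind R P) => [|T].
    have [y [g [e [W [e0 oW Wq HW]]]]] := local_flow X q.
    have [g0 gI] := HW q Wq.
    by exists (fun t => g (row_mx (const_mx t) (y q))), (- e), e; split=> //; lra.
  have [e e0 He] := H T; exists e => // s s' sT sT' [u [a [b [a0 b0 aS sb [uq Iu]]]]].
  have [d ds Id] := He s u a b sT a0 b0 aS sb uq Iu.
  (* The old curve is kept on its whole interval and continued by the new one elsewhere; [ud]
     matches them on the overlap. *)
  pose w t := if (a < t) && (t < b) then u t else d (t - s).
  have ud t : a < t -> t < b -> s - 2 * e < t -> t < s + 2 * e -> u t = d (t - s).
    move=> t1 t2 t3 t4.
    have := @icurve_uniq X (fun r => u (s + r)) d (Num.max (a - s) (- (2 * e))) (Num.min (b - s) (2 * e)).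
    have h1 : Num.max (a - s) (- (2 * e)) < 0 by rewrite gt_max; apply/andP; split; lra.
    have h2 : 0 < Num.min (b - s) (2 * e) by rewrite lt_min; apply/andP; split; lra.
    move=> /(_ h1 h2) U; have := U _ _ _ (t - s); rewrite subrKC; apply.
    - by apply: icurveW (icurve_shift (s := s) Iu); rewrite ?le_max ?ge_min lexx.
    - by apply: icurveW Id; rewrite ?le_max ?ge_min lexx ?orbT.
    - by rewrite addr0.
    - by rewrite gt_max; apply/andP; split; lra.
    - by rewrite lt_min; apply/andP; split; lra.
  exists w, (Num.min a (s - 2 * e)), (Num.max b (s + 2 * e)); split.
  - by rewrite gt_min a0.
  - by rewrite lt_max b0.
  - by move: sT sT'; rewrite !ltr_norml => /andP[? ?] /andP[? ?]; rewrite gt_min; apply/orP; right; lra.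
  - by move: sT sT'; rewrite !ltr_norml => /andP[? ?] /andP[? ?]; rewrite lt_max; apply/orP; right; lra.
  split; first by rewrite /w a0 b0.
  move=> t t1 t2; have [/andP[t3 t4]|nt] := boolP ((a < t) && (t < b)).
    have -> : w t = u t by rewrite /w t3 t4.
    apply: has_vel_near (Iu t t3 t4).
    apply: (@interval_near _ _ _ (Num.min (t - a) (b - t))); first by rewrite lt_min !subr_gt0 t3.
    move=> r; rewrite lt_min !ltr_norml => /andP[/andP[? ?] /andP[? ?]].
    by rewrite /w ifT//; apply/andP; split; lra.
  have [t5 t6] : s - 2 * e < t /\ t < s + 2 * e.
    move: t1 t2 nt; rewrite gt_min lt_max negb_and -!leNgt => /orP h1 /orP h2 /orP h3.
    by case: h1 => ?; case: h2 => ?; case: h3 => ?; split; lra.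
  have -> : w t = d (t - s) by rewrite /w (negPf nt).
  have Id' : has_vel (fun r => d (- s + r)) t (X (d (t - s))).
    apply: (has_vel_shift (a := - s)); rewrite addrC; apply: Id; lra.
  apply: has_vel_near Id'.
  apply: (@interval_near _ _ _ (Num.min (t - (s - 2 * e)) (s + 2 * e - t))); first by rewrite lt_min !subr_gt0 t5.
  move=> r; rewrite lt_min !ltr_norml => /andP[/andP[? ?] /andP[? ?]].
  rewrite /w addrC; case: ifP => // /andP[? ?]; rewrite ud//; lra.
(* One curve reaching [T] is chosen for each [T]; the global solution is the diagonal of this
   family. *)
have [G HG] := choice HP.
have agree T r : (exists a b, [/\ a < 0, 0 < b, a < r, r < b & icurve X (G T) a b]) -> G T r = G r r.
  move=> [a [b [a0 b0 ar rb I1]]]; have [a2 [b2 [a20 b20 ar2 rb2 [G2 I2]]]] := HG r.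
  have [_ [_ [_ _ _ _ [G1 _]]]] := HG T.
  apply: (@icurve_uniq X _ _ (Num.max a a2) (Num.min b b2)).
  - by rewrite gt_max a0.
  - by rewrite lt_min b0.
  - by apply: icurveW I1; rewrite ?le_max ?ge_min lexx.
  - by apply: icurveW I2; rewrite ?le_max ?ge_min lexx ?orbT.
  - by rewrite G1 G2.
  - by rewrite gt_max ar.
  - by rewrite lt_min rb.
exists (fun t => G t t); split; first by have [_ [_ [_ _ _ _ [G0 _]]]] := HG 0.
move=> t; have [a [b [a0 b0 ar rb [G0 I0]]]] := HG t.
apply: has_vel_near (I0 t ar rb).
apply: (@interval_near _ _ _ (Num.min (t - a) (b - t))); first by rewrite lt_min !subr_gt0 ar.
move=> r; rewrite lt_min !ltr_norml => /andP[/andP[? ?] /andP[? ?]].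
by apply: agree; exists a, b; split=> //; lra.
Qed.

Lemma complete_vfP (X : forall p : M, tangent p) : complete_vf X <->
  forall p, exists gam, gam 0 = p /\ forall t, has_vel gam t (X (gam t)).
Proof.
split=> [H p|H p]; have [gam [g0 Hg]] := H p; exists gam; split => //.
  by move=> t; split=> // f; exact: Hg.
by move=> f t; have [_ h] := Hg t; exact: h.
Qed.

(** In coordinates the cut-off field vanishes outside the ball of radius [r / 8]. A trajectory
    cannot leave this ball: at a point outside, the constant curve is a solution, and uniqueness
    would put the starting point there too. *)
Lemma complete_small (p : M) : exists2 W : set M, nbhs p W &
  forall X, (forall q, ~ W q -> X q = 0) -> complete_vf X.
Proof.
have [y [gam [r [V [r0 gyp [oV Vp] yg gy]]]]] := good_coords p.
exists (small_ball p y V (r / 8)).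
  apply: open_nbhs_nbhs; split; first by apply: small_ball_open => //; rewrite divr_gt0.
  by split=> //; rewrite subrr normr0 divr_gt0.
move=> X X0; apply/complete_vfP => q.
have [Wq|nWq] := pselect (small_ball p y V (r / 8) q); last first.
  by exists (fun=> q); split=> // t; rewrite X0//; exact: has_vel_cst.
have [Xt [K [CX [K0 HK] X1 X2 X3]]] := @cutoff_field p y gam r r0 X.
have [F [[F0 dF _] CF]] := flow_joint CX HK.
have Xt0 (x : 'rV[R]_(mdim M)) : r / 8 <= `|x - y p| -> Xt x = 0.
  move=> xr; have [h|h] := leP (r / 2) `|x - y p|; first exact: X2.
  apply/X3/X0 => -[_]; have [|_ ->] := yg x; first by lra.
  by rewrite ltNge xr.
have [Vq yq] := Wq.
have Fr t : `|F t (y q) - y p| < r / 8.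
  rewrite ltNge; apply/negP => h.
  have := @ode_unique R _ Xt (fun s => F (t + s) (y q)) (fun=> F t (y q)) (- `|t| - 1) (`|t| + 1) CX.
  have t0 := normr_ge0 t.
  have d1 : forall s : R, - `|t| - 1 < s -> s < `|t| + 1 -> is_derive s 1 (fun s => F (t + s) (y q)) (Xt (F (t + s) (y q))).
    move=> s _ _; have := @line_is_derive R R _ (fun s => F s (y q)) t 1 s _ _.
    rewrite [s *: 1]mulr1 => /(_ _ (dF (t + s) (y q))).
    by congr is_derive; apply/funext => r'; rewrite [r' *: 1]mulr1.
  have d2 : forall s : R, - `|t| - 1 < s -> s < `|t| + 1 -> is_derive s 1 (fun=> F t (y q)) (Xt (F t (y q))).
    by move=> s _ _; rewrite Xt0//; exact: is_derive_cst.
  have h1 : - `|t| - 1 < 0 by lra.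
  have h2 : 0 < `|t| + 1 by lra.
  move=> /(_ h1 h2 d1 d2); rewrite addr0 => /(_ erefl (- t)); rewrite subrr F0 => E.
  have tn := ler_norm t; have tn' := ler_norm (- t); rewrite normrN in tn'.
  by move: h; rewrite -E; [rewrite leNgt yq|lra|lra].
exists (fun t => gam (F t (y q))); split; first by rewrite F0 gy.
move=> t; apply: (coords_icurve oV yg gy (x := fun s => F s (y q))).
  by apply: lt_trans (Fr t) _; lra.
by have := dF t (y q); rewrite X1//; have := Fr t; lra.
Qed.

End IntegralCurves.

(** * Flows, their smoothness and their action on closed forms *)

Section Flows.
Context (R : realType).
Implicit Types M N : manifold R.

Lemma smap_local M N (h : M -> N) : (forall p : M, exists psi : smap M N, \forall q \near p, h q = psi q) ->
  exists phi : smap M N, phi =1 h.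
Proof.
move=> H; have sh (f : smoothfun N) : smooth (f \o h).
  apply: smooth_local => p; have [psi hpsi] := H p; exists (sf_comp psi f) => //.
  by apply: filterS hpsi => q /= ->.
by exists (SMap sh).
Qed.

Definition is_flow M (X : forall p : M, tangent p) (Fl : R -> M -> M) : Prop :=
  (forall p, Fl 0 p = p) /\ forall p t, has_vel (fun s => Fl s p) t (X (Fl t p)).

Lemma complete_flow M (X : forall p : M, tangent p) : complete_vf X -> exists Fl, is_flow X Fl.
Proof.
move=> /complete_vfP H; have [G HG] := choice H; exists (fun t p => G p t).
by split=> p; have [] := HG p.
Qed.

Section OneFlow.
Context (M : manifold R) (X : vfield M) (Fl : R -> M -> M).
Hypothesis HF : is_flow X Fl.

Lemma flow_eq gam t : (forall t, has_vel gam t (X (gam t))) -> gam t = Fl t (gam 0).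
Proof.
move=> Hg; have [F0 dF] := HF; have tn := ler_norm t; have tn' := ler_norm (- t).
have t0 := normr_ge0 t; rewrite normrN in tn'.
apply: (@icurve_uniq R M X gam (fun s => Fl s (gam 0)) (- `|t| - 1) (`|t| + 1)) => //; try lra.
Qed.

Lemma flow_add s t p : Fl (s + t) p = Fl s (Fl t p).
Proof.
have [F0 dF] := HF; have := @flow_eq (fun r => Fl (t + r) p) s.
rewrite addr0 addrC; apply => r; exact: has_vel_shift (dF p (t + r)).
Qed.

Lemma flowK t : cancel (Fl t) (Fl (- t)).
Proof. by move=> p; rewrite -flow_add addNr; have [->] := HF. Qed.

Lemma flowNK t : cancel (Fl (- t)) (Fl t).
Proof. by move=> p; rewrite -flow_add subrr; have [->] := HF. Qed.

Lemma flow_cont p : continuous (fun t => Fl t p).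
Proof. by move=> t; have [_ dF] := HF; exact: has_vel_cont (dF p t). Qed.

Lemma flow_local_form (p : M) : exists (y : smap M (euclid R (mdim M))) (g : smap (euclid R (1 + mdim M)) M) (e : R) (W : set M),
  [/\ 0 < e, open W, W p &
    forall q t, W q -> `|t| < e -> Fl t q = g (row_mx (const_mx t) (y q))].
Proof.
have [y [g [e [W [e0 oW Wp HW]]]]] := local_flow X p.
exists y, g, e, W; split=> // q t Wq; rewrite ltr_norml => /andP[t1 t2].
have [g0 Ig] := HW q Wq; have [F0 dF] := HF.
apply: (@icurve_uniq R M X (fun t => Fl t q) (fun t => g (row_mx (const_mx t) (y q))) (- e) e) => //; first by lra.
by rewrite F0 g0.
Qed.

Lemma affine_smooth n (c : R) (y : 'rV[R]_n -> R) : Cinfty setT y -> Cinfv setT (fun z : 'rV[R]_n => const_mx (y z + c) : 'rV[R]_1).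
Proof.
move=> Cy i; apply: (@Cinfty_ext R n setT (y + cst c)) => [|x _|k].
- exact: openT.
- by rewrite mxE.
- exact: (Ck_add openT (Cy k) (Ck_cst openT k c)).
Qed.

Lemma row_smap N n m (a : smap N (euclid R n)) (b : smap N (euclid R m)) :
  exists c : smap N (euclid R (n + m)), forall q, c q = row_mx (a q : 'rV[R]_n) (b q).
Proof.
have sm i : smooth (fun q => (row_mx (a q : 'rV[R]_n) (b q) : 'rV[R]_(n + m)) 0 i).
  rewrite -(fintype.splitK i); case: (fintype.split i) => j /=.
    by have := sf_smooth (sf_comp a (ecoord R j)); congr smooth; apply/funext => q; rewrite row_mxEl.
  by have := sf_smooth (sf_comp b (ecoord R j)); congr smooth; apply/funext => q; rewrite row_mxEr.
by exists (SMap (smooth_to_euclid sm)).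
Qed.

(** Flows for short times are smooth by the local form; the group law and induction along the real
    line extend this to all times, along the trajectory of [p]. *)
Lemma flow_near_smap t (p : M) : exists psi : smap M M, \forall q \near p, Fl t q = psi q.
Proof.
have [F0 dF] := HF; move: t; apply: real_ind => [|t].
  exists (SMap (fun f : smoothfun M => sf_smooth f)); near=> q; exact: F0.
have [y [g [e [W [e0 oW Wp HW]]]]] := flow_local_form (Fl t p).
have nW : \forall s \near t, W (Fl s p) by apply: (flow_cont (p := p)); exact: open_nbhs_nbhs.
have [d d0 Hd] := near_interval nW.
exists (Num.min d (e / 2)); first by rewrite lt_min d0 divr_gt0.
move=> s s'; rewrite !lt_min => /andP[sd se] /andP[sd' se'] [psi Hpsi].
have [c cE] := row_smap (to_euclid (fun _ : 'I_1 => sf_cst M (s' - s))) (smap_comp y psi).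
exists (smap_comp g c).
have psip : psi p = Fl s p by rewrite (nbhs_singleton Hpsi).
have nW2 : \forall q \near p, W (psi q).
  by apply: (smap_near (phi := psi)); rewrite psip; apply: open_nbhs_nbhs; split=> //; exact: Hd.
near=> q; have Wq : W (psi q) by near: q.
have Eq : Fl s q = psi q by near: q.
have ss : `|s' - s| < e by move: se se'; rewrite !ltr_norml => /andP[? ?] /andP[? ?]; apply/andP; split; lra.
rewrite -[s'](subrK s) flow_add Eq (HW _ _ Wq ss) /= cE; congr (g (row_mx _ _)).
by apply/rowP => i; rewrite !mxE.
Unshelve. all: by end_near. Qed.

Lemma flow_smap t : exists phi : smap M M, phi =1 Fl t.
Proof. by apply: smap_local => p; exact: flow_near_smap. Qed.

(** Joint smoothness in time and initial point is expressed on Euclidean spaces, with the initial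
    point varying in a family [gam]; in this form it can be iterated over words of flows. *)
Lemma flow_joint_smap k (gam : smap (euclid R k) M) : exists Gam : smap (euclid R (1 + k)) M,
  forall z : 'rV[R]_(1 + k), Gam z = Fl (z 0 0) (gam (rsubmx z)).
Proof.
pose rs : smap (euclid R (1 + k)) (euclid R k) := emap (@Cinfv_rsub R 1 k setT openT).
have [|Gam HG] := @smap_local (euclid R (1 + k)) M (fun z => Fl ((z : 'rV[R]_(1 + k)) 0 0) (gam (rs z))); last first.
  by exists Gam => z; rewrite HG.
move=> z0; set t0 := (z0 : 'rV[R]_(1 + k)) 0 0; set p := gam (rs z0).
have [psi Hpsi] := flow_near_smap t0 p.
have [y [g [e [W [e0 oW Wp HW]]]]] := flow_local_form (Fl t0 p).
have C := @affine_smooth (1 + k) (- t0) (fun z => z 0 0) (fun j => Ck_coord openT j 0).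
have [c cE] := row_smap (emap C) (smap_comp y (smap_comp psi (smap_comp gam rs))).
exists (smap_comp g c).
have psip : psi p = Fl t0 p by rewrite (nbhs_singleton Hpsi).
have n1 : \forall z \near z0, W (psi (gam (rs z))).
  apply: (@smap_near _ _ _ (smap_comp psi (smap_comp gam rs)) z0 W).
  by rewrite /= -/p psip; exact: open_nbhs_nbhs.
have n2 : \forall z \near z0, Fl t0 (gam (rs z)) = psi (gam (rs z)).
  exact: (@smap_near _ _ _ (smap_comp gam rs) z0 (fun q => Fl t0 q = psi q)).
have n3 : \forall z \near z0, `|(z : 'rV[R]_(1 + k)) 0 0 - t0| < e.
  have : {for z0, continuous (fun z : euclid R (1 + k) => (z : 'rV[R]_(1 + k)) 0 0)}.
    exact: (@smooth_near R (euclid R (1 + k)) _ z0 (@coord_smooth R (1 + k) 0)).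
  move=> /(_ [set s | `|s - t0| < e]); apply.
  by apply: (interval_near e0).
near=> z.
have Wz : W (psi (gam (rs z))) by near: z.
have Ez : Fl t0 (gam (rs z)) = psi (gam (rs z)) by near: z.
have tz : `|(z : 'rV[R]_(1 + k)) 0 0 - t0| < e by near: z.
rewrite -[(z : 'rV[R]_(1 + k)) 0 0](subrK t0) flow_add Ez (HW _ _ Wz tz) /= cE.
by congr (g (row_mx _ _)).
Unshelve. all: by end_near. Qed.

End OneFlow.

(** Vectors at provably equal points are compared by their values on functions, which avoids
    transport along the equality. *)
Lemma f2_eq M (F : form2 M) p q (u v : tangent p) (u' v' : tangent q) : p = q ->
  (forall f, u f = u' f) -> (forall f, v f = v' f) -> F p u v = F q u' v'.
Proof. by move=> E; subst q => /tangent_ext -> /tangent_ext ->. Qed.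

Lemma coord_vf_subproof n (i : 'I_n) : smooth_vf (fun x : euclid R n => evec x (delta_mx 0 i)).
Proof.
move=> f; apply/euclid_smooth; have /euclid_smooth Cf := sf_smooth f; exact: (Cinfty_derive i Cf).
Qed.

Definition coord_vf n (i : 'I_n) : vfield (euclid R n) := VField (coord_vf_subproof i).

Lemma coord_vf_comm n (i j : 'I_n) f : lie (coord_vf i) (lie (coord_vf j) f) = lie (coord_vf j) (lie (coord_vf i) f).
Proof.
apply: sf_ext => x; have /euclid_smooth Cf := sf_smooth f.
exact: (Schwarz i j openT (I : setT (x : 'rV[R]_n)) (Cf 2%N)).
Qed.

Lemma coord_vf_bracket n (i j : 'I_n) x : bracket (coord_vf i) (coord_vf j) x = 0.
Proof.
apply: tangent_ext => f; rewrite bracketE tzero.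
by have := congr1 (fun g : smoothfun _ => g x) (coord_vf_comm i j f); rewrite !lieE => ->; rewrite subrr.
Qed.

(* Cartan's formula, applied on R^3 to the pullback of [F] by [(s, x) |-> Fl s (c x)] for a surface [c]. *)
Lemma flow_closed_form M (X : vfield M) Fl (F : form2 M) (H : smoothfun M) : closed_2form F ->
  is_flow X Fl -> (forall p (v : tangent p), F p (X p) v = v H) ->
  forall t (phi : smap M M), phi =1 Fl t -> forall p (u v : tangent p),
  F (phi p) (tmap phi p u) (tmap phi p v) = F p u v.
Proof.
move=> cF HF XH t phi phiE p u v; have [F0 dF] := HF.
have [y [gam [gyp gy _]]] := local_coords p.
pose uu : 'rV[R]_(mdim M) := \row_i u (ycoord y i); pose vv : 'rV[R]_(mdim M) := \row_i v (ycoord y i).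
have C : Cinfv setT (fun w : 'rV[R]_2 => (y p : 'rV[R]_(mdim M)) + (w 0 0 *: uu + w 0 1 *: vv)).
  apply: (Cinfv_add openT (Cinfv_cst _ openT)); apply: (Cinfv_add openT).
    by apply: (Cinfv_scale openT _ (Cinfv_cst _ openT)) => k; apply: Ck_coord; exact: openT.
  by apply: (Cinfv_scale openT _ (Cinfv_cst _ openT)) => k; apply: Ck_coord; exact: openT.
have [Gam HG] := flow_joint_smap HF (smap_comp gam (emap C)).
have {}HG (z : 'rV[R]_3) : Gam z = Fl (z 0 0) (gam ((y p : 'rV[R]_(mdim M)) + (z 0 1 *: uu + z 0 2 *: vv))).
  rewrite HG /=; congr (Fl _ (gam (_ + (_ *: _ + _ *: _)))); rewrite mxE; congr (z _ _); exact: val_inj.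
pose i0 : 'I_3 := 0; pose i1 : 'I_3 := 1; pose i2 : 'I_3 := 2.
have [rB cB] := closed_pull2 Gam cF; set B := pull2 Gam F in rB cB.
have G0 (z : 'rV[R]_3) : tmap Gam z (coord_vf i0 z) = X (Gam z).
  apply: (@has_vel_uniq R M (fun s : R => Gam (z + s *: delta_mx 0 i0)) 0 (Gam z)).
    have := has_vel_line Gam z (delta_mx 0 i0) (0 : R) => -[_ h]; split; first by rewrite scale0r addr0.
    by move=> f; have := h f; congr is_derive; rewrite !dmapE scale0r addr0.
  have := has_vel_shift (dF (gam ((y p : 'rV[R]_(mdim M)) + (z 0 1 *: uu + z 0 2 *: vv))) (z 0 0 + 0)).
  rewrite addr0 -HG; apply: has_vel_near; apply: (interval_near ltr01) => s _.
  by rewrite HG !mxE /= !mulr0 !addr0 mulr1.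
have E0 i : eval2 B (coord_vf i0) (coord_vf i) = lie (coord_vf i) (sf_comp Gam H).
  apply: sf_ext => z; rewrite eval2E// lieE.
  by transitivity (F (Gam z) (tmap Gam z (coord_vf i0 z)) (tmap Gam z (coord_vf i z))); [|rewrite G0 XH].
have dB (x : euclid R 3) : coord_vf i0 x (eval2 B (coord_vf i1) (coord_vf i2)) = 0.
  have := congr1 (fun f : smoothfun _ => f x) (cB (coord_vf i0) (coord_vf i1) (coord_vf i2)).
  rewrite !sfadd !sfopp !E0 coord_vf_comm !lieE !eval2E// !coord_vf_bracket !f2_0L sf0 => h.
  by move: h; rewrite !subr0 addr0; lra.
pose h (s : R) := eval2 B (coord_vf i1) (coord_vf i2) (s *: delta_mx 0 i0 : 'rV[R]_3).
have h0 : h t = h 0.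
  apply: (@is_derive_0_is_cst R _ t 0) => s.
  have [_ D] := has_vel_euclid (is_derive_line (0 : 'rV[R]_3) (delta_mx 0 i0) s).
  have := D (eval2 B (coord_vf i1) (coord_vf i2)); rewrite -[evec _ _]/(coord_vf i0 _) dB.
  by congr is_derive; apply/funext => r; rewrite add0r.
have vel (s : R) (psi : smap M M) (psiE : psi =1 Fl s) (w : tangent p) (i : 'I_3) :
    (forall r : R, let z : 'rV[R]_3 := s *: delta_mx 0 i0 + r *: delta_mx 0 i in z 0 0 = s /\ z 0 1 *: uu + z 0 2 *: vv = r *: \row_j w (ycoord y j)) ->
    forall f, tmap Gam (s *: delta_mx 0 i0 : 'rV[R]_3) (coord_vf i _) f = tmap psi p w f.
  move=> Hz f.
  have h1 := has_vel_line Gam (s *: delta_mx 0 i0 : 'rV[R]_3) (delta_mx 0 i) (0 : R).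
  have h2 : has_vel (fun r : R => gam ((y p : 'rV[R]_(mdim M)) + r *: \row_j w (ycoord y j))) 0 w.
    by apply: (coords_vel gyp gy); [rewrite scale0r addr0|exact: is_derive_line].
  have [_ h3] := has_vel_map psi h2; have [_ {}h1] := h1.
  have h4 : (fun r : R => f (Gam (s *: delta_mx 0 i0 + r *: delta_mx 0 i : 'rV[R]_3))) =
      (fun r : R => f ((psi \o (fun r : R => gam ((y p : 'rV[R]_(mdim M)) + r *: \row_j w (ycoord y j)))) r)).
    by apply/funext => r; have /= [z1 z2] := Hz r; rewrite HG z1 z2 /= psiE.
  have [_ e1] := h1 f; rewrite h4 in e1; have [_ e3] := h3 f.
  by rewrite -[RHS]e3 e1 !dmapE scale0r addr0.
have z1 (s r : R) : let z : 'rV[R]_3 := s *: delta_mx 0 i0 + r *: delta_mx 0 i1 in z 0 0 = s /\ z 0 1 *: uu + z 0 2 *: vv = r *: uu.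
  by rewrite /= !mxE /= !mulr0 !mulr1 !addr0 !add0r scale0r addr0.
have z2 (s r : R) : let z : 'rV[R]_3 := s *: delta_mx 0 i0 + r *: delta_mx 0 i2 in z 0 0 = s /\ z 0 1 *: uu + z 0 2 *: vv = r *: vv.
  by rewrite /= !mxE /= !mulr0 !mulr1 !addr0 !add0r scale0r add0r.
have hE (s : R) (psi : smap M M) (psiE : psi =1 Fl s) : h s = F (psi p) (tmap psi p u) (tmap psi p v).
  rewrite /h eval2E//; set z : 'rV[R]_3 := s *: delta_mx 0 i0.
  transitivity (F (Gam z) (tmap Gam z (coord_vf i1 z)) (tmap Gam z (coord_vf i2 z))) => //; apply: f2_eq.
  - by rewrite HG !mxE /= !mulr0 !mulr1 !scale0r !addr0 gyp psiE.
  - exact: (vel s psi psiE u i1 (z1 s)).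
  - exact: (vel s psi psiE v i2 (z2 s)).
rewrite -(hE t phi phiE) h0 (hE 0 (SMap (fun f : smoothfun M => sf_smooth f))).
  by apply: f2_eq => // f; rewrite dmapE; congr (_ _); exact: sf_ext.
by move=> q; rewrite F0.
Qed.

Lemma smooth_plateau M (f : M -> R) : smooth f -> smooth (fun q => plateau (f q)).
Proof. by move=> sf c cA k; apply: (Ck_plateau (chart_img_open cA)); exact: sf. Qed.

(** A plateau of [4 chi - 4] turns vanishing outside [W] into vanishing near every point outside
    [W]: its argument is 0 where [chi] is 1 and below -2 where [chi] is less than 1/2. *)
Lemma bump_near M (p : M) (W : set M) : nbhs p W -> exists chi : smoothfun M,
  (\forall q \near p, chi q = 1) /\ forall q, ~ W q -> \forall r \near q, chi r = 0.
Proof.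
move=> nW; have [chi [c1 c0]] := bump_manifold nW.
have sg : smooth (fun q => 4 * chi q - 4) := sf_smooth (4 *: chi - sf_cst M 4).
exists (mk_sf (smooth_plateau sg)); split=> [|q nWq].
  by apply: filterS c1 => q cq /=; rewrite plateau1// cq mulr1 subrr normr0.
have : \forall r \near q, chi r < 2^-1.
  have sc := @smooth_near R M _ q (sf_smooth chi).
  by apply: (cvgr_lt _ sc); rewrite c0.
by apply: filterS => r cr /=; rewrite plateau0// ler0_norm; lra.
Qed.

(** The Hamiltonian field of the cut-off function vanishes outside a neighbourhood so small that
    every field supported in it is complete. *)
Lemma ham_complete M (Q : bivector M) : (forall f, smooth_vf (ham Q f)) ->
  forall (p : M) (f : smoothfun M), exists g : smoothfun M,
    complete_vf (ham Q g) /\ \forall q \near p, g q = f q.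
Proof.
move=> sQ p f; have [W nW HW] := complete_small p.
have [chi [c1 c0]] := bump_near nW.
exists (chi * f); split; last by apply: filterS c1 => q cq; rewrite sfmul cq mul1r.
apply: (HW (VField (sQ (chi * f)))) => q nWq /=.
rewrite /ham (_ : differential q _ = 0) ?linear0//.
apply: dual_ext => v; rewrite dzero; transitivity (v (chi * f)) => //.
by apply: (@tg_cst R M q v _ 0); apply: filterS (c0 q nWq) => r cr; rewrite sfmul cr mul0r.
Qed.

End Flows.

(** * Symplectic groupoids *)

Section Lifts.
Context (R : realType).
Implicit Types M N : manifold R.

Definition id_smap M : smap M M := SMap (fun f : smoothfun M => sf_smooth f).

Lemma cst_smooth M N (q : N) (f : smoothfun N) : @smooth R M (f \o fun=> q).
Proof. exact: smooth_cst. Qed.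
Definition cst_smap M N (q : N) : smap M N := SMap (@cst_smooth M N q).

Lemma has_vel_pt M (gam : R -> M) t q (u : tangent q) : has_vel gam t u -> gam t = q.
Proof. by case. Qed.

Lemma vel_fun_eq M N (gam : R -> M) (gam' : R -> N) t q q' (u : tangent q) (u' : tangent q') (f : smoothfun M) (f' : smoothfun N) :
  has_vel gam t u -> has_vel gam' t u' -> (forall r, f (gam r) = f' (gam' r)) -> u f = u' f'.
Proof.
move=> [_ h] [_ h'] E; have [_ <-] := h f; have [_ <-] := h' f'.
by congr ('D__ _ _); apply/funext => r; exact: E.
Qed.

Lemma vel_at M (c : smap (euclid R 1) M) t q : c (pt t) = q -> exists u : tangent q, has_vel (c \o @pt R) t u.
Proof. by move=> <-; exists (cvel c t); exact: cvelP. Qed.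

Lemma has_vel_comp M (c : smap (euclid R 1) M) (th : smap (euclid R 1) (euclid R 1)) t q (u : tangent q) :
  (\forall s \near t, th (pt s) = pt s) -> has_vel (c \o @pt R) t u -> has_vel (smap_comp c th \o @pt R) t u.
Proof. by move=> h; apply: has_vel_near; apply: filterS h => s /= ->. Qed.

(** The local lift is reparametrised into the interval where it lifts [b], so that the relation
    holds on the whole line, up to [th]. *)
Lemma lift_global M N (s : smap M N) (g : M) (u : tangent g) (b : smap (euclid R 1) N) :
  (forall w : tangent (s g), exists v, tmap s g v = w) -> has_vel (b \o @pt R) 0 (tmap s g u) ->
  exists (c : smap (euclid R 1) M) (th : smap (euclid R 1) (euclid R 1)),
    [/\ has_vel (c \o @pt R) 0 u, \forall t \near (0 : R), th (pt t) = pt t & forall x, s (c x) = b (th x)].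
Proof.
move=> surj hb; have [c [hc [r r0 Hr]]] := lift_curve surj hb.
have [th [th1 th2]] := reparam r0.
have nth : \forall t \near (0 : R), th (pt t) = pt t.
  by apply: (@interval_near _ _ _ (r / 4)) => [|t]; [rewrite divr_gt0|rewrite subr0; exact: th2].
exists (smap_comp c th), th; split=> // [|x]; first exact: has_vel_comp.
by rewrite /= -(ptE (th x)); apply: Hr; exact: th1.
Qed.

Lemma lift_const M N (s : smap M N) (g : M) (u : tangent g) :
  (forall w : tangent (s g), exists v, tmap s g v = w) -> tmap s g u = 0 ->
  exists c : smap (euclid R 1) M, has_vel (c \o @pt R) 0 u /\ forall x, s (c x) = s g.
Proof.
move=> surj su; have [|c [th [hc _ Hc]]] := @lift_global _ _ s g u (cst_smap _ (s g)) surj.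
  by rewrite su; exact: has_vel_cst.
by exists c.
Qed.

Lemma ann_ker (V W : lmodType R) (A : {linear V -> W}) (l : dual V) : (forall w, exists v, A v = w) ->
  (forall v, A v = 0 -> l v = 0) -> exists m : dual W, l = transp A m.
Proof.
move=> surj kl; have [g Ag] := choice surj.
have lA v v' : A v = A v' -> l v = l v'.
  move=> E; apply/eqP; rewrite -subr_eq0 -dualB; apply/eqP/kl.
  by rewrite linearB E subrr.
have mP : (fun w => l (g w)) \in @dual_pred R W.
  by apply/asboolP => a u v; rewrite -dualP; apply: lA; rewrite linearP !Ag.
exists (Dual mP); apply: dual_ext => v; apply: lA; by rewrite Ag.
Qed.

Definition real_poisson M N (phi : smap M N) (QM : bivector M) (QN : bivector N) : Prop :=
  forall p (xi : cotangent (phi p)), tmap phi p (QM p (transp (tmap phi p) xi)) = QN (phi p) xi.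

Lemma transp_differential M N (phi : smap M N) p (f : smoothfun N) :
  transp (tmap phi p) (differential (phi p) f) = differential p (sf_comp phi f).
Proof. exact: dual_ext. Qed.

Lemma real_poisson_ham M N (phi : smap M N) (QM : bivector M) (QN : bivector N) p f :
  real_poisson phi QM QN -> tmap phi p (ham QM (sf_comp phi f) p) = ham QN f (phi p).
Proof. by move=> H; rewrite /ham -transp_differential H. Qed.

Lemma complete_opp M (Q : bivector M) f : complete_vf (ham (opp_bivector Q) f) -> complete_vf (ham Q f).
Proof.
move=> /complete_vfP H; apply/complete_vfP => p; have [gam [g0 Hg]] := H p.
exists (fun s => gam (s * -1)); split=> [|t]; first by rewrite mul0r.
have := has_vel_scale (Hg (t * -1)); rewrite /ham /opp_bivector /=.
by rewrite scalerA mulrNN mulr1 scale1r.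
Qed.

Lemma f2_nondeg M (om : form2 M) (Q : bivector M) p (u v : tangent p) : inverse_bivector Q om ->
  (forall w, om p u w = om p v w) -> u = v.
Proof.
move=> HQ h; have [K _] := HQ p; rewrite -[u]K -[v]K; congr (Q p _); exact: dual_ext.
Qed.

Lemma f2_ham M (om : form2 M) (Q : bivector M) p f (w : tangent p) : inverse_bivector Q om ->
  om p (ham Q f p) w = w f.
Proof. by move=> HQ; have [_ K] := HQ p; rewrite /ham K. Qed.

Lemma tmap_id M (p : M) (h : smap M M) (v : tangent p) f : (forall q, h q = q) -> tmap h p v f = v f.
Proof. by move=> H; rewrite dmapE; congr (v _); apply: sf_ext => q /=; rewrite H. Qed.

End Lifts.

Lemma within_comp (T U V : topologicalType) (B : set T) (f : T -> U) (g : U -> V) :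
  {within B, continuous f} -> continuous g -> {within B, continuous g \o f}.
Proof. by move=> cf cg x; exact: (@continuous_comp (subspace B) U V f g x (cf x) (cg (f x))). Qed.

(** * Lie groupoids and multiplicative forms *)

Section LieGroupoids.
Context (R : realType) (M : manifold R) (G : groupoid M).
Hypothesis LG : lie_groupoid G.
Local Notation A := (gr_arrows G).
Local Notation s := (gr_s G).
Local Notation t := (gr_t G).
Local Notation e := (gr_unit G).
Local Notation i := (gr_inv G).
Local Notation p1 := (gr_p1 G).
Local Notation p2 := (gr_p2 G).
Local Notation m := (gr_mul G).
Implicit Types g h k : A.

(** Products as a ternary relation on arrows, so that later statements need not name a composable
    pair. *)
Definition gprod g h k := exists q, [/\ p1 q = g, p2 q = h & m q = k].

Lemma s_surj g (w : tangent (s g)) : exists v, tmap s g v = w.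
Proof. by have [[[_ H] _] _ _ _ _] := LG; exact: H. Qed.
Lemma t_surj g (w : tangent (t g)) : exists v, tmap t g v = w.
Proof. by have [[_ [_ H]] _ _ _ _] := LG; exact: H. Qed.
Lemma s_unit x : s (e x) = x. Proof. by have [_ _ _ [H _ _ _] _] := LG. Qed.
Lemma t_unit x : t (e x) = x. Proof. by have [_ _ _ [_ H _ _] _] := LG. Qed.
Lemma s_inv g : s (i g) = t g. Proof. by have [_ _ _ _ [H _ _ _]] := LG. Qed.
Lemma t_inv g : t (i g) = s g. Proof. by have [_ _ _ _ [_ H _ _]] := LG. Qed.

(** Points are maps from [euclid R 0], on which the uniqueness part of the fibre product is
    tested. *)
Lemma pairs_uniq q q' : p1 q = p1 q' -> p2 q = p2 q' -> q = q'.
Proof.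
move=> h1 h2; have [_ [sp U] _ _ _] := LG.
have [|c [_ _ Hc]] := U (euclid R 0) (cst_smap _ (p1 q)) (cst_smap _ (p2 q)); first by move=> x; exact: sp.
have E1 := Hc (cst_smap _ q) (fun _ => erefl) (fun _ => erefl).
have E2 := Hc (cst_smap _ q') (fun _ => esym h1) (fun _ => esym h2).
by have := E1 0; rewrite -E2.
Qed.

Lemma gprod_curve (N : manifold R) (a b : smap N A) : (forall x, s (a x) = t (b x)) ->
  exists k : smap N A, forall x, gprod (a x) (b x) (k x).
Proof.
move=> sab; have [_ [sp U] _ _ _] := LG; have [c [c1 c2 _]] := U N a b sab.
exists (smap_comp m c) => x; exists (c x); split=> //; [exact: c1|exact: c2].
Qed.

Lemma gprod_exists g h : s g = t h -> exists k, gprod g h k.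
Proof.
move=> sgh; have [|k Hk] := @gprod_curve (euclid R 0) (cst_smap _ g) (cst_smap _ h); first by [].
by exists (k 0); exact: Hk.
Qed.

Lemma gprod_uniq g h k k' : gprod g h k -> gprod g h k' -> k = k'.
Proof. by move=> [q [<- <- <-]] [q' [h1 h2 <-]]; rewrite (@pairs_uniq q' q). Qed.

Lemma gprod_st g h k : gprod g h k -> [/\ s g = t h, s k = s h & t k = t g].
Proof. by move=> [q [<- <- <-]]; have [_ [sp _] [sm tm _] _ _] := LG; split=> //; exact: sp. Qed.

Lemma gprod_assoc g h k a b c : gprod g h a -> gprod h k b -> gprod a k c -> gprod g b c.
Proof.
move=> gh hk ak; have [st1 sa _] := gprod_st gh; have [_ _ tb] := gprod_st hk.
have [|c' gb] := @gprod_exists g b; first by rewrite tb.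
suff -> : c = c' by [].
move: gh hk ak gb => [q [q1 q2 q3]] [q' [q1' q2' q3']] [r [r1 r2 <-]] [r' [r1' r2' <-]].
by have [_ _ [_ _ H] _ _] := LG; apply: (H q q'); rewrite ?q1 ?q2 ?q3 ?q1' ?q2' ?q3' ?r1 ?r2 ?r1' ?r2'.
Qed.

Lemma gprod_unitl g : gprod (e (t g)) g g.
Proof.
have [k gk] := gprod_exists (s_unit (t g)); have [_ _ _ [_ _ H _] _] := LG.
by move: gk (gk) => [q [q1 q2 qk]] gk; rewrite -[X in gprod _ _ X]q2 -(H q) ?q1 ?q2// qk.
Qed.

Lemma gprod_unitr g : gprod g (e (s g)) g.
Proof.
have [k gk] := gprod_exists (esym (t_unit (s g))); have [_ _ _ [_ _ _ H] _] := LG.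
by move: gk (gk) => [q [q1 q2 qk]] gk; rewrite -[X in gprod _ _ X]q1 -(H q) ?q1 ?q2// qk.
Qed.

Lemma gprod_invr g : gprod g (i g) (e (t g)).
Proof.
have [k gk] := gprod_exists (esym (t_inv g)); have [_ _ _ _ [_ _ H _]] := LG.
by move: gk (gk) => [q [q1 q2 qk]] gk; rewrite -[in e _]q1 -(H q) ?q1 ?q2// qk.
Qed.

Lemma gprod_invl g : gprod (i g) g (e (s g)).
Proof.
have [k gk] := gprod_exists (s_inv g); have [_ _ _ _ [_ _ _ H]] := LG.
by move: gk (gk) => [q [q1 q2 qk]] gk; rewrite -[in e _]q2 -(H q) ?q1 ?q2// qk.
Qed.

Lemma gr_invK g : i (i g) = g.
Proof.
have h1 := gprod_unitl (i (i g)); rewrite t_inv s_inv in h1.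
have h2 := gprod_invr (i g); rewrite t_inv in h2.
exact: (gprod_uniq (gprod_assoc (gprod_invr g) h2 h1) (gprod_unitr g)).
Qed.

Lemma gprod_cancel g h a : gprod g (i h) a -> gprod a h g.
Proof.
move=> gh; have [sg sa _] := gprod_st gh; rewrite t_inv in sg; rewrite s_inv in sa.
have [c ac] := gprod_exists sa.
have := gprod_assoc gh (gprod_invl h) ac; rewrite -sg => /gprod_uniq/(_ (gprod_unitr g)) E.
by rewrite E in ac.
Qed.

Lemma gprod_div g h k : gprod g h k -> gprod k (i h) g.
Proof.
move=> gh; have [sg sk _] := gprod_st gh.
have [|c kc] := @gprod_exists k (i h); first by rewrite t_inv.
have := gprod_assoc gh (gprod_invr h) kc; rewrite -sg => /gprod_uniq/(_ (gprod_unitr g)) E.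
by rewrite E in kc.
Qed.

Section Multiplicative.
Context (F : form2 A).
Hypothesis mF : Defs.multiplicative F.

(** Curves of products stand for tangent vectors to the composable pairs, which lets
    multiplicativity be applied without describing the tangent spaces of [gr_pairs G]. *)
Lemma mult_curves (a b k a' b' k' : smap (euclid R 1) A) g h l (u u' : tangent g) (v v' : tangent h) (w w' : tangent l) :
  (forall x, gprod (a x) (b x) (k x)) -> (forall x, gprod (a' x) (b' x) (k' x)) ->
  has_vel (a \o @pt R) 0 u -> has_vel (b \o @pt R) 0 v -> has_vel (k \o @pt R) 0 w ->
  has_vel (a' \o @pt R) 0 u' -> has_vel (b' \o @pt R) 0 v' -> has_vel (k' \o @pt R) 0 w' ->
  F l w w' = F g u u' + F h v v'.
Proof.
move=> P1 P2 ua vb wk ua' vb' wk'; have [_ [sp U] _ _ _] := LG.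
have Pc (a0 b0 k0 : smap (euclid R 1) A) : (forall x, gprod (a0 x) (b0 x) (k0 x)) ->
    exists c : smap (euclid R 1) (gr_pairs G), [/\ p1 \o c =1 a0, p2 \o c =1 b0 & m \o c =1 k0].
  move=> P; have [|c [c1 c2 _]] := U _ a0 b0; first by move=> x; have [] := gprod_st (P x).
  exists c; split=> // x; apply: gprod_uniq (P x); exists (c x); split=> //; [exact: c1|exact: c2].
have [c [c1 c2 c3]] := Pc a b k P1; have [c' [c1' c2' c3']] := Pc a' b' k' P2.
have [q [q1 q2 q3]] : exists q, [/\ p1 q = g, p2 q = h & c (pt 0) = q].
  exists (c (pt 0)); split=> //; first exact: etrans (c1 _) (has_vel_pt ua).
  exact: etrans (c2 _) (has_vel_pt vb).
have q3' : c' (pt 0) = q.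
  apply: pairs_uniq; first by rewrite q1; exact: etrans (c1' _) (has_vel_pt ua').
  by rewrite q2; exact: etrans (c2' _) (has_vel_pt vb').
have [z hz] := vel_at q3; have [z' hz'] := vel_at q3'.
have ev (n : smap (gr_pairs G) A) (d : smap (euclid R 1) (gr_pairs G)) (d0 : smap (euclid R 1) A) (x : tangent q) r (y : tangent r) :
    n \o d =1 d0 -> has_vel (d \o @pt R) 0 x -> has_vel (d0 \o @pt R) 0 y -> forall f, y f = tmap n q x f.
  move=> E hx hy f; apply: (vel_fun_eq hy (has_vel_map n hx)) => r'.
  by exact: (congr1 f (esym (E (pt r')))).
have mq : m q = l by rewrite -(has_vel_pt wk) -q3; exact: c3.
have E : F (m q) (tmap m q z) (tmap m q z') = F (p1 q) (tmap p1 q z) (tmap p1 q z') + F (p2 q) (tmap p2 q z) (tmap p2 q z').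
  exact: (congr1 (fun l : cotangent q => l z') (@mF q z)).
rewrite (@f2_eq R A F g (p1 q) u u' (tmap p1 q z) (tmap p1 q z')) ?q1//; last 2 first.
- exact: ev c1 hz ua.
- exact: ev c1' hz' ua'.
rewrite (@f2_eq R A F h (p2 q) v v' (tmap p2 q z) (tmap p2 q z')) ?q2//; last 2 first.
- exact: ev c2 hz vb.
- exact: ev c2' hz' vb'.
rewrite -E; apply: f2_eq => //; first exact: ev c3 hz wk.
exact: ev c3' hz' wk'.
Qed.

(** A unit is its own square, so multiplicativity makes the value equal to twice itself. *)
Lemma mult_unit x (u v : tangent x) : F (e x) (tmap e x u) (tmap e x v) = 0.
Proof.
have [c hc] := curve_exists u; have [d hd] := curve_exists v.
have P (a : smap (euclid R 1) M) y : gprod (smap_comp e a y) (smap_comp e a y) (smap_comp e a y).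
  by have := gprod_unitl (e (a y)); rewrite t_unit.
have uc := has_vel_map e hc; have ud := has_vel_map e hd.
have := mult_curves (P c) (P d) uc uc uc ud ud ud; lra.
Qed.

(** Multiply a curve by its inverse: the result is a curve of units, on which the form vanishes. *)
Lemma mult_inv g (u v : tangent g) : F (i g) (tmap i g u) (tmap i g v) = - F g u v.
Proof.
have [c hc] := curve_exists u; have [d hd] := curve_exists v.
have P (a : smap (euclid R 1) A) y : gprod (a y) (smap_comp i a y) (smap_comp e (smap_comp t a) y).
  exact: gprod_invr.
have := mult_curves (P c) (P d) hc (has_vel_map i hc) (has_vel_map e (has_vel_map t hc))
  hd (has_vel_map i hd) (has_vel_map e (has_vel_map t hd)).
by rewrite mult_unit; lra.
Qed.

(** A curve in an s-fibre is [a x] times the fixed arrow [g], and one in a t-fibre is a fixed unit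
    times [d x]. In each factor one of the two curves is constant. *)
Lemma mult_orth g (u v : tangent g) : tmap s g u = 0 -> tmap t g v = 0 -> F g u v = 0.
Proof.
move=> su tv; have [c [hc sc]] := lift_const (@s_surj g) su; have [d [hd td]] := lift_const (@t_surj g) tv.
have [|a Ha] := @gprod_curve _ c (cst_smap _ (i g)); first by move=> x; rewrite sc /= t_inv.
have P1 x : gprod (a x) (cst_smap (euclid R 1) g x) (c x) by exact: gprod_cancel (Ha x).
have P2 x : gprod (cst_smap (euclid R 1) (e (t g)) x) (d x) (d x) by rewrite -(td x); exact: gprod_unitl.
have c0 : c (pt 0) = g := has_vel_pt hc.
have [|u' hu'] := @vel_at _ _ a 0 (e (t g)).
  by apply: gprod_uniq (Ha (pt 0)) _; rewrite c0; exact: gprod_invr.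
have z (q : A) : has_vel (cst_smap (euclid R 1) q \o @pt R) 0 (0 : tangent q) by exact: has_vel_cst.
rewrite (mult_curves P1 P2 hu' (z g) hc (z _) hd hd) dual0 f2_0L addr0 //.
Qed.

End Multiplicative.

(** * Hamiltonian fields on a symplectic groupoid *)

Section Symplectic.
Context (om : form2 A) (QG : bivector A).
Hypotheses (mom : Defs.multiplicative om) (com : closed_2form om) (HQ : inverse_bivector QG om).

Let vf f : vfield A := VField (ham_smooth f com.1 HQ).

(** Write the curve [c] with velocity [X] as [c] times its source units, and pair it with a product
    of [a] and [d], where [d] leaves the unit at [s g] in an arbitrary direction [w']. The product
    and its left factor pair with [X] to the same number, because [t] ignores the right factor; so
    the source part of [X] pairs to 0 with [w']. *)
Lemma s_ham_t f g : tmap s g (ham QG (sf_comp t f) g) = 0.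
Proof.
set X := ham QG _ g; have [c hc] := curve_exists X.
suff E : tmap e (s g) (tmap s g X) = 0.
  apply: tangent_ext => h; rewrite tzero.
  have := congr1 (fun w : tangent (e (s g)) => w (sf_comp s h)) E; rewrite tzero => <-.
  by rewrite !dmapE; congr (X _); apply: sf_ext => q /=; rewrite s_unit.
apply: (f2_nondeg HQ) => w'; rewrite f2_0L.
have [d hd] := curve_exists w'.
have d0 : d (pt 0) = e (s g) := has_vel_pt hd.
have td0 : t (d (pt 0)) = s g by rewrite d0 t_unit.
have [b hb] : exists b : tangent (s g), has_vel (smap_comp t d \o @pt R) 0 b by exact: vel_at.
have [u su] := s_surj b.
have [|a [th [ha nth sa]]] := @lift_global _ _ _ s g u (smap_comp t d) (@s_surj g); first by rewrite su.
have [k Hk] := @gprod_curve _ a (smap_comp d th) (fun x => sa x).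
have hd' := has_vel_comp nth hd.
have P1 x : gprod (c x) (smap_comp e (smap_comp s c) x) (c x) by exact: gprod_unitr.
have k0 : k (pt 0) = g.
  apply: gprod_uniq (Hk (pt 0)) _; rewrite (has_vel_pt ha : a (pt 0) = g) (has_vel_pt hd' : smap_comp d th (pt 0) = _).
  exact: gprod_unitr.
have [w hw] := vel_at k0.
have := mult_curves mom P1 Hk hc (has_vel_map e (has_vel_map s hc)) hc ha hd' hw.
rewrite !f2_ham//.
suff -> : w (sf_comp t f) = u (sf_comp t f) by lra.
by apply: (vel_fun_eq hw ha) => r /=; have [_ _ ->] := gprod_st (Hk (pt r)).
Qed.

(** Inversion reverses the sign of [om] and exchanges [s] and [t]. *)
Lemma ham_s_inv f g : ham QG (sf_comp s f) (i g) = - tmap i g (ham QG (sf_comp t f) g).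
Proof.
apply: (f2_nondeg HQ) => w; rewrite f2_ham// f2NL.
pose w0 : tangent g := dmap (gr_invK g) w.
have -> : w = tmap i g w0.
  by apply: tangent_ext => h; rewrite !dmapE; congr (w _); apply: sf_ext => q /=; rewrite gr_invK.
rewrite mult_inv// f2_ham// opprK dmapE; congr (w0 _); apply: sf_ext => q /=; by rewrite s_inv.
Qed.

Lemma t_ham_s f g : tmap t g (ham QG (sf_comp s f) g) = 0.
Proof.
suff H : tmap t (i (i g)) (ham QG (sf_comp s f) (i (i g))) = 0 by rewrite gr_invK in H.
rewrite ham_s_inv linearN; apply/eqP; rewrite oppr_eq0; apply/eqP.
apply: tangent_ext => h; rewrite tzero.
have := congr1 (fun w : tangent (s (i g)) => w h) (s_ham_t f (i g)); rewrite tzero => <-.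
by rewrite !dmapE; congr (_ _); apply: sf_ext => q /=; rewrite t_inv.
Qed.

(** A vector orthogonal to the t-fibre corresponds under [om] to a covector pulled back by [t], so
    it is the value of the Hamiltonian field of some [t^* f], which is tangent to the s-fibres. *)
Lemma ker_s g (u : tangent g) : tmap s g u = 0 <-> forall v, tmap t g v = 0 -> om g u v = 0.
Proof.
split=> [su v tv|H]; first exact: (mult_orth mom).
have [xi xiE] := ann_ker (@t_surj g) H; have [f fE] := covector_differential xi.
rewrite -(proj1 (HQ g) u) xiE fE transp_differential; exact: s_ham_t.
Qed.

Lemma ker_t g (u : tangent g) : tmap t g u = 0 <-> forall v, tmap s g v = 0 -> om g u v = 0.
Proof.
split=> [tu v sv|H]; first by rewrite (f2_alt _ _ com.1) (mult_orth mom) ?oppr0.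
have [xi xiE] := ann_ker (@s_surj g) H; have [f fE] := covector_differential xi.
rewrite -(proj1 (HQ g) u) xiE fE transp_differential; exact: t_ham_s.
Qed.

(** Subtracting vectors tangent to the units makes [u] vertical for [s] and [w] vertical for [t],
    and vertical vectors of the two kinds are orthogonal. *)
Lemma unit_lagrangian : lagrangian om e.
Proof.
move=> x u; split=> [H|[v ->] w]; last exact: (mult_unit mom).
pose v0 : tangent x := dmap (s_unit x) u; exists v0; apply: (f2_nondeg HQ) => w.
have su : tmap s (e x) (u - tmap e x v0) = 0.
  apply: tangent_ext => h; rewrite tzero !dmapE tadd topp !dmapE; apply/eqP; rewrite subr_eq0; apply/eqP.
  by congr (u _); apply: sf_ext => q /=; rewrite s_unit.
pose w0 : tangent x := dmap (t_unit x) w.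
have tw : tmap t (e x) (w - tmap e x w0) = 0.
  apply: tangent_ext => h; rewrite tzero !dmapE tadd topp !dmapE; apply/eqP; rewrite subr_eq0; apply/eqP.
  by congr (w _); apply: sf_ext => q /=; rewrite t_unit.
have := mult_orth mom su tw; rewrite f2DL f2NL !dualB H mult_unit//; lra.
Qed.

(** Split a curve with velocity [w] as a product of [a] and [b']. Right translation adds nothing to
    [om], so the value at the product is that at the left factor, a derivative of [t^* f]; and [t]
    is the same on the product and on the left factor. *)
Lemma ham_right_invariant f (c k : smap (euclid R 1) A) g h l (u : tangent l) :
  (forall x, gprod (c x) h (k x)) -> has_vel (c \o @pt R) 0 (ham QG (sf_comp t f) g) ->
  has_vel (k \o @pt R) 0 u -> u = ham QG (sf_comp t f) l.
Proof.
move=> Pc hc hk; apply: (f2_nondeg HQ) => w; rewrite f2_ham//.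
have gl : gprod g h l by have := Pc (pt 0); rewrite (has_vel_pt hc : c (pt 0) = g) (has_vel_pt hk : k (pt 0) = l).
have [sg sl tl] := gprod_st gl.
have [d hd] := curve_exists w.
have sd0 : s (d (pt 0)) = s h by rewrite (has_vel_pt hd : d (pt 0) = l).
have [b hb] : exists b : tangent (s h), has_vel (smap_comp s d \o @pt R) 0 b by exact: vel_at.
have [v sv] := s_surj b.
have [|b' [th [hb' nth sb']]] := @lift_global _ _ _ s h v (smap_comp s d) (@s_surj h); first by rewrite sv.
have hd' := has_vel_comp nth hd.
have [|a Ha] := @gprod_curve _ (smap_comp d th) (smap_comp i b').
  by move=> x; rewrite /= t_inv sb'.
have P2 x : gprod (a x) (b' x) (smap_comp d th x) by exact: gprod_cancel (Ha x).
have a0 : a (pt 0) = g.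
  apply: gprod_uniq (Ha (pt 0)) _; rewrite (has_vel_pt hd' : smap_comp d th (pt 0) = l) /=.
  by rewrite (has_vel_pt hb' : b' (pt 0) = h); exact: gprod_div.
have [w' hw'] := vel_at a0.
have zh : has_vel (cst_smap (euclid R 1) h \o @pt R) 0 (0 : tangent h) by exact: has_vel_cst.
rewrite (mult_curves mom (b := cst_smap _ h) Pc P2 hc zh hk hw' hb' hd') f2_0L addr0 f2_ham//.
by apply: (vel_fun_eq hw' hd') => r /=; have [_ _ E] := gprod_st (P2 (pt r)); exact: (congr1 f (esym E)).
Qed.

Lemma ham_t_translate f (c k : smap (euclid R 1) A) h r :
  (forall x, gprod (c x) h (k x)) -> has_vel (c \o @pt R) r (ham QG (sf_comp t f) (c (pt r))) ->
  has_vel (k \o @pt R) r (ham QG (sf_comp t f) (k (pt r))).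
Proof.
move=> Pc hc.
have C : Cinfv setT (fun x : 'rV[R]_1 => const_mx r + x).
  exact: (Cinfv_add openT (Cinfv_cst _ openT) (Cinfv_id openT)).
have E x : emap C (pt x) = pt (r + x) by apply/rowP => j; rewrite !mxE.
have sh (d : smap (euclid R 1) A) q (u : tangent q) : has_vel (d \o @pt R) r u -> has_vel (smap_comp d (emap C) \o @pt R) 0 u.
  move=> hd; have := @has_vel_shift R A (d \o @pt R) r 0 q u; rewrite addr0 => /(_ hd).
  by apply: has_vel_near; apply: (interval_near ltr01) => x _; rewrite /= -E.
have [u hu] := @vel_at _ _ k r (k (pt r)) erefl.
have -> : ham QG (sf_comp t f) (k (pt r)) = u; last by [].
apply/esym; apply: (@ham_right_invariant f (smap_comp c (emap C)) (smap_comp k (emap C)) _ h _ u _ (sh _ _ _ hc) (sh _ _ _ hu)) => x.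
exact: Pc.
Qed.

Context (Q : bivector M).
Hypothesis tP : real_poisson t QG Q.
Hypothesis sQ : forall f, smooth_vf (ham Q f).

(** A trajectory stays in an s-fibre and over a flow line on the base. Near the unit at
    [Fl T (t g0)] all trajectories live for a common time [e1]; right translation by [gam r] moves
    the one that starts at the unit over [Fl r (t g0)] to a continuation of the given one. *)
Lemma complete_ham_t f : complete_vf (ham Q f) -> complete_vf (ham QG (sf_comp t f)).
Proof.
move=> cf; pose X : vfield A := VField (ham_smooth (sf_comp t f) com.1 HQ).
pose X0 : vfield M := VField (sQ f).
have [Fl [F0 dF]] := complete_flow cf.
have tX (gam : R -> A) r : has_vel gam r (X (gam r)) -> has_vel (t \o gam) r (X0 (t (gam r))).
  by move=> /(has_vel_map t); rewrite (real_poisson_ham _ f tP).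
have sX (gam : R -> A) a b : a < 0 -> 0 < b -> icurve X gam a b -> forall r, a < r -> r < b -> s (gam r) = s (gam 0).
  move=> a0 b0 Hg.
  have z0 : smooth_vf (fun p : M => 0 : tangent p) by move=> h; exact: smooth_cst.
  apply: (@icurve_uniq R M (VField z0) (s \o gam) (fun=> s (gam 0)) a b) => //.
  - move=> r r1 r2 /=; have := has_vel_map s (Hg r r1 r2); rewrite [X in has_vel _ _ X](s_ham_t f) //.
  - by move=> r _ _; exact: has_vel_cst.
apply/complete_vfP => g0; apply: (@icurve_extend R A X) => T.
have [y [gl [e1 [W [e10 oW We HW]]]]] := local_flow X (e (Fl T (t g0))).
have nW : \forall r \near T, W (e (Fl r (t g0))).
  have c1 : {for T, continuous (fun r => Fl r (t g0))} by exact: has_vel_cont (dF (t g0) T).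
  have nn : nbhs (Fl T (t g0)) [set p | W (e p)] by apply: (@smap_near _ _ _ e _ W); exact: open_nbhs_nbhs.
  exact: c1 nn.
have [d d0 Hd] := near_interval nW.
have [th [th1 th2]] := reparam e10.
(* For times up to twice this amount [th] is still the identity, so the translated curve is an
   integral curve there. *)
exists (Num.min d (e1 / 8)); first by rewrite lt_min d0 divr_gt0.
move=> r gam a b rT a0 b0 ar rb g0E Hg.
have tg : t (gam r) = Fl r (t g0).
  apply: (@icurve_uniq R M X0 (t \o gam) (fun r => Fl r (t g0)) a b) => //.
  - by move=> r' r1 r2; apply: tX; exact: Hg.
  - by rewrite /= g0E F0.
set q := e (Fl r (t g0)) in tg *.
have Wq : W q by apply: Hd; move: rT; rewrite lt_min => /andP[].
have [gq Iq] := HW q Wq.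
have [c cE] := row_smap th (cst_smap _ (y q)).
pose cc := smap_comp gl c.
have scc x : s (cc x) = t (gam r).
  rewrite /cc /= cE -[X in row_mx X _]ptE.
  have /ltr_normlP[h1 h2] := th1 x.
  have := sX _ (- e1) e1 _ e10 Iq (((th x : 'rV[R]_1)) 0 0); rewrite gq /q s_unit tg; apply; lra.
have [k Hk] := @gprod_curve _ cc (cst_smap _ (gam r)) scc.
exists (k \o @pt R).
  have E : cc (pt 0) = e (t (gam r)).
    rewrite /cc /= cE th2 ?normr0 ?divr_gt0//= [pt 0]/(const_mx 0) gq /q tg //.
  by apply: gprod_uniq (Hk (pt 0)) _; rewrite E; exact: gprod_unitl.
move=> r' r1 r2; apply: (ham_t_translate Hk).
have me : 2 * Num.min d (e1 / 8) <= e1 / 4.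
  have : Num.min d (e1 / 8) <= e1 / 8 by rewrite ge_min lexx orbT.
  by lra.
have r'1 : `|r'| < e1 / 4 by rewrite ltr_norml; apply/andP; split; lra.
have n1 : \forall x \near r', gl (row_mx (const_mx x) (y q)) = cc (pt x).
  apply: (@interval_near _ _ _ (e1 / 4 - `|r'|)); first by rewrite subr_gt0.
  move=> x xr; rewrite /cc /= cE th2//.
  by have := ler_normD (x - r') r'; rewrite subrK; lra.
have := Iq r'; rewrite (nbhs_singleton n1) => h; apply: has_vel_near n1 _; apply: h.
  by move: r'1; rewrite ltr_norml => /andP[? ?]; lra.
by move: r'1; rewrite ltr_norml => /andP[? ?]; lra.
Qed.

(** Inversion takes trajectories for [t^* f] to trajectories for [s^* f] run backwards. *)
Lemma complete_ham_s f : complete_vf (ham Q f) -> complete_vf (ham QG (sf_comp s f)).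
Proof.
move=> /complete_ham_t /complete_vfP H; apply/complete_vfP => g.
have [gam [g0 Hg]] := H (i g).
exists (i \o (fun r => gam (r * -1))); split; first by rewrite /= mul0r g0 gr_invK.
move=> r; rewrite [X in has_vel _ _ X]ham_s_inv.
by have := has_vel_map i (has_vel_scale (Hg (r * -1))); rewrite linearZ /= scaleN1r.
Qed.

End Symplectic.

Lemma t_fibres_sc : sc_fibres s -> sc_fibres t.
Proof.
move=> H x; have [cx scx] := H x; have ci := @smap_continuous R _ _ i.
have E : t @^-1` [set x] = i @` (s @^-1` [set x]).
  apply/seteqP; split=> [g /= tg|_ [g /= sg <-] /=]; last by rewrite t_inv.
  by exists (i g); rewrite /= ?gr_invK ?s_inv.
split; first by rewrite E; apply: connected_continuous_connected cx _; apply: continuous_subspaceT.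
move=> gam cg Ag g01; have [|||h [ch Ah h0 h1 hs]] := scx (i \o gam).
- exact: within_comp cg ci.
- by move=> r rI; rewrite /= s_inv; exact: Ag.
- by rewrite /= g01.
exists (i \o h); split.
- exact: within_comp ch ci.
- by move=> a b aI bI; rewrite /= t_inv; exact: Ah.
- by move=> a aI; rewrite /= h0//= gr_invK.
- by move=> a aI; rewrite /= h1//= gr_invK.
- by move=> a aI; rewrite /=; have [-> ->] := hs a aI; rewrite /= gr_invK.
Qed.

Lemma unit_embedding : embedding e.
Proof.
split=> [x y /(congr1 s)|U oU|x u v E]; first by rewrite !s_unit.
- exists (s @^-1` U); first by apply: open_comp => // g _; exact: smap_continuous.
  by apply/seteqP; split=> x /=; rewrite s_unit.
- apply: tangent_ext => f; have := congr1 (fun w : tangent (e x) => w (sf_comp s f)) E.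
  rewrite !dmapE; have -> : sf_comp e (sf_comp s f) = f by apply: sf_ext => q /=; rewrite s_unit.
  by [].
Qed.

Lemma section_diffeo (a : smap A M) : (forall x, a (e x) = x) -> is_diffeo (smap_comp a e).
Proof. by move=> H; exists (@Diffeo R M M (id_smap M) (id_smap M) (fun=> erefl) (fun=> erefl)) => x; rewrite /= H. Qed.

End LieGroupoids.

(** * Gauge transformations *)

Section ComplexLinear.
Context (R : realType).
Implicit Types M N : manifold R.

Lemma cpair_eq (T : Type) (x y : T * T) : x.1 = y.1 -> x.2 = y.2 -> x = y.
Proof. by case: x y => [a b] [c d] /= -> ->. Qed.

Lemma bivector_alt M (Q : bivector M) p (xi eta : cotangent p) : (forall xi : cotangent p, xi (Q p xi) = 0) ->
  xi (Q p eta) = - eta (Q p xi).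
Proof.
move=> a; have := a (xi + eta); rewrite linearD dadd !dualD !a add0r addr0 => /eqP.
by rewrite addr_eq0 => /eqP.
Qed.

(** On real covectors, the vanishing of [sigma] on the diagonal shows that [I Q] is antisymmetric.
    As [Q] is antisymmetric too, [I] moves across it. *)
Lemma sigma_type M (I : endo M) (Q : bivector M) p (eta : cotangent p) :
  real_bivector Q -> (forall zeta : cplx (cotangent p), cpair zeta (sigma I Q zeta) = 0) ->
  I p (Q p eta) = Q p (transp (I p) eta).
Proof.
move=> [_ aQ] aS.
have aI (xi : cotangent p) : xi (I p (Q p xi)) = 0.
  have : xi (- 4^-1 *: (I p (Q p xi) - Q p 0)) - (0 : cotangent p) (sigma I Q (xi, 0)).2 = 0 := congr1 fst (aS (xi, 0)).
  rewrite dzero subr0 linear0 subr0 dualZ => /eqP.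
  by rewrite mulf_eq0 oppr_eq0 invr_eq0 pnatr_eq0 /= => /eqP.
have aI2 (xi : cotangent p) : xi (I p (Q p eta)) = - eta (I p (Q p xi)).
  have := aI (xi + eta); rewrite !linearD dadd !dualD !aI add0r addr0 => /eqP.
  by rewrite addr_eq0 => /eqP.
apply: tangent_ext => f.
rewrite -[LHS]/(differential p f (I p (Q p eta))) -[RHS]/(differential p f (Q p (transp (I p) eta))).
by rewrite aI2 (bivector_alt _ _ (aQ p)).
Qed.

(* L_sigma is the (-i)-eigenspace of X + xi |-> (IX - Q xi) - I^* xi. *)
Lemma L_sigmaP M (I : endo M) (Q : bivector M) p (Y : cplx (tangent p)) (xi : cplx (cotangent p)) :
  (forall v, I p (I p v) = - v) -> (forall eta, I p (Q p eta) = Q p (transp (I p) eta)) ->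
  L_sigma I Q (Y, xi) <-> cext (transp (I p)) xi = imul xi /\ cext (I p) Y + imul Y = cext (Q p) xi.
Proof.
move=> II IQ.
have E0 (z : cplx (cotangent p)) : cext (transp (I p)) z = imul z ->
    cext (I p) (sigma I Q z) = imul (sigma I Q z) /\ 2 *: imul (sigma I Q z) = cext (Q p) z.
  case: z => z1 z2 h; have h1 : transp (I p) z1 = - z2 := congr1 fst h.
  have h2 : transp (I p) z2 = z1 := congr1 snd h.
  have q1 : I p (Q p z1) = - Q p z2 by rewrite IQ h1 linearN.
  have q2 : I p (Q p z2) = Q p z1 by rewrite IQ h2.
  have -> : sigma I Q (z1, z2) = (2^-1 *: Q p z2, - 2^-1 *: Q p z1).
    apply: cpair_eq; first transitivity (- 4^-1 *: (I p (Q p z1) - Q p z2)) => //.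
      by rewrite q1; apply: tangent_ext => f; rewrite !(tscale, tadd, topp); field.
    transitivity (- 4^-1 *: (I p (Q p z2) + Q p z1)) => //.
    by rewrite q2; apply: tangent_ext => f; rewrite !(tscale, tadd, topp); field.
  split; apply: cpair_eq => /=.
  - by rewrite linearZ /= q2 scaleNr opprK.
  - by rewrite linearZ /= q1 scalerN scaleNr opprK.
  - by rewrite scaleNr opprK scalerA mulfV ?scale1r.
  - by rewrite scalerA mulfV ?scale1r.
have cD (u v : cplx (tangent p)) : cext (I p) (u + v) = cext (I p) u + cext (I p) v.
  by apply: cpair_eq => /=; rewrite linearD.
have iD (u v : cplx (tangent p)) : imul (u + v) = imul u + imul v.
  by apply: cpair_eq => //=; rewrite opprD.
split=> [[X [z [XI zI [-> ->]]]]|[xiI YI]].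
  split=> //; have [s1 s2] := E0 _ zI.
  by rewrite cD iD XI s1 -s2 scaler_nat mulr2n addrACA addNr add0r.
have [s1 s2] := E0 _ xiI.
exists (Y - sigma I Q xi), xi; split=> //; last by rewrite subrK.
have -> : cext (I p) (Y - sigma I Q xi) = cext (I p) Y - cext (I p) (sigma I Q xi).
  by apply: cpair_eq => /=; rewrite linearB.
have -> : cext (I p) Y = cext (Q p) xi - imul Y by rewrite -YI addrK.
have -> : imul (Y - sigma I Q xi) = imul Y - imul (sigma I Q xi).
  by apply: cpair_eq => //=; rewrite opprD.
by rewrite s1 -s2 scaler_nat mulr2n addrAC addrK opprB.
Qed.

Section Gauge.
Context (M : manifold R) (Ip Im : endo M) (Q : bivector M) (F : form2 M) (p : M).
Hypotheses (Ip2 : forall v : tangent p, Ip p (Ip p v) = - v) (Im2 : forall v : tangent p, Im p (Im p v) = - v).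
Hypotheses (IpQ : forall eta, Ip p (Q p eta) = Q p (transp (Ip p) eta)) (ImQ : forall eta, Im p (Q p eta) = Q p (transp (Im p) eta)).
Hypotheses (aF : forall v : tangent p, F p v v = 0) (aQ : forall xi : cotangent p, xi (Q p xi) = 0).

Let Falt u v : F p u v = - F p v u.
Proof.
have := aF (u + v); rewrite f2DL !dualD !aF add0r addr0 => /eqP.
by rewrite addr_eq0 => /eqP.
Qed.

Definition gauge_related : Prop := (forall v : tangent p, Ip p v - Im p v = Q p (F p v)) /\
  (forall v w : tangent p, F p (Ip p v) w + F p v (Im p w) = 0).

Lemma gauge_relatedP : L_sigma Ip Q (p := p) = expF F (p := p) @` L_sigma Im Q (p := p) <-> gauge_related.
Proof.
split=> [E|[h1 h2]].
  (* [v + i I_- v] is of type (0,1) for [I_-], so it lies in [L_sigma] with zero covector; the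
     equations for its image under [expF] are the two relations. *)
  have H (v : tangent p) : L_sigma Ip Q (expF F ((v, Im p v), (0, 0))).
    rewrite E; exists ((v, Im p v), (0, 0)) => //; apply/L_sigmaP => //; split.
      by apply: cpair_eq; rewrite /= linear0 ?oppr0.
    by apply: cpair_eq; rewrite /= linear0 ?subrr ?Im2 ?addNr.
  have {}H v := proj1 (@L_sigmaP M Ip Q p _ _ Ip2 IpQ) (H v).
  split=> [v|v w].
    have [_ h] := H v; have e : Ip p v - Im p v = Q p (0 + F p v) := congr1 fst h.
    by rewrite e add0r.
  have [h _] := H w; have e : transp (Ip p) (0 + F p w) = - (0 + F p (Im p w)) := congr1 fst h.
  move: e; rewrite !add0r => /(congr1 (fun l : cotangent p => l v)) e.
  have {}e : F p w (Ip p v) = - F p (Im p w) v := e.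
  by rewrite (Falt (Ip p v)) (Falt v) e; lra.
have h1' v : Im p v - Ip p v = - Q p (F p v) by rewrite -h1 opprB.
have h2' (v w : tangent p) : F p (Im p v) w + F p v (Ip p w) = 0.
  by rewrite Falt (Falt v); have := h2 w v; lra.
(* Dual form of the first relation: [I_+^*] and [I_-^*] differ by [F Q]. *)
have tr (xi : cotangent p) v : transp (Ip p) xi v = transp (Im p) xi v + F p (Q p xi) v.
  transitivity (xi (Ip p v)) => //; rewrite -[Ip p v](subrK (Im p v)) h1 dualD (bivector_alt _ _ aQ) addrC.
  by rewrite (Falt (Q p xi)).
have trE (I : endo M) (xi : cotangent p) v : transp (I p) xi v = xi (I p v) by [].
apply/seteqP; split=> [[[Y1 Y2] [x1 x2]]|_ [[[Y1 Y2] [x1 x2]] + <-]].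
  move=> /(L_sigmaP _ _ Ip2 IpQ)[h h'].
  have e1 : transp (Ip p) x1 = - x2 := congr1 fst h.
  have e2 : transp (Ip p) x2 = x1 := congr1 snd h.
  have e3 : Ip p Y1 - Y2 = Q p x1 := congr1 fst h'.
  have e4 : Ip p Y2 + Y1 = Q p x2 := congr1 snd h'.
  exists ((Y1, Y2), (x1 - F p Y1, x2 - F p Y2)); last first.
    by congr (_, _); apply: cpair_eq; exact: subrK.
  apply/L_sigmaP => //; split; apply: cpair_eq.
  - apply: dual_ext => v; transitivity (transp (Im p) (x1 - F p Y1) v) => //.
    transitivity (- (x2 - F p Y2) v) => //.
    have := congr1 (fun l : cotangent p => l v) e1; rewrite tr linearB !(dadd, dopp) -e3 f2DL f2NL.
    by rewrite (trE Im (F p Y1)); have := h2 Y1 v; lra.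
  - apply: dual_ext => v; transitivity (transp (Im p) (x2 - F p Y2) v) => //.
    transitivity ((x1 - F p Y1) v) => //.
    have := congr1 (fun l : cotangent p => l v) e2; rewrite tr linearB !(dadd, dopp) -e4 f2DL.
    by rewrite (trE Im (F p Y2)); have := h2 Y2 v; lra.
  - transitivity (Im p Y1 - Y2) => //; transitivity (Q p (x1 - F p Y1)) => //.
    by rewrite linearB -e3 -h1; apply: tangent_ext => f; rewrite !(tadd, topp); ring.
  - transitivity (Im p Y2 + Y1) => //; transitivity (Q p (x2 - F p Y2)) => //.
    by rewrite linearB -e4 -h1; apply: tangent_ext => f; rewrite !(tadd, topp); ring.
move=> /(L_sigmaP _ _ Im2 ImQ)[h h'].
have e1 : transp (Im p) x1 = - x2 := congr1 fst h.
have e2 : transp (Im p) x2 = x1 := congr1 snd h.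
have e3 : Im p Y1 - Y2 = Q p x1 := congr1 fst h'.
have e4 : Im p Y2 + Y1 = Q p x2 := congr1 snd h'.
apply/(L_sigmaP _ _ Ip2 IpQ); split; apply: cpair_eq.
- apply: dual_ext => v; transitivity (transp (Ip p) (x1 + F p Y1) v) => //.
  transitivity (- (x2 + F p Y2) v) => //.
  have := congr1 (fun l : cotangent p => l v) e1.
  have -> : transp (Ip p) (x1 + F p Y1) v = transp (Ip p) x1 v + transp (Ip p) (F p Y1) v by [].
  rewrite tr !(dadd, dopp) -e3 f2DL f2NL.
  by rewrite (trE Ip (F p Y1)); have := h2' Y1 v; lra.
- apply: dual_ext => v; transitivity (transp (Ip p) (x2 + F p Y2) v) => //.
  transitivity ((x1 + F p Y1) v) => //.
  have := congr1 (fun l : cotangent p => l v) e2.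
  have -> : transp (Ip p) (x2 + F p Y2) v = transp (Ip p) x2 v + transp (Ip p) (F p Y2) v by [].
  rewrite tr !(dadd, dopp) -e4 f2DL.
  by rewrite (trE Ip (F p Y2)); have := h2' Y2 v; lra.
- transitivity (Ip p Y1 - Y2) => //; transitivity (Q p (x1 + F p Y1)) => //.
  by rewrite linearD -e3 -h1; apply: tangent_ext => f; rewrite !(tadd, topp); ring.
- transitivity (Ip p Y2 + Y1) => //; transitivity (Q p (x2 + F p Y2)) => //.
  by rewrite linearD -e4 -h1; apply: tangent_ext => f; rewrite !(tadd, topp); ring.
Qed.

End Gauge.

(** On a real covector the imaginary part of [sigma] is [- Q / 4], so the second components of the
    complex equation give the real one. *)
Lemma poisson_mapW (X Y : hpdata R) (phi : smap X Y) : poisson_map phi -> real_poisson phi (hp_Q X) (hp_Q Y).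
Proof.
move=> H p xi; have : tmap phi p (- 4^-1 *: (hp_I X p (hp_Q X p (transp (tmap phi p) 0)) + hp_Q X p (transp (tmap phi p) xi))) =
  - 4^-1 *: (hp_I Y _ (hp_Q Y _ 0) + hp_Q Y _ xi) := congr1 snd (H p (xi, 0)).
have n4 : - 4^-1 != 0 :> R by rewrite oppr_eq0 invr_eq0 pnatr_eq0.
by rewrite !linear0 !add0r linearZ => /(scalerI n4).
Qed.

Lemma holomorphic_poisson_map (X Y : hpdata R) (phi : smap X Y) : real_poisson phi (hp_Q X) (hp_Q Y) ->
  holomorphic_map (hp_I X) (hp_I Y) phi -> poisson_map phi.
Proof.
move=> H hol p [z1 z2]; apply: cpair_eq; rewrite /sigma /= !linearZ /= !linearD ?linearN /=;
  by rewrite hol !H.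
Qed.

(* d omega (IX,IY,Z) - dB (IX,Y,Z) - dB (X,IY,Z) - d omega (X,Y,Z) = - omega (N(X,Y),Z) *)
Lemma nijenhuis_closed M (I : endo M) (B om : form2 M) (Q : bivector M) :
  closed_2form B -> closed_2form om -> inverse_bivector Q om ->
  (forall p (v : tangent p), om p (I p v) = B p v) -> (forall p (v : tangent p), I p (I p v) = - v) ->
  complex_structure I.
Proof.
move=> cB com HQ omI II; split=> //.
have sI : smooth_endo I.
  move=> X; have sX := inverse_smooth com.1 HQ (xi := fun p => B p (X p)) (fun Y => cB.1.1 X Y).
  by move=> f; have := sX f; congr smooth; apply/funext => p; rewrite -omI (proj1 (HQ p)).
exists sI => X Y p; apply: (f2_nondeg HQ) => w; rewrite f2_0L.
have [Z <-] := vf_extend w.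
have e1 q (u v : tangent q) : om q (I q u) v = B q u v by rewrite omI.
have e2 q (u v : tangent q) : om q u (I q v) = B q u v.
  by rewrite (f2_alt _ _ com.1) e1 (f2_alt _ _ cB.1) opprK.
have e3 q (u v : tangent q) : B q (I q u) v = - om q u v by rewrite -omI II f2NL.
have e4 q (u v : tangent q) : B q u (I q v) = - om q u v by rewrite -e1 e2 e3.
have e5 q (u v : tangent q) : om q (I q u) (I q v) = - om q u v by rewrite e1 e4.
pose IX := endo_vf sI X; pose IY := endo_vf sI Y.
have E1 := congr1 (fun f : smoothfun M => f p) (com.2 IX IY Z).
have E2 := congr1 (fun f : smoothfun M => f p) (cB.2 IX Y Z).
have E3 := congr1 (fun f : smoothfun M => f p) (cB.2 X IY Z).
have E4 := congr1 (fun f : smoothfun M => f p) (com.2 X Y Z).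
have s1 : eval2 om IY Z = eval2 B Y Z by apply: sf_ext => q; rewrite !eval2E ?e1//; [exact: cB.1|exact: com.1].
have s2 : eval2 om IX Z = eval2 B X Z by apply: sf_ext => q; rewrite !eval2E ?e1//; [exact: cB.1|exact: com.1].
have s3 : eval2 om IX IY = - eval2 om X Y by apply: sf_ext => q; rewrite sfopp !eval2E ?e5//; exact: com.1.
have s4 : eval2 B IX Z = - eval2 om X Z by apply: sf_ext => q; rewrite sfopp !eval2E ?e3//; [exact: com.1|exact: cB.1].
have s5 : eval2 B IX Y = - eval2 om X Y by apply: sf_ext => q; rewrite sfopp !eval2E ?e3//; [exact: com.1|exact: cB.1].
have s6 : eval2 B IY Z = - eval2 om Y Z by apply: sf_ext => q; rewrite sfopp !eval2E ?e3//; [exact: com.1|exact: cB.1].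
have s7 : eval2 B X IY = - eval2 om X Y by apply: sf_ext => q; rewrite sfopp !eval2E ?e4//; [exact: com.1|exact: cB.1].
move: E1 E2 E3 E4; rewrite s1 s2 s3 s4 s5 s6 s7 !(sfadd, sfopp, lieE, sf0, tgN).
rewrite !(eval2E _ _ _ com.1) !(eval2E _ _ _ cB.1).
rewrite -/IX -/IY !e2 !e4 => E1 E2 E3 E4.
by rewrite !(f2DL, f2NL) !e1; lra.
Qed.

End ComplexLinear.

(** * The gauged groupoid as a Morita equivalence *)

Section GaugeGroupoid.
Context (R : realType) (M : manifold R) (D : gkdata M) (G : groupoid M).
Variables (I0 : endo (gr_arrows G)) (Om : cform2 (gr_arrows G)).
Hypotheses (HD : degenerate_GK D) (HG : @weinstein_groupoid R (Xminus D) G I0 Om).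

Lemma gk_gauge p : gauge_related (gk_Ip D) (gk_Im D) (gk_Q D) (gk_F D) p.
Proof.
have [[[Ip2 _] rQ aSp _ _] [[Im2 _] _ aSm _ _] [[_ aF] _] HL] := HD.
have IpQ eta : gk_Ip D p (gk_Q D p eta) = gk_Q D p (transp (gk_Ip D p) eta) by apply: sigma_type => //; exact: aSp.
have ImQ eta : gk_Im D p (gk_Q D p eta) = gk_Q D p (transp (gk_Im D p) eta) by apply: sigma_type => //; exact: aSm.
exact: (proj1 (gauge_relatedP (Ip2 p) (Im2 p) IpQ ImQ (aF p) (rQ.2 p))).
Qed.

Lemma gauge_complex_structure : exists I : endo (gr_arrows G), complex_structure_of (gauge_form Om (gk_F D)) I.
Proof.
have [[LG _ _ _ [QG [HQ _ _]]] _] := HG.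
by exists (fun p => QG p \o re2 (gauge_form Om (gk_F D)) p) => p v /=; rewrite (proj2 (HQ p)).
Qed.

(** Gauging adds [T], the inverse of [om] applied to [t^* F], to the complex structure of the
    groupoid. [T] takes values in the s-fibres and [t] maps it to [Q F], so [s] stays holomorphic
    for [I_-] while [t] becomes holomorphic for [I_+]. *)
Lemma gauge_morita (I : endo (gr_arrows G)) : complex_structure_of (gauge_form Om (gk_F D)) I ->
  morita_brane (span_of_gk D Om I).
Proof.
move=> HI; have [[LG [[I02 _] [cB com] tyO _] [hs ht _ _ _] [mB mom] [QG [HQ pt_ ps_]]] scs] := HG.
have [[[Ip2 _] [sQ aQ] _ _ _] [[Im2 _] _ _ _ _] cF _] := HD.
have rt : real_poisson (gr_t G) QG (gk_Q D) := poisson_mapW pt_.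
have rs : real_poisson (gr_s G) QG (opp_bivector (gk_Q D)) := poisson_mapW ps_.
have rel := gk_gauge.
set B := re2 (gauge_form Om (gk_F D)); set om := im2 Om.
have cB' : closed_2form B by apply: closed_add2 => //; exact: closed_pull2.
have omI p v : om p (I p v) = B p v := HI p v.
have om0 p (u v : tangent p) : om p (I0 p u) v = re2 Om p u v by have := congr1 snd (tyO p u v).
have om0' p (u v : tangent p) : om p u (I0 p v) = om p (I0 p u) v.
  by rewrite (f2_alt _ _ com.1) !om0 (f2_alt _ _ cB.1) opprK.
pose T p v := QG p (transp (tmap (gr_t G) p) (gk_F D _ (tmap (gr_t G) p v))).
have IE p v : I p v = I0 p v + T p v.
  apply: (f2_nondeg HQ) => w; rewrite omI f2DL om0 /T (proj2 (HQ p)) //.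
have Tw p v w : om p (T p v) w = gk_F D _ (tmap (gr_t G) p v) (tmap (gr_t G) p w).
  by rewrite /T (proj2 (HQ p)).
have tI : holomorphic_map I (gk_Ip D) (gr_t G).
  by move=> p v; rewrite IE linearD /= ht /T rt -(proj1 (rel _)) /= addrC subrK.
have sT p v : tmap (gr_s G) p (T p v) = 0.
  have [f fE] := covector_differential (gk_F D _ (tmap (gr_t G) p v)).
  rewrite /T fE transp_differential; exact: (s_ham_t LG mom HQ).
have sI : holomorphic_map I (gk_Im D) (gr_s G).
  by move=> p v; rewrite IE linearD /= hs sT addr0.
(* Expanding the square leaves [F (I_+ x) y + F x (I_- y)] at the images under [t], which is
   zero. *)
have II p v : I p (I p v) = - v.
  rewrite [in LHS]IE; apply: (f2_nondeg HQ) => w; rewrite f2DL Tw tI om0 -om0 -om0' IE f2DL Tw om0' I02.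
  rewrite ht; apply/eqP; rewrite -addrA -subr_eq0 addrAC subrr add0r addrC; apply/eqP.
  exact: (proj2 (rel _)).
have hs_ : holomorphic_symplectic I (gauge_form Om (gk_F D)).
  split=> //.
  - exact: nijenhuis_closed cB' com HQ omI II.
  - move=> p u v; apply: cpair_eq; last by transitivity (om p (I p u) v); [|rewrite omI].
    transitivity (B p (I p u) v) => //; transitivity (- om p u v) => //.
    by rewrite -omI II f2NL.
  - move=> p u h; apply: (f2_nondeg HQ) => w; rewrite f2_0L; exact: (congr1 snd (h w)).
have [[ss1 ss2] [st1 st2]] : surjective_submersion (gr_s G) /\ surjective_submersion (gr_t G) by have [] := LG.
have ks p u := @ker_s _ _ _ LG om QG mom HQ p u.
have kt p u := @ker_t _ _ _ LG om QG mom com HQ p u.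
split; last first.
  split; [exact: (unit_embedding LG)|exact: (unit_lagrangian LG mom HQ)| |].
    by apply: section_diffeo; exact: s_unit.
  by apply: section_diffeo; exact: t_unit.
split=> //.
- by split=> //; exact: t_fibres_sc.
- move=> p; split; apply/seteqP; split=> u /=.
  (* For the real part, [B u v] is [om (I u) v], and [I] preserves the kernel of a holomorphic
     map. *)
  + move=> su v tv; apply: cpair_eq; last exact: (proj1 (ks p u) su).
    by transitivity (B p u v); [|rewrite -omI; apply: (proj1 (ks p _)) => //; rewrite sI su linear0].
  + by move=> H; apply/ks => v tv; have := congr1 snd (H v tv).
  + move=> su v tv; apply: cpair_eq; last exact: (proj1 (kt p u) su).
    by transitivity (B p u v); [|rewrite -omI; apply: (proj1 (kt p _)) => //; rewrite tI su linear0].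
  + by move=> H; apply/kt => v tv; have := congr1 snd (H v tv).
- exists QG; split=> //.
  + exact: holomorphic_poisson_map.
  + exact: holomorphic_poisson_map.
  + by move=> f; exact: (complete_ham_t LG mom com HQ rt sQ).
  + by move=> f /complete_opp; exact: (complete_ham_s LG mom com HQ rt sQ).
Qed.

End GaugeGroupoid.

(** * Restriction to the brane *)

Section Transport.
Context (R : realType).
Implicit Types M N L : manifold R.

(** Equality of the packed maps, beyond that of the functions, lets one bivector be rewritten to
    another inside dependent statements; it rests on proof irrelevance. *)
Lemma linear_ext (V W : lmodType R) (f g : {linear V -> W}) : f =1 g -> f = g.
Proof.
move=> fg; have E : (f : V -> W) = g by exact/funext.
case: f g {fg} E => f cf [g cg] /= E; subst g; congr GRing.Linear.Pack.
case: cf cg => [[a1] [b1]] [[a2] [b2]]; congr GRing.Linear.Class; congr (_ _); exact: Prop_irrelevance.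
Qed.

Lemma tmap_comp M N L (g : smap N L) (f : smap M N) p (u : tangent p) :
  tmap (smap_comp g f) p u = tmap g (f p) (tmap f p u).
Proof. by apply: tangent_ext => h; rewrite !dmapE; congr (u _); exact: sf_ext. Qed.

Lemma dmapD M N (phi : smap M N) p q (e : phi p = q) (u v : tangent p) : dmap e (u + v) = dmap e u + dmap e v.
Proof. exact: linearD. Qed.

Lemma dmapB M N (phi : smap M N) p q (e : phi p = q) (u v : tangent p) : dmap e (u - v) = dmap e u - dmap e v.
Proof. exact: linearB. Qed.

Lemma endo_eq M (I : endo M) p q (u : tangent p) (v : tangent q) : p = q -> (forall f, u f = v f) ->
  forall f, I p u f = I q v f.
Proof. by move=> E; subst q => /tangent_ext ->. Qed.

Lemma bivector_eq M (Q : bivector M) p q (xi : cotangent p) (eta : cotangent q) : p = q ->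
  (forall (u : tangent p) (v : tangent q), (forall f, u f = v f) -> xi u = eta v) ->
  forall f, Q p xi f = Q q eta f.
Proof. by move=> E; subst q => H; have -> : xi = eta by apply: dual_ext => u; exact: H. Qed.

Section Diffeo.
Context (L X : manifold R) (D : diffeo L X).
Local Notation E := (df_bwd D).

Lemma diffeo_smooth_comp (h : X -> R) : smooth (h \o D) -> smooth h.
Proof.
move=> sh; have := sm_smooth E (mk_sf sh); congr smooth; apply/funext => q /=; by rewrite df_bwdK.
Qed.

(** Functions that are not smooth are included: both sides are then the default value 0, since [h]
    and [h \o D] are smooth together. Brackets are defined through [to_sf], so this case has to be
    covered. *)
Lemma to_sf_comp (h : X -> R) : to_sf (h \o D) = sf_comp D (to_sf h).
Proof.
have [sh|nsh] := pselect (smooth h).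
  have shD : smooth (h \o D) := sm_smooth D (mk_sf sh).
  by apply: sf_ext => p; rewrite to_sfE// [RHS]to_sfE.
have z (K : manifold R) (k : K -> R) : ~ smooth k -> to_sf k = 0.
  move=> nk; rewrite /to_sf /insubd insubN//; apply/negP => /asboolP.
  by move=> sk; apply: nk.
by rewrite !z//; [exact: sf_ext|move=> /diffeo_smooth_comp].
Qed.

Lemma dmapK p (w : tangent (D p)) : tmap D p (dmap (df_fwdK D p) w) = w.
Proof. by apply: tangent_ext => f; rewrite !dmapE; congr (w _); apply: sf_ext => q /=; rewrite df_bwdK. Qed.

Lemma dmapKV p (u : tangent p) : dmap (df_fwdK D p) (tmap D p u) = u.
Proof. by apply: tangent_ext => f; rewrite !dmapE; congr (u _); apply: sf_ext => q /=; rewrite df_fwdK. Qed.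

Lemma bwd_inj q (u : tangent q) : tmap E q u = 0 -> u = 0.
Proof.
move=> H; apply: tangent_ext => f; have := congr1 (fun w : tangent _ => w (sf_comp D f)) H; rewrite !dmapE => E0.
by transitivity (u (sf_comp E (sf_comp D f))); [congr (u _); apply: sf_ext => q' /=; rewrite df_bwdK|].
Qed.

Lemma bwd_surj q (w : tangent (E q)) : exists v, tmap E q v = w.
Proof.
exists (dmap (df_bwdK D q) w); apply: tangent_ext => f; rewrite !dmapE; congr (w _).
by apply: sf_ext => q' /=; rewrite df_fwdK.
Qed.

Section Structures.
Context (I : endo X) (Q : bivector X).

Lemma pull_endo_map : holomorphic_map (pull_endo D I) I D.
Proof. by move=> p v; exact: dmapK. Qed.

Lemma pull_endo_bwd : holomorphic_map I (pull_endo D I) E.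
Proof.
move=> q v; apply: tangent_ext => f; rewrite !dmapE.
apply: endo_eq => [|h]; first by rewrite df_bwdK.
by rewrite !dmapE; congr (v _); apply: sf_ext => q' /=; rewrite df_bwdK.
Qed.

Lemma pull_bivector_bwd : real_poisson E Q (pull_bivector D Q).
Proof.
move=> q xi; apply: tangent_ext => f; rewrite !dmapE.
apply: bivector_eq => [|u v H]; first by rewrite df_bwdK.
by transitivity (xi (tmap E q u)) => //; congr (xi _); apply: tangent_ext => h; rewrite !dmapE.
Qed.

Definition vf_related (V : vfield L) (W : vfield X) := forall p g, V p (sf_comp D g) = W (D p) g.

Lemma push_subproof (V : vfield L) : smooth_vf (fun q => dmap (df_bwdK D q) (V (E q))).
Proof. by move=> f; exact: (sf_smooth (sf_comp E (lie V (sf_comp D f)))). Qed.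
Definition push (V : vfield L) : vfield X := VField (push_subproof V).

Lemma push_related V : vf_related V (push V).
Proof.
by move=> p g; transitivity (lie V (sf_comp D g) (E (D p))); [rewrite df_fwdK|].
Qed.

Lemma related_bracket V V' W W' : vf_related V W -> vf_related V' W' -> vf_related (bracket V V') (bracket W W').
Proof.
move=> h h' p g; rewrite !bracketE.
have l : lie V (sf_comp D g) = sf_comp D (lie W g) by apply: sf_ext => q; exact: h.
have l' : lie V' (sf_comp D g) = sf_comp D (lie W' g) by apply: sf_ext => q; exact: h'.
by rewrite l l' h h'.
Qed.

Lemma related_tmap V W p : vf_related V W -> tmap D p (V p) = W (D p).
Proof. by move=> h; apply: tangent_ext => g; exact: h. Qed.

(** Fields are pushed forward along the diffeomorphism, and related fields have related brackets, so
    the Nijenhuis tensor is transported. *)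
Lemma pull_complex_structure : complex_structure I -> complex_structure (pull_endo D I).
Proof.
move=> [I2 [sI NI]]; split=> [p v|].
  by rewrite /pull_endo /= dmapK I2 linearN /= dmapKV.
have sP : smooth_endo (pull_endo D I).
  move=> V f; have := sf_smooth (sf_comp D (lie (endo_vf sI (push V)) (sf_comp E f))).
  congr smooth; apply/funext => p; transitivity (I (D p) (push V (D p)) (sf_comp E f)) => //.
  by rewrite -(related_tmap p (push_related V)).
exists sP => V W p; have relI U U' : vf_related U U' -> vf_related (endo_vf sP U) (endo_vf sI U').
  move=> h q g; transitivity (I (D q) (U' (D q)) g) => //.
  by rewrite -(related_tmap q h) -pull_endo_map.
have rV := push_related V; have rW := push_related W.
apply: tangent_ext => f; rewrite tzero.
have fE : f = sf_comp D (sf_comp E f) by apply: sf_ext => q /=; rewrite df_fwdK.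
have := congr1 (fun w : tangent _ => w (sf_comp E f)) (NI (push V) (push W) (D p)); rewrite tzero => <-.
rewrite fE !(tadd, topp) (related_bracket (relI _ _ rV) (relI _ _ rW)) (related_bracket rV rW).
have pI U U' : vf_related U U' -> pull_endo D I p (U p) (sf_comp D (sf_comp E f)) = I (D p) (U' (D p)) (sf_comp E f).
  move=> h; transitivity (tmap D p (pull_endo D I p (U p)) (sf_comp E f)) => //.
  by rewrite pull_endo_map (related_tmap p h).
by rewrite (pI _ _ (related_bracket (relI _ _ rV) rW)) (pI _ _ (related_bracket rV (relI _ _ rW))) -fE.
Qed.

Lemma pull_ham f p : ham (pull_bivector D Q) f p = dmap (df_fwdK D p) (ham Q (sf_comp E f) (D p)).
Proof. by rewrite /ham /pull_bivector /=; congr (dmap _ (Q _ _)); exact: dual_ext. Qed.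

Lemma pull_real_bivector : real_bivector Q -> real_bivector (pull_bivector D Q).
Proof.
move=> [sQ aQ]; split=> [f h|p xi]; last exact: (aQ (D p) (transp (dmap (df_fwdK D p)) xi)).
have := sf_smooth (sf_comp D (lie (VField (sQ (sf_comp E f))) (sf_comp E h))).
by congr smooth; apply/funext => p; rewrite pull_ham.
Qed.

Lemma pull_sigma p (z : cplx (cotangent p)) : sigma (pull_endo D I) (pull_bivector D Q) z =
  cext (dmap (df_fwdK D p)) (sigma I Q (cext (transp (dmap (df_fwdK D p))) z)).
Proof.
by case: z => z1 z2; rewrite /sigma /cext /imul /pull_endo /pull_bivector; apply: cpair_eq;
  rewrite /= !dmapK !linearZ /= !linearD ?linearN.
Qed.

Lemma pull_sigma_bracket (f g : cplx (smoothfun L)) :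
  sigma_bracket (pull_endo D I) (pull_bivector D Q) f g =
  (sf_comp D (sigma_bracket I Q (sf_comp E f.1, sf_comp E f.2) (sf_comp E g.1, sf_comp E g.2)).1,
   sf_comp D (sigma_bracket I Q (sf_comp E f.1, sf_comp E f.2) (sf_comp E g.1, sf_comp E g.2)).2).
Proof.
have H p : cext (transp (dmap (df_fwdK D p))) (cext (differential p) f) = cext (differential (D p)) (sf_comp E f.1, sf_comp E f.2).
  by apply: cpair_eq; exact: dual_ext.
have Hb p : cpair (cext (differential p) g) (sigma (pull_endo D I) (pull_bivector D Q) (cext (differential p) f)) =
    cpair (cext (differential (D p)) (sf_comp E g.1, sf_comp E g.2)) (sigma I Q (cext (differential (D p)) (sf_comp E f.1, sf_comp E f.2))).
  by rewrite pull_sigma H; move: (sigma I Q _) => [s1 s2].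
apply: cpair_eq.
  transitivity (to_sf ((fun q => (cpair (cext (differential q) (sf_comp E g.1, sf_comp E g.2)) (sigma I Q (cext (differential q) (sf_comp E f.1, sf_comp E f.2)))).1) \o D)); last exact: to_sf_comp.
  by rewrite /sigma_bracket; congr to_sf; apply/funext => p; rewrite Hb.
transitivity (to_sf ((fun q => (cpair (cext (differential q) (sf_comp E g.1, sf_comp E g.2)) (sigma I Q (cext (differential q) (sf_comp E f.1, sf_comp E f.2)))).2) \o D)); last exact: to_sf_comp.
by rewrite /sigma_bracket; congr to_sf; apply/funext => p; rewrite Hb.
Qed.

Lemma push_sigma_bracket (f g : cplx (smoothfun L)) :
  (sf_comp E (sigma_bracket (pull_endo D I) (pull_bivector D Q) f g).1,
   sf_comp E (sigma_bracket (pull_endo D I) (pull_bivector D Q) f g).2) =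
  sigma_bracket I Q (sf_comp E f.1, sf_comp E f.2) (sf_comp E g.1, sf_comp E g.2).
Proof.
have DE h : sf_comp E (sf_comp D h) = h by apply: sf_ext => q /=; rewrite df_bwdK.
by rewrite pull_sigma_bracket; apply: cpair_eq; exact: DE.
Qed.

Lemma holomorphic_bwd (U : set L) (f : cplx (smoothfun L)) : holomorphic_on (pull_endo D I) U f <->
  holomorphic_on I (E @^-1` U) (sf_comp E f.1, sf_comp E f.2).
Proof.
have fE h : h = sf_comp D (sf_comp E h) by apply: sf_ext => q /=; rewrite df_fwdK.
split=> H p v Up.
  have := H (E p) (tmap E p v) Up; rewrite -pull_endo_bwd !dmapE //.
have Up' : (E @^-1` U) (D p) by rewrite /= df_fwdK.
have := H (D p) (tmap D p v) Up'; rewrite -pull_endo_map !dmapE -!fE //.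
Qed.

Lemma pull_hpoisson : holomorphic_poisson I Q -> holomorphic_poisson (pull_endo D I) (pull_bivector D Q).
Proof.
move=> [cI rQ aS hS jS]; split.
- exact: pull_complex_structure.
- exact: pull_real_bivector.
- move=> p z; rewrite pull_sigma; exact: (aS (D p) (cext (transp (dmap (df_fwdK D p))) z)).
- move=> U f g oU Hf Hg; apply/holomorphic_bwd.
  have oE : open (E @^-1` U) by apply: open_comp => // q _; exact: smap_continuous.
  have := hS _ _ _ oE (proj1 (holomorphic_bwd U f) Hf) (proj1 (holomorphic_bwd U g) Hg).
  by rewrite push_sigma_bracket.
- move=> f g h.
  have J := jS (sf_comp E f.1, sf_comp E f.2) (sf_comp E g.1, sf_comp E g.2) (sf_comp E h.1, sf_comp E h.2).
  rewrite [sigma_bracket _ _ f _]pull_sigma_bracket [sigma_bracket _ _ g (sigma_bracket _ _ h f)]pull_sigma_bracket.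
  rewrite [sigma_bracket _ _ h (sigma_bracket _ _ f g)]pull_sigma_bracket !push_sigma_bracket.
  by apply: cpair_eq; apply: sf_ext => p;
    [exact: (congr1 (fun k : cplx (smoothfun X) => k.1 (D p)) J)|exact: (congr1 (fun k : cplx (smoothfun X) => k.2 (D p)) J)].
Qed.

Lemma complete_bwd f : complete_vf (ham (pull_bivector D Q) f) -> complete_vf (ham Q (sf_comp E f)).
Proof.
move=> /complete_vfP H; apply/complete_vfP => q; have [gam [g0 Hg]] := H (E q).
exists (D \o gam); split=> [|t]; first by rewrite /= g0 df_bwdK.
have := has_vel_map D (Hg t); rewrite pull_ham dmapK //.
Qed.

End Structures.
End Diffeo.
End Transport.

(** * Morita equivalences with both bases identified with the brane *)

Section BranePairs.
Context (R : realType).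

(** [a] and [b] are the projections to X_- and X_+, both followed by the identification with the
    brane, and [l] is a common section. Gauged groupoids and arbitrary spans are brought to this
    form in order to be compared. *)
Record brane_pair (L : manifold R) (Ip Im : endo L) (Qp Qm : bivector L) (Z : manifold R) (I : endo Z)
    (B om : form2 Z) (QZ : bivector Z) (a b : smap Z L) (l : smap L Z) : Prop := BranePair {
  bp_B : closed_2form B;
  bp_om : closed_2form om;
  bp_inv : inverse_bivector QZ om;
  bp_omI : forall p (u v : tangent p), om p (I p u) v = B p u v;
  bp_BI : forall p (u v : tangent p), B p (I p u) v = - om p u v;
  bp_a : surjective_submersion a;
  bp_b : surjective_submersion b;
  bp_al : forall x, a (l x) = x;
  bp_bl : forall x, b (l x) = x;
  bp_ka : forall p (u : tangent p), tmap a p u = 0 <-> forall v, tmap b p v = 0 -> om p u v = 0;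
  bp_kb : forall p (u : tangent p), tmap b p u = 0 <-> forall v, tmap a p v = 0 -> om p u v = 0;
  bp_Ia : holomorphic_map I Im a;
  bp_Ib : holomorphic_map I Ip b;
  bp_pb : real_poisson b QZ Qp;
  bp_pa : real_poisson a QZ (opp_bivector Qm);
  bp_cb : complete_map b QZ Qp;
  bp_sc : sc_fibres a;
  bp_lag : lagrangian om l;
  bp_sQ : forall f, smooth_vf (ham Qp f)
}.

Lemma span_brane_pair (Xm Xp : hpdata R) (S : bspan Xm Xp) (Dm : diffeo (bs_L S) Xm) (Dp : diffeo (bs_L S) Xp)
    (Ip Im : endo (bs_L S)) (Qp Qm : bivector (bs_L S)) :
  morita_brane S -> Dm =1 bs_pim S \o bs_emb S -> Dp =1 bs_pip S \o bs_emb S ->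
  holomorphic_map (hp_I Xm) Im (df_bwd Dm) -> holomorphic_map (hp_I Xp) Ip (df_bwd Dp) ->
  real_poisson (df_bwd Dm) (hp_Q Xm) Qm -> real_poisson (df_bwd Dp) (hp_Q Xp) Qp ->
  (forall f, complete_vf (ham Qp f) -> complete_vf (ham (hp_Q Xp) (sf_comp (df_bwd Dp) f))) ->
  (forall f, smooth_vf (ham Qp f)) ->
  exists QZ, brane_pair Ip Im Qp Qm (bs_I S) (re2 (bs_Om S)) (im2 (bs_Om S)) QZ
    (smap_comp (df_bwd Dm) (bs_pim S)) (smap_comp (df_bwd Dp) (bs_pip S)) (bs_emb S).
Proof.
move=> [[[[II _] [cB com] ty _] [[pm1 pm2] [pp1 pp2] hm hp] [scm scp] ker [QZ [HQ Pp Pm cp cm]]] [_ lag _ _]] HDm HDp Im_ Ip_ Qm_ Qp_ cE sQ.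
have omI p (u v : tangent p) : im2 (bs_Om S) p (bs_I S p u) v = re2 (bs_Om S) p u v := congr1 snd (ty p u v).
have BI p (u v : tangent p) : re2 (bs_Om S) p (bs_I S p u) v = - im2 (bs_Om S) p u v := congr1 fst (ty p u v).
have omI' p (u v : tangent p) : im2 (bs_Om S) p u (bs_I S p v) = re2 (bs_Om S) p u v.
  by rewrite (f2_alt _ _ com.1) omI (f2_alt _ _ cB.1) opprK.
have rp : real_poisson (bs_pip S) QZ (hp_Q Xp) := poisson_mapW Pp.
have rm : real_poisson (bs_pim S) QZ (opp_bivector (hp_Q Xm)) := poisson_mapW Pm.
have zm p (u : tangent p) : tmap (smap_comp (df_bwd Dm) (bs_pim S)) p u = 0 <-> tmap (bs_pim S) p u = 0.
  by rewrite tmap_comp; split=> [/bwd_inj|->]; rewrite ?linear0.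
have zp p (u : tangent p) : tmap (smap_comp (df_bwd Dp) (bs_pip S)) p u = 0 <-> tmap (bs_pip S) p u = 0.
  by rewrite tmap_comp; split=> [/bwd_inj|->]; rewrite ?linear0.
(* Orthogonality for the complex form reduces to [om], since [B u v] is [om u (I v)] and the kernel
   of a holomorphic projection is stable under [I]. *)
have km p (u : tangent p) : tmap (bs_pim S) p u = 0 <-> forall v, tmap (bs_pip S) p v = 0 -> im2 (bs_Om S) p u v = 0.
  have /(congr1 (fun A : set (tangent p) => A u)) /= E1 := (ker p).1; rewrite E1; split=> H v Hv.
    exact: (congr1 snd (H v Hv)).
  apply: cpair_eq; last exact: H.
  by transitivity (re2 (bs_Om S) p u v) => //; rewrite -omI'; apply: H; rewrite hp Hv linear0.
have kp p (u : tangent p) : tmap (bs_pip S) p u = 0 <-> forall v, tmap (bs_pim S) p v = 0 -> im2 (bs_Om S) p u v = 0.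
  have /(congr1 (fun A : set (tangent p) => A u)) /= E1 := (ker p).2; rewrite E1; split=> H v Hv.
    exact: (congr1 snd (H v Hv)).
  apply: cpair_eq; last exact: H.
  by transitivity (re2 (bs_Om S) p u v) => //; rewrite -omI'; apply: H; rewrite hm Hv linear0.
have sub (X : manifold R) (D : diffeo (bs_L S) X) (f : smap (bs_Z S) X) : surjective_submersion f ->
    surjective_submersion (smap_comp (df_bwd D) f).
  move=> [f1 f2]; split=> [x|p w]; first by have [p fp] := f1 (D x); exists p; rewrite /= fp df_fwdK.
  have [w' w'E] := bwd_surj w; have [v vE] := f2 p w'; exists v.
  by rewrite tmap_comp vE.
exists QZ; split=> //.
- exact: sub.
- exact: sub.
- by move=> x /=; rewrite -[bs_pim S _]/((bs_pim S \o bs_emb S) x) -HDm df_fwdK.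
- by move=> x /=; rewrite -[bs_pip S _]/((bs_pip S \o bs_emb S) x) -HDp df_fwdK.
- by move=> p u; rewrite zm km; split=> H v; [rewrite zp|rewrite -zp]; exact: H.
- by move=> p u; rewrite zp kp; split=> H v; [rewrite zm|rewrite -zm]; exact: H.
- by move=> p v; rewrite !tmap_comp hm Im_.
- by move=> p v; rewrite !tmap_comp hp Ip_.
- move=> p xi; rewrite tmap_comp -Qp_ -rp; congr (tmap _ _ (tmap _ _ (QZ p _))).
  by apply: dual_ext => u; transitivity (xi (tmap (smap_comp (df_bwd Dp) (bs_pip S)) p u)) => //; rewrite tmap_comp.
- move=> p xi; rewrite tmap_comp.
  transitivity (- tmap (df_bwd Dm) (bs_pim S p) (hp_Q Xm _ (transp (tmap (df_bwd Dm) (bs_pim S p)) xi))); last first.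
    by rewrite Qm_ /opp_bivector /= scaleN1r.
  have -> : QZ p (transp (tmap (smap_comp (df_bwd Dm) (bs_pim S)) p) xi) = QZ p (transp (tmap (bs_pim S) p) (transp (tmap (df_bwd Dm) (bs_pim S p)) xi)).
    congr (QZ p _).
    by apply: dual_ext => u; transitivity (xi (tmap (smap_comp (df_bwd Dm) (bs_pim S)) p u)) => //; rewrite tmap_comp.
  by rewrite rm /opp_bivector /= scaleN1r linearN.
- move=> f /cE /cp; have -> // : sf_comp (bs_pip S) (sf_comp (df_bwd Dp) f) = sf_comp (smap_comp (df_bwd Dp) (bs_pip S)) f.
  exact: sf_ext.
- move=> x; have -> : (smap_comp (df_bwd Dm) (bs_pim S)) @^-1` [set x] = bs_pim S @^-1` [set Dm x]; last exact: scm.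
  by apply/seteqP; split=> z /=; [move=> <-; rewrite df_bwdK|move=> ->; rewrite df_fwdK].
Qed.

Section LinearAlgebra.
Context (L : manifold R) (Ip Im : endo L) (Qp Qm : bivector L) (Z : manifold R) (I : endo Z).
Context (B om : form2 Z) (QZ : bivector Z) (a b : smap Z L) (l : smap L Z).
Hypothesis HP : brane_pair Ip Im Qp Qm I B om QZ a b l.

Lemma bp_section (c : smap Z L) x (v : tangent x) : (forall x, c (l x) = x) -> forall f, tmap c (l x) (tmap l x v) f = v f.
Proof. by move=> H f; rewrite !dmapE; congr (v _); apply: sf_ext => q /=; rewrite H. Qed.

Lemma bp_ham_b f p : tmap a p (ham QZ (sf_comp b f) p) = 0.
Proof.
apply/(bp_ka HP) => v bv; rewrite (f2_ham _ _ (bp_inv HP)).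
by have := congr1 (fun w : tangent _ => w f) bv; rewrite dmapE.
Qed.

Lemma bp_ham_a f p : tmap b p (ham QZ (sf_comp a f) p) = 0.
Proof.
apply/(bp_kb HP) => v av; rewrite (f2_ham _ _ (bp_inv HP)).
by have := congr1 (fun w : tangent _ => w f) av; rewrite dmapE.
Qed.

Lemma bp_isotropic x (u v : tangent x) : om (l x) (tmap l x u) (tmap l x v) = 0.
Proof. by apply: (proj2 (bp_lag HP (tmap l x u))); exists u. Qed.

Lemma real_poisson_val (c : smap Z L) (Q : bivector L) (Hc : real_poisson c QZ Q) x (cx : c (l x) = x) f h :
  tmap c (l x) (ham QZ (sf_comp c f) (l x)) h = ham Q f x h.
Proof.
rewrite (real_poisson_ham _ _ Hc) /ham; apply: bivector_eq => // u v uv; exact: uv.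
Qed.

(** The functions [b^* f] and [a^* f] agree on the brane, so the difference of their Hamiltonian
    vectors is orthogonal to it, hence tangent. Its projections by [b] and [a] are [Qp df] and
    [Qm df]. *)
Lemma bp_bivector x (xi : cotangent x) : Qp x xi = Qm x xi.
Proof.
have [f ->] := covector_differential xi.
pose X := ham QZ (sf_comp b f) (l x) - ham QZ (sf_comp a f) (l x).
have [w Xw] : exists w, X = tmap l x w.
  apply/(bp_lag HP) => v; rewrite f2DL f2NL !(f2_ham _ _ (bp_inv HP)) !dmapE.
  apply/eqP; rewrite subr_eq0; apply/eqP; congr (v _); apply: sf_ext => q /=.
  by rewrite (bp_al HP) (bp_bl HP).
apply: tangent_ext => h; transitivity (w h).
  rewrite -(bp_section w (bp_bl HP)) -Xw dmapB bp_ham_a subr0.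
  by rewrite (real_poisson_val (bp_pb HP) (bp_bl HP x)).
rewrite -(bp_section w (bp_al HP)) -Xw dmapB bp_ham_b sub0r topp.
transitivity (- ham (opp_bivector Qm) f x h); first by rewrite (real_poisson_val (bp_pa HP) (bp_al HP x)).
have -> : ham (opp_bivector Qm) f x = - ham Qm f x by rewrite /ham /opp_bivector /= scaleN1r.
by rewrite topp opprK.
Qed.

Lemma bp_gauge x : gauge_related Ip Im Qp (pull2 l B) x.
Proof.
have omI' p (u v : tangent p) : om p u (I p v) = B p u v.
  by rewrite (f2_alt _ _ (bp_om HP).1) (bp_omI HP) (f2_alt _ _ (bp_B HP).1) opprK.
have bI (v : tangent x) h : tmap b (l x) (I _ (tmap l x v)) h = Ip x v h.
  by rewrite (bp_Ib HP); apply: endo_eq; [exact: bp_bl HP x|exact: bp_section (bp_bl HP)].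
have aI (v : tangent x) h : tmap a (l x) (I _ (tmap l x v)) h = Im x v h.
  by rewrite (bp_Ia HP); apply: endo_eq; [exact: bp_al HP x|exact: bp_section (bp_al HP)].
split=> [v|v w].
  have [f fE] := covector_differential (pull2 l B x v).
  pose u := I _ (tmap l x v); pose u' := ham QZ (sf_comp b f) (l x).
  have [w0 w0E] : exists w0, u - u' = tmap l x w0.
    apply/(bp_lag HP) => w; rewrite f2DL f2NL (bp_omI HP) (f2_ham _ _ (bp_inv HP)).
    have := congr1 (fun l : cotangent x => l w) fE => E1.
    rewrite -[X in X - _]/(pull2 l B x v w) E1 dmapE; apply/eqP; rewrite subr_eq0; apply/eqP.
    transitivity (w f) => //; congr (w _); apply: sf_ext => q /=; by rewrite (bp_bl HP).
  have uE : u = u' + tmap l x w0 by rewrite -w0E subrKC.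
  rewrite fE; apply: tangent_ext => h; rewrite tadd topp -bI -aI -/u uE !dmapD !tadd bp_ham_b tzero add0r.
  rewrite (bp_section w0 (bp_bl HP)) (bp_section w0 (bp_al HP)) addrK.
  exact: (real_poisson_val (bp_pb HP) (bp_bl HP x)).
(* For the second relation: [k] is vertical for [b] and [k'] for [a], so they are orthogonal; as the
   brane is isotropic, only the two mixed terms survive, and these are values of [B]. *)
pose k := tmap l x (Ip x v) - I _ (tmap l x v); pose k' := tmap l x (Im x w) - I _ (tmap l x w).
have bk : tmap b (l x) k = 0.
  apply: tangent_ext => h; rewrite dmapB tadd topp (bp_section _ (bp_bl HP)) bI subrr //.
have ak : tmap a (l x) k' = 0.
  apply: tangent_ext => h; rewrite dmapB tadd topp (bp_section _ (bp_al HP)) aI subrr //.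
have := proj1 (bp_kb HP k) bk k' ak.
rewrite f2DL f2NL !dualB bp_isotropic !omI' (bp_omI HP) (bp_BI HP) bp_isotropic.
rewrite -[B _ (tmap l x (Ip x v)) _]/(pull2 l B x (Ip x v) w) -[B _ _ (tmap l x (Im x w))]/(pull2 l B x v (Im x w)).
by lra.
Qed.

End LinearAlgebra.

Lemma span_degenerate_GK (Xm Xp : hpdata R) (S : bspan Xm Xp) (Dm : diffeo (bs_L S) Xm) (Dp : diffeo (bs_L S) Xp) :
  hpoisson Xm -> hpoisson Xp -> morita_brane S -> Dm =1 bs_pim S \o bs_emb S -> Dp =1 bs_pip S \o bs_emb S ->
  [/\ pull_bivector Dp (hp_Q Xp) = pull_bivector Dm (hp_Q Xm),
      forall p u v, pull2 (bs_emb S) (im2 (bs_Om S)) p u v = 0,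
      degenerate_GK (gk_of_span S Dm Dp) &
      exists QZ, brane_pair (gk_Ip (gk_of_span S Dm Dp)) (gk_Im (gk_of_span S Dm Dp)) (gk_Q (gk_of_span S Dm Dp)) (gk_Q (gk_of_span S Dm Dp))
        (bs_I S) (re2 (bs_Om S)) (im2 (bs_Om S)) QZ
        (smap_comp (df_bwd Dm) (bs_pim S)) (smap_comp (df_bwd Dp) (bs_pip S)) (bs_emb S)].
Proof.
move=> hm hp HS HDm HDp; have hm' := pull_hpoisson Dm hm; have hp' := pull_hpoisson Dp hp.
have [QZ HP] := span_brane_pair HS HDm HDp (pull_endo_bwd Dm _) (pull_endo_bwd Dp _)
  (@pull_bivector_bwd _ _ _ Dm _) (@pull_bivector_bwd _ _ _ Dp _) (@complete_bwd _ _ _ Dp _) (let: And5 _ r _ _ _ := hp' in r.1).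
have QE : pull_bivector Dp (hp_Q Xp) = pull_bivector Dm (hp_Q Xm).
  by apply: functional_extensionality_dep => x; apply: linear_ext => xi; exact: (bp_bivector HP).
split; first exact: QE.
- by move=> x u v; exact: (bp_isotropic HP).
- have hm2 : holomorphic_poisson (pull_endo Dm (hp_I Xm)) (pull_bivector Dp (hp_Q Xp)) by rewrite QE.
  have cF : closed_2form (pull2 (bs_emb S) (re2 (bs_Om S))) by apply: closed_pull2; exact: (bp_B HP).
  split; [exact: hp'|exact: hm2|exact: cF|] => x.
  have [[Ip2 _] rQ aSp _ _] := hp'; have [[Im2 _] _ aSm _ _] := hm2.
  apply/(gauge_relatedP (Ip2 x) (Im2 x) _ _ (cF.1.2 x) (rQ.2 x)).
  + by move=> eta; apply: sigma_type => //; exact: aSp.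
  + by move=> eta; apply: sigma_type => //; exact: aSm.
  + exact: (bp_gauge HP).
- by exists QZ; rewrite -QE in HP; exact: HP.
Qed.

Lemma endo_of_id (M : manifold R) (D : diffeo M M) (I : endo M) p : (forall q, D q = q) -> pull_endo D I p =1 I p.
Proof.
move=> H v; apply: tangent_ext => f; transitivity (I (D p) (tmap D p v) (sf_comp (df_bwd D) f)) => //.
have -> : sf_comp (df_bwd D) f = f by apply: sf_ext => q /=; rewrite -[in RHS](df_bwdK D q) H.
by apply: endo_eq => // h; exact: tmap_id.
Qed.

Lemma bivector_of_id (M : manifold R) (D : diffeo M M) (Q : bivector M) p : (forall q, D q = q) -> pull_bivector D Q p =1 Q p.
Proof.
move=> H xi; apply: tangent_ext => f; transitivity (Q (D p) (transp (dmap (df_fwdK D p)) xi) (sf_comp (df_bwd D) f)) => //.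
have E h : sf_comp (df_bwd D) h = h by apply: sf_ext => q /=; rewrite -[in RHS](df_bwdK D q) H.
rewrite E; apply: bivector_eq => // u v uv; transitivity (xi (dmap (df_fwdK D p) u)) => //.
by congr (xi _); apply: tangent_ext => h; rewrite dmapE E uv.
Qed.

(** The form of the groupoid vanishes on the units, so only [t^* F] remains there. *)
Lemma gauge_unit (M : manifold R) (G : groupoid M) (Om : cform2 (gr_arrows G)) (F : form2 M) (x : M) (u v : tangent x) :
  lie_groupoid G -> Defs.multiplicative (re2 Om) ->
  re2 (gauge_form Om F) _ (tmap (gr_unit G) x u) (tmap (gr_unit G) x v) = F x u v.
Proof.
move=> LG mB; transitivity (re2 Om _ (tmap (gr_unit G) x u) (tmap (gr_unit G) x v) +
  F _ (tmap (gr_t G) _ (tmap (gr_unit G) x u)) (tmap (gr_t G) _ (tmap (gr_unit G) x v))) => //.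
rewrite (mult_unit LG mB) add0r; apply: f2_eq => [|f|f]; first exact: t_unit.
- by rewrite !dmapE; congr (u _); apply: sf_ext => q /=; rewrite t_unit.
- by rewrite !dmapE; congr (v _); apply: sf_ext => q /=; rewrite t_unit.
Qed.

Lemma gk_of_span_of_gk (M : manifold R) (D : gkdata M) (G : groupoid M) (I0 I : endo (gr_arrows G))
    (Om : cform2 (gr_arrows G)) (Dm : diffeo M (Xminus D)) (Dp : diffeo M (Xplus D)) :
  @weinstein_groupoid R (Xminus D) G I0 Om -> Dm =1 gr_s G \o gr_unit G -> Dp =1 gr_t G \o gr_unit G ->
  gk_eq (gk_of_span (span_of_gk D Om I) Dm Dp) D.
Proof.
move=> [[LG _ _ [mB _] _] _] HDm HDp p.
have m1 q : Dm q = q by rewrite HDm /= s_unit.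
have p1 q : Dp q = q by rewrite HDp /= t_unit.
split; [exact: endo_of_id|exact: endo_of_id|exact: bivector_of_id|].
move=> u; apply: dual_ext => v; exact: (gauge_unit _ _ _ LG mB).
Qed.

End BranePairs.

(** * Monodromy *)

Section Monodromy.
Context (R : realType) (T : topologicalType) (S : Type) (A : set T) (Lam : T -> S -> Prop).
(* Over [V z] the relation [Lam] is the disjoint union of the graphs of the sections [sec z s]. *)
Variables (V : T -> set T) (sec : T -> S -> T -> S).
Hypothesis V_nbhs : forall z, A z -> nbhs z (V z).
Hypothesis sec_refl : forall z s, A z -> Lam z s -> sec z s z = s.
Hypothesis sec_Lam : forall z s v, A z -> Lam z s -> V z v -> A v -> Lam v (sec z s v).
Hypothesis sec_inj : forall z s s' v, sec z s v = sec z s' v -> s = s'.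
Hypothesis sec_surj : forall z v r, A z -> V z v -> A v -> Lam v r -> exists s, Lam z s /\ sec z s v = r.
Hypothesis sec_trans : forall z s v, A z -> Lam z s -> V z v -> A v ->
  \forall w \near v, A w -> sec z s w = sec v (sec z s v) w.

(** Near each time [lam] follows the section through its current value; this stands for continuity,
    as [S] carries no topology. *)
Definition is_lift (gam : R -> T) (lam : R -> S) : Prop :=
  forall t, Lam (gam t) (lam t) /\ \forall s \near t, lam s = sec (gam t) (lam t) (gam s).

Lemma lift_comp gam lam (th : R -> R) : continuous th -> is_lift gam lam -> is_lift (gam \o th) (lam \o th).
Proof. by move=> cth H t; have [h1 h2] := H (th t); split=> //; exact: (cth t _ h2). Qed.

(** Near a given time both lifts are sections of the same base point; if they agree once there,
    injectivity of [sec] makes these sections equal. *)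
Lemma lift_uniq gam lam mu r : is_lift gam lam -> is_lift gam mu -> lam r = mu r -> forall t, lam t = mu t.
Proof.
move=> H H' E t; suff : (fun s => lam (r + s) = mu (r + s)) (t - r) by rewrite subrKC.
apply: (@real_ind R (fun s => lam (r + s) = mu (r + s))); first by rewrite addr0.
move=> s; have [_ h] := H (r + s); have [_ h'] := H' (r + s).
have [e e0 He] := near_interval (filterI h h'); exists e => // u u' us us' Eu.
have cl (v : R) : `|v - s| < e -> `|r + v - (r + s)| < e by rewrite opprD addrACA subrr add0r.
have [E1 E2] := He _ (cl _ us); have [E3 E4] := He _ (cl _ us').
by rewrite E3 E4; congr (sec _ _ _); apply: (@sec_inj (gam (r + s)) _ _ (gam (r + u))); rewrite -E1 -E2.
Qed.

Lemma continuous_minl (T0 : R) : continuous (fun s : R => Num.min T0 s).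
Proof. by move=> s; apply: (@continuous_min R R (cst T0) id); [exact: cst_continuous|exact: cvg_id]. Qed.

Lemma continuous_maxl (T0 : R) : continuous (fun s : R => Num.max T0 s).
Proof. by move=> s; apply: (@continuous_max R R (cst T0) id); [exact: cst_continuous|exact: cvg_id]. Qed.

(** Induction on the final time [T0]. The path is frozen after [T0] and constant before 0, so lifts
    are defined on the whole line and only their extension near one time is at issue. *)
Lemma lift_exists (gam : R -> T) (s0 : S) : continuous gam -> (forall t, A (gam t)) -> (forall t : R, t <= 0 -> gam t = gam 0) ->
  Lam (gam 0) s0 -> forall T0 : R, exists lam : R -> S, is_lift (fun t : R => gam (Num.min T0 t)) lam /\ lam 0 = s0.
Proof.
move=> cg Ag g0 L0.
pose P (T0 : R) := exists lam : R -> S, is_lift (fun t : R => gam (Num.min T0 t)) lam /\ forall t : R, t <= 0 -> lam t = s0.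
suff H : forall T0, P T0 by move=> T0; have [lam [H1 H2]] := H T0; exists lam; rewrite H2.
apply: (@real_ind R P) => [|t0].
  have E t : gam (Num.min 0 t) = gam 0 by rewrite g0// ge_min lexx.
  by exists (fun=> s0); split=> // t; rewrite !E; split=> //; near=> s; rewrite E sec_refl.
set z := gam t0; have [e e0 He] := near_interval (cg t0 _ (V_nbhs (Ag t0))).
exists e => // T1 T2 h1 h2 [lam [Hl l0]].
have [T21|T12] := leP T2 T1.
  exists (lam \o (fun s : R => Num.min T2 s)); split=> [|t tn] /=.
    have := lift_comp (@continuous_minl T2) Hl; congr is_lift; apply/funext => t /=.
    by rewrite minA (min_idPr T21).
  by rewrite l0// ge_min tn orbT.
have [Lz _] := Hl T1; rewrite minxx in Lz.
have [r [Lr rE]] := sec_surj (Ag t0) (He T1 h1) (Ag T1) Lz.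
(* After [T1], follow the section of [z] through [lam T1]; the middle case keeps the value [s0] at
   negative times when [T1] is itself negative. *)
pose mu (t : R) : S := if t <= T1 then lam t else if t <= 0 then s0 else sec z r (gam (Num.min T2 t)).
have near2 (t : R) : T1 <= t -> `|Num.min T2 t - t0| < e.
  by move: h1 h2; rewrite !ltr_norml => /andP[? ?] /andP[? ?] ?; case: (leP T2 t) => ?; apply/andP; split; lra.
have lamT : forall t : R, T1 <= t -> lam t = lam T1.
  move=> t tT; have := @lift_uniq (fun s : R => gam (Num.min T1 s)) lam (lam \o (fun s : R => Num.min T1 s)) T1 Hl.
  move=> ->; rewrite /= ?minxx ?(min_idPl tT)//.
  have := lift_comp (@continuous_minl T1) Hl; congr is_lift; apply/funext => s /=; by rewrite minA minxx.
have muE (t : R) : T1 <= t -> mu t = sec z r (gam (Num.min T2 t)).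
  move=> tT; rewrite /mu; case: leP => [tT'|_].
    have -> : t = T1 by apply/eqP; rewrite eq_le tT'.
    by rewrite (min_idPr (ltW T12)) rE.
  case: leP => // tn.
  have g1 : gam (Num.min T2 t) = gam T1.
    by rewrite g0 ?ge_min ?tn ?orbT// -(g0 T1)//; lra.
  by rewrite g1 rE -(l0 T1)//; lra.
exists mu; split=> [t|t tn]; last first.
  by rewrite /mu tn; case: leP => // _; exact: l0.
have gmin (s : R) : s <= T1 -> gam (Num.min T2 s) = gam (Num.min T1 s).
  by move=> sT; rewrite (min_idPr sT) (min_idPr (le_trans sT (ltW T12))).
have cgm : continuous (fun s : R => gam (Num.min T2 s)).
  by move=> s; apply: (@continuous_comp _ _ _ (fun s : R => Num.min T2 s) gam); [exact: continuous_minl|exact: cg].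
have tr (s : R) : T1 <= s -> \forall u \near s, sec z r (gam (Num.min T2 u)) = sec (gam (Num.min T2 s)) (sec z r (gam (Num.min T2 s))) (gam (Num.min T2 u)).
  move=> sT; have := @sec_trans z r (gam (Num.min T2 s)) (Ag t0) Lr (He _ (near2 _ sT)) (Ag _).
  by move=> h; near=> u; (have := Ag (Num.min T2 u)); near: u; exact: (cgm s _ h).
have [tT|tT] := ltP t T1.
  have [h3 h4] := Hl t; have tE : mu t = lam t by rewrite /mu (ltW tT).
  rewrite tE gmin ?(ltW tT)//; split=> //.
  have n1 : \forall u \near t, u < T1 by apply: lt_nbhsl.
  near=> u; have uT : u < T1 by near: u.
  by rewrite /mu (ltW uT) gmin ?(ltW uT)//; near: u.
rewrite muE//; split; first exact: (sec_Lam (Ag t0) Lr (He _ (near2 _ tT)) (Ag _)).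
have := tr t tT; have [->|tT'] := eqVneq t T1.
  have [_ h4] := Hl T1; move=> h5; near=> u.
  have -> : sec z r (gam (Num.min T2 T1)) = lam T1 by rewrite (min_idPr (ltW T12)) rE.
  have [uT|uT] := leP u T1.
    rewrite /mu uT gmin// gmin//; near: u; exact: h4.
  rewrite muE ?(ltW uT)//.
  have -> : lam T1 = sec z r (gam (Num.min T2 T1)) by rewrite (min_idPr (ltW T12)) rE.
  by near: u.
have n1 : \forall u \near t, T1 < u by apply: lt_nbhsr; rewrite lt_neqAle eq_sym tT'.
move=> h5; near=> u; have uT : T1 < u by near: u.
by rewrite muE ?(ltW uT)//; near: u.
Unshelve. all: by end_near. Qed.

(** The end value is locally constant in [t]: for fixed [t0], induction on [s] shows that the lifts
    for [t] near [t0] are given by the section through [lam t0 s], and at [s = 1] the path does not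
    depend on [t]. *)
Lemma homotopy_lift (H : R * R -> T) (lam : R -> R -> S) z0 z1 s0 : continuous H -> (forall x, A (H x)) ->
  (forall t, H (t, 0) = z0) -> (forall t, H (t, 1) = z1) ->
  (forall t, is_lift (fun s : R => H (t, s)) (lam t)) -> (forall t, lam t 0 = s0) -> forall t, lam t 1 = lam 0 1.
Proof.
move=> cH AH H0 H1 Hl l0.
have cHs (t : R) : continuous (fun s : R => H (t, s)).
  move=> s; apply: (@continuous_comp _ _ _ (fun s : R => (t, s)) H); last exact: cH.
  by apply: (@cvg_pair _ _ _ (nbhs s) (nbhs t) (nbhs s)); [exact: cvg_cst|exact: cvg_id].
have cHt (s : R) : continuous (fun t => H (t, s)).
  move=> t; apply: (@continuous_comp _ _ _ (fun t : R => (t, s)) H); last exact: cH.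
  by apply: (@cvg_pair _ _ _ (nbhs t) (nbhs t) (nbhs s)); [exact: cvg_id|exact: cvg_cst].
suff Hloc t0 : \forall t \near t0, lam t 1 = lam t0 1.
  apply: (@real_ind R (fun t => lam t 1 = lam 0 1)) => // t.
  have [e e0 He] := near_interval (Hloc t); exists e => // u u' ut ut' E.
  by rewrite (He u' ut') -(He u ut).
pose Q (s : R) := \forall t \near t0, lam t s = sec (H (t0, s)) (lam t0 s) (H (t, s)).
suff /(_ 1) : forall s, Q s.
  rewrite /Q => h; near=> t; have -> : lam t 1 = sec (H (t0, 1)) (lam t0 1) (H (t, 1)) by near: t.
  rewrite !H1 sec_refl// -(H1 t0) //; exact: (Hl t0 1).1.
apply: (@real_ind R Q) => [|ss].
  by rewrite /Q; near=> t; rewrite !H0 !l0 sec_refl// -(H0 t0) // -(l0 t0); exact: (Hl t0 0).1.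
set z := H (t0, ss).
have /nbhs_ballP[d /= d0 Hd] : nbhs (t0, ss) (fun x => V z (H x)) by apply: cH; exact: V_nbhs.
have {}Hd (t s : R) : `|t - t0| < d -> `|s - ss| < d -> V z (H (t, s)).
  by move=> td sd; apply: (Hd (t, s)); split; rewrite /= -ball_normE /ball_/= distrC.
have [Lz hz] := Hl t0 ss; have [e e0 He] := near_interval hz.
exists (Num.min d e); first by rewrite lt_min d0.
move=> s1 s2; rewrite !lt_min => /andP[s1d s1e] /andP[s2d s2e] Q1.
have t00 : `|t0 - t0| < d by rewrite subrr normr0.
have A4 (s : R) : `|s - ss| < d -> `|s - ss| < e -> \forall t \near t0,
    sec z (lam t0 ss) (H (t, s)) = sec (H (t0, s)) (lam t0 s) (H (t, s)).
  move=> sd se; have := @sec_trans z (lam t0 ss) (H (t0, s)) (AH _) Lz (Hd _ _ t00 sd) (AH _).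
  by rewrite -(He s se) => h; near=> t; (have := AH (t, s)); near: t; exact: (cHt s t0 _ h).
have nt : \forall t \near t0, `|t - t0| < d by apply: (interval_near d0).
have a1 := A4 s1 s1d s1e; have a2 := A4 s2 s2d s2e.
rewrite /Q; near=> t.
have td : `|t - t0| < d by near: t.
have e1 : lam t s1 = sec (H (t0, s1)) (lam t0 s1) (H (t, s1)) by near: t.
have e2 : sec z (lam t0 ss) (H (t, s1)) = sec (H (t0, s1)) (lam t0 s1) (H (t, s1)) by near: t.
have e3 : sec z (lam t0 ss) (H (t, s2)) = sec (H (t0, s2)) (lam t0 s2) (H (t, s2)) by near: t.
rewrite -e3.
(* [th] clamps time to the segment between [s1] and [s2], where the path stays in [V z]; there
   [lam t] and the section through [lam t0 ss] are two lifts of the same path. *)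
pose th (s : R) : R := Num.max (Num.min s1 s2) (Num.min (Num.max s1 s2) s).
have cth : continuous th.
  by move=> s; apply: (@continuous_comp _ _ _ (fun s : R => Num.min (Num.max s1 s2) s) (fun s : R => Num.max (Num.min s1 s2) s));
    [exact: continuous_minl|exact: continuous_maxl].
have th1 : th s1 = s1.
  by rewrite /th; case: (leP s1 s2) => h; [rewrite ?(min_idPr h) maxxx|rewrite minxx ?(max_idPr (ltW h))].
have th2 : th s2 = s2.
  by rewrite /th; case: (leP s1 s2) => h; [rewrite minxx ?(max_idPr h)|rewrite ?(min_idPr (ltW h)) maxxx].
have thd (s : R) : `|th s - ss| < d.
  by move: s1d s2d; rewrite /th !ltr_norml => /andP[? ?] /andP[? ?]; case: (leP s1 s2) => ?; [case: (leP s2 s) => ?|case: (leP s1 s) => ?];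
    [case: (leP s1 s2)|case: (leP s1 s)|case: (leP s2 s1)|case: (leP s2 s)] => ?; apply/andP; split; lra.
have L1 := lift_comp cth (Hl t).
have L2 : is_lift ((fun s : R => H (t, s)) \o th) (fun s => sec z (lam t0 ss) (H (t, th s))).
  move=> s; split; first exact: (sec_Lam (AH (t0, ss)) Lz (Hd t (th s) td (thd s)) (AH (t, th s))).
  have := @sec_trans z (lam t0 ss) (H (t, th s)) (AH _) Lz (Hd _ _ td (thd s)) (AH _).
  have cc : continuous (fun s : R => H (t, th s)).
    by move=> u; apply: (@continuous_comp _ _ _ th (fun s : R => H (t, s))); [exact: cth|exact: cHs].
  by move=> h; near=> u; (have := AH (t, th u)); near: u; exact: (cc s _ h).
by have := lift_uniq (r := s1) L1 L2; rewrite /= th1 e1 -e2 => /(_ erefl s2); rewrite th2.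
Unshelve. all: by end_near. Qed.

(** A null homotopy carries the lift of the loop to a lift of the constant loop without changing its
    end value. *)
Lemma monodromy_trivial (gam : R -> T) (lam : R -> S) : simply_connected R A -> continuous gam -> (forall t, A (gam t)) ->
  (forall t : R, t <= 0 -> gam t = gam 0) -> (forall t : R, 1 <= t -> gam t = gam 1) -> gam 0 = gam 1 ->
  is_lift gam lam -> lam 1 = lam 0.
Proof.
move=> scA cg Ag g0 g1 g01 Hl; have [||//|H [cH AH H0 H1 Hs]] := scA gam.
- exact: continuous_subspaceT.
- by move=> s _.
(* [simply_connected] controls the homotopy on the unit square only; clamping both variables extends
   it to the plane. *)
pose c (t : R) : R := Num.max 0 (Num.min 1 t).
have cc : continuous c.
  by move=> s; apply: (@continuous_comp _ _ _ (fun s : R => Num.min 1 s) (fun s : R => Num.max 0 s));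
    [exact: continuous_minl|exact: continuous_maxl].
have cI (t : R) : c t \in `[0, 1].
  by rewrite in_itv /= /c le_max lexx/= ge_max ler01 ge_min lexx.
have c0 (t : R) : t <= 0 -> c t = 0 by move=> h; rewrite /c (min_idPr (le_trans h ler01)) (max_idPl h).
have c1 (t : R) : 1 <= t -> c t = 1 by move=> h; rewrite /c (min_idPl h) (max_idPr ler01).
pose K (x : R * R) := H (c x.1, c x.2).
have cK : continuous K.
  move=> x; pose c2 (y : R * R) := (c y.1, c y.2).
  have cc2 : {for x, continuous c2}.
    apply: (@cvg_pair _ _ _ (nbhs x) (nbhs (c x.1)) (nbhs (c x.2))); [apply: (@continuous_comp _ _ _ fst c x)|apply: (@continuous_comp _ _ _ snd c x)];
      [exact: cvg_fst|exact: cc|exact: cvg_snd|exact: cc].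
  move=> W WK.
  have h : nbhs (c2 x) (fun y => (`[0, 1]%classic `*` `[0, 1]%classic) y -> W (H y)).
    exact: (proj1 (subspace_continuousP _ _) cH (c2 x) (conj (cI x.1) (cI x.2)) W WK).
  have h2 := cc2 _ h; rewrite /nbhs /= in h2 *; near=> y.
  have h3 : (`[0, 1]%classic `*` `[0, 1]%classic) (c2 y) -> W (H (c2 y)) by near: y; exact: h2.
  exact: h3 (conj (cI y.1) (cI y.2)).
have AK x : A (K x) by apply: AH; exact: cI.
have K0 t : K (t, 0) = gam 0 by rewrite /K /= (c0 0)// (Hs _ (cI t)).1.
have K1 t : K (t, 1) = gam 0 by rewrite /K /= (c1 1)// (Hs _ (cI t)).2.
have cKs (t : R) : continuous (fun s : R => K (t, s)).
  move=> s; apply: (@continuous_comp _ _ _ (fun s : R => (t, s)) K); last exact: cK.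
  by apply: (@cvg_pair _ _ _ (nbhs s) (nbhs t) (nbhs s)); [exact: cvg_cst|exact: cvg_id].
have ex (t : R) : exists mu : R -> S, is_lift (fun s : R => K (t, s)) mu /\ mu 0 = lam 0.
  have h0 (s : R) : s <= 0 -> K (t, s) = K (t, 0) by move=> s0; rewrite /K /= (c0 s s0) (c0 0).
  have L0 : Lam (K (t, 0)) (lam 0) by rewrite K0; exact: (Hl 0).1.
  have [mu [Hmu m0]] := @lift_exists (fun s : R => K (t, s)) (lam 0) (cKs t) (fun s => AK (t, s)) h0 L0 1.
  exists mu; split=> //; move: Hmu; congr is_lift; apply/funext => s.
  by rewrite /K /=; case: (leP 1 s) => // h; rewrite (c1 1)// (c1 s).
have [mu Hmu] := choice ex.
have E := @homotopy_lift K mu (gam 0) (gam 0) (lam 0) cK AK K0 K1 (fun t => (Hmu t).1) (fun t => (Hmu t).2).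
have -> : lam 1 = mu 0 1.
  apply: (@lift_uniq gam lam (mu 0) 0 Hl) => //; last by rewrite (Hmu 0).2.
  have := (Hmu 0).1; congr is_lift; apply/funext => s; rewrite /K /= (c0 0)// H0//.
  have [s0|s0] := leP s 0; first by rewrite c0// (g0 s).
  have [s1|s1] := leP 1 s; first by rewrite c1// (g1 s).
  by rewrite /c (min_idPr (ltW s1)) (max_idPr (ltW s0)).
rewrite -(E 1); have := @lift_uniq (fun s : R => K (1, s)) (mu 1) (fun=> lam 0) 0 (Hmu 1).1.
apply; last by rewrite (Hmu 1).2.
have KK (s : R) : K (1, s) = gam 0 by rewrite /K /= (c1 1)// H1.
move=> s; rewrite KK; split; first exact: (Hl 0).1.
by near=> u; rewrite KK sec_refl//; exact: (Hl 0).1.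
Unshelve. all: by end_near. Qed.

End Monodromy.

(** * Words of Hamiltonian flows *)

Section Words.
Context (R : realType) (L : manifold R) (Qp : bivector L).

Definition chf := {f : smoothfun L | complete_vf (ham Qp f)}.

(** The last letter of the word acts first, so that concatenation is composition. *)
Definition act (Z : manifold R) (F : chf -> R -> smap Z Z) (w : seq (chf * R)) : smap Z Z :=
  foldr (fun kt => smap_comp (F kt.1 kt.2)) (id_smap Z) w.

Definition winv (w : seq (chf * R)) : seq (chf * R) := rev [seq (kt.1, - kt.2) | kt <- w].

Section TimeVectors.
Context (J : Type) (k : J -> chf) (m : nat).

(* A point of R^(size s + m) lists times for the flows of the [k j], [j] in [s], followed by a point of R^m. *)
Fixpoint par (s : seq J) : 'rV[R]_(size s + m) -> seq (chf * R) :=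
  match s return 'rV[R]_(size s + m) -> seq (chf * R) with
  | [::] => fun _ => [::]
  | j :: s' => fun z => (k j, (z : 'rV[R]_(1 + (size s' + m))) 0 0) :: par (rsubmx (z : 'rV[R]_(1 + (size s' + m))))
  end.

Fixpoint tail (s : seq J) : 'rV[R]_(size s + m) -> 'rV[R]_m :=
  match s return 'rV[R]_(size s + m) -> 'rV[R]_m with
  | [::] => fun z => z
  | j :: s' => fun z => tail (rsubmx (z : 'rV[R]_(1 + (size s' + m))))
  end.

Fixpoint pad (s : seq J) (c : J -> R) (y : 'rV[R]_m) : 'rV[R]_(size s + m) :=
  match s return 'rV[R]_(size s + m) with
  | [::] => y
  | j :: s' => (row_mx (const_mx (c j) : 'rV[R]_1) (pad s' c y) : 'rV[R]_(1 + (size s' + m)))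
  end.

(* the Hamiltonian generating the velocity of the word with times [z] in direction [h], see [theta_vel] *)
Fixpoint par_ham (FL : chf -> R -> smap L L) (s : seq J) : 'rV[R]_(size s + m) -> 'rV[R]_(size s + m) -> smoothfun L :=
  match s return 'rV[R]_(size s + m) -> 'rV[R]_(size s + m) -> smoothfun L with
  | [::] => fun _ _ => 0
  | j :: s' => fun z h => (h : 'rV[R]_(1 + (size s' + m))) 0 0 *: sval (k j) +
      sf_comp (FL (k j) (- (z : 'rV[R]_(1 + (size s' + m))) 0 0))
        (par_ham FL (rsubmx (z : 'rV[R]_(1 + (size s' + m)))) (rsubmx (h : 'rV[R]_(1 + (size s' + m)))))
  end.

Lemma row_mx_hd n (c : R) (y : 'rV[R]_n) : (row_mx (const_mx c : 'rV[R]_1) y : 'rV[R]_(1 + n)) 0 0 = c.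
Proof.
have -> : (0 : 'I_(1 + n)) = lshift n (0 : 'I_1) by exact: val_inj.
by rewrite row_mxEl mxE.
Qed.

Lemma tail_pad s c y : tail (pad s c y) = y.
Proof. by elim: s => //= j s IH; rewrite row_mxKr. Qed.

Lemma tail_smap s : exists T : smap (euclid R (size s + m)) (euclid R m), forall z, T z = tail z.
Proof.
elim: s => [|j s [T ET]]; first by exists (id_smap _).
by exists (smap_comp T (emap (@Cinfv_rsub R 1 (size s + m) setT openT))) => z; rewrite /= ET.
Qed.

End TimeVectors.

Lemma has_vel_line0 n (z u : 'rV[R]_n) : has_vel (fun r : R => (z + r *: u : euclid R n)) 0 (evec (z : euclid R n) u).
Proof. by have := has_vel_euclid (is_derive_line z u 0); rewrite scale0r addr0. Qed.

Lemma evecD n (z : euclid R n) (u v : 'rV[R]_n) f : evec z (u + v) f = evec z u f + evec z v f.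
Proof.
rewrite tangent_euclid [evec z u f]tangent_euclid [evec z v f]tangent_euclid -big_split; apply: eq_bigr => i _.
transitivity ((evec z u (ecoord R i) + evec z v (ecoord R i)) * 'D_(delta_mx 0 i) (f : 'rV[R]_n -> R) z); last exact: mulrDl.
by congr (_ * _); rewrite !evec_coord mxE.
Qed.

Section Pair.
Context (Ip Im : endo L) (Qm : bivector L) (Z : manifold R) (I : endo Z).
Context (B om : form2 Z) (QZ : bivector Z) (a b : smap Z L) (l : smap L Z).
Hypothesis HP : brane_pair Ip Im Qp Qm I B om QZ a b l.
Context (FL : chf -> R -> smap L L) (F : chf -> R -> smap Z Z).
Hypothesis HFL : forall f, is_flow (ham Qp (sval f)) (fun t => FL f t).
Hypothesis HF : forall f, is_flow (ham QZ (sf_comp b (sval f))) (fun t => F f t).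

Let hamb_smooth (f : smoothfun L) : smooth_vf (ham QZ (sf_comp b f)) := @ham_smooth R Z om QZ _ (bp_om HP).1 (bp_inv HP).
Let hamb (f : smoothfun L) : vfield Z := VField (hamb_smooth f).
Let haml (f : smoothfun L) : vfield L := VField (bp_sQ HP f).

Let FK f t : cancel (F f t) (F f (- t)) := @flowK R Z (hamb (sval f)) (fun t => F f t) (HF f) t.
Let FNK f t : cancel (F f (- t)) (F f t) := @flowNK R Z (hamb (sval f)) (fun t => F f t) (HF f) t.
Let F0 f z : F f 0 z = z. Proof. by have [->] := HF f. Qed.

Lemma act_cat w w' z : act F (w ++ w') z = act F w (act F w' z).
Proof. by elim: w => //= kt w ->. Qed.

Lemma act_winv w z : act F (winv w) (act F w z) = z.
Proof.
elim: w z => [|[f t] w IH] z //; rewrite /winv /= rev_cons -cats1 act_cat /= FK; exact: IH.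
Qed.

Lemma act_inj w : injective (act F w).
Proof. by move=> z z' E; rewrite -(act_winv w z) E act_winv. Qed.

Lemma act_winvK w z : act F w (act F (winv w) z) = z.
Proof.
elim: w z => [|[f t] w IH] z //; rewrite /winv /= rev_cons -cats1 act_cat /= IH; exact: FNK.
Qed.

Lemma flow_b f t z : b (F f t z) = FL f t (b z).
Proof.
have := @flow_eq R L (haml (sval f)) (fun t => FL f t) (HFL f) (fun t => b (F f t z)) t.
rewrite F0; apply => s; have [_ dF] := HF f.
have := has_vel_map b (dF z s); rewrite (real_poisson_ham _ _ (bp_pb HP)) //.
Qed.

Lemma flow_a f t z : a (F f t z) = a z.
Proof.
have [_ dF] := HF f; have hz s : has_vel (a \o fun s => F f s z) s (0 : tangent (a (F f s z))).
  by rewrite -(bp_ham_b HP (sval f) (F f s z)); exact: has_vel_map (dF z s).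
have sm0 : smooth_vf (fun p : L => 0 : tangent p) by move=> g; exact: smooth_cst.
have := @flow_eq R L (VField sm0) (fun _ p => p) _ (a \o fun s => F f s z) t hz; rewrite /= F0; apply.
by split=> // p s; exact: has_vel_cst.
Qed.

Lemma act_b w z : b (act F w z) = act FL w (b z).
Proof. by elim: w => //= -[f t] w IH /=; rewrite flow_b IH. Qed.

Lemma act_a w z : a (act F w z) = a z.
Proof. by elim: w => //= -[f t] w IH /=; rewrite flow_a IH. Qed.

Lemma flow_om f t z (u v : tangent z) : om (F f t z) (tmap (F f t) z u) (tmap (F f t) z v) = om z u v.
Proof.
have h p (v : tangent p) : om p (hamb (sval f) p) v = v (sf_comp b (sval f)) := f2_ham _ _ (bp_inv HP).
exact: (@flow_closed_form R Z (hamb (sval f)) (fun t => F f t) om (sf_comp b (sval f)) (bp_om HP) (HF f) h t (F f t) (fun p => erefl)).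
Qed.

Lemma tmap_flow_surj f t z (w : tangent (F f t z)) : exists u : tangent z, w = tmap (F f t) z u.
Proof.
exists (dmap (FK f t z) w); apply: tangent_ext => h; rewrite !dmapE; congr (w _).
by apply: sf_ext => q /=; rewrite FNK.
Qed.

(** The flow preserves [om], so it carries a Hamiltonian vector to that of the transported function;
    as the flow covers one on the base, that function is again a pullback by [b]. *)
Lemma flow_ham f t z g :
  tmap (F f t) z (ham QZ (sf_comp b g) z) = ham QZ (sf_comp b (sf_comp (FL f (- t)) g)) (F f t z).
Proof.
apply: (f2_nondeg (bp_inv HP)) => w; have [u ->] := tmap_flow_surj w.
rewrite flow_om !(f2_ham _ _ (bp_inv HP)) dmapE; congr (u _); apply: sf_ext => q /=.
by rewrite flow_b (@flowK R L (haml (sval f)) (fun t => FL f t) (HFL f)).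
Qed.

Lemma ham_b_ext g h z : (forall v : tangent (b z), v g = v h) -> ham QZ (sf_comp b g) z = ham QZ (sf_comp b h) z.
Proof. by move=> E; congr (QZ z _); apply: dual_ext => v; exact: E (tmap b z v). Qed.

(** [b] is a submersion, so the Hamiltonian vector determines the differential on the base. *)
Lemma ham_b_inj g h z : ham QZ (sf_comp b g) z = ham QZ (sf_comp b h) z -> forall v : tangent (b z), v g = v h.
Proof.
move=> E w; have [v <-] := (bp_b HP).2 z w; rewrite !dmapE.
by rewrite -!(f2_ham _ _ (bp_inv HP)) E.
Qed.

Lemma near_chf q (g : smoothfun L) : exists f : chf, forall v : tangent q, v (sval f) = v g.
Proof.
have [f [cf nf]] := ham_complete (bp_sQ HP) q g; exists (exist _ f cf) => v; exact: tg_near.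
Qed.

(** Vectors vertical for [a] are orthogonal to those vertical for [b], so [om] turns them into
    covectors pulled back by [b], and every covector is the differential of a function with complete
    field. *)
Lemma ker_a_ham z (u : tangent z) : tmap a z u = 0 -> exists f : chf, u = ham QZ (sf_comp b (sval f)) z.
Proof.
move=> /(bp_ka HP) H; have [m mE] := ann_ker ((bp_b HP).2 z) H.
have [g gE] := covector_differential m; have [f fE] := near_chf (b z) g; exists f.
rewrite (@ham_b_ext (sval f) g z fE); apply: (f2_nondeg (bp_inv HP)) => w.
rewrite (f2_ham _ _ (bp_inv HP)); transitivity ((transp (tmap b z) m) w); first by rewrite -mE.
by rewrite gE.
Qed.

Section Theta.
Context (J : Type) (k : J -> chf) (m : nat).
Implicit Types (s : seq J) (bet : smap (euclid R m) Z).

Lemma theta_exists s bet : exists Th : smap (euclid R (size s + m)) Z,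
  forall z, Th z = act F (par k (m := m) (s := s) z) (bet (tail (m := m) (s := s) z)).
Proof.
elim: s => [|j s [Th HTh]]; first by exists bet.
have [Th' HTh'] := @flow_joint_smap R Z (hamb (sval (k j))) (fun t => F (k j) t) (HF (k j)) _ Th.
by exists Th' => z; rewrite HTh' HTh.
Qed.

(** Each flow carries Hamiltonian vectors to Hamiltonian vectors, so a change of the times moves the
    endpoint by a single one, whose function lives on the base. The other term is the motion of the
    starting point [bet]. *)
Lemma theta_vel s bet (Th : smap (euclid R (size s + m)) Z) :
  (forall z, Th z = act F (par k (m := m) (s := s) z) (bet (tail (m := m) (s := s) z))) ->
  forall (z h : 'rV[R]_(size s + m)) f, tmap Th (z : euclid R (size s + m)) (evec (z : euclid R (size s + m)) h) f =
    ham QZ (sf_comp b (par_ham k FL z h)) (Th z) f +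
    evec (tail z : euclid R m) (tail h) (sf_comp (smap_comp (act F (par k z)) bet) f).
Proof.
elim: s Th => [|j s IH] Th HTh z h f.
  have -> : ham QZ (sf_comp b (par_ham k FL (s := [::]) z h)) (Th z) f = 0.
    have -> : ham QZ (sf_comp b (par_ham k FL (s := [::]) z h)) (Th z) = 0.
      apply: (f2_nondeg (bp_inv HP)) => w; rewrite (f2_ham _ _ (bp_inv HP)) f2_0L.
      by have -> : sf_comp b (par_ham k FL (s := [::]) z h) = 0 by [apply: sf_ext]; rewrite tg0.
    exact: tzero.
  by rewrite add0r dmapE; congr (evec _ _ _); apply: sf_ext => x /=; rewrite HTh.
have [Th' HTh'] := theta_exists s bet.
pose z0 : R := (z : 'rV[R]_(1 + (size s + m))) 0 0; pose z1 := rsubmx (z : 'rV[R]_(1 + (size s + m))).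
pose h0 : R := (h : 'rV[R]_(1 + (size s + m))) 0 0; pose h1 := rsubmx (h : 'rV[R]_(1 + (size s + m))).
have zE x : Th x = F (k j) ((x : 'rV[R]_(1 + (size s + m))) 0 0) (Th' (rsubmx (x : 'rV[R]_(1 + (size s + m))))).
  by rewrite HTh HTh'.
(* The direction [h] is split into the time of the first letter and the remaining coordinates. *)
pose u1 : 'rV[R]_(1 + (size s + m)) := row_mx (const_mx h0 : 'rV[R]_1) 0.
pose u2 : 'rV[R]_(1 + (size s + m)) := row_mx (const_mx 0 : 'rV[R]_1) h1.
have hE : h = u1 + u2.
  have E : (const_mx h0 : 'rV[R]_1) + const_mx 0 = lsubmx (h : 'rV[R]_(1 + (size s + m))).
    by apply/rowP => i; rewrite !mxE addr0 !ord1; congr (h _ _); exact: val_inj.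
  have K := hsubmxK (h : 'rV[R]_(1 + (size s + m))).
  transitivity (row_mx (lsubmx (h : 'rV[R]_(1 + (size s + m)))) h1); first by rewrite /h1 K.
  rewrite -E; transitivity (row_mx (const_mx h0 + const_mx 0 : 'rV[R]_1) (0 + h1)); first by rewrite add0r.
  by rewrite -add_row_mx.
have A1 : evec (z : euclid R (size (j :: s) + m)) u1 (sf_comp Th f) = h0 * ham QZ (sf_comp b (sval (k j))) (Th z) f.
  have [_ dF] := HF (k j).
  have v2 : has_vel (fun r : R => F (k j) (z0 + r * h0) (Th' z1)) 0 (h0 *: ham QZ (sf_comp b (sval (k j))) (F (k j) z0 (Th' z1))).
    have := @has_vel_scale R Z (fun r => F (k j) (z0 + r) (Th' z1)) h0 0; apply.
    have e : has_vel (fun r : R => F (k j) r (Th' z1)) (z0 + 0) (ham QZ (sf_comp b (sval (k j))) (F (k j) z0 (Th' z1))).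
      by rewrite addr0; exact: dF.
    by rewrite mul0r; exact: (@has_vel_shift R Z (fun r : R => F (k j) r (Th' z1)) z0 0 _ _ e).
  have := @vel_fun_eq R _ _ _ _ _ _ _ _ _ (sf_comp Th f) f (has_vel_line0 (z : 'rV[R]_(size (j :: s) + m)) u1) v2.
  move=> ->; first by rewrite tscale /z0 /z1 -zE.
  move=> r; rewrite /= zE; congr (f (F _ _ (Th' _))).
    by rewrite mxE mxE row_mx_hd.
  by rewrite linearD linearZ /= row_mxKr scaler0 addr0.
have A2 : evec (z : euclid R (size (j :: s) + m)) u2 (sf_comp Th f) = evec (z1 : euclid R (size s + m)) h1 (sf_comp Th' (sf_comp (F (k j) z0) f)).
  have := @vel_fun_eq R _ _ _ _ _ _ _ _ _ (sf_comp Th f) (sf_comp Th' (sf_comp (F (k j) z0) f)) (has_vel_line0 (z : 'rV[R]_(size (j :: s) + m)) u2) (has_vel_line0 z1 h1).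
  apply => r; rewrite /= zE; congr (f (F _ _ (Th' _))).
    by rewrite mxE mxE row_mx_hd mulr0 addr0.
  by rewrite linearD linearZ /= row_mxKr.
rewrite dmapE hE evecD A1 A2 -hE.
have := IH Th' HTh' z1 h1 (sf_comp (F (k j) z0) f); rewrite dmapE => ->.
have E3 : sf_comp (smap_comp (act F (par k z1)) bet) (sf_comp (F (k j) z0) f) =
    sf_comp (smap_comp (act F (par k (s := j :: s) z)) bet) f by exact: sf_ext.
rewrite addrA E3; congr (_ + _).
rewrite -[ham _ _ (Th' z1) _]/(tmap (F (k j) z0) (Th' z1) (ham QZ (sf_comp b (par_ham k FL z1 h1)) (Th' z1)) f) flow_ham.
have -> : F (k j) z0 (Th' z1) = Th z by rewrite zE.
rewrite -tscale -tadd; congr (tg_val _ f).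
apply: (f2_nondeg (bp_inv HP)) => w; rewrite f2DL f2ZL !(f2_ham _ _ (bp_inv HP)) -tg_lin.
by congr (w _); exact: sf_ext.
Qed.

Lemma act_par0 s (y : 'rV[R]_m) z : act F (par k (pad s (fun=> 0) y)) z = z.
Proof. by elim: s => //= j s IH; rewrite row_mxKr IH row_mx_hd F0. Qed.

Lemma par_ham_pad s c (y y' : 'rV[R]_m) q (v : tangent q) :
  v (par_ham k FL (pad s (fun=> 0) y) (pad s c y')) = \sum_(j <- s) c j * v (sval (k j)).
Proof.
elim: s => [|j s IH]; first by rewrite big_nil /= tg0.
rewrite big_cons /= tg_lin !row_mxKr !row_mx_hd -IH; congr (_ + v _).
by apply: sf_ext => p /=; rewrite oppr0; have [->] := HFL (k j).
Qed.

End Theta.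

(* the flows of [b^* k], for [k] running through coordinates at [b z0], sweep out the fibre of [a] *)
Lemma local_words z0 (sig : smap L Z) : (\forall x \near a z0, a (sig x) = x) -> sig (a z0) = z0 ->
  exists (n : nat) (s : seq 'I_n) (k : 'I_n -> chf) (gam : smap (euclid R (mdim L)) L) (psi : smap Z (euclid R (size s + mdim L))) (y0 : 'rV[R]_(mdim L)),
    psi z0 = pad s (fun=> 0) y0 /\
    \forall z \near z0, gam (tail (psi z)) = a z /\ act F (par k (psi z)) (sig (a z)) = z.
Proof.
move=> asig sig0; have [y [gam [gyx gy yg]]] := local_coords (a z0).
have [y' [gam' [gyx' gy' yg']]] := local_coords (b z0).
have [k kE] := choice (fun i => near_chf (b z0) (ycoord y' i)).
pose s := enum 'I_(mdim L); pose y0 : 'rV[R]_(mdim L) := y (a z0); pose zs := pad s (fun=> 0) y0.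
have [Th HTh] := theta_exists k s (smap_comp sig gam).
have Th0 : Th zs = z0 by rewrite HTh act_par0 tail_pad /= gyx.
have surj (w : tangent (Th zs)) : exists v, tmap Th (zs : euclid R _) v = w.
  have ea : a (Th zs) = a z0 by rewrite Th0.
  have eb : b (Th zs) = b z0 by rewrite Th0.
  have tc q (v : tangent q) f : q = a z0 -> v f = evec (y0 : euclid R _) (\row_i v (ycoord y i)) (sf_comp gam f).
    move=> E; subst q; rewrite (tangent_coord gy) tangent_euclid; apply: eq_bigr => i _.
    by rewrite evec_coord mxE.
  pose v := tmap a (Th zs) w; pose hl := \row_i v (ycoord y i).
  have e1 : smap_comp sig gam (y0 : euclid R _) = Th zs by rewrite Th0 /= gyx.
  pose w1 := dmap e1 (evec (y0 : euclid R _) hl).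
  have aw : tmap a (Th zs) (w - w1) = 0.
    apply: tangent_ext => f; rewrite dmapB tadd topp tzero; apply/eqP; rewrite subr_eq0; apply/eqP.
    rewrite [LHS](tc _ v) // !dmapE; apply: tg_near.
    have := @smap_near R _ _ gam (y0 : euclid R _) (fun x => a (sig x) = x).
    by rewrite gyx => /(_ asig); apply: filterS => x /= ->.
  have [g gE] := ker_a_ham aw.
  pose c i := 'D_(delta_mx 0 i) (fun x : 'rV[R]_(mdim L) => sval g (gam' x)) (y' (b z0)).
  have gc q (v' : tangent q) : q = b z0 -> v' (sval g) = \sum_(i <- s) c i * v' (sval (k i)).
    move=> E; subst q; rewrite (tangent_coord gy') /s big_enum /=; apply: eq_bigr => i _.
    by rewrite kE mulrC.
  exists (evec (zs : euclid R _) (pad s c hl)); apply: tangent_ext => f.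
  rewrite (theta_vel HTh) -[w](subrK w1) tadd gE; congr (_ + _).
    congr (tg_val _ f); apply: ham_b_ext => v'; rewrite par_ham_pad gc //.
  rewrite !tail_pad dmapE; congr (evec _ _ _); apply: sf_ext => x /=; congr (f _); exact: act_par0.
have [psi [psi0 Hpsi]] := local_section surj.
rewrite Th0 in psi0 Hpsi.
exists (mdim L), s, k, gam, psi, y0; split; first exact: psi0.
have n1 : \forall z \near z0, a (sig (gam (tail (psi z)))) = gam (tail (psi z)).
  have [T ET] := tail_smap (mdim L) s.
  have := @smap_near R _ _ (smap_comp gam (smap_comp T psi)) z0 (fun x => a (sig x) = x).
  rewrite /= ET psi0 tail_pad gyx => /(_ asig); apply: filterS => z /=; by rewrite ET.
near=> z.
have E1 : Th (psi z) = z by near: z.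
have E2 : a (sig (gam (tail (psi z)))) = gam (tail (psi z)) by near: z.
have E3 : gam (tail (psi z)) = a z by rewrite -{2}E1 HTh act_a /= E2.
by split=> //; rewrite -E3 -[RHS]E1 HTh.
Unshelve. all: by end_near. Qed.

Lemma fibre_words z0 : exists (n : nat) (s : seq 'I_n) (k : 'I_n -> chf) (psi : smap Z (euclid R (size s + mdim L))) (y0 : 'rV[R]_(mdim L)),
  psi z0 = pad s (fun=> 0) y0 /\ \forall z \near z0, a z = a z0 -> act F (par k (psi z)) z0 = z.
Proof.
have [sig [sig0 asig]] := local_section ((bp_a HP).2 z0).
have [n [s [k [gam [psi [y0 [psi0 H]]]]]]] := local_words asig sig0.
exists n, s, k, psi, y0; split=> //; apply: filterS H => z [_ E] az; by rewrite -[RHS]E az sig0.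
Qed.

(** Near each of its points a fibre of [a] is swept out by words starting there, so within the fibre
    the reached points and the unreached points both form open sets; the fibre is connected. *)
Lemma reached z : exists w, z = act F w (l (a z)).
Proof.
set x := a z; pose A := a @^-1` [set x]; pose E : set Z := fun v => exists w, v = act F w (l x).
have [conA _] := bp_sc HP x.
have near_E z0 : A z0 -> (E z0 -> \forall v \near z0, A v -> E v) /\ (~ E z0 -> \forall v \near z0, A v -> ~ E v).
  move=> Az0; have [n [s [k [psi [y0 [_ H]]]]]] := fibre_words z0; split=> [[w wE]|nE].
    apply: filterS H => v Hv Av; exists (par k (psi v) ++ w).
    by rewrite act_cat -wE Hv// Av Az0.
  apply: filterS H => v Hv Av [w wE]; apply: nE; exists (winv (par k (psi v)) ++ w).
  by rewrite act_cat -wE -{2}[v]Hv ?act_winv// Av Az0.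
have AE : A `&` E = A.
  apply: conA.
  - by exists (l x); split; [exact: (bp_al HP x)|exists [::]].
  - exists (interior [set v | A v -> E v]); first exact: open_interior.
    apply/seteqP; split=> v [Av Ev]; split=> //; first exact: (near_E v Av).1.
    exact: (interior_subset Ev).
  - exists (~` interior [set v | A v -> ~ E v]).
      by rewrite closedC; exact: open_interior.
    apply/seteqP; split=> v [Av Ev]; split=> //.
      by move=> /interior_subset; apply.
    by apply: contrapT => nE; apply: Ev; exact: (near_E v Av).2.
have : A z by [].
by rewrite -AE => -[].
Qed.

Lemma tmap_la p q (e : l q = p) (T : form2 Z) : (forall x (u v : tangent x), T (l x) (tmap l x u) (tmap l x v) = 0) ->
  forall u v, T p (dmap e u) (dmap e v) = 0.
Proof. by move: e => e; subst p. Qed.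

(* such a form is preserved by the flows of the [b^* f] and vanishes on [T_{l x}Z = ker da + l_* T_xL] *)
Lemma form_zero (T : form2 Z) : closed_2form T -> (forall f z (v : tangent z), T z (ham QZ (sf_comp b f) z) v = 0) ->
  (forall x (u v : tangent x), T (l x) (tmap l x u) (tmap l x v) = 0) -> forall z (u v : tangent z), T z u v = 0.
Proof.
move=> cT TX Tl z; have [w ->] := reached z; elim: w => [|[f t] w IH] u v /=.
  set x := a z; have e : l (a (l x)) = l x by rewrite (bp_al HP).
  have dec (u' : tangent (l x)) : exists g, u' = ham QZ (sf_comp b g) (l x) + dmap e (tmap a (l x) u').
    have [|g gE] := @ker_a_ham (l x) (u' - dmap e (tmap a (l x) u')).
      apply: tangent_ext => h; rewrite dmapB tadd topp tzero; apply/eqP; rewrite subr_eq0; apply/eqP.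
      by rewrite !dmapE; congr (u' _); apply: sf_ext => q /=; rewrite (bp_al HP).
    by exists (sval g); rewrite -gE subrK.
  have [g gE] := dec u; have [h hE] := dec v.
  have alt := f2_alt _ _ cT.1.
  by rewrite gE hE f2DL TX add0r alt f2DL TX add0r -alt tmap_la.
have [u' ->] := tmap_flow_surj u; have [v' ->] := tmap_flow_surj v.
have h p (v0 : tangent p) : T p (hamb (sval f) p) v0 = v0 (0 : smoothfun Z) by rewrite TX tg0.
have := @flow_closed_form R Z (hamb (sval f)) (fun t => F f t) T 0 cT (HF f) h t (F f t) (fun p => erefl) _ u' v'.
by move=> ->; exact: IH.
Qed.

End Pair.
End Words.

(** * Comparison of two Morita equivalences with the same brane data *)

Section TwoPairs.
Context (R : realType) (L : manifold R) (Qp : bivector L).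
Local Notation chf := (chf Qp).
Context (FL : chf -> R -> smap L L).
Hypothesis HFL : forall f, is_flow (ham Qp (sval f)) (fun t => FL f t).

Context (Ip Im : endo L) (Qm : bivector L) (Z : manifold R) (I : endo Z).
Context (B om : form2 Z) (QZ : bivector Z) (a b : smap Z L) (l : smap L Z).
Hypothesis HP : brane_pair Ip Im Qp Qm I B om QZ a b l.
Context (F : chf -> R -> smap Z Z).
Hypothesis HF : forall f, is_flow (ham QZ (sf_comp b (sval f))) (fun t => F f t).

Context (Ip' Im' : endo L) (Qm' : bivector L) (Z' : manifold R) (I' : endo Z').
Context (B' om' : form2 Z') (QZ' : bivector Z') (a' b' : smap Z' L) (l' : smap L Z').
Hypothesis HP' : brane_pair Ip' Im' Qp Qm' I' B' om' QZ' a' b' l'.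
Context (F' : chf -> R -> smap Z' Z').
Hypothesis HF' : forall f, is_flow (ham QZ' (sf_comp b' (sval f))) (fun t => F' f t).

Let hamb_smooth f : smooth_vf (ham QZ (sf_comp b f)) := @ham_smooth R Z om QZ _ (bp_om HP).1 (bp_inv HP).
Let hamb f : vfield Z := VField (hamb_smooth f).
Let hamb'_smooth f : smooth_vf (ham QZ' (sf_comp b' f)) := @ham_smooth R Z' om' QZ' _ (bp_om HP').1 (bp_inv HP').
Let hamb' f : vfield Z' := VField (hamb'_smooth f).

Let F0 f z : F f 0 z = z. Proof. by have [->] := HF f. Qed.
Let F'0 f z : F' f 0 z = z. Proof. by have [->] := HF' f. Qed.
Let FD f s t z : F f (s + t) z = F f s (F f t z) := @flow_add R Z (hamb (sval f)) (fun t => F f t) (HF f) s t z.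
Let F'D f s t z : F' f (s + t) z = F' f s (F' f t z) := @flow_add R Z' (hamb' (sval f)) (fun t => F' f t) (HF' f) s t z.

Definition related (z : Z) (z' : Z') : Prop := exists w x, z = act F w (l x) /\ z' = act F' w (l' x).

Lemma related_l x : related (l x) (l' x).
Proof. by exists [::], x. Qed.

Lemma related_act w z z' : related z z' -> related (act F w z) (act F' w z').
Proof. by move=> [w' [x [-> ->]]]; exists (w ++ w'), x; rewrite !act_cat. Qed.

Lemma related_a z z' : related z z' -> a z = a' z'.
Proof. by move=> [w [x [-> ->]]]; rewrite (act_a HP HF) (act_a HP' HF') (bp_al HP) (bp_al HP'). Qed.

Lemma related_b z z' : related z z' -> b z = b' z'.
Proof. by move=> [w [x [-> ->]]]; rewrite (act_b HP HFL HF) (act_b HP' HFL HF') (bp_bl HP) (bp_bl HP'). Qed.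

Lemma ham_pt (f : smoothfun Z) p q h : p = q -> ham QZ f p h = ham QZ f q h.
Proof. by move=> ->. Qed.

(* [horizontal V x S]: over the fibre of [x], the map [S] intertwines the flows *)
Definition horizontal (V : set Z) (x : L) (S : Z -> Z') : Prop := forall (k : chf) (e : R) (u : Z), a u = x ->
  (forall r : R, `|r| < e -> V (F k r u)) -> forall r : R, `|r| < e -> S (F k r u) = F' k r (S u).

Lemma evec_cst n (q : euclid R n) (h : 'rV[R]_n) (N : manifold R) (p : N) (g : smap N N) (f : smoothfun N) :
  evec q h (sf_comp (smap_comp g (cst_smap (euclid R n) p)) f) = 0.
Proof. by apply: (@tg_cst R _ q _ _ (f (g p))); near=> y. Unshelve. all: by end_near. Qed.

(** While a point moves along a flow in [Z], the times of its word change so that [par_ham] has the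
    differential of the Hamiltonian at the base point. As [par_ham] and the base point are common to
    both spaces, the same times move along the corresponding flow in [Z']. *)
Lemma word_horizontal (z0 : Z) (s0 : Z') (n : nat) (s : seq 'I_n) (k : 'I_n -> chf) (psi : smap Z (euclid R (size s + mdim L))) (V : set Z) :
  b z0 = b' s0 -> open V -> (forall z, V z -> a z = a z0 -> act F (par k (psi z)) z0 = z) ->
  horizontal V (a z0) (fun z => act F' (par k (psi z)) s0).
Proof.
move=> bs oV HV f e u au Vu r re; pose gam (t : R) := F f t u.
have e0 : 0 < e by exact: le_lt_trans (normr_ge0 r) re.
have ag t : a (gam t) = a z0 by rewrite (flow_a HP HF).
have [Th HTh] := theta_exists HP HF k s (cst_smap (euclid R (mdim L)) z0).
have [Th' HTh'] := theta_exists HP' HF' k s (cst_smap (euclid R (mdim L)) s0).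
have cE t : act F' (par k (psi (gam t))) s0 = Th' (psi (gam t)) by rewrite HTh'.
have ic : icurve (hamb' (sval f)) (fun t => act F' (par k (psi (gam t))) s0) (- e) e.
  move=> t te te'; have Vt : V (gam t) by apply: Vu; rewrite ltr_norml te.
  have [_ dF] := HF f; have dg : has_vel gam t (ham QZ (sf_comp b (sval f)) (gam t)) := dF u t.
  have dp := has_vel_map psi dg; have [h hE] : exists h, tmap psi (gam t) (ham QZ (sf_comp b (sval f)) (gam t)) = evec (psi (gam t)) h.
    by eexists; exact: evecK.
  rewrite hE in dp; have dT := has_vel_map Th dp; have dT' := has_vel_map Th' dp.
  have gE : \forall t' \near t, (Th \o (psi \o gam)) t' = gam t'.
    have : \forall t' \near t, V (gam t').
      by apply: (has_vel_cont dg); apply: open_nbhs_nbhs.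
    by apply: filterS => t' Vt' /=; rewrite HTh; exact: HV.
  have tE : Th (psi (gam t)) = gam t by rewrite HTh; exact: HV.
  have {}dT := has_vel_near gE dT.
  have E1 : ham QZ (sf_comp b (par_ham k FL (psi (gam t)) h)) (gam t) = ham QZ (sf_comp b (sval f)) (gam t).
    apply: tangent_ext => f1; rewrite -(vel_fun_eq (f := f1) (f' := f1) dT dg)//.
    by rewrite (theta_vel HP HFL HF HTh) evec_cst addr0; apply: ham_pt.
  have bE : b' (Th' (psi (gam t))) = b (gam t).
    by rewrite HTh' (act_b HP' HFL HF') -[in RHS]tE HTh (act_b HP HFL HF) /= bs.
  have E2 : ham QZ' (sf_comp b' (par_ham k FL (psi (gam t)) h)) (Th' (psi (gam t))) = ham QZ' (sf_comp b' (sval f)) (Th' (psi (gam t))).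
    apply: ham_b_ext; rewrite bE; exact: (ham_b_inj HP E1).
  rewrite cE.
  have -> : (hamb' (sval f) (Th' (psi (gam t)))) = tmap Th' (psi (gam t)) (evec (psi (gam t)) h).
    by apply: tangent_ext => f1; rewrite (theta_vel HP' HFL HF' HTh') evec_cst addr0 E2.
  by apply: has_vel_near dT'; apply: (interval_near ltr01) => t' _; rewrite /= -cE.
have ic' : icurve (hamb' (sval f)) (fun t => F' f t (act F' (par k (psi u)) s0)) (- e) e.
  by move=> t _ _; have [_ dF'] := HF' f; exact: dF'.
move: re; rewrite ltr_norml => /andP[r1 r2].
apply: (icurve_uniq (a := - e) (b := e) _ e0 ic ic') => //; first by rewrite oppr_lt0.
by rewrite /gam /= F0 F'0.
Qed.

Lemma euclid_nbhs n (x : euclid R n) (P : set (euclid R n)) : nbhs x P -> exists2 e : R, 0 < e &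
  forall y : 'rV[R]_n, (forall i, `|y 0 i - (x : 'rV[R]_n) 0 i| < e) -> P y.
Proof.
move=> /(@nbhs_ballP R ('rV[R]_n))[e /= e0 H]; exists e => // y Hy; apply: H; split=> // i j.
by rewrite ord1 -ball_normE /ball_/= distrC; exact: Hy.
Qed.

Lemma euclid_box n (x : euclid R n) (e : R) : 0 < e -> \forall y \near x, forall i, `|(y : 'rV[R]_n) 0 i - (x : 'rV[R]_n) 0 i| < e.
Proof.
move=> e0; apply/(@nbhs_ballP R ('rV[R]_n)); exists e => //= y [_ Hy] i; have := Hy 0 i.
by rewrite -ball_normE /ball_/= distrC.
Qed.

(** For small times every letter keeps the point in [V], where [S] intertwines the flows; one letter
    is added at a time. *)
Lemma small_words (z0 : Z) (n : nat) (s : seq 'I_n) (k : 'I_n -> chf) (y0 : 'rV[R]_(mdim L)) (V : set Z) (S : Z -> Z') :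
  open V -> V z0 -> horizontal V (a z0) S ->
  \forall z \near (pad s (fun=> 0) y0 : euclid R (size s + mdim L)),
    V (act F (par k z) z0) /\ S (act F (par k z) z0) = act F' (par k z) (S z0).
Proof.
move=> oV V0 hS; elim: s => [|j s IH]; first by near=> z.
have [Th HTh] := theta_exists HP HF k s (cst_smap (euclid R (mdim L)) z0).
have [G HG] := @flow_joint_smap R Z (hamb (sval (k j))) (fun t => F (k j) t) (HF (k j)) _ Th.
pose p : euclid R (1 + (size s + mdim L)) := pad (j :: s) (fun=> 0) y0.
have Gp : G p = z0 by rewrite HG HTh /p /= row_mx_hd F0 row_mxKr (act_par0 HF).
have nG : nbhs p (fun x => V (G x)) by apply: (@smap_near _ _ _ G p V); rewrite Gp; exact: open_nbhs_nbhs.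
have [e e0 He] := euclid_nbhs nG.
have nI : \forall z \near p, V (act F (par k (rsubmx (z : 'rV[R]_(1 + (size s + mdim L))))) z0) /\
    S (act F (par k (rsubmx (z : 'rV[R]_(1 + (size s + mdim L))))) z0) = act F' (par k (rsubmx (z : 'rV[R]_(1 + (size s + mdim L))))) (S z0).
  apply: (@smap_near _ _ _ (emap (@Cinfv_rsub R 1 (size s + mdim L) setT openT)) p
    (fun z => V (act F (par k z) z0) /\ S (act F (par k z) z0) = act F' (par k z) (S z0))).
  by rewrite /= row_mxKr.
have p0 : (p : 'rV[R]_(1 + (size s + mdim L))) 0 0 = 0 by rewrite /p /= row_mx_hd.
near=> z.
have bz : forall i, `|(z : 'rV[R]_(1 + (size s + mdim L))) 0 i - (p : 'rV[R]_(1 + (size s + mdim L))) 0 i| < e.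
  by near: z; exact: euclid_box.
have [Vu Su] : V (act F (par k (rsubmx (z : 'rV[R]_(1 + (size s + mdim L))))) z0) /\
    S (act F (par k (rsubmx (z : 'rV[R]_(1 + (size s + mdim L))))) z0) = act F' (par k (rsubmx (z : 'rV[R]_(1 + (size s + mdim L))))) (S z0).
  by near: z.
have Vr (r : R) : `|r| < e -> V (F (k j) r (act F (par k (rsubmx (z : 'rV[R]_(1 + (size s + mdim L))))) z0)).
  move=> re; have := He (row_mx (const_mx r : 'rV[R]_1) (rsubmx (z : 'rV[R]_(1 + (size s + mdim L))))).
  rewrite HG HTh /= row_mx_hd row_mxKr; apply => i.
  case: (fintype.split_ordP i) => i' ->; first by rewrite row_mxEl /p /= row_mxEl !mxE subr0.
  rewrite row_mxEr.
  have -> : rsubmx (z : 'rV[R]_(1 + (size s + mdim L))) 0 i' = (z : 'rV[R]_(1 + (size s + mdim L))) 0 (rshift 1 i') by rewrite mxE.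
  exact: bz.
have z00 : `|(z : 'rV[R]_(1 + (size s + mdim L))) 0 0| < e by have := bz 0; rewrite p0 subr0.
split; first exact: (Vr _ z00).
by rewrite /= (hS _ e _ _ Vr _ z00) ?Su// (act_a HP HF).
Unshelve. all: by end_near. Qed.

Lemma section_exists (z0 : Z) : exists VW : set Z * (Z -> seq (chf * R)),
  [/\ open VW.1, VW.1 z0, forall z z', act F (VW.2 z0) z = z /\ act F' (VW.2 z0) z' = z',
      forall v, VW.1 v -> a v = a z0 -> act F (VW.2 v) z0 = v &
      (forall s0, b z0 = b' s0 -> horizontal VW.1 (a z0) (fun v => act F' (VW.2 v) s0)) /\
      forall (V : set Z) (S : Z -> Z'), open V -> V z0 -> horizontal V (a z0) S ->
        \forall v \near z0, a v = a z0 -> S v = act F' (VW.2 v) (S z0)].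
Proof.
have [n [s [k [psi [y0 [psi0 H]]]]]] := fibre_words HP HFL HF z0.
have [V [oV V0 HV]] := near_open H.
exists (V, fun v => par k (psi v)); split=> //=.
- by move=> z z'; rewrite psi0 (act_par0 HF) (act_par0 HF').
- split=> [s0 bs|V' S oV' V'0 hS]; first exact: word_horizontal.
  have := @smap_near R _ _ psi z0 _.
  rewrite psi0 => /(_ _ (small_words s k y0 oV' V'0 hS)) h; near=> v => av.
  have [_ E] : V' (act F (par k (psi v)) z0) /\ S (act F (par k (psi v)) z0) = act F' (par k (psi v)) (S z0) by near: v.
  rewrite -E; congr S; apply/esym; move: av; near: v; exact: H.
Unshelve. all: by end_near. Qed.

(** The letters are run in unit time each, starting with the last; outside [[0, size w]] the path
    rests. *)
Fixpoint wpath (Y : manifold R) (G : chf -> R -> smap Y Y) (w : seq (chf * R)) (y : Y) (t : R) : Y :=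
  match w with
  | [::] => y
  | kt :: w' => G kt.1 (kt.2 * Num.max 0 (Num.min 1 (t - (size w')%:R))) (wpath G w' y t)
  end.

(** Two words leading from the brane to the same [z] form a loop in a fibre of [a], and the same
    letters in [Z'] lift it. Simple connectedness closes the lifted loop. *)
Lemma related_fun z z1 z2 : related z z1 -> related z z2 -> z1 = z2.
Proof.
have [VW HVW] := choice section_exists.
pose V z := (VW z).1; pose sec z s v := act F' ((VW z).2 v) s.
move=> [w1 [x [zE1 ->]]] [w2 [x2 [zE2 ->]]].
have x2E : x2 = x.
  by rewrite -(bp_al HP x2) -(act_a HP HF w2) -zE2 zE1 (act_a HP HF) (bp_al HP).
subst x2; pose A := a @^-1` [set x].
have V_nbhs y : A y -> nbhs y (V y).
  by move=> _; have [oV V0 _ _ _] := HVW y; exact: open_nbhs_nbhs.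
have sec_refl y s : A y -> related y s -> sec y s y = s.
  by move=> _ _; have [_ _ h _ _] := HVW y; exact: (h y s).2.
have sec_rel y s v : A y -> related y s -> V y v -> A v -> related v (sec y s v).
  move=> Ay rs Vv Av; have [_ _ _ h _] := HVW y; rewrite -{1}(h v Vv); last by rewrite Av Ay.
  exact: related_act.
have sec_inj y s s' v : sec y s v = sec y s' v -> s = s' by apply: (act_inj HP' HF').
have sec_surj y v r : A y -> V y v -> A v -> related v r -> exists s, related y s /\ sec y s v = r.
  move=> Ay Vv Av rv; exists (act F' (winv ((VW y).2 v)) r); split; last exact: (act_winvK HP' HF').
  have [_ _ _ h _] := HVW y.
  have E : act F (winv ((VW y).2 v)) v = y by rewrite -{2}(h v Vv) ?(act_winv HP HF)// Av Ay.
  by rewrite -{1}E; exact: related_act.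
have hor y s : A y -> related y s -> horizontal (V y) x (sec y s).
  move=> Ay rs; have [_ _ _ _ [h _]] := HVW y; have := h s (related_b rs).
  by have -> : a y = x by exact: Ay.
have sec_trans y s v : A y -> related y s -> V y v -> A v ->
    \forall w \near v, A w -> sec y s w = sec v (sec y s v) w.
  move=> Ay rs Vv Av; have [oV _ _ _ _] := HVW y; have [_ _ _ _ [_ h]] := HVW v.
  have ax : a v = x by exact: Av.
  have := h (V y) (sec y s) oV Vv; rewrite ax => /(_ (hor y s Ay rs)).
  by apply: filterS => w hw Aw; apply: hw.
pose lift := @is_lift R Z Z' related sec.
(* A path with a lift, both at rest after time [N], is prolonged by one flow run during
   [[N, N + 1]]. *)
have ext_lift (g : R -> Z) (m : R -> Z') (k : chf) (tau : R) (N : nat) :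
    lift g m -> continuous g -> (forall t, A (g t)) -> (forall t : R, N%:R <= t -> g t = g N%:R /\ m t = m N%:R) ->
    let th (t : R) := tau * Num.max 0 (Num.min 1 (t - N%:R)) in
    lift (fun t => F k (th t) (g t)) (fun t => F' k (th t) (m t)) /\ continuous (fun t => F k (th t) (g t)).
  move=> Hl cg Ag gN th.
  have th0 (t : R) : t <= N%:R -> th t = 0.
    by move=> tN; rewrite /th (min_idPr _) ?(max_idPl _) ?mulr0//; lra.
  have cth : continuous th.
    move=> t; apply: (@continuous_comp _ _ _ (fun s : R => Num.max 0 (Num.min 1 (s - N%:R))) ( *%R tau)); last exact: mulrl_continuous.
    apply: (@continuous_comp _ _ _ (fun s : R => Num.min 1 (s - N%:R)) (fun s : R => Num.max 0 s)); last exact: continuous_maxl.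
    apply: (@continuous_comp _ _ _ (fun s : R => s - N%:R) (fun s : R => Num.min 1 s)); last exact: continuous_minl.
    by apply: cvgB; [exact: cvg_id|exact: cvg_cst].
  have step (t : R) : N%:R <= t -> \forall s \near t, N%:R <= s ->
      F' k (th s) (m s) = sec (F k (th t) (g t)) (F' k (th t) (m t)) (F k (th s) (g s)).
    move=> Nt; set y := F k (th t) (g t); set y' := F' k (th t) (m t).
    have Ay : A y by rewrite /A /= (flow_a HP HF); exact: Ag.
    have ry : related y y' by apply: (@related_act [:: (k, th t)]); exact: (Hl t).1.
    have [oV V0 hid _ _] := HVW y.
    have nV : \forall r \near (0 : R), V y (F k r y).
      have h : nbhs (F k 0 y) (V y) by rewrite F0; exact: open_nbhs_nbhs.
      exact: (@flow_cont R Z (hamb (sval k)) (fun t => F k t) (HF k) y 0 _ h).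
    have [e e0 He] := near_interval nV.
    have nth : \forall s \near t, `|th s - th t| < e.
      have := cth t; move=> /cvgrPdist_lt /(_ e e0); apply: filterS => s; by rewrite distrC.
    near=> s => Ns; have se : `|th s - th t| < e by near: s.
    have [gs ms] := gN s Ns; have [gt mt] := gN t Nt.
    have -> : F k (th s) (g s) = F k (th s - th t) y by rewrite /y -FD subrK gs gt.
    rewrite (hor y y' Ay ry k e y) //.
      by rewrite /sec (hid y y').2 /y' -F'D subrK ms mt.
    by move=> r re; apply: He; rewrite subr0.
  split=> t.
    split; first by apply: (@related_act [:: (k, th t)]); exact: (Hl t).1.
    have [tN|tN] := ltP t N%:R.
      have n1 : \forall s \near t, s < N%:R by apply: lt_nbhsl.
      have [_ h] := Hl t; near=> s; have sN : s < N%:R by near: s.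
      rewrite (th0 _ (ltW tN)) (th0 _ (ltW sN)) !F0 !F'0; near: s; exact: h.
    have st := step t tN; have [tE|tE] := eqVneq t N%:R.
      have [_ h] := Hl t; near=> s; have [sN|sN] := leP N%:R s; first by move: sN; near: s.
      rewrite (th0 t) ?tE// (th0 _ (ltW sN)) !F0 !F'0 -tE; near: s; exact: h.
    have n1 : \forall s \near t, N%:R < s by apply: lt_nbhsr; rewrite lt_neqAle eq_sym tE.
    near=> s; have sN : N%:R < s by near: s.
    by move: (ltW sN); near: s.
  move=> W nW; change (\forall s \near t, W (F k (th s) (g s))); have [tN|tN] := ltP t N%:R.
    have n1 : \forall s \near t, s < N%:R by apply: lt_nbhsl.
    have h : \forall s \near t, W (g s) by apply: cg; move: nW; rewrite (th0 _ (ltW tN)) F0.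
    near=> s; have sN : s < N%:R by near: s.
    rewrite (th0 _ (ltW sN)) F0; near: s; exact: h.
  have c2 : \forall s \near t, W (F k (th s) (g N%:R)).
    have := @flow_cont R Z (hamb (sval k)) (fun t => F k t) (HF k) (g N%:R) (th t) W.
    rewrite -(gN t tN).1 => /(_ nW); exact: cth.
  have [tE|tE] := eqVneq t N%:R.
    have h : \forall s \near t, W (g s) by apply: cg; move: nW; rewrite (th0 t) ?tE// F0.
    near=> s; have [sN|sN] := leP N%:R s; first by rewrite (gN s sN).1; near: s; exact: c2.
    by rewrite (th0 _ (ltW sN)) F0; near: s; exact: h.
  have n1 : \forall s \near t, N%:R < s by apply: lt_nbhsr; rewrite lt_neqAle eq_sym tE.
  near=> s; have sN : N%:R < s by near: s.
  by rewrite (gN s (ltW sN)).1; near: s; exact: c2.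
have wl w y y' : A y -> related y y' -> [/\ lift (wpath F w y) (wpath F' w y'), continuous (wpath F w y),
    forall t, A (wpath F w y t), forall t : R, (size w)%:R <= t -> wpath F w y t = act F w y /\ wpath F' w y' t = act F' w y' &
    forall t : R, t <= 0 -> wpath F w y t = y /\ wpath F' w y' t = y'].
  move=> Ay ry; elim: w => [|[k tau] w [IH1 IH2 IH3 IH4 IH5]].
    split=> //=; last by move=> t; exact: cst_continuous.
    by move=> t; split=> //; apply: (interval_near ltr01) => s _; rewrite sec_refl.
  have gN (t : R) : (size w)%:R <= t -> wpath F w y t = wpath F w y (size w)%:R /\ wpath F' w y' t = wpath F' w y' (size w)%:R.
    by move=> h; have [-> ->] := IH4 t h; have [-> ->] := IH4 _ (lexx _).
  have [h1 h2] := ext_lift _ _ k tau _ IH1 IH2 IH3 gN; split=> // t.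
  - by rewrite /A /= (flow_a HP HF); exact: IH3.
  - rewrite /= -natr1 => ht; have ht' : (size w)%:R <= t by lra.
    have [-> ->] := IH4 t ht'; rewrite (min_idPl _) ?(max_idPr ler01) ?mulr1//; lra.
  - move=> t0; have sw : 0 <= (size w)%:R :> R := ler0n _ _.
    rewrite /=; have [-> ->] := IH5 t t0; rewrite (min_idPr _) ?(max_idPl _) ?mulr0 ?F0 ?F'0//; lra.
(* The loop goes out along [w1] and back along [w2]; rescaling time by its length [N] makes it end
   at time 1. *)
pose w := winv w2 ++ w1; pose N : R := (size w)%:R.
have wz : act F w (l x) = l x by rewrite /w act_cat -zE1 zE2 (act_winv HP HF).
have Al : A (l x) by exact: (bp_al HP x).
have [h1 h2 h3 h4 h5] := wl w (l x) (l' x) Al (related_l x).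
have cN : continuous (fun t : R => N * t).
  exact: mulrl_continuous.
have N0 : 0 <= N := ler0n _ _.
have e1 (t : R) : 1 <= t -> wpath F w (l x) (N * t) = l x /\ wpath F' w (l' x) (N * t) = act F' w (l' x).
  by move=> t1; have [|-> ->] := h4 (N * t); rewrite ?wz// ler_peMr.
have e0 (t : R) : t <= 0 -> wpath F w (l x) (N * t) = l x /\ wpath F' w (l' x) (N * t) = l' x.
  by move=> t0; apply: h5; rewrite mulr_ge0_le0.
pose gam (t : R) := wpath F w (l x) (N * t); pose lam (t : R) := wpath F' w (l' x) (N * t).
have cgam : continuous gam by move=> t; apply: (@continuous_comp _ _ _ ( *%R N) (wpath F w (l x))); [exact: cN|exact: h2].
have g0 (t : R) : t <= 0 -> gam t = gam 0 by move=> t0; rewrite /gam (e0 t t0).1 (e0 0 (lexx _)).1.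
have g1 (t : R) : 1 <= t -> gam t = gam 1 by move=> t1; rewrite /gam (e1 t t1).1 (e1 1 (lexx _)).1.
have g01 : gam 0 = gam 1 by rewrite /gam (e0 0 (lexx _)).1 (e1 1 (lexx _)).1.
have Hl : is_lift related sec gam lam := lift_comp cN h1.
have := @monodromy_trivial R Z Z' A related V sec V_nbhs sec_refl sec_rel sec_inj sec_surj sec_trans
  gam lam (bp_sc HP x).2 cgam (fun t => h3 _) g0 g1 g01 Hl.
rewrite /lam (e1 1 (lexx _)).2 (e0 0 (lexx _)).2 /w act_cat => E.
by rewrite -(act_winvK HP' HF' w2 (act F' w1 (l' x))) E.
Unshelve. all: by end_near. Qed.

(** Near [z0] points are words with smoothly varying times applied to a local section of [a]; the
    same words in [Z'] give a smooth map, which is the relation because the latter is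
    single-valued. *)
Lemma related_smap : exists phi : smap Z Z', forall z, related z (phi z).
Proof.
have ex z : exists z', related z z'.
  have [w wE] := reached HP HFL HF z; exists (act F' w (l' (a z))).
  by rewrite {1}wE; apply: related_act; exact: related_l.
have [h Hh] := choice ex.
have [|phi phiE] := @smap_local R Z Z' h; last by exists phi => z; rewrite phiE.
move=> z0; have [w0 w0E] := reached HP HFL HF z0.
pose sig := smap_comp (act F w0) l.
have asig : \forall x \near a z0, a (sig x) = x.
  by near=> x; rewrite /= (act_a HP HF) (bp_al HP).
have [n [s [k [gam [psi [y0 [psi0 H]]]]]]] := local_words HP HFL HF asig (esym w0E).
have [Th HTh] := theta_exists HP' HF' k s (smap_comp (smap_comp (act F' w0) l') gam).
exists (smap_comp Th psi); apply: filterS H => z [gE zE]; apply: related_fun (Hh z) _.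
rewrite -{1}zE /= HTh /= gE; apply: related_act; apply: related_act; exact: related_l.
Unshelve. all: by end_near. Qed.

End TwoPairs.

(** * The isomorphism of two Morita equivalences with the same brane data *)

Section Isomorphism.
Context (R : realType) (L : manifold R) (Qp : bivector L) (Ip : endo L).
Context (Im : endo L) (Qm : bivector L) (Z : manifold R) (I : endo Z).
Context (B om : form2 Z) (QZ : bivector Z) (a b : smap Z L) (l : smap L Z).
Hypothesis HP : brane_pair Ip Im Qp Qm I B om QZ a b l.
Context (Im' : endo L) (Qm' : bivector L) (Z' : manifold R) (I' : endo Z').
Context (B' om' : form2 Z') (QZ' : bivector Z') (a' b' : smap Z' L) (l' : smap L Z').
Hypothesis HP' : brane_pair Ip Im' Qp Qm' I' B' om' QZ' a' b' l'.

Lemma flow_family (N : manifold R) (X : vfield N) : complete_vf X -> exists Fl : R -> smap N N, is_flow X (fun t => Fl t).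
Proof.
move=> /complete_flow[Fl HFl]; have [G HG] := choice (flow_smap HFl).
exists G; have -> // : (fun t => G t : N -> N) = Fl by apply/funext => t; apply/funext => p; exact: HG.
Qed.

Lemma pair_flows (W : manifold R) (om0 : form2 W) (QW : bivector W) (c : smap W L) : real_2form om0 -> inverse_bivector QW om0 ->
  complete_map c QW Qp -> exists F : chf Qp -> R -> smap W W, forall f, is_flow (ham QW (sf_comp c (sval f))) (fun t => F f t).
Proof.
move=> ro HQ cc.
have H (f : chf Qp) : exists Fl : R -> smap W W, is_flow (ham QW (sf_comp c (sval f))) (fun t => Fl t).
  by case: f => f cf; exact: (@flow_family W (VField (ham_smooth (sf_comp c f) ro HQ)) (cc _ cf)).
by have [F HF] := choice H; exists F.
Qed.

Definition opp2 (N : manifold R) (T : form2 N) : form2 N := fun p => -1 \*: T p.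

Lemma opp2E (N : manifold R) (T : form2 N) p (u v : tangent p) : opp2 T p u v = - T p u v.
Proof. by transitivity ((-1 *: T p u : cotangent p) v); [|rewrite scaleN1r]. Qed.

Lemma closed_opp2 (N : manifold R) (T : form2 N) : closed_2form T -> closed_2form (opp2 T).
Proof.
move=> [rT cT]; have rS : real_2form (opp2 T).
  split=> [X Y|p v]; last by rewrite opp2E rT.2 oppr0.
  have := sf_smooth (- eval2 T X Y); congr smooth; apply/funext => p; by rewrite sfopp eval2E// opp2E.
split=> // X Y W.
have E A C : eval2 (opp2 T) A C = - eval2 T A C by apply: sf_ext => p; rewrite sfopp !eval2E// opp2E.
have D A f : lie A (- f) = - lie A f by apply: sf_ext => p; rewrite sfopp; exact: tgN.
by rewrite !E !D -[RHS]oppr0 -(cT X Y W); ring.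
Qed.

Lemma pair_iso : (forall x (u v : tangent x), B' (l' x) (tmap l' x u) (tmap l' x v) = B (l x) (tmap l x u) (tmap l x v)) ->
  exists Phi : diffeo Z Z',
    [/\ holomorphic_map I I' Phi,
      forall z (u v : tangent z), B' (Phi z) (tmap Phi z u) (tmap Phi z v) = B z u v /\
        om' (Phi z) (tmap Phi z u) (tmap Phi z v) = om z u v,
      forall z, a' (Phi z) = a z, forall z, b' (Phi z) = b z & forall x, Phi (l x) = l' x].
Proof.
move=> Bl.
have [FL HFL] : exists FL : chf Qp -> R -> smap L L, forall f, is_flow (ham Qp (sval f)) (fun t => FL f t).
  have H (f : chf Qp) : exists Fl : R -> smap L L, is_flow (ham Qp (sval f)) (fun t => Fl t).
    by case: f => f cf; exact: (@flow_family L (VField (bp_sQ HP f)) cf).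
  by have [FL HFL] := choice H; exists FL.
have [F HF] := pair_flows (bp_om HP).1 (bp_inv HP) (bp_cb HP).
have [F' HF'] := pair_flows (bp_om HP').1 (bp_inv HP') (bp_cb HP').
have [phi Hphi] := related_smap HFL HP HF HP' HF'.
have [psi Hpsi] := related_smap HFL HP' HF' HP HF.
have sym z z' : related l' F' l F z' z -> related l F l' F' z z' by move=> [w [x [-> ->]]]; exists w, x.
have sym' z z' : related l F l' F' z z' -> related l' F' l F z' z by move=> [w [x [-> ->]]]; exists w, x.
(* [psi (phi z)] and [z] are both related to [phi z], and the relation is single-valued in each
   direction. *)
have fK : cancel phi psi.
  move=> z; apply: (related_fun HFL HP' HF' HP HF (Hpsi (phi z))); exact: sym'.
have bK : cancel psi phi.
  move=> z; apply: (related_fun HFL HP HF HP' HF' (Hphi (psi z))); exact: sym.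
have pa z : a' (phi z) = a z by rewrite (related_a HP HF HP' HF' (Hphi z)).
have pb z : b' (phi z) = b z by rewrite (related_b HFL HP HF HP' HF' (Hphi z)).
have pl x : phi (l x) = l' x.
  apply: (related_fun HFL HP HF HP' HF' (Hphi (l x))); exact: related_l.
have pF f t z : phi (F f t z) = F' f t (phi z).
  apply: (related_fun HFL HP HF HP' HF' (Hphi _)); exact: (related_act [:: (f, t)] (Hphi z)).
(* [phi] commutes with the flows, hence with their velocities; a general [f] is first replaced by
   one with a complete field and the same differential. *)
have hamE f z : tmap phi z (ham QZ (sf_comp b f) z) = ham QZ' (sf_comp b' f) (phi z).
  have [k kE] := near_chf HP (b z) f.
  have <- : ham QZ (sf_comp b (sval k)) z = ham QZ (sf_comp b f) z by apply: ham_b_ext.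
  have <- : ham QZ' (sf_comp b' (sval k)) (phi z) = ham QZ' (sf_comp b' f) (phi z) by apply: ham_b_ext; rewrite pb.
  have [F0 dF] := HF k; have [F'0 dF'] := HF' k.
  have h1 := has_vel_map phi (dF z 0); have h2 := dF' (phi z) 0.
  rewrite F0 in h1; rewrite F'0 in h2; apply: (has_vel_uniq h1).
  by apply: has_vel_near h2; apply: (interval_near ltr01) => s _ /=; rewrite pF.
have same (T : form2 Z) (T' : form2 Z') : closed_2form T -> closed_2form T' ->
    (forall f z (v : tangent z), T' (phi z) (ham QZ' (sf_comp b' f) (phi z)) (tmap phi z v) = T z (ham QZ (sf_comp b f) z) v) ->
    (forall x (u v : tangent x), T' (l' x) (tmap l' x u) (tmap l' x v) = T (l x) (tmap l x u) (tmap l x v)) ->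
    forall z (u v : tangent z), T' (phi z) (tmap phi z u) (tmap phi z v) = T z u v.
  move=> cT cT' TX Tl z u v; have cN := closed_opp2 cT.
  have cS := closed_add2 (closed_pull2 phi cT') cN.
  have SE p (u' v' : tangent p) : add2 (pull2 phi T') (opp2 T) p u' v' = T' (phi p) (tmap phi p u') (tmap phi p v') - T p u' v'.
    by rewrite -opp2E.
  apply/eqP; rewrite -subr_eq0 -SE; apply/eqP; apply: (form_zero HP HFL HF cS) => [f p v'|x u' v'].
    by rewrite SE hamE TX subrr.
  have cl f : sf_comp l (sf_comp phi f) = sf_comp l' f by apply: sf_ext => q /=; rewrite pl.
  rewrite SE -Tl; apply/eqP; rewrite subr_eq0; apply/eqP.
  by apply: f2_eq => // f; rewrite !dmapE cl.
have tb z (v : tangent z) f : tmap b' (phi z) (tmap phi z v) f = tmap b z v f.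
  by rewrite !dmapE; congr (v _); apply: sf_ext => q /=; rewrite pb.
have omI' p (u v : tangent p) : om p u (I p v) = B p u v.
  by rewrite (f2_alt _ _ (bp_om HP).1) (bp_omI HP) (f2_alt _ _ (bp_B HP).1) opprK.
have om'I' p (u v : tangent p) : om' p u (I' p v) = B' p u v.
  by rewrite (f2_alt _ _ (bp_om HP').1) (bp_omI HP') (f2_alt _ _ (bp_B HP').1) opprK.
have omE z (u v : tangent z) : om' (phi z) (tmap phi z u) (tmap phi z v) = om z u v.
  apply: (same _ _ (bp_om HP) (bp_om HP')) => [f p w|x u' v'].
    rewrite (f2_ham _ _ (bp_inv HP)) (f2_ham _ _ (bp_inv HP')) dmapE; congr (w _).
    by apply: sf_ext => q /=; rewrite pb.
  by rewrite (bp_isotropic HP) (bp_isotropic HP').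
(* Against the Hamiltonian vector of [b^* f], the form [B] gives, up to the sign convention shared
   by both spaces, [df] on the image of [w] under [b] and [I_+], which involves the base only. *)
have BE z (u v : tangent z) : B' (phi z) (tmap phi z u) (tmap phi z v) = B z u v.
  apply: (same _ _ (bp_B HP) (bp_B HP')) => [f p w|x u' v']; last exact: Bl.
  rewrite -omI' -om'I' (f2_ham _ _ (bp_inv HP)) (f2_ham _ _ (bp_inv HP')).
  transitivity (tmap b' (phi p) (I' (phi p) (tmap phi p w)) f) => //.
  rewrite (bp_Ib HP'); transitivity (tmap b p (I p w) f) => //.
  by rewrite (bp_Ib HP); apply: endo_eq => //; exact: tb.
have hol : holomorphic_map I I' phi.
  move=> z v; apply: (f2_nondeg (bp_inv HP')) => w.
  have [w' ->] : exists w', w = tmap phi z w'.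
    exists (dmap (fK z) w); apply: tangent_ext => h; rewrite !dmapE; congr (w _).
    by apply: sf_ext => q /=; rewrite bK.
  by rewrite omE (bp_omI HP) (bp_omI HP') BE.
by exists (Diffeo fK bK); split=> [|z u v|||]; [exact: hol|split; [exact: BE|exact: omE]|exact: pa|exact: pb|exact: pl].
Qed.

End Isomorphism.

(** * Recovering a Morita equivalence from its brane data *)

Section Uniqueness.
Context (R : realType).

Lemma id_smapK (M : manifold R) : cancel (id_smap M) (id_smap M).
Proof. by []. Qed.

Definition id_diffeo (M : manifold R) : diffeo M M := Diffeo (@id_smapK M) (@id_smapK M).

Lemma holomorphic_id (M : manifold R) (I : endo M) : holomorphic_map I I (id_smap M).
Proof.
move=> p v; apply: tangent_ext => f; rewrite tmap_id//.
by apply: endo_eq => // h; rewrite tmap_id.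
Qed.

Lemma real_poisson_id (M : manifold R) (Q : bivector M) : real_poisson (id_smap M) Q Q.
Proof.
move=> p xi; apply: tangent_ext => f; rewrite tmap_id//; apply: bivector_eq => // u v uv.
transitivity (xi (tmap (id_smap M) p u)) => //; congr (xi _).
by apply: tangent_ext => h; rewrite tmap_id.
Qed.

(** With identity maps as identifications, the gauged groupoid is a [brane_pair] for the same data
    as [S], so [pair_iso] compares them; the real forms agree on the branes by [gauge_unit]. *)
Lemma gk_of_span_unique (Xm Xp : hpdata R) (S : bspan Xm Xp) (Dm : diffeo (bs_L S) Xm) (Dp : diffeo (bs_L S) Xp) :
  hpoisson Xm -> hpoisson Xp -> morita_brane S -> Dm =1 bs_pim S \o bs_emb S -> Dp =1 bs_pip S \o bs_emb S ->
  let D := gk_of_span S Dm Dp in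
  forall (G : groupoid (bs_L S)) (I0 : endo (gr_arrows G)) (Om : cform2 (gr_arrows G)),
  @weinstein_groupoid R (Xminus D) G I0 Om ->
  forall I : endo (gr_arrows G), complex_structure_of (gauge_form Om (gk_F D)) I ->
  bspan_iso (@retarget R Xm Xp (Xminus D) (Xplus D) Dm Dp (span_of_gk D Om I)) S.
Proof.
move=> hm hp HS HDm HDp D G I0 Om HW I HI.
have [_ _ HD [QZ HP]] := span_degenerate_GK hm hp HS HDm HDp.
have HG := gauge_morita HD HW HI.
have [[LG _ _ [mB _] _] _] := HW.
have sQ : forall f, smooth_vf (ham (gk_Q D) f) by have [[_ [r _] _ _ _] _ _ _] := HD.
have cE (f : smoothfun (bs_L S)) : complete_vf (ham (gk_Q D) f) -> complete_vf (ham (gk_Q D) (sf_comp (id_smap (bs_L S)) f)).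
  by have -> : sf_comp (id_smap (bs_L S)) f = f by exact: sf_ext.
have [QG HPG] := @span_brane_pair R (Xminus D) (Xplus D) (span_of_gk D Om I) (id_diffeo _) (id_diffeo _)
  (gk_Ip D) (gk_Im D) (gk_Q D) (gk_Q D) HG (fun x => esym (s_unit LG x)) (fun x => esym (t_unit LG x))
  (holomorphic_id _) (holomorphic_id _) (real_poisson_id _) (real_poisson_id _)
  cE sQ.
have [x u v|Phi [hol forms Pa Pb Pl]] := pair_iso HPG HP; first exact: (esym (@gauge_unit R _ G Om (gk_F D) x u v LG mB)).
exists Phi; split.
- exact: hol.
- by move=> p u v; have [E1 E2] := forms p u v; apply: cpair_eq; [exact: E1|exact: E2].
(* [pair_iso] works with projections to the brane; applying [Dm], and then [Dp], returns to [Xm] and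
   [Xp]. *)
- move=> z; have := congr1 Dm (Pa z); by rewrite /= df_bwdK.
- move=> z; have := congr1 Dp (Pb z); by rewrite /= df_bwdK.
- apply/seteqP; split=> [_ [_ [x _ <-] <-]|_ [x _ <-]]; first by exists x => //; rewrite Pl.
  by exists (gr_unit G x); [exists x|exact: Pl].
Qed.

End Uniqueness.

Theorem theorem4p3 (R : realType) :
  (* from generalized Kaehler structures to Morita equivalences *)
  (forall (M : manifold R) (D : gkdata M),
     degenerate_GK D -> hp_integrable (Xminus D) -> hp_integrable (Xplus D) ->
   forall (G : groupoid M) (I0 : endo (gr_arrows G)) (Om : cform2 (gr_arrows G)),
     @weinstein_groupoid R (Xminus D) G I0 Om ->
   exists I : endo (gr_arrows G),
     complex_structure_of (gauge_form Om (gk_F D)) I /\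
     morita_brane (span_of_gk D Om I))
  /\
  (* from Morita equivalences to generalized Kaehler structures *)
  (forall Xm Xp : hpdata R,
     hpoisson Xm -> hpoisson Xp -> hp_integrable Xm -> hp_integrable Xp ->
   forall S : bspan Xm Xp, morita_brane S ->
   forall (Dm : diffeo (bs_L S) Xm) (Dp : diffeo (bs_L S) Xp),
     Dm =1 bs_pim S \o bs_emb S -> Dp =1 bs_pip S \o bs_emb S ->
   [/\ forall p, pull_bivector Dp (hp_Q Xp) p =1 pull_bivector Dm (hp_Q Xm) p,
       forall p u v, pull2 (bs_emb S) (im2 (bs_Om S)) p u v = 0%R &
       degenerate_GK (gk_of_span S Dm Dp)])
  /\
  (* the second construction is a left inverse of the first *)
  (forall (M : manifold R) (D : gkdata M),
     degenerate_GK D -> hp_integrable (Xminus D) -> hp_integrable (Xplus D) ->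
   forall (G : groupoid M) (I0 : endo (gr_arrows G)) (Om : cform2 (gr_arrows G)),
     @weinstein_groupoid R (Xminus D) G I0 Om ->
   forall I : endo (gr_arrows G),
     complex_structure_of (gauge_form Om (gk_F D)) I ->
   forall (Dm : diffeo M (Xminus D)) (Dp : diffeo M (Xplus D)),
     Dm =1 gr_s G \o gr_unit G -> Dp =1 gr_t G \o gr_unit G ->
   gk_eq (gk_of_span (span_of_gk D Om I) Dm Dp) D)
  /\
  (* the second construction is a right inverse of the first, up to isomorphism *)
  (forall Xm Xp : hpdata R,
     hpoisson Xm -> hpoisson Xp -> hp_integrable Xm -> hp_integrable Xp ->
   forall S : bspan Xm Xp, morita_brane S ->
   forall (Dm : diffeo (bs_L S) Xm) (Dp : diffeo (bs_L S) Xp),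
     Dm =1 bs_pim S \o bs_emb S -> Dp =1 bs_pip S \o bs_emb S ->
   let D := gk_of_span S Dm Dp in
   forall (G : groupoid (bs_L S)) (I0 : endo (gr_arrows G))
     (Om : cform2 (gr_arrows G)),
     @weinstein_groupoid R (Xminus D) G I0 Om ->
   forall I : endo (gr_arrows G),
     complex_structure_of (gauge_form Om (gk_F D)) I ->
   bspan_iso (@retarget R Xm Xp (Xminus D) (Xplus D) Dm Dp (span_of_gk D Om I)) S).
Proof.
split; [|split; [|split]].
- move=> M D HD _ _ G I0 Om HG.
  have [I HI] := gauge_complex_structure HG; exists I; split; first exact: HI.
  have H := gauge_morita HD HG HI; exact: H.
- move=> Xm Xp hm hp _ _ S HS Dm Dp HDm HDp.
  have [QE iso HD _] := span_degenerate_GK hm hp HS HDm HDp.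
  by split; [move=> p xi; rewrite QE|exact: iso|exact: HD].
- move=> M D _ _ _ G I0 Om HG I _ Dm Dp HDm HDp; exact: gk_of_span_of_gk HG HDm HDp.
- move=> Xm Xp hm hp _ _ S HS Dm Dp HDm HDp D G I0 Om HW I HI.
  exact: gk_of_span_unique hm hp HS HDm HDp _ _ _ HW _ HI.
Qed.
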